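(* Let $s \ge 9$ be an integer, let $\tau \in \mathbb{R}$, let $\eta > 0$, and let $h_1, \ldots, h_s \in \mathbb{R}[x]$ be polynomials of degree exactly $3$ satisfying the irrationality condition. Put $H(\mathbf{x}) = \sum_{i=1}^s h_i(x_i)$. Then there exists $\mathbf{x} \in \mathbb{Z}^s$ such that $|H(\mathbf{x}) - \tau| < \eta$.
   Context: Irrationality condition: writing $h_i(x) = \beta_{i3}x^3 + \beta_{i2}x^2 + \beta_{i1}x + \beta_{i0}$ for $i=1,\ldots,s$, the polynomials $h_1,\ldots,h_s$ satisfy the irrationality condition if there exist $i_1, i_2 \in \{1,\ldots,s\}$ and $j_1, j_2 \in \{1,2,3\}$ such that $\beta_{i_2 j_2} \ne 0$ and $\beta_{i_1 j_1}/\beta_{i_2 j_2}$ is irrational. *)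

(* Defs.v *)
From mathcomp Require Export all_boot all_order all_algebra.
From mathcomp Require Export classical_sets reals.

Set Implicit Arguments.
Unset Strict Implicit.
Unset Printing Implicit Defensive.

Local Open Scope ring_scope.

Definition irrationality_condition (R : realType) (s : nat)
    (h : 'I_s -> {poly R}) : Prop :=
  exists (i1 i2 : 'I_s) (j1 j2 : nat),
    [/\ (1 <= j1 <= 3)%N, (1 <= j2 <= 3)%N, (h i2)`_j2 != 0
      & irrational ((h i1)`_j1 / (h i2)`_j2)].

Definition separable_sum (R : realType) (s : nat) (h : 'I_s -> {poly R})
    (x : 'I_s -> int) : R :=
  \sum_(i < s) (h i).[(x i)%:~R].

(* Main.v *)
Require Import Defs.
From mathcomp Require Import ring lra zify.
From mathcomp Require Import archimedean intdiv.
From mathcomp Require Import boolp topology normedtype derive realfun exp trigo.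

Set Implicit Arguments.
Unset Strict Implicit.
Unset Printing Implicit Defensive.

Import Order.TTheory GRing.Theory Num.Theory.
Import numFieldNormedType.Exports.
Local Open Scope ring_scope.

(** The proof is a discrete version of the Davenport-Heilbronn method. Fix nine
variables, including those of the irrationality condition, set the others to [0],
and flip signs so that exactly one leading coefficient is negative. Let [V] be the
list of values of [H - tau] when five variables run up to multiples of [P], two over
[(P, 2P]] and two over the diminished range [(Y, 2Y]], with [P = m ^ 40] and
[Y = m ^ 31]. All values are [O(M)] with [M] proportional to [P ^ 3].

The trigonometric polynomial [D(u) = sum_j sin(pi j / N) e(j u)], [N ~ M / eta],
satisfies [(cos (2 pi u) - cos (pi / N)) |D(u)| ^ 2 = sin (pi / N) * sum_j sin(pi j / N) cos(2 pi j u)],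
and the first factor is negative when [u = v / M] with [|v| >= eta]. If no value is smaller
than [eta], summing over [V] therefore bounds the number of [v] with [|v| <= M / (16 K)],
which is of order [|V| / K] because the variable with negative leading coefficient fills
the range, by the exponential sums of [V] at the frequencies [k / M], [1 <= k <= N], weighted
by [min(1, k / K)]. It remains to show that those sums contribute [o(|V|)].

- When the five sums over full ranges are all small, Weyl's inequality is combined with
  a count of the solutions of [|f(x) - f(x') + g(y) - g(y')| < 1], [x, x'] in [(P, 2P]] and
  [y, y'] in [(Y, 2Y]]: Cauchy-Schwarz over short blocks of [y] shows that they are
  essentially diagonal.
- Otherwise a Weyl bound without loss of [X ^ eps] on the major arcs shows that the
  [20/21]-th powers of the normalised sums have bounded total.
- Finally the sums tend to [0] uniformly in [k >= K1]: if all sums were large, the inverse form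
  of Weyl's inequality would put all coefficients times [k / M] close to rationals with bounded
  denominators, which contradicts the irrationality condition. *)

(** * Exponential sums *)

(** Write [Y = P^theta]. Five Weyl sums save almost [P^(5/4)], and the two diagonal pairs leave a
    total of order [P^3 / (P Y)] over all frequencies, so [theta > 3/4] is required. The count of
    solutions with blocks of length [U = Y^4 / P^3] stays diagonal while [Y^2 U^2 <= P Y], that is
    [theta <= 7/9]. The ratio [31/40] lies in this narrow window. The lower coefficients are
    arbitrary reals, so near a fraction [a/q] one only has a bound of about [q^(-1/4)] per sum.
    Summation over [a] and [q] needs a total exponent above 2, and nine sums give [9/4]. The slack
    pays for [d(q) <= C q^(1/50)] and for the power [20/21]: indeed [9/4 * 49/50 * 20/21 = 21/10].
    What the power [20/21] leaves over is a factor [eps^(1/21)]; through it enters the decay that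
    comes from irrationality. This decay has no rate, hence no loss of any power of [P] is
    affordable on the major arcs. The lowest frequencies are not small at all. The weight
    [min(1, k/K)] exists to damp them: [K] is chosen after the threshold [K1] and before [P]. *)

Definition c2 (R : realType) (t : R) : R := cos (2 * pi * t).
Definition s2 (R : realType) (t : R) : R := sin (2 * pi * t).

Lemma c2D (R : realType) (x y : R) : c2 (x + y) = c2 x * c2 y - s2 x * s2 y.
Proof. by rewrite /c2 /s2 mulrDr cosD. Qed.

Lemma s2D (R : realType) (x y : R) : s2 (x + y) = s2 x * c2 y + c2 x * s2 y.
Proof. by rewrite /c2 /s2 mulrDr sinD. Qed.

Lemma c2N (R : realType) (x : R) : c2 (- x) = c2 x.
Proof. by rewrite /c2 mulrN cosN. Qed.

Lemma s2N (R : realType) (x : R) : s2 (- x) = - s2 x.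
Proof. by rewrite /s2 mulrN sinN. Qed.

Lemma c20 (R : realType) : c2 (0 : R) = 1.
Proof. by rewrite /c2 mulr0 cos0. Qed.

Lemma s20 (R : realType) : s2 (0 : R) = 0.
Proof. by rewrite /s2 mulr0 sin0. Qed.

Lemma c2B (R : realType) (x y : R) : c2 (x - y) = c2 x * c2 y + s2 x * s2 y.
Proof. by rewrite c2D c2N s2N; ring. Qed.

Lemma c2s2_norm (R : realType) (x : R) : c2 x ^+ 2 + s2 x ^+ 2 = 1.
Proof. exact: cos2Dsin2. Qed.

Lemma c2s2_nat (R : realType) (n : nat) : c2 (n%:R : R) = 1 /\ s2 (n%:R : R) = 0.
Proof.
elim: n => [|n [IHc IHs]]; first by rewrite c20 s20.
rewrite -natr1 c2D s2D IHc IHs.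
have -> : c2 (1 : R) = 1 by rewrite /c2 mulr1 mulr_natl cos2pi.
have -> : s2 (1 : R) = 0 by rewrite /s2 mulr1 mulr_natl sin2pi.
by split; ring.
Qed.

Lemma c2s2_int (R : realType) (z : int) : c2 (z%:~R : R) = 1 /\ s2 (z%:~R : R) = 0.
Proof.
case: z => n; first exact: c2s2_nat.
have [hc hs] := c2s2_nat R n.+1.
by rewrite NegzE mulrNz c2N s2N /= -pmulrn hc hs oppr0.
Qed.

Lemma c2Dint (R : realType) (x : R) (z : int) : c2 (x + z%:~R) = c2 x.
Proof. by have [hc hs] := c2s2_int R z; rewrite c2D hc hs; ring. Qed.

Lemma s2Dint (R : realType) (x : R) (z : int) : s2 (x + z%:~R) = s2 x.
Proof. by have [hc hs] := c2s2_int R z; rewrite s2D hc hs; ring. Qed.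

(** * Elementary inequalities for sine and cosine *)

Lemma sin_mvt (R : realType) (x y : R) : x <= y ->
  exists2 c, x <= c <= y & sin y - sin x = cos c * (y - x).
Proof.
move=> xy; have [|c cI E] := @MVT_segment R sin cos x y xy.
- by apply: continuous_subspaceT => z; exact: continuous_sin.
- by exists c => //; move: cI; rewrite in_itv.
Qed.

Lemma cos_mvt (R : realType) (x y : R) : x <= y ->
  exists2 c, x <= c <= y & cos y - cos x = - sin c * (y - x).
Proof.
move=> xy; have [|c cI E] := @MVT_segment R cos (fun t => - sin t) x y xy.
- by apply: continuous_subspaceT => z; exact: continuous_cos.
- by exists c => //; move: cI; rewrite in_itv.
Qed.

Lemma sin_le (R : realType) (x : R) : 0 <= x -> sin x <= x.
Proof.
move=> x0.
have [c _ E] := sin_mvt x0.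
by move: E; rewrite sin0 !subr0 => ->; have := cos_le1 c; nra.
Qed.

Lemma normr_sin_le (R : realType) (x : R) : `|sin x| <= `|x|.
Proof.
suff H (y : R) : 0 <= y -> `|sin y| <= y.
  have [x0|x0] := leP 0 x; first by rewrite (ger0_norm x0) H.
  by rewrite -normrN -sinN (ltr0_norm x0) H // oppr_ge0 ltW.
move=> y0; rewrite ler_norml sin_le // andbT.
have [c _ E] := sin_mvt y0.
by move: E; rewrite sin0 !subr0 => ->; have := cos_geN1 c; nra.
Qed.

Lemma cos_ge_sqr (R : realType) (x : R) : 1 - x ^+ 2 / 2 <= cos x.
Proof.
have E : cos x = 1 - 2 * sin (x / 2) ^+ 2.
  have := cos_mulr2n (x / 2); have -> : x / 2 *+ 2 = x by field.
  by move=> ->; rewrite cos2sin2 -mulr_natr; ring.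
have h := normr_sin_le (x / 2).
have : sin (x / 2) ^+ 2 <= (x / 2) ^+ 2.
  by rewrite -(real_normK (num_real (sin _))) -(real_normK (num_real (x / 2))) lerXn2r ?nnegrE.
rewrite E; lra.
Qed.

Lemma sin_ge_quarter (R : realType) (x : R) : 0 <= x <= pi / 2 -> x / 4 <= sin x.
Proof.
move=> /andP[x0 xpi].
have H (y : R) : 0 <= y <= 1 -> y / 2 <= sin y.
  move=> /andP[y0 y1].
  have [c /andP[c0 cy] E] := sin_mvt y0.
  move: E; rewrite sin0 !subr0 => ->.
  have := cos_ge_sqr c; nra.
have [x1|x1] := leP x 1.
  by apply: le_trans (H x _); [lra | rewrite x0].
have h1 := H 1 ltac:(by rewrite ler01 lexx).
have hp := @pihalf_lt2 R; have hp1 := @pihalf_ge1 R.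
have : sin 1 < sin x.
  by rewrite ltr_sin // in_itv /=; apply/andP; split; lra.
lra.
Qed.

Lemma sin_pi_dist (R : realType) (t : R) (a : int) :
  `|t - a%:~R| <= 1 / 2 -> `|t - a%:~R| / 2 <= `|sin (pi * t)|.
Proof.
move=> h; set u := t - a%:~R.
have E : `|sin (pi * t)| = `|sin (pi * u)|.
  have -> : pi * t = pi * u + pi * a%:~R by rewrite /u; ring.
  suff Hn (n : nat) (v : R) : `|sin (v + pi * n%:R)| = `|sin v|.
    case: a @u h => n u h; first exact: Hn.
    have := Hn n.+1 (pi * u - pi * n.+1%:R); rewrite subrK => ->.
    by rewrite [in LHS]NegzE mulrNz mulrN -pmulrn.
  elim: n v => [|n IH] v; first by rewrite mulr0 addr0.
  by rewrite -natr1 mulrDr mulr1 addrA sinDpi normrN IH.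
rewrite E; have hp := @pihalf_ge1 R.
have K (v : R) : 0 <= v <= 1 / 2 -> v / 2 <= `|sin (pi * v)|.
  move=> /andP[v0 v1].
  have h1 : pi * v / 4 <= sin (pi * v).
    by apply: sin_ge_quarter; apply/andP; split; nra.
  by apply: le_trans (ler_norm _); nra.
have [u0|u0] := leP 0 u.
  by rewrite (ger0_norm u0); apply: K; rewrite u0 -(ger0_norm u0).
rewrite -[in X in _ <= X]normrN -sinN -mulrN (ltr0_norm u0); apply: K.
by rewrite oppr_ge0 (ltW u0) -(ltr0_norm u0).
Qed.

Lemma normr_cosB (R : realType) (x y : R) : `|cos x - cos y| <= `|x - y|.
Proof.
wlog xy : x y / x <= y.
  move=> H; have [/H//|/ltW /H] := leP x y; by rewrite distrC [X in _ <= X]distrC.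
have [c _ E] := cos_mvt xy.
rewrite distrC E [X in _ <= X]distrC normrM normrN ler_piMl //; exact: sin_max.
Qed.

Lemma normr_sinB (R : realType) (x y : R) : `|sin x - sin y| <= `|x - y|.
Proof.
have := normr_cosB (x - pi / 2) (y - pi / 2); rewrite !cosBpihalf.
by have -> : x - pi / 2 - (y - pi / 2) = x - y by ring.
Qed.

(* The modulus of the exponential sum [sum_v e(v)], with [e(t) = exp(2 i pi t)]. *)
Definition eabs (R : realType) (vs : seq R) : R :=
  Num.sqrt ((\sum_(v <- vs) c2 v) ^+ 2 + (\sum_(v <- vs) s2 v) ^+ 2).

Lemma eabs_ge0 (R : realType) (vs : seq R) : 0 <= eabs vs.
Proof. exact: sqrtr_ge0. Qed.

Lemma eabs_sqr (R : realType) (vs : seq R) :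
  eabs vs ^+ 2 = (\sum_(v <- vs) c2 v) ^+ 2 + (\sum_(v <- vs) s2 v) ^+ 2.
Proof. by rewrite sqr_sqrtr // addr_ge0 ?sqr_ge0. Qed.

Lemma eabs_sqrE (R : realType) (vs : seq R) :
  eabs vs ^+ 2 = \sum_(v <- vs) \sum_(w <- vs) c2 (v - w).
Proof.
rewrite eabs_sqr !expr2 !mulr_suml -big_split /=; apply: eq_bigr => v _.
rewrite !mulr_sumr -big_split /=; apply: eq_bigr => w _.
by rewrite c2B.
Qed.

Lemma eabs_nil (R : realType) : eabs ([::] : seq R) = 0.
Proof. by rewrite /eabs !big_nil expr0n /= addr0 sqrtr0. Qed.

Lemma eabs_seq1 (R : realType) (v : R) : eabs [:: v] = 1.
Proof. by rewrite /eabs !big_seq1 c2s2_norm sqrtr1. Qed.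

(** The left side is the absolute real part of [e(c)] times the exponential sum, so a common shift
    of the phases never takes it beyond the modulus. *)
Lemma eabs_cos (R : realType) (vs : seq R) (c : R) :
  `|\sum_(v <- vs) c2 (v + c)| <= eabs vs.
Proof.
have -> : \sum_(v <- vs) c2 (v + c)
    = (\sum_(v <- vs) c2 v) * c2 c - (\sum_(v <- vs) s2 v) * s2 c.
  rewrite !mulr_suml -sumrB; apply: eq_bigr => v _; exact: c2D.
rewrite -(@ler_pXn2r _ 2) // ?nnegrE ?eabs_ge0 // eabs_sqr real_normK ?num_real //.
move: (\sum_(v <- vs) c2 v) (\sum_(v <- vs) s2 v) => a b.
have := c2s2_norm c; have := sqr_ge0 (a * s2 c + b * c2 c).
move: (c2 c) (s2 c) => x y h1 h2.
rewrite -[X in _ <= X]mulr1 -h2; nra.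
Qed.

Lemma eabs_sum_cos (R : realType) (vs : seq R) : \sum_(v <- vs) c2 v <= eabs vs.
Proof.
apply: le_trans (ler_norm _) _; have := eabs_cos vs 0.
by under eq_bigr do rewrite addr0.
Qed.

Lemma eabs_allpairs (R : realType) (vs ws : seq R) :
  eabs [seq v + w | v <- vs, w <- ws] = eabs vs * eabs ws.
Proof.
rewrite /eabs -sqrtrM ?addr_ge0 ?sqr_ge0 //; congr Num.sqrt.
rewrite !big_allpairs_dep.
have -> : \sum_(v <- vs) \sum_(w <- ws) c2 (v + w)
   = (\sum_(v <- vs) c2 v) * (\sum_(w <- ws) c2 w)
     - (\sum_(v <- vs) s2 v) * (\sum_(w <- ws) s2 w).
  rewrite !mulr_suml -sumrB; apply: eq_bigr => v _.
  by rewrite !mulr_sumr -sumrB; apply: eq_bigr => w _; rewrite c2D.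
have -> : \sum_(v <- vs) \sum_(w <- ws) s2 (v + w)
   = (\sum_(v <- vs) s2 v) * (\sum_(w <- ws) c2 w)
     + (\sum_(v <- vs) c2 v) * (\sum_(w <- ws) s2 w).
  rewrite !mulr_suml -big_split; apply: eq_bigr => v _ /=.
  by rewrite !mulr_sumr -big_split; apply: eq_bigr => w _; rewrite /= s2D.
ring.
Qed.

Lemma eabs_cat (R : realType) (vs ws : seq R) : eabs (vs ++ ws) <= eabs vs + eabs ws.
Proof.
rewrite -(@ler_pXn2r _ 2) // ?nnegrE ?addr_ge0 ?eabs_ge0 // sqrrD !eabs_sqr !big_cat /=.
set a := \sum_(v <- vs) c2 v; set b := \sum_(v <- vs) s2 v.
set c := \sum_(v <- ws) c2 v; set d := \sum_(v <- ws) s2 v.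
have : a * c + b * d <= eabs vs * eabs ws.
  apply: le_trans (ler_norm _) _.
  rewrite -(@ler_pXn2r _ 2) // ?nnegrE ?mulr_ge0 ?eabs_ge0 //.
  rewrite exprMn !eabs_sqr -/a -/b -/c -/d real_normK ?num_real //.
  by have := sqr_ge0 (a * d - b * c); nra.
lra.
Qed.

Lemma eabs_le_size (R : realType) (vs : seq R) : eabs vs <= (size vs)%:R.
Proof.
elim: vs => [|v vs IH]; first by rewrite eabs_nil.
by rewrite -cat1s; apply: le_trans (eabs_cat _ _) _; rewrite eabs_seq1 /= -natr1 addrC lerD2r.
Qed.

Lemma eabs_perturb (R : realType) (T : Type) (s : seq T) (f g : T -> R) :
  eabs [seq f x | x <- s] <= eabs [seq g x | x <- s] + \sum_(x <- s) 8 * pi * `|f x - g x|.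
Proof.
have pi0 := @pi_gt0 R.
(* [e] bounds the change of each coordinate of the sum, and the modulus then moves by at most
   [2 * e]. With the crude Lipschitz constant [4 * pi] for [c2] and [s2] this gives [8 * pi]. *)
have K (a b c d e : R) : 0 <= e -> `|a - c| <= e -> `|b - d| <= e ->
    Num.sqrt (a ^+ 2 + b ^+ 2) <= Num.sqrt (c ^+ 2 + d ^+ 2) + 2 * e.
  move=> e0 h1 h2; set S := Num.sqrt (c ^+ 2 + d ^+ 2).
  have S0 : 0 <= S by exact: sqrtr_ge0.
  have SS : S ^+ 2 = c ^+ 2 + d ^+ 2 by rewrite sqr_sqrtr // addr_ge0 ?sqr_ge0.
  rewrite -(@ler_pXn2r _ 2) // ?nnegrE ?sqrtr_ge0 //; last by rewrite addr_ge0 // mulr_ge0.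
  rewrite sqr_sqrtr ?addr_ge0 ?sqr_ge0 //.
  move: h1 h2; rewrite !ler_norml => /andP[h1 h1'] /andP[h2 h2'].
  have cS : `|c| <= S by rewrite -(@ler_pXn2r _ 2) // ?nnegrE // real_normK ?num_real // SS lerDl sqr_ge0.
  have dS : `|d| <= S by rewrite -(@ler_pXn2r _ 2) // ?nnegrE // real_normK ?num_real // SS lerDr sqr_ge0.
  move: cS dS; rewrite !ler_norml => /andP[? ?] /andP[? ?].
  have h3 : a ^+ 2 <= c ^+ 2 + 2 * S * e + e ^+ 2 by nra.
  have h4 : b ^+ 2 <= d ^+ 2 + 2 * S * e + e ^+ 2 by nra.
  nra.
rewrite /eabs !big_map.
set e := \sum_(x <- s) 4 * pi * `|f x - g x|.
have -> : \sum_(x <- s) 8 * pi * `|f x - g x| = 2 * e.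
  by rewrite /e mulr_sumr; apply: eq_bigr => x _; ring.
have e0 : 0 <= e by apply: sumr_ge0 => x _; rewrite !mulr_ge0 // ltW.
apply: K => //; rewrite -sumrB; apply: le_trans (ler_norm_sum _ _ _) _;
  apply: ler_sum => x _.
  apply: le_trans (normr_cosB _ _) _.
  rewrite -mulrBr normrM ger0_norm; last by rewrite mulr_ge0 // ltW.
  by rewrite ler_wpM2r //; lra.
apply: le_trans (normr_sinB _ _) _.
rewrite -mulrBr normrM ger0_norm; last by rewrite mulr_ge0 // ltW.
by rewrite ler_wpM2r //; lra.
Qed.

(** * Diophantine approximation, divisors and power sums *)

Lemma dirichlet (R : realType) (t : R) (N : nat) : (0 < N)%N ->
  exists q a, [/\ (0 < q <= N)%N & `|q%:R * t - a%:~R| <= N%:R^-1 :> R].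
Proof.
move=> N0.
pose fr (i : nat) : R := i%:R * t - (Num.floor (i%:R * t))%:~R.
have fr01 i : 0 <= fr i < 1.
  by rewrite /fr subr_ge0 floor_le /= ltrBlDr; have := floorD1_gt (i%:R * t); rewrite intrD addrC.
have NR0 : (0 : R) < N%:R by rewrite ltr0n.
pose bin (i : nat) : nat := Num.truncn (N%:R * fr i).
have binP i : (bin i)%:R <= N%:R * fr i < (bin i).+1%:R.
  by apply: truncn_itv; rewrite mulr_ge0 ?ler0n //; case/andP: (fr01 i).
have binlt i : (bin i < N)%N.
  have /andP[h1 _] := binP i; have /andP[_ h2] := fr01 i.
  by rewrite -(@ltr_nat R); apply: le_lt_trans h1 _; rewrite -[X in _ < X]mulr1 ltr_pM2l.
pose F (i : 'I_N.+1) : 'I_N := Ordinal (binlt i).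
have /injectivePn [i [j ij Fij]] : ~~ injectiveb F.
  by apply/negP => /injectiveP/leq_card; rewrite !card_ord ltnn.
have {}Fij : bin i = bin j by move/(congr1 val): Fij.
wlog lt : i j ij Fij / (i < j)%N.
  move=> H; have : (i != j :> nat) by [].
  by rewrite neq_ltn => /orP[|] lt; [exact: (H i j)|apply: (H j i) => //; rewrite eq_sym].
exists (j - i)%N, (Num.floor (j%:R * t) - Num.floor (i%:R * t)).
rewrite subn_gt0 lt /=; split; first by have := ltn_ord j; lia.
have -> : (j - i)%:R * t - (Num.floor (j%:R * t) - Num.floor (i%:R * t))%:~R = fr j - fr i.
  by rewrite /fr natrB ?(ltnW lt) // intrB; ring.
have /andP[a1 a2] := binP i; have /andP[b1 b2] := binP j; rewrite Fij in a1 a2.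
rewrite -(@ler_pM2l _ N%:R) // divff ?gt_eqF // -[X in X * `|_|](gtr0_norm NR0) -normrM mulrBr.
by rewrite ler_norml; move: a1 a2 b1 b2; rewrite -natr1; lra.
Qed.

Lemma dirichlet_coprime (R : realType) (t : R) (N : nat) : (0 < N)%N ->
  exists q (a : int), [/\ (0 < q <= N)%N, coprime q `|a|%N &
    `|q%:R * t - a%:~R| <= N%:R^-1 :> R].
Proof.
move=> N0; have [q [a [/andP[q0 qN] h]]] := dirichlet t N0.
pose g := gcdn q `|a|.
have g0 : (0 < g)%N by rewrite gcdn_gt0 q0.
have gq : (g %| q)%N := dvdn_gcdl _ _.
have ga : (g %| `|a|)%N := dvdn_gcdr _ _.
have qE : q = (q %/ g * g)%N by rewrite divnK.
have [b aE] : exists b : int, a = b * g%:Z.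
  have /dvdzP[b ->] : (g%:Z %| a)%Z by rewrite dvdzE.
  by exists b.
have cop : coprime (q %/ g) `|b|.
  rewrite /coprime; have : gcdn (q %/ g * g) (`|b| * g) = g.
    have bE : (`|b| * g)%N = `|a|%N by rewrite [in RHS]aE abszM.
    by rewrite -qE bE.
  by rewrite -muln_gcdl -[RHS]mul1n => /eqP; rewrite eqn_pmul2r.
exists (q %/ g)%N, b; split => //.
  by rewrite divn_gt0 // dvdn_leq //= (leq_trans (leq_div _ _)).
apply: le_trans h; rewrite [in X in _ <= X]qE aE natrM intrM.
have -> : (q %/ g)%:R * g%:R * t - b%:~R * g%:~R = ((q %/ g)%:R * t - b%:~R) * g%:R :> R.
  by rewrite -pmulrn; ring.
by rewrite normrM normr_nat ler_peMr // ler1n.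
Qed.

(** * The divisor function *)

Lemma size_divisors_mul_le (p a m : nat) : prime p -> (0 < m)%N ->
  (size (divisors (p ^ a * m)) <= a.+1 * size (divisors m))%N.
Proof.
move=> pp m0; have p0 := prime_gt0 pp.
rewrite -[a.+1 in X in (_ <= X)%N](size_iota 0 a.+1).
rewrite -(size_allpairs (fun i e => p ^ i * e)%N).
apply: uniq_leq_size; first exact: divisors_uniq.
move=> d; rewrite -dvdn_divisors ?muln_gt0 ?expn_gt0 ?p0 // => dn.
(* A divisor is its common part with [p ^ a], one of [a.+1] powers of [p], times a cofactor that
   divides [m]. *)
have : d = (gcdn d (p ^ a) * (d %/ gcdn d (p ^ a)))%N by rewrite mulnC divnK // dvdn_gcdl.
have /(dvdn_pfactor _ _ pp)[i ia gE] : (gcdn d (p ^ a) %| p ^ a)%N := dvdn_gcdr _ _.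
move=> dE; rewrite dE gE; apply: allpairs_f; first by rewrite mem_iota.
rewrite -dvdn_divisors // -gE.
have g0 : (0 < gcdn d (p ^ a))%N by rewrite gcdn_gt0 expn_gt0 p0 orbT.
have h : (d %/ gcdn d (p ^ a) %| (p ^ a %/ gcdn d (p ^ a)) * m)%N.
  rewrite -(@dvdn_pmul2r (gcdn d (p ^ a))) // divnK ?dvdn_gcdl // mulnAC divnK ?dvdn_gcdr //.
rewrite Gauss_dvdr // in h.
rewrite /coprime; apply/eqP/(@eqP _ _ 1%N); rewrite -(eqn_pmul2r g0) muln_gcdl mul1n.
by rewrite !divnK ?dvdn_gcdl ?dvdn_gcdr.
Qed.

(** This is the [k]-th power of [a + 1 <= k * 2 ^ (a %/ k)]. In [divisor_bound] it handles a small
    prime [p], for which [a.+1 ^ k] may exceed [p ^ a], at the cost of the constant [k ^ k]. *)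
Lemma exp_pow2_le (k a : nat) : (0 < k)%N -> (a.+1 ^ k <= k ^ k * 2 ^ a)%N.
Proof.
move=> k0; have h : (a.+1 <= k * 2 ^ (a %/ k))%N.
  apply: leq_trans (_ : k * (a %/ k).+1 <= _)%N; last by rewrite leq_mul2l ltn_expl ?orbT.
  by rewrite mulnS {1}(divn_eq a k) mulnC -addSn addnC mulnC; have := ltn_pmod a k0; lia.
apply: (@leq_trans ((k * 2 ^ (a %/ k)) ^ k)%N); first by rewrite leq_exp2r.
by rewrite expnMn leq_mul2l -expnM leq_pexp2l ?orbT // leq_divM.
Qed.

(* [d(p ^ a) = a + 1] is at most [p ^ (a / k)] as soon as [p >= 2 ^ k], so only
   the finitely many smaller primes contribute to the constant. *)
Lemma divisor_bound (k : nat) : exists C : nat, (0 < C)%N /\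
  forall n, (0 < n)%N -> (size (divisors n) ^ k <= C * n)%N.
Proof.
case: k => [|k']; first by exists 1%N; split => // n n0; rewrite expn0 mul1n.
set k := k'.+1; set c := (k ^ k)%N; have c0 : (0 < c)%N by rewrite expn_gt0.
exists (c ^ (2 ^ k))%N; split; first by rewrite expn_gt0 c0.
suff H n : (0 < n)%N ->
    (size (divisors n) ^ k <= c ^ count (fun p => p < 2 ^ k)%N (primes n) * n)%N.
  move=> n n0; apply: leq_trans (H n n0) _; rewrite leq_mul2r leq_pexp2l ?orbT //.
  rewrite -size_filter -[X in (_ <= X)%N](size_iota 0); apply: uniq_leq_size.
    by rewrite filter_uniq // primes_uniq.
  by move=> p; rewrite mem_filter mem_iota add0n /= => /andP[].
have [N] := ubnP n; elim: N n => // N IH n nN n0.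
have [n1|n1] := leqP n 1%N.
  have -> : n = 1%N by lia.
  by rewrite (_ : divisors 1 = [:: 1%N]) //= exp1n.
set p := pdiv n; have pp : prime p := pdiv_prime n1.
have [m pm nE] := pfactor_coprime pp n0; set a := logn p n in nE.
have a0 : (0 < a)%N by rewrite logn_gt0 mem_primes pp n0 pdiv_dvd.
have m0 : (0 < m)%N by move: n0; rewrite nE muln_gt0 => /andP[].
have mn : (m < n)%N by rewrite [X in (_ < X)%N]nE ltn_Pmulr // -(exp1n a) ltn_exp2r // prime_gt1.
have {}IH := IH m (leq_trans mn (ltnSE nN)) m0.
have cntE : count (fun p => p < 2 ^ k)%N (primes n)
    = ((p < 2 ^ k)%N + count (fun p => p < 2 ^ k)%N (primes m))%N.
  rewrite -[RHS]/(count _ (p :: primes m)); apply/permP.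
  apply: uniq_perm; first exact: primes_uniq.
    by rewrite /= primes_uniq mem_primes pp m0 /= -prime_coprime // pm.
  move=> r; have -> : (r \in primes n) = (r \in primes (m * p ^ a)) by rewrite -nE.
  rewrite primesM ?expn_gt0 ?(prime_gt0 pp) // (primesX _ a0) (primes_prime pp).
  by rewrite !inE orbC.
have h1 : (a.+1 ^ k <= c ^ (p < 2 ^ k)%N * p ^ a)%N.
  case: ltnP => hp.
    rewrite expn1; apply: leq_trans (exp_pow2_le a _) _ => //.
    by rewrite leq_mul2l leq_exp2r ?prime_gt1 ?orbT.
  rewrite expn0 mul1n; apply: leq_trans (_ : (2 ^ k) ^ a <= _)%N; last by rewrite leq_exp2r.
  by rewrite -expnM mulnC expnM leq_exp2r // ltn_expl.
have h2 := size_divisors_mul_le a pp m0.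
have h3 : (size (divisors n) <= a.+1 * size (divisors m))%N by move: h2; rewrite mulnC -nE.
rewrite cntE expnD; apply: (@leq_trans ((a.+1 * size (divisors m)) ^ k)%N).
  by rewrite leq_exp2r.
rewrite expnMn; apply: leq_trans (leq_mul h1 IH) _.
by rewrite [X in (_ <= _ * X)%N]nE leq_eqVlt; apply/orP; left; apply/eqP; ring.
Qed.

(** * Sums of real powers *)

Lemma powR_root_pow (R : realType) (x : R) (k : nat) : (0 < k)%N -> 0 <= x ->
  (x `^ (k%:R^-1)) ^+ k = x.
Proof.
move=> k0 x0; rewrite -powR_mulrn ?powR_ge0 // -powRrM mulVf ?powRr1 //.
by rewrite pnatr_eq0 -lt0n.
Qed.

Lemma powR_div (R : realType) (x y r : R) : 0 <= x -> 0 < y ->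
  (x / y) `^ r = x `^ r * y `^ (- r).
Proof.
move=> x0 y0; rewrite powRM ?invr_ge0 ?(ltW y0) //; congr (_ * _).
by rewrite -(powR_inv1 (ltW y0)) -powRrM mulN1r.
Qed.

Lemma subrX_le (R : realType) (u v : R) (k : nat) : 0 <= v <= u ->
  u ^+ k - v ^+ k <= (u - v) * (k%:R * u ^+ k.-1).
Proof.
move=> /andP[v0 vu]; rewrite subrXX; apply: ler_wpM2l; first by rewrite subr_ge0.
have -> : k%:R * u ^+ k.-1 = \sum_(i < k) u ^+ k.-1 by rewrite sumr_const card_ord mulr_natl.
apply: ler_sum => i _.
have -> : u ^+ k.-1 = u ^+ (k.-1 - i) * u ^+ i.
  by rewrite -exprD; congr (_ ^+ _); have := ltn_ord i; lia.
by apply: ler_pM; rewrite ?exprn_ge0 ?lerXn2r ?nnegrE ?(le_trans v0 vu).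
Qed.

(** A comparison with an integral, done algebraically: if [u] and [v] are the [k]-th roots of
    consecutive integers, then [1 = u^k - v^k <= (u - v) k u^(k-1)], and the sum telescopes. For
    this reason the exponents are built from reciprocals of integers. *)
Lemma sum_root_le (R : realType) (k Q : nat) : (0 < k)%N ->
  \sum_(1 <= q < Q.+1) (q%:R : R) `^ (k%:R^-1 - 1) <= k%:R * Q%:R `^ (k%:R^-1).
Proof.
move=> k0; elim: Q => [|Q IH].
  by rewrite big_geq // mulr_ge0 ?powR_ge0 ?ler0n.
rewrite big_nat_recr //=; apply: le_trans (lerD IH (lexx _)) _.
set u := Q.+1%:R `^ (k%:R^-1) : R; set v := Q%:R `^ (k%:R^-1) : R.
have v0 : 0 <= v by exact: powR_ge0.
have u0 : 0 < u by rewrite powR_gt0 // ltr0Sn.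
have uv : v <= u by rewrite ge0_ler_powR ?nnegrE ?ler0n // ?invr_ge0 ?ler0n // ler_nat.
have h : u ^+ k - v ^+ k <= (u - v) * (k%:R * u ^+ k.-1) by apply: subrX_le; rewrite v0.
rewrite !powR_root_pow ?ler0n // -natr1 addrAC subrr add0r in h.
have -> : (Q.+1%:R : R) `^ (k%:R^-1 - 1) = (u ^+ k.-1)^-1.
  rewrite powRB ?powRr1 ?ler0n //; last by rewrite pnatr_eq0 implybT.
  rewrite -/u -[X in _ / X](@powR_root_pow R _ k) ?ler0n // -/u -[in X in _ / X](prednK k0) exprS.
  by rewrite invfM mulrA divff ?gt_eqF // mul1r.
rewrite -lerBrDl -mulrBr -(@ler_pM2r _ (u ^+ k.-1)) ?exprn_gt0 // mulVf ?gt_eqF ?exprn_gt0 //.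
by apply: le_trans h _; rewrite le_eqVlt; apply/orP; left; apply/eqP; ring.
Qed.

(** [1/q <= q^(1/k - 1)] trades the logarithm for a small power, so that a single quantity of the
    shape [C * X^(2/k)] bounds both this sum and the divisor function. *)
Lemma harmonic_le (R : realType) (k Q : nat) : (0 < k)%N ->
  \sum_(1 <= q < Q.+1) (q%:R : R)^-1 <= k%:R * Q%:R `^ (k%:R^-1).
Proof.
move=> k0; apply: le_trans (sum_root_le R Q k0).
rewrite big_nat [X in _ <= X]big_nat; apply: ler_sum => q /andP[q1 _].
have q0 : (0 : R) <= q%:R by rewrite ler0n.
rewrite -powR_inv1 //; apply: ler_powR; first by rewrite ler1n.
by rewrite lerDr invr_ge0 ler0n.
Qed.

(** With [u] and [v] the roots of consecutive integers, [u^-(k+1) <= k (1/v - 1/u)], so the sum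
    telescopes again; the first term accounts for the [1] in [k.+1]. *)
Lemma sum_zeta_le (R : realType) (k Q : nat) : (0 < k)%N ->
  \sum_(1 <= q < Q.+1) (q%:R : R) `^ (- 1 - k%:R^-1) <= k.+1%:R.
Proof.
move=> k0.
have kR : (0 : R) < k%:R by rewrite ltr0n.
suff H n : \sum_(1 <= q < n.+2) (q%:R : R) `^ (- 1 - k%:R^-1)
    <= k.+1%:R - k%:R * (n.+1%:R `^ (k%:R^-1))^-1.
  case: Q => [|Q]; first by rewrite big_geq.
  apply: le_trans (H Q) _; rewrite gerBl mulr_ge0 ?invr_ge0 ?powR_ge0 //.
elim: n => [|n IH].
  by rewrite big_nat1 !powR1 invr1 -natr1; lra.
rewrite big_nat_recr //=; apply: le_trans (lerD IH (lexx _)) _.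
set u := n.+2%:R `^ (k%:R^-1) : R; set v := n.+1%:R `^ (k%:R^-1) : R.
have v0 : 0 < v by rewrite powR_gt0 // ltr0Sn.
have u0 : 0 < u by rewrite powR_gt0 // ltr0Sn.
have uv : v <= u by rewrite ge0_ler_powR ?nnegrE ?ler0n // ?invr_ge0 ?ler0n // ler_nat.
have h : u ^+ k - v ^+ k <= (u - v) * (k%:R * u ^+ k.-1).
  by apply: subrX_le; rewrite uv ltW.
rewrite !powR_root_pow ?ler0n // -(natr1 n.+1) addrAC subrr add0r in h.
have -> : (n.+2%:R : R) `^ (- 1 - k%:R^-1) = (u ^+ k * u)^-1.
  by rewrite -opprD powRN powRD ?pnatr_eq0 ?implybT // powRr1 ?ler0n // -/u powR_root_pow ?ler0n.
have -> : u ^+ k = u * u ^+ k.-1 by rewrite -exprS prednK.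
have w0 : 0 < u ^+ k.-1 by rewrite exprn_gt0.
move: (u ^+ k.-1) w0 h => w w0 h.
suff : (u * w * u)^-1 <= k%:R * (v^-1 - u^-1) by rewrite mulrBr; lra.
have -> : v^-1 - u^-1 = (u - v) / (u * v) by field; rewrite !gt_eqF.
have -> : (u * w * u)^-1 = 1 / (w * (u * u)) by field; rewrite !gt_eqF.
apply: le_trans (_ : (u - v) * (k%:R * w) / (w * (u * u)) <= _).
  by rewrite ler_wpM2r // invr_ge0 !mulr_ge0 // ltW.
have -> : (u - v) * (k%:R * w) / (w * (u * u)) = k%:R * ((u - v) / (u * u)).
  by field; rewrite !gt_eqF.
rewrite ler_wpM2l ?(ltW kR) // ler_wpM2l ?subr_ge0 // lef_pV2 ?posrE ?mulr_gt0 //.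
by rewrite ler_wpM2l // ltW.
Qed.

(** * Weyl differencing *)

Lemma sqr_sum_le (R : realType) (T : Type) (s : seq T) (a : T -> R) :
  (\sum_(x <- s) a x) ^+ 2 <= (size s)%:R * \sum_(x <- s) a x ^+ 2.
Proof.
elim: s => [|x s IH]; first by rewrite !big_nil mulr0 expr0n.
rewrite !big_cons /= -natr1; move: IH.
set S := \sum_(y <- s) a y; set T' := \sum_(y <- s) a y ^+ 2.
have T0 : 0 <= T' by apply: sumr_ge0 => y _; exact: sqr_ge0.
have [->|s0] := eqVneq (size s) 0%N.
  rewrite mul0r add0r mul1r => h; have /eqP : S ^+ 2 = 0 by apply/le_anti; rewrite h sqr_ge0.
  by rewrite sqrf_eq0 => /eqP ->; lra.
have n0 : (0 : R) < (size s)%:R by rewrite ltr0n lt0n.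
move: (_%:R) n0 => n n0 h.
have h2 : 2 * S * a x <= T' + n * a x ^+ 2.
  have := sqr_ge0 (S - n * a x) => h3.
  rewrite -(ler_pM2l n0); nra.
lra.
Qed.

Lemma sqr_sum_ord_le (R : realType) (n : nat) (a : nat -> R) :
  (\sum_(i < n) a i) ^+ 2 <= n%:R * \sum_(i < n) a i ^+ 2.
Proof.
have := sqr_sum_le (iota 0 n) a; rewrite size_iota.
by rewrite -[n in iota 0 n]subn0 -/(index_iota 0 n) !big_mkord.
Qed.

Definition esum (R : realType) (phi : nat -> R) (n : nat) : R :=
  eabs [seq phi i | i <- iota 0 n].

Definition dph (R : realType) (phi : nat -> R) (h : nat) : nat -> R :=
  fun i => phi (i + h)%N - phi i.

Lemma esum_ge0 (R : realType) (phi : nat -> R) n : 0 <= esum phi n.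
Proof. exact: eabs_ge0. Qed.

Lemma esum_le (R : realType) (phi : nat -> R) n : esum phi n <= n%:R.
Proof. by apply: le_trans (eabs_le_size _) _; rewrite size_map size_iota. Qed.

Lemma esum_sqrE (R : realType) (phi : nat -> R) n :
  esum phi n ^+ 2 = (\sum_(i < n) c2 (phi i)) ^+ 2 + (\sum_(i < n) s2 (phi i)) ^+ 2.
Proof.
by rewrite eabs_sqr !big_map -[n in iota 0 n]subn0 -/(index_iota 0 n) !big_mkord.
Qed.

Lemma esum_sum_cos (R : realType) (phi : nat -> R) n :
  \sum_(i < n) c2 (phi i) <= esum phi n.
Proof.
apply: le_trans (eabs_sum_cos _).
by rewrite !big_map -[n in iota 0 n]subn0 -/(index_iota 0 n) !big_mkord.
Qed.

Lemma eq_esum (R : realType) (phi psi : nat -> R) n : phi =1 psi -> esum phi n = esum psi n.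
Proof. by move=> h; rewrite /esum (eq_map h). Qed.

Lemma esum_sqr_diffE (R : realType) (phi : nat -> R) n :
  esum phi n ^+ 2 = n%:R
    + 2 * \sum_(h < n) \sum_(i < n - h.+1) c2 (dph phi h.+1 i).
Proof.
rewrite esum_sqrE; elim: n => [|n IH]; first by rewrite !big_ord0; ring.
rewrite [in LHS]big_ord_recr [\sum_(i < n.+1) s2 _]big_ord_recr /=.
rewrite [in RHS]big_ord_recr /= subnn big_ord0 addr0.
have -> : \sum_(h < n) \sum_(i < n.+1 - h.+1) c2 (dph phi h.+1 i)
  = \sum_(h < n) \sum_(i < n - h.+1) c2 (dph phi h.+1 i)
    + \sum_(h < n) c2 (phi n - phi h).
  rewrite [X in _ = _ + X](reindex_inj rev_ord_inj) -big_split /=; apply: eq_bigr => h _.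
  have -> : (n.+1 - h.+1 = (n - h.+1).+1)%N by have := ltn_ord h; lia.
  by rewrite big_ord_recr /= /dph subnK.
have -> : \sum_(h < n) c2 (phi n - phi h)
  = c2 (phi n) * \sum_(h < n) c2 (phi h) + s2 (phi n) * \sum_(h < n) s2 (phi h).
  by rewrite !mulr_sumr -big_split; apply: eq_bigr => h _; rewrite c2B.
rewrite mulrDr addrA -natr1; have h1 := c2s2_norm (phi n).
move: IH; set T := 2 * \sum_(h < n) _; move: T => T IH.
move: IH h1; set A := \sum_(i < n) c2 _; set B := \sum_(i < n) s2 _ => IH h1.
have -> : (A + c2 (phi n)) ^+ 2 + (B + s2 (phi n)) ^+ 2 = (A ^+ 2 + B ^+ 2)
    + (c2 (phi n) ^+ 2 + s2 (phi n) ^+ 2) + 2 * (c2 (phi n) * A + s2 (phi n) * B) by ring.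
by rewrite IH h1; ring.
Qed.

(** Weyl differencing: the shifts [h] and [-h] contribute equal cosines, hence the factor 2. The
    shift 0 is then counted twice, which keeps the right side uniform in [h]. *)
Lemma esum_diff (R : realType) (phi : nat -> R) n :
  esum phi n ^+ 2 <= 2 * \sum_(h < n) esum (dph phi h) (n - h).
Proof.
rewrite esum_sqr_diffE; case: n => [|n]; first by rewrite !big_ord0; lra.
rewrite [in X in _ <= X]big_ord_recl /= subn0.
have -> : esum (dph phi 0) n.+1 = n.+1%:R.
  apply/eqP; rewrite -(@eqrXn2 _ 2) ?esum_ge0 ?ler0n // esum_sqrE.
  rewrite (eq_bigr (fun=> 1)); last by move=> i _; rewrite /dph addn0 subrr c20.
  rewrite [\sum_(i < n.+1) s2 _](eq_bigr (fun=> 0)); last by move=> i _; rewrite /dph addn0 subrr s20.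
  by rewrite !sumr_const card_ord mul0rn expr0n addr0.
rewrite [in X in X <= _]big_ord_recr /= subnn big_ord0 addr0 mulrDr.
apply: lerD; first by rewrite ler_peMl ?ler0n //; lra.
rewrite ler_pM2l //; apply: ler_sum => h _.
exact: esum_sum_cos.
Qed.

(** * Linear phases and their sums over residue classes *)

Lemma esum_lin (R : realType) (t s : R) n :
  esum (fun i => t * i%:R + s) n * `|sin (pi * t)| <= 1.
Proof.
pose C := \sum_(i < n) c2 (t * i%:R + s); pose S := \sum_(i < n) s2 (t * i%:R + s).
(* The phase at [m] moved back by half a step: multiplication by [2 * sin (pi * t)] turns each term
   into a difference of values at [z m.+1] and [z m]. *)
pose z m := 2 * pi * (t * m%:R + s) - pi * t : R.
have zS m : z m.+1 = z m + (pi * t + pi * t) by rewrite /z -natr1; ring.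
have EC m : 2 * sin (pi * t) * \sum_(i < m) c2 (t * i%:R + s) = sin (z m) - sin (z 0%N).
  elim: m => [|m IH]; first by rewrite big_ord0 mulr0 subrr.
  rewrite big_ord_recr /= mulrDr IH zS addrA !(sinD _ (pi * t)) !(cosD _ (pi * t)) /c2.
  have -> : 2 * pi * (t * m%:R + s) = z m + pi * t by rewrite /z; ring.
  rewrite cosD; apply/eqP; rewrite -subr_eq0; apply/eqP.
  transitivity (sin (z m) * (1 - (cos (pi * t) ^+ 2 + sin (pi * t) ^+ 2))); first by ring.
  by rewrite cos2Dsin2; ring.
have ES m : 2 * sin (pi * t) * \sum_(i < m) s2 (t * i%:R + s) = cos (z 0%N) - cos (z m).
  elim: m => [|m IH]; first by rewrite big_ord0 mulr0 subrr.
  rewrite big_ord_recr /= mulrDr IH zS addrA !(cosD _ (pi * t)) !(sinD _ (pi * t)) /s2.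
  have -> : 2 * pi * (t * m%:R + s) = z m + pi * t by rewrite /z; ring.
  rewrite sinD; apply/eqP; rewrite -subr_eq0; apply/eqP.
  transitivity (cos (z m) * (cos (pi * t) ^+ 2 + sin (pi * t) ^+ 2 - 1)); first by ring.
  by rewrite cos2Dsin2; ring.
rewrite -(@ler_pXn2r _ 2) // ?nnegrE ?mulr_ge0 ?esum_ge0 // exprMn esum_sqrE -/C -/S.
rewrite real_normK ?num_real // expr1n.
have h1 := cos2Dsin2 (z n); have h2 := cos2Dsin2 (z 0%N).
have h3 := sqr_ge0 (sin (z n) + sin (z 0%N)); have h4 := sqr_ge0 (cos (z n) + cos (z 0%N)).
have : (2 * sin (pi * t) * C) ^+ 2 + (2 * sin (pi * t) * S) ^+ 2 <= 4.
  by rewrite /C /S EC ES; nra.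
lra.
Qed.

(** The usual [min(X, 1/||t||)], with [|sin(pi t)|] in the role of the distance to the nearest
    integer. The test is there because the inverse of 0 is 0. *)
Definition wmin (R : realType) (X t : R) : R :=
  if sin (pi * t) == 0 then X else Num.min X `|sin (pi * t)|^-1.

Lemma wmin_ge0 (R : realType) (X t : R) : 0 <= X -> 0 <= wmin X t.
Proof. by move=> X0; rewrite /wmin; case: ifP => // _; rewrite le_min X0 invr_ge0 normr_ge0. Qed.

Lemma wmin_le (R : realType) (X t : R) : wmin X t <= X.
Proof. by rewrite /wmin; case: ifP => // _; rewrite ge_min lexx. Qed.

Lemma wmin_le_inv (R : realType) (X t y : R) : 0 < y -> y <= `|sin (pi * t)| -> wmin X t <= y^-1.
Proof.
move=> y0 h; rewrite /wmin ifF; last first.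
  by apply/negP => /eqP E; move: h; rewrite E normr0; lra.
by rewrite ge_min lef_pV2 ?posrE ?h ?orbT // (lt_le_trans y0 h).
Qed.

Lemma esum_lin_wmin (R : realType) (t s : R) n (X : R) : n%:R <= X ->
  esum (fun i => t * i%:R + s) n <= wmin X t.
Proof.
move=> nX; rewrite /wmin; case: ifP => [_|/negbT h].
  exact: le_trans (esum_le _ _) nX.
rewrite le_min (le_trans (esum_le _ _) nX) /=.
rewrite -[X in _ <= X]mul1r ler_pdivlMr ?normr_gt0 //; exact: esum_lin.
Qed.

Definition cubic (R : realType) (t3 t2 t1 t0 : R) (x : R) : R :=
  t3 * x ^+ 3 + t2 * x ^+ 2 + t1 * x + t0.

Lemma weyl2 (R : realType) (t2 t1 t0 : R) n :
  esum (fun i => cubic 0 t2 t1 t0 i%:R) n ^+ 2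
    <= 2 * \sum_(h < n) wmin n%:R (2 * h%:R * t2).
Proof.
apply: le_trans (esum_diff _ _) _; rewrite ler_pM2l //; apply: ler_sum => h _.
rewrite (@eq_esum _ _ (fun i => 2 * h%:R * t2 * i%:R + (t2 * h%:R ^+ 2 + t1 * h%:R))).
  by apply: esum_lin_wmin; rewrite ler_nat leq_subr.
by move=> i; rewrite /dph /cubic natrD; ring.
Qed.

(** Two differencings joined by Cauchy-Schwarz leave a linear phase of slope [6 h k t3]. The lower
    coefficients only enter the constant term of that phase, so they disappear from the bound. *)
Lemma weyl3 (R : realType) (t3 t2 t1 t0 : R) n :
  esum (fun i => cubic t3 t2 t1 t0 i%:R) n ^+ 4
    <= 8 * n%:R * \sum_(h < n) \sum_(k < n) wmin n%:R (6 * h%:R * k%:R * t3).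
Proof.
set phi := fun i => _; have h1 := esum_diff phi n.
have -> : esum phi n ^+ 4 = (esum phi n ^+ 2) ^+ 2 by rewrite -exprM.
apply: le_trans (_ : (2 * \sum_(h < n) esum (dph phi h) (n - h)) ^+ 2 <= _).
  rewrite lerXn2r ?nnegrE ?exprn_ge0 ?esum_ge0 ?mulr_ge0 ?sumr_ge0 // => h _; exact: esum_ge0.
rewrite exprMn.
apply: le_trans (_ : 2 ^+ 2 * (n%:R * \sum_(h < n) esum (dph phi h) (n - h) ^+ 2) <= _).
  by rewrite ler_pM2l ?exprn_gt0 //; exact: (sqr_sum_ord_le n (fun h => esum (dph phi h) (n - h))).
have -> : 8 * n%:R * \sum_(h < n) \sum_(k < n) wmin n%:R (6 * h%:R * k%:R * t3)
   = 2 ^+ 2 * (n%:R * \sum_(h < n) (2 * \sum_(k < n) wmin n%:R (6 * h%:R * k%:R * t3))).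
  by rewrite -mulr_sumr; ring.
rewrite ler_pM2l ?exprn_gt0 // ler_wpM2l ?ler0n //; apply: ler_sum => h _.
apply: le_trans (esum_diff _ _) _; rewrite ler_pM2l //.
apply: le_trans (_ : \sum_(k < n - h) wmin n%:R (6 * h%:R * k%:R * t3) <= _).
  apply: ler_sum => k _.
  rewrite (@eq_esum _ _ (fun i => 6 * h%:R * k%:R * t3 * i%:R
     + (3 * t3 * h%:R * k%:R * (h%:R + k%:R) + 2 * t2 * h%:R * k%:R))).
    by apply: esum_lin_wmin; rewrite ler_nat (leq_trans (leq_subr _ _)) // leq_subr.
  by move=> i; rewrite /dph /phi /cubic !natrD; ring.
rewrite -!(big_mkord xpredT (fun k => wmin n%:R (6 * h%:R * k%:R * t3))).
rewrite [X in _ <= X](@big_cat_nat _ _ _ (n - h)) ?leq_subr //= lerDl.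
by apply: sumr_ge0 => k _; rewrite wmin_ge0 ?ler0n.
Qed.

(** Modulo 1, [h a / q] is [r / q] with [r = (h * a) %% q], and the perturbation [h b] is at most
    half of [1 / q]. So the distance to the nearest integer is at least half of [r / q] or half of
    [(q - r) / q]; the right side adds the bounds of both cases. *)
Lemma wmin_rat_le (R : realType) (X : R) (q a h : nat) (b : R) : (0 < q)%N ->
  `|h%:R * b| <= (2 * q%:R)^-1 -> (0 < (h * a) %% q)%N ->
  wmin X (h%:R * (a%:R / q%:R + b))
    <= 4 * q%:R * (((h * a) %% q)%:R^-1 + (q - (h * a) %% q)%:R^-1).
Proof.
move=> q0 hb r0; set r := ((h * a) %% q)%N; set k := ((h * a) %/ q)%N.
have rq : (r < q)%N by rewrite ltn_mod.
have qR : (0 : R) < q%:R by rewrite ltr0n.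
have rR : (0 : R) < r%:R by rewrite ltr0n.
have r1 : (1 : R) <= r%:R by rewrite ler1n.
have qrR : (1 : R) <= (q - r)%:R by rewrite ler1n subn_gt0.
have qrE : (q - r)%:R = q%:R - r%:R :> R by rewrite natrB // ltnW.
set u : R := r%:R / q%:R + h%:R * b.
have tE : h%:R * (a%:R / q%:R + b) = u + (k%:Z)%:~R.
  have := divn_eq (h * a) q; rewrite -/r -/k => /(congr1 (fun x => x%:R : R)).
  rewrite natrM natrD natrM /u -pmulrn => E.
  have -> : h%:R * (a%:R / q%:R + b) = (h%:R * a%:R) / q%:R + h%:R * b by ring.
  by rewrite E; field; rewrite gt_eqF.
have [hb1 hb2] : - (2 * q%:R)^-1 <= h%:R * b /\ h%:R * b <= (2 * q%:R)^-1.
  by apply/andP; rewrite -ler_norml.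
have E2 : (2 * q%:R)^-1 = 1 / 2 / q%:R :> R by field; rewrite gt_eqF.
rewrite E2 in hb1 hb2.
have iq0 : 0 < q%:R^-1 :> R by rewrite invr_gt0.
have u1 : r%:R / 2 / q%:R <= u.
  have : 1 / 2 / q%:R <= r%:R / 2 / q%:R :> R by rewrite (ler_pM2r iq0); lra.
  by rewrite /u; lra.
have u2 : u <= 1 - (q - r)%:R / 2 / q%:R.
  have : 1 / 2 / q%:R <= (q - r)%:R / 2 / q%:R :> R by rewrite (ler_pM2r iq0); lra.
  have : 1 = q%:R / q%:R :> R by rewrite divff ?gt_eqF.
  by rewrite /u qrE; lra.
have p1 : 0 < r%:R / 2 / q%:R :> R by rewrite !divr_gt0.
have p2 : 0 < (q - r)%:R / 2 / q%:R :> R by rewrite !divr_gt0 //; lra.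
have [uh|uh] := leP u (1 / 2).
  apply: le_trans (@wmin_le_inv _ _ _ (r%:R / 2 / q%:R / 2) _ _) _; first by rewrite divr_gt0.
    have := @sin_pi_dist R (h%:R * (a%:R / q%:R + b)) k.
    rewrite tE addrK ger0_norm; last lra.
    by move=> /(_ uh); lra.
  have -> : (r%:R / 2 / q%:R / 2)^-1 = 4 * q%:R * r%:R^-1 :> R by field; rewrite !gt_eqF.
  by rewrite ler_pM2l ?mulr_gt0 // lerDl invr_ge0 ler0n.
apply: le_trans (@wmin_le_inv _ _ _ ((q - r)%:R / 2 / q%:R / 2) _ _) _; first by rewrite divr_gt0.
  have := @sin_pi_dist R (h%:R * (a%:R / q%:R + b)) (k%:Z + 1).
  rewrite tE intrD.
  have -> : u + k%:~R - (k%:~R + 1%:~R) = u - 1 by ring.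
  rewrite ler0_norm; last lra.
  by move=> /(_ ltac:(lra)); lra.
have -> : ((q - r)%:R / 2 / q%:R / 2)^-1 = 4 * q%:R * (q - r)%:R^-1 :> R.
  by field; rewrite !gt_eqF //; lra.
by rewrite ler_pM2l ?mulr_gt0 // lerDr invr_ge0 ler0n.
Qed.

Lemma sum_mod_le (R : realType) (q H : nat) (F : nat -> R) : (0 < q)%N ->
  (forall i, 0 <= F i) ->
  \sum_(h < H) F (h %% q)%N <= (H %/ q).+1%:R * \sum_(i < q) F i.
Proof.
move=> q0 F0.
have E J : \sum_(h < J * q) F (h %% q)%N = J%:R * \sum_(i < q) F i.
  elim: J => [|J IH]; first by rewrite mul0n big_ord0 mul0r.
  rewrite mulSn addnC big_split_ord /= IH -natr1 mulrDl mul1r; congr (_ + _).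
  by apply: eq_bigr => i _; rewrite modnMDl modn_small.
rewrite -E -!(big_mkord xpredT (fun h => F (h %% q)%N)).
have le : (H <= (H %/ q).+1 * q)%N by rewrite ltnW // -ltn_divLR.
by rewrite [X in _ <= X](@big_cat_nat _ _ _ H) //= lerDl; apply: sumr_ge0.
Qed.

(** Multiplication by [a] permutes the residues modulo [q], so each of the [H / q + 1] blocks costs
    at most [8 q L]. Multiples of [q] are set aside, because there the phase is governed by [b]
    alone and no cancellation is guaranteed. *)
Lemma sum_wmin_nonmult (R : realType) (X L : R) (q a H : nat) (b : R) :
  (0 < q)%N -> coprime q a ->
  (forall h, (h < H)%N -> `|h%:R * b| <= (2 * q%:R)^-1) ->
  \sum_(1 <= r < q.+1) (r%:R : R)^-1 <= L ->
  \sum_(h < H | ~~ (q %| h)%N) wmin X (h%:R * (a%:R / q%:R + b)) <= 8 * (H + q)%:R * L.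
Proof.
move=> q0 qa hb hL.
pose g (r : nat) : R := if r == 0%N then 0 else 4 * q%:R * (r%:R^-1 + (q - r)%:R^-1).
have g0 r : 0 <= g r by rewrite /g; case: ifP => // _; rewrite !mulr_ge0 ?addr_ge0 ?invr_ge0 ?ler0n.
have L0 : 0 <= L by apply: le_trans hL; apply: sumr_ge0 => r _; rewrite invr_ge0 ler0n.
apply: le_trans (_ : \sum_(h < H) g ((h %% q) * a %% q)%N <= _).
  rewrite [X in _ <= X](bigID (fun h : 'I_H => ~~ (q %| h)%N)) /= -[X in X <= _]addr0.
  apply: lerD; last by apply: sumr_ge0.
  apply: ler_sum => h qh; rewrite modnMml /g ifF; first apply: wmin_rat_le => //.
  - exact: hb.
  - by rewrite lt0n -/(dvdn q (h * a)) Gauss_dvdl.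
  - by apply/negbTE; rewrite -/(dvdn q (h * a)) Gauss_dvdl.
apply: le_trans (@sum_mod_le R q H (fun i => g (i * a %% q)%N) q0 _) _ => //.
have S1 : \sum_(i < q) g (i * a %% q)%N = \sum_(i < q) g i.
  case: q q0 qa {hb hL} g {g0} => // q _ qa g.
  pose f (i : 'I_q.+1) : 'I_q.+1 := inord (i * a %% q.+1).
  have fE i : f i = (i * a %% q.+1)%N :> nat by rewrite inordK // ltn_mod.
  have fI : injective f.
    move=> i j /(congr1 val) /=; rewrite !fE => /eqP.
    wlog ij : i j / (i <= j)%N.
      move=> K; have [/K//|/ltnW /K K'] := leqP i j; by move=> h; apply/esym/K'; rewrite eq_sym.
    rewrite eq_sym eqn_mod_dvd ?leq_mul2r ?ij ?orbT // -mulnBl Gauss_dvdl // => dv.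
    apply/val_inj/eqP; rewrite /= eqn_leq ij /= -subn_eq0.
    have : (j - i < q.+1)%N by apply: leq_ltn_trans (leq_subr _ _) (ltn_ord j).
    by apply: contraTT; rewrite -lt0n => jpos; rewrite -leqNgt dvdn_leq.
  by rewrite [RHS](reindex_inj fI) /=; apply: eq_bigr => i _; rewrite fE.
have S2 : \sum_(i < q) g i <= 8 * q%:R * L.
  have -> : 8 * q%:R * L = 4 * q%:R * (L + L) by ring.
  rewrite /g; clear g g0 S1 qa hb; case: q q0 hL => // q _ hL; rewrite big_ord_recl /= add0r.
  rewrite -mulr_sumr ler_wpM2l ?mulr_ge0 ?ler0n // big_split /=.
  have K : \sum_(i < q) (i.+1%:R : R)^-1 <= L.
    apply: le_trans hL; rewrite big_add1 /= big_mkord big_ord_recr /= lerDl invr_ge0 ler0n.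
    by [].
  apply: lerD; first exact: K.
  apply: le_trans K; rewrite [X in _ <= X](reindex_inj rev_ord_inj) /=.
  by apply: ler_sum => i _; rewrite subSS -subSn // subSS.
rewrite S1; apply: le_trans (ler_wpM2l _ S2) _; first by rewrite ler0n.
have : ((H %/ q).+1 * q <= H + q)%N by rewrite mulSn addnC leq_add2r leq_divM.
rewrite -(ler_nat R) natrM => h.
have -> : (H %/ q).+1%:R * (8 * q%:R * L) = 8 * L * ((H %/ q).+1%:R * q%:R) by ring.
have -> : 8 * (H + q)%:R * L = 8 * L * (H + q)%:R by ring.
by rewrite ler_wpM2l // mulr_ge0.
Qed.

Lemma wminDint (R : realType) (X t : R) (z : int) : wmin X (t + z%:~R) = wmin X t.
Proof.
have E : `|sin (pi * (t + z%:~R))| = `|sin (pi * t)|.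
  rewrite mulrDr.
  suff Hn (n : nat) (v : R) : `|sin (v + pi * n%:R)| = `|sin v|.
    case: z => n; first exact: Hn.
    have := Hn n.+1 (pi * t - pi * n.+1%:R); rewrite subrK => ->.
    by rewrite NegzE mulrNz mulrN -pmulrn.
  elim: n v => [|n IH] v; first by rewrite mulr0 addr0.
  by rewrite -natr1 mulrDr mulr1 addrA sinDpi normrN IH.
by rewrite /wmin -(normr_eq0 (sin _)) E normr_eq0.
Qed.

Lemma sum_mult (R : realType) (q N : nat) (F : nat -> R) : (0 < q)%N ->
  \sum_(1 <= n < N.+1 | (q %| n)%N) F n = \sum_(1 <= j < (N %/ q).+1) F (q * j)%N.
Proof.
move=> q0; elim: N => [|N IH]; first by rewrite div0n !big_geq.
rewrite big_mkcond big_nat_recr //= -big_mkcond IH divnS //.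
case: ifP => qN; last by rewrite add0n addr0.
rewrite add1n [RHS]big_nat_recr //=; congr (_ + F _).
by have := divnK qN; rewrite divnS // qN; lia.
Qed.

Lemma sum_mult_root (R : realType) (k q N : nat) : (0 < k)%N -> (0 < q)%N ->
  \sum_(1 <= n < N.+1 | (q %| n)%N) (n%:R : R) `^ (k%:R^-1 - 1)
    <= k%:R * N%:R `^ (k%:R^-1) / q%:R.
Proof.
move=> k0 q0; rewrite (sum_mult N (fun n => (n%:R : R) `^ (k%:R^-1 - 1)) q0).
have qR : (0 : R) < q%:R by rewrite ltr0n.
under eq_bigr do rewrite natrM powRM ?ler0n //.
rewrite -mulr_sumr; apply: le_trans (ler_wpM2l _ (sum_root_le R _ k0)) _; first exact: powR_ge0.
have -> : (q%:R : R) `^ (k%:R^-1 - 1) = q%:R `^ (k%:R^-1) / q%:R.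
  by rewrite powRB ?powRr1 ?ler0n // (gt_eqF qR) implybT.
set r := k%:R^-1.
have h : q%:R `^ r * (N %/ q)%:R `^ r <= (N%:R : R) `^ r.
  rewrite -powRM ?ler0n //; apply: ge0_ler_powR; rewrite ?nnegrE ?mulr_ge0 ?invr_ge0 ?ler0n //.
  by rewrite -natrM ler_nat mulnC leq_divM.
have -> : q%:R `^ r / q%:R * (k%:R * (N %/ q)%:R `^ r)
   = (k%:R / q%:R) * (q%:R `^ r * (N %/ q)%:R `^ r) by ring.
have -> : k%:R * N%:R `^ r / q%:R = (k%:R / q%:R) * N%:R `^ r by ring.
by rewrite ler_wpM2l // divr_ge0 ?ler0n.
Qed.

(** [gcdn n q] is itself one of the divisors [g] of [q] that divide [n]. The factor [g] cancels the
    density [1/g] of its multiples, so every divisor contributes the same amount. *)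
Lemma sum_gcd_root (R : realType) (k q N : nat) : (0 < k)%N -> (0 < q)%N ->
  \sum_(1 <= n < N.+1) (gcdn n q)%:R * (n%:R : R) `^ (k%:R^-1 - 1)
    <= k%:R * N%:R `^ (k%:R^-1) * (size (divisors q))%:R.
Proof.
move=> k0 q0.
apply: le_trans (_ : \sum_(g <- divisors q) k%:R * N%:R `^ (k%:R^-1) <= _); last first.
  by rewrite big_const_seq count_predT iter_addr_0 mulr_natr.
apply: le_trans (_ : \sum_(g <- divisors q) \sum_(1 <= n < N.+1)
     (g %| n)%N%:R * (g%:R * (n%:R : R) `^ (k%:R^-1 - 1)) <= _); last first.
  rewrite big_seq [X in _ <= X]big_seq; apply: ler_sum => g; rewrite -dvdn_divisors // => gq.
  have g0 : (0 < g)%N := dvdn_gt0 q0 gq.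
  have -> : \sum_(1 <= n < N.+1) (g %| n)%N%:R * (g%:R * (n%:R : R) `^ (k%:R^-1 - 1))
     = g%:R * \sum_(1 <= n < N.+1 | (g %| n)%N) (n%:R : R) `^ (k%:R^-1 - 1).
    rewrite mulr_sumr [RHS]big_mkcond; apply: eq_bigr => n _.
    by case: ifP => _; rewrite ?mul1r ?mul0r.
  apply: le_trans (ler_wpM2l (ler0n _ _) (sum_mult_root R N k0 g0)) _.
  by rewrite mulrCA divff ?mulr1 // pnatr_eq0 -lt0n.
rewrite exchange_big /= big_nat [X in _ <= X]big_nat; apply: ler_sum => n /andP[n1 _].
have gd : gcdn n q \in divisors q by rewrite -dvdn_divisors // dvdn_gcdr.
rewrite (bigD1_seq _ gd (divisors_uniq q)) /= dvdn_gcdl mul1r lerDl.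
by apply: sumr_ge0 => g _; rewrite !mulr_ge0 ?powR_ge0 ?ler0n.
Qed.

(** A representation [n = 6 h k] is determined by the divisor [h] of [n]. *)
Lemma sum_divisors_le (R : realType) (X : nat) (L : R) (G : nat -> R) :
  (forall n, 0 <= G n) ->
  (forall n, (0 < n <= 6 * X ^ 2)%N -> (size (divisors n))%:R <= L) ->
  \sum_(1 <= h < X) \sum_(1 <= k < X) G (6 * h * k)%N
    <= L * \sum_(1 <= n < (6 * X ^ 2).+1) G n.
Proof.
move=> G0 hL.
have E h k : (1 <= h < X)%N -> (1 <= k < X)%N ->
    G (6 * h * k)%N = \sum_(1 <= n < (6 * X ^ 2).+1) (n == 6 * h * k)%N%:R * G n.
  move=> /andP[h1 hX] /andP[k1 kX].
  rewrite (bigD1_seq (6 * h * k)%N) ?iota_uniq //=; last first.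
    rewrite mem_index_iota ltnS; apply/andP; split; first by rewrite !muln_gt0 h1 k1.
    by rewrite -mulnA leq_mul2l /= -mulnn leq_mul // ltnW.
  rewrite eqxx mul1r big1 ?addr0 // => n /negbTE ->; by rewrite mul0r.
rewrite big_nat; under eq_bigr => h hh.
  rewrite big_nat; under eq_bigr => k hk do rewrite (E h k hh hk).
  rewrite -big_nat exchange_big /=; over.
rewrite -big_nat exchange_big /= mulr_sumr big_nat [X in _ <= X]big_nat.
apply: ler_sum => n /andP[n1 nN].
under eq_bigr do rewrite -mulr_suml.
rewrite -mulr_suml ler_wpM2r //.
apply: le_trans (hL n _); last by rewrite n1 -ltnS.
under eq_bigr do rewrite -natr_sum.
rewrite -natr_sum ler_nat.
apply: leq_trans (_ : \sum_(1 <= h < X) (h %| n)%N <= _)%N.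
  rewrite big_nat [X in (_ <= X)%N]big_nat; apply: leq_sum => h /andP[h1 _].
  have [hn|hn] := boolP (h %| n)%N; last first.
    rewrite big1 // => k _; apply/eqP; rewrite eqb0; apply: contra hn => /eqP ->.
    by rewrite mulnAC dvdn_mull.
  apply: leq_trans (_ : \sum_(1 <= k < X) (k == n %/ (6 * h))%N <= 1)%N.
    rewrite big_nat [X in (_ <= X)%N]big_nat; apply: leq_sum => k _.
    by case: eqP => // ->; rewrite mulKn ?eqxx // muln_gt0.
  rewrite -big_mkcond /= sum1_count.
  rewrite (eq_count (_ : _ =1 pred1 (n %/ (6 * h))%N)) // count_uniq_mem ?iota_uniq //.
  by case: (_ \in _).
rewrite -big_mkcond /= sum1_count -size_filter; apply: uniq_leq_size.
  by rewrite filter_uniq // iota_uniq.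
by move=> h; rewrite mem_filter -dvdn_divisors // => /andP[].
Qed.

(** With [y = X^2 / u >= 1] the two trivial bounds amount to [X * min(1, y / B)], and this is at
    most [X * (y / B)^(3/4)]. An exponent below 1 makes the later sums over [u] pure power sums,
    without a logarithm. *)
Lemma wmin_root_le (R : realType) (X : R) (u b : R) : 1 <= X -> 0 < u <= X ^+ 2 ->
  `|6 * u * b| <= 1 / 2 ->
  wmin X (6 * u * b)
    <= X * (Num.max 1 (X ^+ 3 * `|b|)) `^ (- (3 / 4)) * ((X ^+ 2) `^ (3 / 4) * u `^ (- (3 / 4))).
Proof.
move=> X1 /andP[u0 uX] hb; set B := Num.max _ _.
have X0 : 0 < X by lra.
have B1 : 1 <= B by rewrite le_max lexx.
have B0 : 0 < B by lra.
have X20 : 0 < X ^+ 2 by rewrite exprn_gt0.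
set y := X ^+ 2 / u; have y1 : 1 <= y by rewrite ler_pdivlMr // mul1r.
have y0 : 0 < y by lra.
have -> : (X ^+ 2) `^ (3 / 4) * u `^ (- (3 / 4)) = y `^ (3 / 4).
  by rewrite /y powR_div // ltW.
have -> : X * B `^ (- (3 / 4)) * y `^ (3 / 4) = X * (y / B) `^ (3 / 4).
  by rewrite (@powR_div _ y B) ?(ltW y0) //; ring.
have yB0 : 0 < y / B by rewrite divr_gt0.
have [h|h] := leP 1 (y / B).
  apply: le_trans (wmin_le _ _) _; rewrite ler_peMr ?(ltW X0) //.
  have := @ler_powR R (y / B) h 0 (3 / 4); rewrite powRr0; apply; lra.
have h1 : X * (y / B) <= X * (y / B) `^ (3 / 4).
  rewrite ler_pM2l //; apply: ger1_powR; [by rewrite yB0 ltW | lra].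
apply: le_trans h1.
have XB : B = X ^+ 3 * `|b|.
  have [h2|h2] := leP 1 (X ^+ 3 * `|b|); first by rewrite /B max_r.
  have B1' : B = 1 by rewrite /B max_l // ltW.
  by exfalso; move: h; rewrite B1' divr1; lra.
have b0 : 0 < `|b| by rewrite normr_gt0; apply/eqP => b0; move: B1; rewrite XB b0 normr0; lra.
have E : X * (y / B) = (u * `|b|)^-1.
  rewrite /y XB; field; rewrite !gt_eqF //.
rewrite E; apply: wmin_le_inv; first by rewrite mulr_gt0.
have := @sin_pi_dist R (6 * u * b) 0; rewrite subr0 => /(_ hb); apply: le_trans.
rewrite !normrM (gtr0_norm u0) ger0_norm //.
have := mulr_gt0 u0 b0; lra.
Qed.

(** The frequencies [6 h k] divisible by [q] carry the main contribution. If [q L > X] they are few,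
    and grouping by [n = 6 h k] costs only the divisor bound [L]. Otherwise the sum is taken row by
    row in [h], which treats these multiples exactly; then only [d(q)] appears in the main term and
    [L] is confined to the error. *)
Lemma weyl_majorant (R : realType) (X : nat) (L t3 t2 t1 t0 : R) :
  (0 < X)%N -> 1 <= L ->
  (forall n, (0 < n <= 6 * X ^ 2)%N -> (size (divisors n))%:R <= L) ->
  \sum_(1 <= r < (12 * X ^ 2).+1) (r%:R : R)^-1 <= L ->
  let A := esum (fun i => cubic t3 t2 t1 t0 i%:R) X in
  A ^+ 4 <= 2000 * L ^+ 3 * X%:R ^+ 3 \/
  exists q (a : int), [/\ (0 < q)%N, q%:R * L <= X%:R, coprime q `|a|%N,
    `|q%:R * t3 - a%:~R| <= (12 * X ^ 2)%:R^-1 &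
    A ^+ 4 <= 2000 * X%:R ^+ 4 * ((size (divisors q))%:R / q%:R)
      * (Num.max 1 (X%:R ^+ 3 * `|t3 - a%:~R / q%:R|)) `^ (- (3 / 4))].
Proof.
move=> X0 L1 hd hH A.
have XR : (1 : R) <= X%:R by rewrite ler1n.
(* The denominator bound [12 X^2] ensures [|n b| <= 1 / (2 q)] for every [n = 6 h k] that occurs, as
   [wmin_rat_le] requires. *)
have [q [a [/andP[q0 qN] cop hq]]] := dirichlet_coprime t3 (N := 12 * X ^ 2) ltac:(by rewrite muln_gt0 expn_gt0 X0).
have qR : (0 : R) < q%:R by rewrite ltr0n.
pose b := t3 - a%:~R / q%:R.
have hb : `|b| <= (12 * X%:R ^+ 2 * q%:R)^-1.
  have -> : b = (q%:R * t3 - a%:~R) / q%:R by rewrite /b; field; rewrite gt_eqF.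
  rewrite normrM normfV (gtr0_norm qR) ler_pdivrMr //; apply: le_trans hq _.
  rewrite natrM natrX le_eqVlt; apply/orP; left; apply/eqP; field.
  by rewrite gt_eqF //=; apply/eqP; lra.
pose a' := `|(a %% q)%Z|%N.
have qz : q%:Z != 0 by rewrite -lt0n in q0 *; apply/eqP; lia.
have a'E : a = (a %/ q)%Z * q%:Z + a'%:Z.
  by rewrite {1}(divz_eq a q) /a' gez0_abs // modz_ge0.
have cop' : coprime q a'.
  have := gcdz_modr q a => /(congr1 absz) /= E.
  by rewrite /coprime /a'; move: cop; rewrite /coprime -E.
pose w (n : nat) : R := wmin X%:R (n%:R * t3).
have wE n : w n = wmin X%:R (n%:R * (a'%:R / q%:R + b)).
  rewrite /w -(@wminDint _ _ (n%:R * (a'%:R / q%:R + b)) (n%:Z * (a %/ q)%Z)); congr wmin.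
  rewrite /b [in X in _ = _ + X]intrM {1}a'E intrD intrM -!pmulrn; field; rewrite gt_eqF //.
have w0 n : 0 <= w n by rewrite wmin_ge0 ?ler0n.
have wX n : w n <= X%:R by exact: wmin_le.
have hnb n : (n <= 6 * X ^ 2)%N -> `|n%:R * b| <= (2 * q%:R)^-1.
  move=> nX; rewrite normrM normr_nat.
  apply: le_trans (ler_pM (ler0n _ _) (normr_ge0 _) (_ : _ <= (6 * X ^ 2)%:R) hb) _; first by rewrite ler_nat.
  rewrite natrM natrX le_eqVlt; apply/orP; left; apply/eqP; field.
  by rewrite gt_eqF //=; apply/eqP; lra.
pose S := \sum_(1 <= h < X) \sum_(1 <= k < X) w (6 * h * k)%N.
have hA : A ^+ 4 <= 8 * X%:R * (2 * X%:R ^+ 2 + S).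
  apply: le_trans (weyl3 _ _ _ _ _) _; rewrite ler_wpM2l ?mulr_ge0 ?ler0n //.
  rewrite -(big_mkord xpredT (fun h => \sum_(k < X) wmin X%:R (6 * h%:R * k%:R * t3))).
  rewrite big_ltn //.
  have -> : 2 * X%:R ^+ 2 + S = X%:R * X%:R + (X%:R * X%:R + S) by ring.
  apply: lerD.
    apply: le_trans (_ : \sum_(k < X) X%:R <= _); first by apply: ler_sum => k _; exact: wmin_le.
    by rewrite sumr_const card_ord mulr_natl.
  apply: le_trans (_ : \sum_(1 <= h < X) (X%:R + \sum_(1 <= k < X) w (6 * h * k)%N) <= _).
    apply: ler_sum => h _.
    rewrite -(big_mkord xpredT (fun k => wmin X%:R (6 * h%:R * k%:R * t3))) big_ltn //.
    apply: lerD; first exact: wmin_le.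
    by apply: ler_sum => k _; rewrite /w !natrM.
  rewrite big_split /= lerD2r sumr_const_nat -[X in X <= _]mulr_natl.
  by rewrite ler_wpM2r ?ler0n // ler_nat leq_subr.
have hHq : \sum_(1 <= r < q.+1) (r%:R : R)^-1 <= L.
  apply: le_trans hH; rewrite [X in _ <= X](@big_cat_nat _ _ _ q.+1) //= ?ltnS //.
  by rewrite lerDl; apply: sumr_ge0 => r _; rewrite invr_ge0 ler0n.
have [qL|qL] := leP (q%:R * L) X%:R; last first.
  left; apply: le_trans hA _.
  have : S <= L * (L * 6 * X%:R ^+ 2 + 152 * X%:R ^+ 2 * L).
    apply: le_trans (@sum_divisors_le R X L w w0 hd) _.
    rewrite ler_wpM2l //; first lra.
    rewrite (bigID (fun n => (q %| n)%N)) /=; apply: lerD.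
      rewrite (sum_mult (6 * X ^ 2) w q0).
      apply: le_trans (_ : ((6 * X ^ 2) %/ q)%:R * X%:R <= _).
        rewrite mulr_natl -[X in _ <= _ *+ X]subn0 -(subSS 0) -sumr_const_nat.
        by apply: ler_sum => j _.
      have h1 : ((6 * X ^ 2) %/ q)%:R * q%:R <= 6 * X%:R ^+ 2 :> R.
        by rewrite -natrM -natrX -natrM ler_nat leq_divM.
      rewrite -(ler_pM2r qR); apply: le_trans (_ : 6 * X%:R ^+ 2 * X%:R <= _).
        by rewrite mulrAC ler_wpM2r ?ler0n.
      have -> : L * 6 * X%:R ^+ 2 * q%:R = 6 * X%:R ^+ 2 * (q%:R * L) by ring.
      by rewrite ler_wpM2l ?(ltW qL) // mulr_ge0 ?exprn_ge0 ?ler0n.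
    apply: le_trans (_ : \sum_(h < (6 * X ^ 2).+1 | ~~ (q %| h)%N) w h <= _).
      rewrite -[X in _ <= X](big_mkord (fun h => ~~ (q %| h)%N) w) big_mkcond [X in _ <= X]big_mkcond.
      by rewrite [X in _ <= X]big_ltn // dvdn0 /= add0r.
    under eq_bigr do rewrite wE.
    apply: le_trans (@sum_wmin_nonmult R X%:R L q a' (6 * X ^ 2).+1 b q0 cop' _ hHq) _.
      by move=> h hh; apply: hnb.
    rewrite ler_wpM2r //; first lra.
    have -> : 152 * X%:R ^+ 2 = 8 * (19 * X ^ 2)%:R :> R by rewrite natrM natrX; ring.
    rewrite ler_pM2l // ler_nat; have : (0 < X ^ 2)%N by rewrite expn_gt0 X0.
    by move: qN; lia.
  move=> hS.
  have L0 : 0 <= L by lra.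
  have L3 : L ^+ 2 <= L ^+ 3 by rewrite ler_weXn2l.
  have L2 : 1 <= L ^+ 2 by rewrite exprn_ege1.
  have XX : 0 <= X%:R ^+ 3 :> R by rewrite exprn_ge0 ?ler0n.
  apply: le_trans (_ : 8 * X%:R * (160 * L ^+ 2 * X%:R ^+ 2) <= _).
    rewrite ler_wpM2l ?mulr_ge0 ?ler0n //.
    have : X%:R ^+ 2 <= L ^+ 2 * X%:R ^+ 2 :> R by rewrite ler_peMl ?exprn_ge0 ?ler0n.
    lra.
  have -> : 8 * X%:R * (160 * L ^+ 2 * X%:R ^+ 2) = 1280 * (L ^+ 2 * X%:R ^+ 3) by ring.
  have : L ^+ 2 * X%:R ^+ 3 <= L ^+ 3 * X%:R ^+ 3 by rewrite ler_wpM2r.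
  have : 0 <= L ^+ 3 * X%:R ^+ 3 by rewrite mulr_ge0 ?exprn_ge0.
  lra.
have qX : (q <= X)%N.
  by rewrite -(ler_nat R); apply: le_trans qL; rewrite ler_peMr // ltW.
set B := Num.max 1 (X%:R ^+ 3 * `|t3 - a%:~R / q%:R|).
set d := (size (divisors q))%:R : R.
have hS : S <= 16 * X%:R ^+ 2 * L + 96 * X%:R ^+ 3 * (d / q%:R) * B `^ (- (3 / 4)).
  (* For fixed [h] let [q1 = q / gcd(6 h, q)], so that [q] divides [6 h k] exactly when [q1] divides
     [k]. Non-multiples of [q1] cost [16 X L]. Multiples have density [gcd(6 h, q) / q], at most
     [6 gcd(h, q) / q], and are weighted by [wmin_root_le]. *)
  have row h : (1 <= h < X)%N -> \sum_(1 <= k < X) w (6 * h * k)%N <= 16 * X%:R * L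
     + X%:R * B `^ (- (3 / 4)) * (X%:R ^+ 2) `^ (3 / 4)
       * (4 * X%:R `^ (4^-1) * (6 / q%:R) * ((gcdn h q)%:R * h%:R `^ (4^-1 - 1))).
    move=> /andP[h1 hX].
    set g := gcdn (6 * h) q; have g0 : (0 < g)%N by rewrite gcdn_gt0 q0 orbT.
    have gq : (g %| q)%N by exact: dvdn_gcdr.
    have gh : (g %| 6 * h)%N by exact: dvdn_gcdl.
    pose q1 := (q %/ g)%N; pose a1 := ((6 * h) %/ g * a')%N.
    have q10 : (0 < q1)%N by rewrite divn_gt0 // dvdn_leq.
    have q1q : (q1 <= q)%N by exact: leq_div.
    have qE : q = (q1 * g)%N by rewrite divnK.
    have hE : (6 * h = (6 * h) %/ g * g)%N by rewrite divnK.
    have c1 : coprime q1 ((6 * h) %/ g).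
      by rewrite /coprime -(eqn_pmul2r g0) mul1n muln_gcdl -qE -hE gcdnC.
    have cop1 : coprime q1 a1.
      by rewrite coprimeMr c1 /= (coprime_dvdl _ cop') // qE dvdn_mulr.
    have dvE k : (q %| 6 * h * k)%N = (q1 %| k)%N.
      by rewrite qE hE mulnAC dvdn_pmul2r // Gauss_dvdr.
    have gR : (0 : R) < g%:R by rewrite ltr0n.
    have q1R : (0 : R) < q1%:R by rewrite ltr0n.
    have wE1 k : w (6 * h * k)%N = wmin X%:R (k%:R * (a1%:R / q1%:R + (6 * h)%:R * b)).
      rewrite wE; congr wmin; rewrite /a1 !natrM qE natrM.
      have -> : 6 * h%:R = ((6 * h) %/ g)%:R * g%:R :> R by rewrite -[RHS]natrM -hE natrM.
      by field; rewrite !gt_eqF.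
    rewrite (bigID (fun k => ~~ (q1 %| k)%N)) /=; apply: lerD.
      apply: le_trans (_ : \sum_(k < X | ~~ (q1 %| k)%N) w (6 * h * k)%N <= _).
        rewrite -[X in _ <= X](big_mkord (fun k => ~~ (q1 %| k)%N) (fun k => w (6 * h * k)%N)).
        by rewrite big_mkcond [X in _ <= X]big_mkcond [X in _ <= X]big_ltn // dvdn0 /= add0r.
      under eq_bigr do rewrite wE1.
      apply: le_trans (@sum_wmin_nonmult R X%:R L q1 a1 X _ q10 cop1 _ _) _.
      - move=> k kX; rewrite mulrA -natrM; apply: le_trans (hnb _ _) _.
          by rewrite mulnC -mulnA leq_mul2l -mulnn leq_mul // ltnW.
        by rewrite lef_pV2 ?posrE ?mulr_gt0 // ler_pM2l // ler_nat.
      - apply: le_trans hHq; rewrite [X in _ <= X](@big_cat_nat _ _ _ q1.+1) //=.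
        by rewrite lerDl; apply: sumr_ge0 => r _; rewrite invr_ge0 ler0n.
      rewrite ler_wpM2r //; first lra.
      have -> : 16 * X%:R = 8 * (2 * X)%:R :> R by rewrite natrM; ring.
      by rewrite ler_pM2l // ler_nat mul2n -addnn leq_add2l (leq_trans q1q).
    under eq_bigl do rewrite negbK.
    apply: le_trans (_ : \sum_(1 <= k < X.+1 | (q1 %| k)%N) X%:R * B `^ (- (3 / 4)) *
        ((X%:R ^+ 2) `^ (3 / 4) * (h%:R `^ (4^-1 - 1) * k%:R `^ (4^-1 - 1))) <= _).
      rewrite [X in _ <= X]big_mkcond big_nat_recr //= -big_mkcond.
      rewrite -[X in X <= _]addr0; apply: lerD; last first.
        by case: ifP => // _; rewrite !mulr_ge0 ?powR_ge0 ?ler0n.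
      rewrite big_nat_cond [X in _ <= X]big_nat_cond; apply: ler_sum => k /andP[/andP[k1 kX] qk].
      have -> : w (6 * h * k)%N = wmin X%:R (6 * (h%:R * k%:R) * b).
        have [j kE] := dvdnP qk.
        rewrite wE1 -(@wminDint _ _ (6 * (h%:R * k%:R) * b) (j * a1)%N); congr wmin.
        rewrite kE -pmulrn !natrM; field; rewrite gt_eqF //.
      apply: le_trans (wmin_root_le _ _ _) _ => //.
      - rewrite mulr_gt0 ?ltr0n //= expr2 ler_pM ?ler0n ?ler_nat ?(ltnW hX) ?(ltnW kX) //.
      - apply: le_trans (_ : (2 * q%:R)^-1 <= _).
          have := hnb (6 * h * k)%N; rewrite !natrM mulrA; apply.
          by rewrite -mulnA leq_mul2l -mulnn leq_mul // ltnW.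
        rewrite div1r lef_pV2 ?posrE ?mulr_gt0 // ler_peMr // ler1n //.
      - rewrite -/b -/B powRM ?ler0n //.
        by have -> : - (3 / 4) = 4^-1 - 1 :> R by field.
    have -> : \sum_(1 <= k < X.+1 | (q1 %| k)%N) X%:R * B `^ (- (3 / 4)) *
        ((X%:R ^+ 2) `^ (3 / 4) * (h%:R `^ (4^-1 - 1) * k%:R `^ (4^-1 - 1)))
      = X%:R * B `^ (- (3 / 4)) * (X%:R ^+ 2) `^ (3 / 4) * (h%:R `^ (4^-1 - 1) *
          \sum_(1 <= k < X.+1 | (q1 %| k)%N) (k%:R : R) `^ (4^-1 - 1)).
      by rewrite !mulr_sumr; apply: eq_bigr => k _; ring.
    rewrite ler_wpM2l ?mulr_ge0 ?powR_ge0 ?ler0n //.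
    have -> : 4 * X%:R `^ 4^-1 * (6 / q%:R) * ((gcdn h q)%:R * h%:R `^ (4^-1 - 1))
       = h%:R `^ (4^-1 - 1) * (4 * X%:R `^ 4^-1 * (6 / q%:R * (gcdn h q)%:R)) :> R by ring.
    rewrite ler_wpM2l ?powR_ge0 //.
    apply: le_trans (@sum_mult_root R 4 q1 X isT q10) _.
    rewrite ler_wpM2l ?mulr_ge0 ?powR_ge0 //.
    have -> : 6 / q%:R * (gcdn h q)%:R = (6 * gcdn h q)%:R / q%:R :> R by rewrite natrM; ring.
    have -> : q1%:R^-1 = g%:R / q%:R :> R by rewrite qE natrM; field; rewrite !gt_eqF.
    rewrite ler_pM2r ?invr_gt0 // ler_nat dvdn_leq //; first by rewrite muln_gt0 gcdn_gt0 h1.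
    by rewrite muln_gcdr dvdn_gcd gh (dvdn_trans gq) ?dvdn_mull.
  rewrite /S big_nat; apply: le_trans (ler_sum _ row) _; rewrite -big_nat.
  rewrite big_split /=; apply: lerD.
    rewrite sumr_const_nat -[X in X <= _]mulr_natl expr2.
    have -> : 16 * (X%:R * X%:R) * L = X%:R * (16 * X%:R * L) by ring.
    by rewrite ler_wpM2r ?ler_nat ?leq_subr // !mulr_ge0 ?ler0n //; lra.
  rewrite -!mulr_sumr.
  apply: le_trans (_ : X%:R * B `^ (- (3 / 4)) * (X%:R ^+ 2) `^ (3 / 4) * (4 * X%:R `^ 4^-1 * (6 / q%:R)
      * (4 * X%:R `^ 4^-1 * d)) <= _).
    rewrite ler_wpM2l ?mulr_ge0 ?powR_ge0 ?ler0n // ler_wpM2l ?mulr_ge0 ?invr_ge0 ?powR_ge0 ?ler0n //.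
    apply: le_trans (@sum_gcd_root R 4 q X isT q0).
    rewrite [X in _ <= X]big_nat_recr //= lerDl !mulr_ge0 ?powR_ge0 ?ler0n //.
  have E1 : (X%:R ^+ 2) `^ (3 / 4) * (X%:R `^ 4^-1 * X%:R `^ 4^-1) = X%:R ^+ 2 :> R.
    rewrite -(powR_mulrn 2 (ler0n _ X)) -powRrM -!powRD ?pnatr_eq0 -?lt0n ?X0 ?implybT //.
    by congr powR; field.
  rewrite le_eqVlt; apply/orP; left; apply/eqP.
  transitivity (96 * X%:R * ((X%:R ^+ 2) `^ (3 / 4) * (X%:R `^ 4^-1 * X%:R `^ 4^-1))
     * (d / q%:R) * B `^ (- (3 / 4))); first by ring.
  by rewrite E1; ring.
have hA2 : A ^+ 4 <= 144 * L * X%:R ^+ 3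
    + 768 * (X%:R ^+ 4 * (d / q%:R) * B `^ (- (3 / 4))).
  apply: le_trans hA _.
  apply: le_trans (_ : 8 * X%:R * (2 * X%:R ^+ 2 + (16 * X%:R ^+ 2 * L
     + 96 * X%:R ^+ 3 * (d / q%:R) * B `^ (- (3 / 4)))) <= _).
    by rewrite ler_wpM2l ?mulr_ge0 ?ler0n // lerD2l.
  have : X%:R ^+ 3 <= L * X%:R ^+ 3 by rewrite ler_peMl ?exprn_ge0 ?ler0n.
  move: (B `^ _) => z.
  have -> : 8 * X%:R * (2 * X%:R ^+ 2 + (16 * X%:R ^+ 2 * L + 96 * X%:R ^+ 3 * (d / q%:R) * z))
    = 16 * X%:R ^+ 3 + 128 * (L * X%:R ^+ 3) + 768 * (X%:R ^+ 4 * (d / q%:R) * z) by ring.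
  have -> : 144 * L * X%:R ^+ 3 = 144 * (L * X%:R ^+ 3) by ring.
  lra.
(* Unless the first alternative holds, [144 L X^3] is a small fraction of [A ^+ 4] and is absorbed
   by the left side of [hA2]. *)
have [small|big] := leP (A ^+ 4) (2000 * L ^+ 3 * X%:R ^+ 3); first by left.
right; exists q, a; split => //.
have -> : 2000 * X%:R ^+ 4 * (d / q%:R) * B `^ (- (3 / 4))
  = 2000 * (X%:R ^+ 4 * (d / q%:R) * B `^ (- (3 / 4))) by ring.
have : L * X%:R ^+ 3 <= L ^+ 3 * X%:R ^+ 3.
  by rewrite ler_wpM2r ?exprn_ge0 ?ler0n // -[X in X <= _]expr1 ler_weXn2l.
have : 0 <= L * X%:R ^+ 3 by rewrite mulr_ge0 ?exprn_ge0 ?ler0n //; lra.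
lra.
Qed.

(** * The kernel inequality *)

Lemma sum_dist_le (R : realType) (n i : nat) (g : nat -> R) : (forall k, 0 <= g k) ->
  (i < n)%N -> \sum_(j < n) g `|i - j|%N <= 2 * \sum_(k < n) g k.
Proof.
move=> g0 ilt; rewrite -(big_mkord xpredT (fun j => g `|i - j|%N)) -(big_mkord xpredT g).
have mono a b : (a <= b)%N -> \sum_(0 <= k < a) g k <= \sum_(0 <= k < b) g k.
  by move=> ab; rewrite [X in _ <= X](@big_cat_nat _ _ _ a) //= lerDl sumr_ge0.
rewrite (@big_cat_nat _ _ _ i.+1) //= mulr2n mulrDl !mul1r; apply: lerD.
  rewrite big_nat_rev /= add0n; apply: le_trans (mono i.+1 n ilt).
  rewrite big_nat [X in _ <= X]big_nat; apply: ler_sum => j /andP[_ ji].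
  by have -> : `|i - (i.+1 - j.+1)|%N = j by lia.
rewrite -{1}(add0n i.+1) big_addn; apply: le_trans (mono (n - i)%N n (leq_subr _ _)).
rewrite -[(n - i)%N]prednK ?subn_gt0 // big_nat_recl //=.
have -> : (n - i.+1 = (n - i).-1)%N by lia.
rewrite -[X in X <= _]add0r; apply: lerD => //.
rewrite big_nat [X in _ <= X]big_nat; apply: ler_sum => j _.
by have -> : `|i - (j + i.+1)|%N = j.+1 by lia.
Qed.

(** The principal eigenvector of a path: these weights vanish at [0] and [N] and satisfy
    [c_(j-1) + c_(j+1) = 2 cos(pi / N) c_j]. Multiplying their trigonometric polynomial by
    [2 (cos(2 pi t) - cos(pi / N))] therefore leaves boundary terms only. Since [c_0 = 0], frequency
    zero is absent from the right side of [kernelE]. *)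
Definition kc (R : realType) (N : nat) (j : nat) : R := sin (j%:R * (pi / N%:R)).

Lemma kernel_real (R : realType) (N : nat) (t : R) : (0 < N)%N ->
  2 * (c2 t - cos (pi / N%:R)) * \sum_(j < N.+1) kc R N j * c2 (j%:R * t)
   = sin (pi / N%:R) * (1 + c2 (N%:R * t)).
Proof.
move=> N0.
have NR : (0 : R) < N%:R by rewrite ltr0n.
set a := pi / N%:R.
have E n : 2 * (c2 t - cos a) * \sum_(j < n) kc R N j * c2 (j%:R * t)
  = (sin a + sin ((n%:R - 1) * a) * c2 (n%:R * t) - sin (n%:R * a) * c2 ((n%:R - 1) * t)).
  elim: n => [|n IH].
    by rewrite big_ord0 mulr0 !mul0r sin0 c20 mul0r mulr1 add0r mulN1r sinN; ring.
  rewrite big_ord_recr /= mulrDr IH /kc -/a.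
  have -> : (n.+1%:R - 1) * a = n%:R * a by rewrite -natr1; ring.
  have -> : (n.+1%:R - 1) * t = n%:R * t by rewrite -natr1; ring.
  have -> : n.+1%:R * a = n%:R * a + a by rewrite -natr1; ring.
  have -> : n.+1%:R * t = n%:R * t + t by rewrite -natr1; ring.
  rewrite !mulrBl !mul1r sinB sinD c2B c2D; ring.
rewrite E.
have -> : (N.+1%:R - 1) * a = pi by rewrite -natr1 /a; field; rewrite gt_eqF.
have -> : N.+1%:R * a = a + pi by rewrite -natr1 /a; field; rewrite gt_eqF.
have -> : (N.+1%:R - 1) * t = N%:R * t by rewrite -natr1; ring.
by rewrite sinpi sinDpi; ring.
Qed.

Lemma kernel_im (R : realType) (N : nat) (t : R) : (0 < N)%N ->
  2 * (c2 t - cos (pi / N%:R)) * \sum_(j < N.+1) kc R N j * s2 (j%:R * t)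
   = sin (pi / N%:R) * s2 (N%:R * t).
Proof.
move=> N0.
have NR : (0 : R) < N%:R by rewrite ltr0n.
set a := pi / N%:R.
have E n : 2 * (c2 t - cos a) * \sum_(j < n) kc R N j * s2 (j%:R * t)
  = (sin ((n%:R - 1) * a) * s2 (n%:R * t) - sin (n%:R * a) * s2 ((n%:R - 1) * t)).
  elim: n => [|n IH].
    by rewrite big_ord0 mulr0 !mul0r sin0 s20 mul0r mulr0 subr0.
  rewrite big_ord_recr /= mulrDr IH /kc -/a.
  have -> : (n.+1%:R - 1) * a = n%:R * a by rewrite -natr1; ring.
  have -> : (n.+1%:R - 1) * t = n%:R * t by rewrite -natr1; ring.
  have -> : n.+1%:R * a = n%:R * a + a by rewrite -natr1; ring.
  have -> : n.+1%:R * t = n%:R * t + t by rewrite -natr1; ring.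
  rewrite !mulrBl !mul1r sinB sinD !s2D c2N s2N; ring.
rewrite E.
have -> : (N.+1%:R - 1) * a = pi by rewrite -natr1 /a; field; rewrite gt_eqF.
have -> : N.+1%:R * a = a + pi by rewrite -natr1 /a; field; rewrite gt_eqF.
have -> : (N.+1%:R - 1) * t = N%:R * t by rewrite -natr1; ring.
by rewrite sinpi sinDpi; ring.
Qed.

Definition D2 (R : realType) (N : nat) (t : R) : R :=
  (\sum_(j < N.+1) kc R N j * c2 (j%:R * t)) ^+ 2 + (\sum_(j < N.+1) kc R N j * s2 (j%:R * t)) ^+ 2.

Lemma kc_rev (R : realType) (N j : nat) : (0 < N)%N -> (j <= N)%N -> kc R N (N - j) = kc R N j.
Proof.
move=> N0 jN; rewrite /kc natrB // mulrBl mulrCA divff ?pnatr_eq0 -?lt0n // mulr1.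
by rewrite sinB sinpi cospi; ring.
Qed.

(** By the symmetry [c_(N-j) = c_j], the conjugate of [D] times [e(N t)] is [D] itself. So the
    boundary factor [1 + e(N t)], multiplied by the conjugate of [D], is twice the real part of
    [D]. *)
Lemma kernelE (R : realType) (N : nat) (t : R) : (0 < N)%N ->
  (c2 t - cos (pi / N%:R)) * D2 N t = sin (pi / N%:R) * \sum_(j < N.+1) kc R N j * c2 (j%:R * t).
Proof.
move=> N0.
have h1 := kernel_real t N0; have h2 := kernel_im t N0; rewrite /D2.
set C := \sum_(j < N.+1) kc R N j * c2 _ in h1 *; set S := \sum_(j < N.+1) kc R N j * s2 _ in h2 *.
have E : C * c2 (N%:R * t) + S * s2 (N%:R * t) = C.
  rewrite /C [in RHS](reindex_inj rev_ord_inj) /= !mulr_suml -big_split; apply: eq_bigr => j _ /=.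
  rewrite subSS kc_rev //; last by rewrite -ltnS.
  rewrite natrB; last by rewrite -ltnS.
  by rewrite mulrBl c2B; ring.
have h3 : 2 * ((c2 t - cos (pi / N%:R)) * (C ^+ 2 + S ^+ 2)) = 2 * (sin (pi / N%:R) * C).
  transitivity (2 * (c2 t - cos (pi / N%:R)) * C * C + 2 * (c2 t - cos (pi / N%:R)) * S * S).
    by ring.
  rewrite h1 h2.
  transitivity (sin (pi / N%:R) * (C + (C * c2 (N%:R * t) + S * s2 (N%:R * t)))); first by ring.
  by rewrite E; ring.
by apply: (mulfI (_ : 2 != 0 :> R)); rewrite ?pnatr_eq0.
Qed.

Lemma D2_ge0 (R : realType) (N : nat) (t : R) : 0 <= D2 N t.
Proof. by rewrite addr_ge0 ?sqr_ge0. Qed.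

Lemma D2E (R : realType) (N : nat) (t : R) : D2 N t = \sum_(i < N.+1) \sum_(j < N.+1) kc R N i * kc R N j * c2 ((i%:R - j%:R) * t).
Proof.
rewrite /D2 !expr2 !mulr_suml -big_split; apply: eq_bigr => i _ /=.
rewrite !mulr_sumr -big_split; apply: eq_bigr => j _ /=.
by rewrite mulrBl c2B; ring.
Qed.

Lemma kc_ge0 (R : realType) (N j : nat) : (0 < N)%N -> (j <= N)%N -> 0 <= kc R N j.
Proof.
move=> N0 jN; have pi0 := @pi_gt0 R; have NR : (0 : R) < N%:R by rewrite ltr0n.
apply: sin_ge0_pi; rewrite mulr_ge0 ?divr_ge0 ?ler0n ?(ltW pi0) //=.
by rewrite mulrCA -[X in _ <= X]mulr1 ler_pM2l // ler_pdivrMr // mul1r ler_nat.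
Qed.

Lemma kc_le1 (R : realType) (N j : nat) : kc R N j <= 1.
Proof. exact: sin_le1. Qed.

Lemma kc_le (R : realType) (N j : nat) : (0 < N)%N -> kc R N j <= 4 * j%:R / N%:R.
Proof.
move=> N0.
have pi0 := @pi_gt0 R; have NR : (0 : R) < N%:R by rewrite ltr0n.
apply: le_trans (sin_le _) _; first by rewrite mulr_ge0 ?divr_ge0 ?ler0n ?ltW.
rewrite mulrA ler_pM2r ?invr_gt0 // mulrC ler_wpM2r ?ler0n //.
by have := @pihalf_lt2 R; lra.
Qed.

Lemma kc_lip (R : realType) (N i j : nat) : (0 < N)%N -> `|kc R N i - kc R N j| <= 4 * `|i - j|%N%:R / N%:R.
Proof.
move=> N0.
have pi0 := @pi_gt0 R; have NR : (0 : R) < N%:R by rewrite ltr0n.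
apply: le_trans (normr_sinB _ _) _.
rewrite -mulrBl normrM [X in _ * X]ger0_norm ?divr_ge0 ?ler0n ?(ltW pi0) //.
have -> : `|i%:R - j%:R| = (`|i - j|%N%:R : R).
  by rewrite -[RHS]normr_nat natr_absz intr_norm normr_id rmorphB.
rewrite mulrA ler_pM2r ?invr_gt0 // mulrC ler_wpM2r ?ler0n //.
by have := @pihalf_lt2 R; lra.
Qed.

Definition freq (R : realType) (al : R) (vs : seq R) : R := eabs [seq al * v | v <- vs].

Lemma freq_ge0 (R : realType) (al : R) (vs : seq R) : 0 <= freq al vs.
Proof. exact: eabs_ge0. Qed.

Lemma freq_le (R : realType) (al : R) (vs : seq R) : freq al vs <= (size vs)%:R.
Proof. by apply: le_trans (eabs_le_size _) _; rewrite size_map. Qed.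

Lemma sum_c2_freq (R : realType) (i j : nat) (M : R) (vs : seq R) :
  `|\sum_(v <- vs) c2 ((i%:R - j%:R) * (v / M))| <= freq (`|i - j|%N%:R / M) vs.
Proof.
have H (k : nat) : `|\sum_(v <- vs) c2 (k%:R * (v / M))| <= freq (k%:R / M) vs.
  have -> : \sum_(v <- vs) c2 (k%:R * (v / M)) = \sum_(v <- [seq k%:R / M * v | v <- vs]) c2 (v + 0).
    by rewrite big_map; apply: eq_bigr => v _; congr c2; ring.
  exact: eabs_cos.
have [ij|ij] := leqP i j.
  have -> : `|i - j|%N = (j - i)%N by lia.
  rewrite (eq_bigr (fun v => c2 ((j - i)%:R * (v / M)))) // => v _.
  by rewrite -c2N natrB // -mulNr opprB.
have -> : `|i - j|%N = (i - j)%N by lia.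
rewrite (eq_bigr (fun v => c2 ((i - j)%:R * (v / M)))) // => v _.
by rewrite natrB // ltnW.
Qed.

(** * Fejer kernels and localisation near zero *)

Definition fejer (R : realType) (K : nat) (t : R) : R :=
  K%:R^-1 * \sum_(a < K) \sum_(b < K) c2 ((a%:R - b%:R) * t).

Lemma fejer_ge0 (R : realType) (K : nat) (t : R) : 0 <= fejer K t.
Proof.
rewrite mulr_ge0 ?invr_ge0 ?ler0n //.
have -> : \sum_(a < K) \sum_(b < K) c2 ((a%:R - b%:R) * t)
  = (\sum_(a < K) c2 (a%:R * t)) ^+ 2 + (\sum_(a < K) s2 (a%:R * t)) ^+ 2.
  rewrite !expr2 !mulr_suml -big_split; apply: eq_bigr => a _ /=.
  by rewrite !mulr_sumr -big_split; apply: eq_bigr => b _ /=; rewrite mulrBl c2B.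
by rewrite addr_ge0 ?sqr_ge0.
Qed.

Lemma fejer_ge (R : realType) (K : nat) (t : R) : (0 < K)%N ->
  `|t| <= (16 * K%:R)^-1 -> K%:R / 2 <= fejer K t.
Proof.
move=> K0 ht; have KR : (0 : R) < K%:R by rewrite ltr0n.
have pi0 := @pi_gt0 R; have pi4 := @pihalf_lt2 R.
rewrite /fejer [X in _ <= X]mulrC ler_pdivlMr //.
apply: le_trans (_ : \sum_(a < K) \sum_(b < K) (2^-1 : R) <= _); last first.
  apply: ler_sum => a _; apply: ler_sum => b _.
  apply: le_trans (cos_ge_sqr _).
  have h : `|(a%:R - b%:R) * t| <= 1 / 16.
    rewrite normrM.
    have h1 : `|a%:R - b%:R| <= K%:R :> R.
      rewrite ler_norml; have := ler0n R a; have := ler0n R b.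
      have : a%:R <= K%:R :> R by rewrite ler_nat ltnW.
      have : b%:R <= K%:R :> R by rewrite ler_nat ltnW.
      by move=> *; apply/andP; split; lra.
    apply: le_trans (ler_pM (normr_ge0 _) (normr_ge0 _) h1 ht) _.
    by rewrite le_eqVlt; apply/orP; left; apply/eqP; field; rewrite gt_eqF.
  move: ((_ - _) * t) h => u; rewrite ler_norml => /andP[h1 h2].
  have [h3 h4] : - (1 / 2) <= 2 * pi * u /\ 2 * pi * u <= 1 / 2 by split; nra.
  by move: (2 * pi * u) h3 h4 => z h3 h4; nra.
rewrite !sumr_const card_ord.
have -> : 2^-1 *+ K *+ K = K%:R / 2 * K%:R :> R.
  by rewrite -mulrnA -[LHS]mulr_natr natrM; ring.
exact: lexx.
Qed.

Lemma sum_kc_sqr_ge (R : realType) (N K : nat) : (0 < K)%N -> (8 * K <= N)%N ->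
  N%:R / 1024 <= \sum_(i < N.+1 | (K <= i <= N - K)%N) (kc R N i) ^+ 2.
Proof.
move=> K0 KN; have N0 : (0 < N)%N by lia.
have NR : (0 : R) < N%:R by rewrite ltr0n.
have pi0 := @pi_gt0 R; have pi1 := @pihalf_ge1 R.
rewrite -(big_mkord (fun i => (K <= i <= N - K)%N) (fun i => kc R N i ^+ 2)) big_mkcond.
set n1 := (N %/ 4).+1; set n2 := (N %/ 2).+1.
have h12 : (n1 <= n2)%N by rewrite /n1 /n2; lia.
have h2N : (n2 <= N.+1)%N by rewrite /n2; lia.
rewrite (@big_cat_nat _ _ _ n1) //=; last by rewrite (leq_trans h12).
rewrite [X in _ + X](@big_cat_nat _ _ _ n2) //=.
have P a b : 0 <= \sum_(a <= i < b) (if (K <= i <= N - K)%N then kc R N i ^+ 2 else 0).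
  by apply: sumr_ge0 => i _; case: ifP => // _; exact: sqr_ge0.
apply: le_trans (_ : \sum_(n1 <= i < n2) (64^-1 : R) <= _); last first.
  have := P 0%N n1; have := P n2 N.+1.
  suff : \sum_(n1 <= i < n2) (64^-1 : R)
    <= \sum_(n1 <= i < n2) (if (K <= i <= N - K)%N then kc R N i ^+ 2 else 0) by lra.
  rewrite big_nat [X in _ <= X]big_nat; apply: ler_sum => i; rewrite /n1 /n2 => hi.
  rewrite ifT; last lia.
  have i1 : N%:R / 4 <= i%:R :> R by rewrite ler_pdivrMr // -natrM ler_nat; lia.
  have i2 : i%:R <= N%:R / 2 :> R by rewrite ler_pdivlMr // -natrM ler_nat; lia.
  have h : 1 / 8 <= kc R N i.
    apply: le_trans (@sin_ge_quarter R _ _).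
      have : pi / 4 <= i%:R * (pi / N%:R) :> R.
        have -> : pi / 4 = N%:R / 4 * (pi / N%:R) :> R by field; rewrite gt_eqF.
        by rewrite ler_pM2r // divr_gt0.
      lra.
    rewrite mulr_ge0 ?divr_ge0 ?ler0n ?(ltW pi0) //=.
    have -> : pi / 2 = N%:R / 2 * (pi / N%:R) :> R by field; rewrite gt_eqF.
    by rewrite ler_pM2r // divr_gt0.
  have -> : 64^-1 = (1 / 8) ^+ 2 :> R by field.
  by rewrite lerXn2r ?nnegrE //; lra.
rewrite sumr_const_nat -[X in _ <= X]mulr_natr.
have : (N <= 16 * (n2 - n1))%N by rewrite /n1 /n2; lia.
by rewrite -(ler_nat R) natrM; lra.
Qed.

(* The [c_i^2 w_K(i - j)] part of [c_i c_j] reassembles into Fejer kernels. *)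
Lemma sum_window (R : realType) (N K i : nat) (G : nat -> R) : (0 < K)%N -> (K <= i <= N - K)%N ->
  (K <= N)%N ->
  exists w : nat -> R, (forall j, 0 <= w j <= 1 /\ 1 - w j <= `|i - j|%N%:R / K%:R) /\
   K%:R^-1 * \sum_(a < K) \sum_(b < K) G (i - a + b)%N = \sum_(j < N.+1) w j * G j.
Proof.
move=> K0 /andP[Ki iN] KN; have KR : (0 : R) < K%:R by rewrite ltr0n.
pose n j := (\sum_(a < K) ((i - a <= j) && (j < i - a + K))%N)%N.
exists (fun j => (n j)%:R / K%:R); split.
  move=> j; split.
    rewrite divr_ge0 ?ler0n //= ler_pdivrMr // mul1r ler_nat.
    apply: leq_trans (_ : \sum_(a < K) 1 <= _)%N; first by apply: leq_sum => a _; case: (_ && _).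
    by rewrite sum1_card card_ord.
  have h : (K <= n j + `|i - j|)%N.
    rewrite -{1}(card_ord K) -sum1_card.
    rewrite (bigID (fun a : 'I_K => (i - a <= j) && (j < i - a + K))%N) /=; apply: leq_add.
      by rewrite /n big_mkcond; apply: leq_sum => a _; case: (_ && _).
    have [ij|ij] := leqP i j.
      have -> : `|i - j|%N = (j - i)%N by lia.
      apply: leq_trans (_ : \sum_(a < K | (K <= j - i + a)%N) 1 <= _)%N.
        rewrite big_mkcond [X in (_ <= X)%N]big_mkcond; apply: leq_sum => a _.
        case: ifP => // nh; rewrite ifT //; move: nh (ltn_ord a); lia.
      rewrite -(big_mkord (fun a => (K <= j - i + a)%N) (fun=> 1%N)) big_mkcond.
      apply: leq_trans (_ : \sum_(K - (j - i) <= a < K) 1 <= _)%N; last first.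
        by rewrite sum_nat_const_nat; lia.
      rewrite (@big_cat_nat _ _ _ (K - (j - i))) ?leq_subr //= big_nat big1 ?add0n.
        by apply: leq_sum => a _; case: ifP.
      by move=> a ha; rewrite ifF //; lia.
    have -> : `|i - j|%N = (i - j)%N by lia.
    apply: leq_trans (_ : \sum_(a < K | (a < i - j)%N) 1 <= _)%N.
      rewrite big_mkcond [X in (_ <= X)%N]big_mkcond; apply: leq_sum => a _.
      case: ifP => // nh; rewrite ifT //; move: nh (ltn_ord a); lia.
    rewrite sum1_card; apply: leq_trans (_ : #|'I_(i - j)| <= _)%N; last by rewrite card_ord.
    have [le|gt] := leqP K (i - j)%N.
      by rewrite card_ord (leq_trans (max_card _)) // card_ord.
    rewrite card_ord -[X in (_ <= X)%N](size_iota 0) cardE -(size_map val).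
    apply: uniq_leq_size; first by rewrite map_inj_uniq ?enum_uniq //; exact: val_inj.
    by move=> x /mapP[a]; rewrite mem_enum => ha ->; rewrite mem_iota.
  rewrite -(ler_nat R) natrD in h.
  by rewrite ler_pdivlMr // mulrBl divfK ?gt_eqF //; lra.
transitivity (K%:R^-1 * \sum_(a < K) \sum_(j < N.+1) ((i - a <= j) && (j < i - a + K))%N%:R * G j).
  congr (_ * _); apply: eq_bigr => a _; have aK := ltn_ord a.
  rewrite -(big_mkord xpredT (fun b => G (i - a + b)%N)).
  rewrite -(big_mkord xpredT (fun j => ((i - a <= j) && (j < i - a + K))%N%:R * G j)).
  rewrite [RHS](@big_cat_nat _ _ _ (i - a)) //=; last by lia.
  rewrite [X in _ = X + _]big_nat [X in _ = X + _]big1 ?add0r; last first.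
    by move=> j hj; rewrite (_ : (_ && _) = false) ?mul0r //; lia.
  rewrite [RHS](@big_cat_nat _ _ _ (i - a + K)) //=; [|lia|lia].
  rewrite [X in _ = _ + X]big_nat [X in _ = _ + X]big1 ?addr0; last first.
    by move=> j hj; rewrite (_ : (_ && _) = false) ?mul0r //; lia.
  rewrite [RHS](_ : _ = \sum_(0 + (i - a) <= j < i - a + K)
     ((i - a <= j) && (j < i - a + K))%N%:R * G j) // big_addn addKn.
  rewrite big_nat [RHS]big_nat; apply: eq_bigr => b hb.
  by rewrite (_ : (_ && _) = true) ?mul1r ?[(b + _)%N]addnC //; lia.
rewrite exchange_big /= mulr_sumr; apply: eq_bigr => j _.
by rewrite -mulr_suml -natr_sum mulrA [K%:R^-1 * _]mulrC.
Qed.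

(** The peak of [D2] at scale [M] has width comparable with [M / N], too narrow to count values in.
    It is compared with Fejer kernels of length [K], which see all [|v| <= M / (16 K)]. The weights
    [c_i c_j] differ from [c_i^2 w_K(i - j)] by at most [5 min(1, |i - j| / K)], since [c] is
    Lipschitz with constant [4 / N] and [1 - w_K] is at most [|i - j| / K]. Near the ends of the
    range, where no window fits, [c_i <= 4 K / N]. *)
Lemma kernel_coarse (R : realType) (M : R) (N K : nat) (vs : seq R) :
  (0 < K)%N -> (8 * K <= N)%N ->
  (\sum_(i < N.+1 | (K <= i <= N - K)%N) (kc R N i) ^+ 2) * \sum_(v <- vs) fejer K (v / M)
  <= \sum_(v <- vs) D2 N (v / M)
     + 5 * \sum_(i < N.+1) \sum_(j < N.+1)
         Num.min 1 (`|i - j|%N%:R / K%:R) * freq (`|i - j|%N%:R / M) vs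
     + \sum_(i < N.+1 | ~~ (K <= i <= N - K)%N) \sum_(j < N.+1)
         4 * K%:R / N%:R * freq (`|i - j|%N%:R / M) vs.
Proof.
move=> K0 KN; have N0 : (0 < N)%N by lia.
have KN1 : (K <= N)%N by lia.
have KR : (0 : R) < K%:R by rewrite ltr0n.
have NR : (0 : R) < N%:R by rewrite ltr0n.
pose Gm (i j : nat) : R := \sum_(v <- vs) c2 ((i%:R - j%:R) * (v / M)).
have GA i j : `|Gm i j| <= freq (`|i - j|%N%:R / M) vs := sum_c2_freq i j M vs.
have -> : \sum_(v <- vs) D2 N (v / M) = \sum_(i < N.+1) \sum_(j < N.+1) kc R N i * kc R N j * Gm i j.
  under eq_bigr do rewrite D2E.
  rewrite exchange_big /=; apply: eq_bigr => i _; rewrite exchange_big /=; apply: eq_bigr => j _.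
  by rewrite mulr_sumr.
have Fw i : (K <= i <= N - K)%N -> exists w : nat -> R,
   (forall j, 0 <= w j <= 1 /\ 1 - w j <= `|i - j|%N%:R / K%:R) /\
   \sum_(v <- vs) fejer K (v / M) = \sum_(j < N.+1) w j * Gm i j.
  move=> hi; have KN' : (K <= N)%N by lia.
  have [w [hw E]] := sum_window (Gm i) K0 hi KN'.
  exists w; split => //; rewrite -E /fejer -mulr_sumr; congr (_ * _).
  rewrite exchange_big /=; apply: eq_bigr => a _; rewrite exchange_big /=; apply: eq_bigr => b _.
  apply: eq_bigr => v _; congr (c2 (_ * _)).
  by rewrite natrD natrB; [ring | have := ltn_ord a; lia].
rewrite (bigID (fun i : 'I_N.+1 => (K <= i <= N - K)%N) predT) /=.
rewrite [X in 5 * X](bigID (fun i : 'I_N.+1 => (K <= i <= N - K)%N) predT) /=.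
pose A1 : R := \sum_(i < N.+1 | (K <= i <= N - K)%N) \sum_(j < N.+1) kc R N i * kc R N j * Gm i j.
rewrite -/A1.
have fr0 k : 0 <= freq k vs by exact: freq_ge0.
have kb i : (i < N.+1)%N -> 0 <= kc R N i <= 1.
  by rewrite ltnS => iN; rewrite kc_ge0 // kc_le1.
have part1 : (\sum_(i < N.+1 | (K <= i <= N - K)%N) kc R N i ^+ 2) * \sum_(v <- vs) fejer K (v / M)
   <= A1 + 5 * \sum_(i < N.+1 | (K <= i <= N - K)%N) \sum_(j < N.+1)
         Num.min 1 (`|i - j|%N%:R / K%:R) * freq (`|i - j|%N%:R / M) vs.
  rewrite mulr_suml /A1 mulr_sumr -big_split; apply: ler_sum => i hi /=.
  have [w [hw ->]] := Fw i hi.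
  rewrite mulr_sumr mulr_sumr -big_split; apply: ler_sum => j _ /=.
  have /andP[ci0 ci1] := kb i (ltn_ord i); have /andP[cj0 cj1] := kb j (ltn_ord j).
  have [/andP[w0 w1] w2] := hw j.
  have lip := @kc_lip R N i j N0.
  have gA := GA i j; have f0 := fr0 (`|i - j|%N%:R / M).
  set ci := kc R N i in ci0 ci1 lip *; set cj := kc R N j in cj0 cj1 lip *.
  set d := (`|i - j|%N%:R : R) in w2 lip *.
  have d0 : 0 <= d by rewrite ler0n.
  have dN : 4 * d / N%:R <= 4 * (d / K%:R).
    by rewrite -mulrA ler_wpM2l // ler_wpM2l // lef_pV2 ?posrE // ler_nat.
  have Emin : `|ci * ci * w j - ci * cj| <= 5 * Num.min 1 (d / K%:R).
    rewrite /Num.min; case: ifP => _.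
      rewrite mulr1 ler_norml; apply/andP; split; nra.
    have -> : ci * ci * w j - ci * cj = ci * (ci - cj) - ci * ci * (1 - w j) by ring.
    apply: le_trans (ler_normB _ _) _; rewrite !normrM (ger0_norm ci0).
    have -> : 5 * (d / K%:R) = 4 * (d / K%:R) + d / K%:R by ring.
    apply: lerD.
      apply: le_trans (ler_piMl (normr_ge0 _) ci1) _; exact: le_trans lip dN.
    rewrite ger0_norm; last lra.
    apply: le_trans w2; rewrite ler_piMl //; first lra.
    by rewrite mulr_ile1.
  rewrite -lerBlDl.
  have -> : ci ^+ 2 * (w j * Gm i j) - ci * cj * Gm i j = (ci * ci * w j - ci * cj) * Gm i j by ring.
  apply: le_trans (ler_norm _) _; rewrite normrM mulrA.
  exact: ler_pM.
have part2 : 0 <= \sum_(i < N.+1 | ~~ (K <= i <= N - K)%N) \sum_(j < N.+1) kc R N i * kc R N j * Gm i j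
   + \sum_(i < N.+1 | ~~ (K <= i <= N - K)%N) \sum_(j < N.+1)
         4 * K%:R / N%:R * freq (`|i - j|%N%:R / M) vs.
  rewrite -big_split; apply: sumr_ge0 => i hi /=; rewrite -big_split; apply: sumr_ge0 => j _ /=.
  have /andP[ci0 ci1] := kb i (ltn_ord i); have /andP[cj0 cj1] := kb j (ltn_ord j).
  have ciK : kc R N i <= 4 * K%:R / N%:R.
    have [iK|iK] := leqP i K.
      apply: le_trans (@kc_le R N i N0) _.
      by rewrite ler_pM2r ?invr_gt0 // ler_pM2l // ler_nat.
    have iN : (i <= N)%N by rewrite -ltnS.
    rewrite -(@kc_rev R N i N0 iN); apply: le_trans (@kc_le R N _ N0) _.
    rewrite ler_pM2r ?invr_gt0 // ler_pM2l // ler_nat.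
    by move: hi iK; clear; lia.
  have gA := GA i j.
  have : `|kc R N i * kc R N j * Gm i j| <= 4 * K%:R / N%:R * freq (`|i - j|%N%:R / M) vs.
    rewrite normrM ger0_norm ?mulr_ge0 //; apply: ler_pM => //; first by rewrite mulr_ge0.
    by apply: le_trans ciK; rewrite ler_piMr.
  by rewrite ler_norml => /andP[h _]; lra.
have part3 : 0 <= 5 * \sum_(i < N.+1 | ~~ (K <= i <= N - K)%N) \sum_(j < N.+1)
         Num.min 1 (`|i - j|%N%:R / K%:R) * freq (`|i - j|%N%:R / M) vs.
  rewrite mulr_ge0 // sumr_ge0 // => i _; rewrite sumr_ge0 // => j _.
  by rewrite mulr_ge0 ?freq_ge0 // le_min ler01 divr_ge0 ?ler0n.
lra.
Qed.

(* As no value of [vs] is smaller than [eta], the kernel of [kernelE] is nonpositive at every value. *)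
Lemma kernel_bound (R : realType) (M eta : R) (N K : nat) (vs : seq R) :
  (0 < K)%N -> (8 * K <= N)%N -> 0 < eta -> M <= eta * N%:R -> 0 < M ->
  (forall v, v \in vs -> eta <= `|v| <= M / 4) ->
  (count (fun v => `|v| <= M / (16 * K%:R)) vs)%:R * (K%:R / 2) * N%:R
   <= 1024 * (148 * N.+1%:R + 16 * K%:R ^+ 3)
        * (\sum_(1 <= k < N.+1) Num.min 1 (k%:R / K%:R) * freq (k%:R / M) vs)
      + 1024 * 16 * K%:R ^+ 2 * (size vs)%:R / N%:R * 2.
Proof.
move=> K0 KN eta0 MN M0 hv; have N0 : (0 < N)%N by lia.
have KN1 : (K <= N)%N by lia.
have N2 : (2 <= N)%N by lia.
have KR : (1 : R) <= K%:R by rewrite ler1n.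
have NR : (0 : R) < N%:R by rewrite ltr0n.
have pi0 := @pi_gt0 R; have pi1 := @pihalf_ge1 R.
pose A k := freq (k%:R / M) vs.
have A0 k : 0 <= A k by exact: freq_ge0.
set S1 := \sum_(1 <= k < N.+1) _.
have S10 : 0 <= S1.
  by apply: sumr_ge0 => k _; rewrite mulr_ge0 ?freq_ge0 // le_min ler01 divr_ge0 ?ler0n.
have S1E : \sum_(k < N.+1) Num.min 1 (k%:R / K%:R) * A k = S1.
  rewrite -(big_mkord xpredT (fun k => Num.min 1 (k%:R / K%:R) * A k)) big_ltn //.
  by rewrite mul0r min_r // mul0r add0r.
have b1 : \sum_(v <- vs) D2 N (v / M) <= 64 * N%:R * S1.
  pose a : R := pi / N%:R.
  have a0 : 0 < a by rewrite divr_gt0.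
  have apih : a <= pi / 2 by rewrite ler_pM2l // lef_pV2 ?posrE // (ler_nat R 2).
  have [->|] := eqVneq vs [::]; first by rewrite big_nil !mulr_ge0 // ltW.
  rewrite -size_eq0 -lt0n -has_predT => /hasP[v0 v0in _].
  have etaM : eta <= M / 4 by have /andP[h1 h2] := hv _ v0in; exact: le_trans h1 h2.
  set kap := cos (2 * pi * (eta / M)).
  have eM : N%:R^-1 <= eta / M by rewrite ler_pdivlMr // mulrC ler_pdivrMr.
  have eM2 : eta / M <= 1 / 4 by rewrite ler_pdivrMr //; lra.
  have cosle (x y : R) : 0 <= x <= y -> y <= pi -> cos y <= cos x.
    move=> /andP[x0 xy] ypi; rewrite leNgt ltr_cos ?in_itv /= ?x0 ?ypi ?(le_trans x0 xy) ?(le_trans xy ypi) //.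
    by rewrite -leNgt.
  (* As [M <= eta N], a value with [|v| >= eta] has [2 pi |v| / M >= 2 a]. The gap between [cos a]
     and [cos (2 a)] is of order [a^2], whereas the right side of [kernelE] carries [sin a <= a];
     the quotient is the factor [N] in [b1]. *)
  have Del : a ^+ 2 / 32 <= cos a - kap.
    have k1 : kap <= cos (a *+ 2).
      apply: cosle; rewrite ?mulrn_wge0 ?(ltW a0) //=.
        have -> : a *+ 2 = 2 * pi * N%:R^-1 by rewrite /a; ring.
        by rewrite ler_wpM2l // mulr_ge0 // ltW.
      by nra.
    rewrite cos_mulr2n in k1.
    have c0 : 0 <= cos a by apply: cos_ge0_pihalf; rewrite apih andbT; lra.
    have s1 := @sin_ge_quarter R (a / 2) ltac:(by apply/andP; split; lra).
    have E : cos a = 1 - 2 * sin (a / 2) ^+ 2.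
      have := cos_mulr2n (a / 2); have -> : a / 2 *+ 2 = a by field.
      by move=> ->; rewrite cos2sin2 -mulr_natr; ring.
    have s2' : (a / 8) ^+ 2 <= sin (a / 2) ^+ 2 by rewrite lerXn2r ?nnegrE; lra.
    have cle := cos_le1 a; rewrite -mulr_natr in k1; nra.
  have Dv v : v \in vs -> (cos a - kap) * D2 N (v / M)
     <= - (sin a * \sum_(j < N.+1) kc R N j * c2 (j%:R * (v / M))).
    move=> vin; have /andP[h1 h2] := hv _ vin; rewrite -(kernelE (v / M) N0) -/a.
    have ck : c2 (v / M) <= kap.
      rewrite /c2 -cos_norm; apply: cosle.
        rewrite !mulr_ge0 ?invr_ge0 ?(ltW pi0) ?(ltW eta0) ?(ltW M0) //=.
        rewrite !normrM (ger0_norm (ltW pi0)) ger0_norm // ler_wpM2l ?mulr_ge0 ?(ltW pi0) //.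
        by rewrite normfV (gtr0_norm M0) ler_pM2r ?invr_gt0.
      rewrite !normrM (ger0_norm (ltW pi0)) ger0_norm // normfV (gtr0_norm M0).
      have : `|v| / M <= 1 / 4 by rewrite ler_pdivrMr //; lra.
      by nra.
    have := D2_ge0 N (v / M); nra.
  have Sum : (cos a - kap) * \sum_(v <- vs) D2 N (v / M) <= a * (4 * S1).
    rewrite mulr_sumr big_seq; apply: le_trans (ler_sum _ Dv) _; rewrite -big_seq.
    rewrite sumrN -mulr_sumr exchange_big /= -mulrN.
    have sa0 : 0 <= sin a by apply: sin_ge0_pi; rewrite ltW //=; lra.
    have inner : - (\sum_(j < N.+1) \sum_(v <- vs) kc R N j * c2 (j%:R * (v / M))) <= 4 * S1.
      rewrite -S1E mulr_sumr -sumrN; apply: ler_sum => j _; rewrite -mulr_sumr -mulrN.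
      have jN : (j <= N)%N by rewrite -ltnS.
      have kj0 := @kc_ge0 R N j N0 jN; have kj1 := @kc_le1 R N j; have kj2 := @kc_le R N j N0.
      have h : - (\sum_(v <- vs) c2 (j%:R * (v / M))) <= A j.
        have := sum_c2_freq j 0 M vs; rewrite subr0 distn0 => h.
        by apply: le_trans (ler_norm _) _; rewrite normrN.
      apply: le_trans (ler_wpM2l kj0 h) _; rewrite mulrA ler_wpM2r //.
      rewrite /Num.min; case: ifP => _; first by lra.
      apply: le_trans kj2 _; rewrite -mulrA ler_wpM2l // ler_wpM2l ?ler0n //.
      by rewrite lef_pV2 ?posrE ?(lt_le_trans ltr01 KR) // ler_nat.
    apply: le_trans (ler_wpM2l sa0 inner) _; rewrite ler_wpM2r ?mulr_ge0 //.
    by apply: sin_le; exact: ltW.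
  have D20 : 0 <= \sum_(v <- vs) D2 N (v / M) by apply: sumr_ge0 => v _; exact: D2_ge0.
  move: (\sum_(v <- vs) D2 N (v / M)) Sum D20 => T Sum T0.
  have h1 : a ^+ 2 / 32 * T <= a * (4 * S1) by apply: le_trans Sum; rewrite ler_wpM2r.
  have h2 : a * T <= 128 * S1.
    rewrite -(ler_pM2l a0); lra.
  have aN : a * N%:R = pi by rewrite /a divfK ?gt_eqF.
  have h3 : pi * T <= 128 * S1 * N%:R.
    by rewrite -aN; have := ler_wpM2r (ltW NR) h2; lra.
  nra.
have b2 : \sum_(i < N.+1) \sum_(j < N.+1)
    Num.min 1 (`|i - j|%N%:R / K%:R) * freq (`|i - j|%N%:R / M) vs <= 2 * N.+1%:R * S1.
  apply: le_trans (_ : \sum_(i < N.+1) 2 * S1 <= _); last first.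
    by rewrite sumr_const card_ord -[X in X <= _]mulr_natr; lra.
  apply: ler_sum => i _; rewrite -S1E.
  apply: (@sum_dist_le R N.+1 i (fun k => Num.min 1 (k%:R / K%:R) * A k)) => // k.
  by rewrite mulr_ge0 ?freq_ge0 // le_min ler01 divr_ge0 ?ler0n.
(* Here the weight [min(1, k / K)] is missing. It is restored at the price of a factor [K] for
   [k >= 1], and frequency 0 is bounded trivially; [b3] can afford this because of its factor
   [1 / N]. *)
have AK : \sum_(k < N.+1) A k <= (size vs)%:R + K%:R * S1.
  rewrite -(big_mkord xpredT A) big_ltn // lerD ?freq_le // /S1 mulr_sumr.
  rewrite big_nat [X in _ <= X]big_nat; apply: ler_sum => k /andP[k1 _].
  rewrite mulrA -[X in X <= _]mul1r ler_wpM2r //.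
  rewrite /Num.min; case: ifP => _; first by rewrite mulr1.
  by rewrite mulrCA divff ?gt_eqF ?mulr1 ?ler1n // (lt_le_trans ltr01 KR).
have b3 : \sum_(i < N.+1 | ~~ (K <= i <= N - K)%N) \sum_(j < N.+1)
         4 * K%:R / N%:R * freq (`|i - j|%N%:R / M) vs
    <= 2 * K%:R * (4 * K%:R / N%:R * (2 * ((size vs)%:R + K%:R * S1))).
  have c0 : 0 <= 4 * K%:R / N%:R :> R by rewrite divr_ge0 ?mulr_ge0 ?ler0n.
  have q0 : 0 <= 2 * ((size vs)%:R + K%:R * S1) by rewrite mulr_ge0 ?addr_ge0 ?mulr_ge0 ?ler0n.
  apply: le_trans (_ : \sum_(i < N.+1 | ~~ (K <= i <= N - K)%N)
     4 * K%:R / N%:R * (2 * ((size vs)%:R + K%:R * S1)) <= _).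
    apply: ler_sum => i _; rewrite -mulr_sumr ler_wpM2l //.
    apply: le_trans (@sum_dist_le R N.+1 i A A0 (ltn_ord i)) _.
    by rewrite ler_pM2l.
  rewrite sumr_const -[X in X <= _]mulr_natl ler_wpM2r ?(mulr_ge0 c0 q0) //.
  rewrite -natrM ler_nat cardE -(size_map val).
  apply: leq_trans (_ : size (iota 0 K ++ iota (N - K).+1 K) <= _)%N; last first.
    by rewrite size_cat !size_iota mul2n addnn.
  apply: uniq_leq_size; first by rewrite map_inj_uniq ?enum_uniq //; exact: val_inj.
  move=> x /mapP[i]; rewrite mem_enum => hi ->; rewrite mem_cat !mem_iota.
  by move: hi (ltn_ord i) KN1; rewrite unfold_in /=; clear; lia.
have b4 := @sum_kc_sqr_ge R N K K0 KN.
have b5 : (count (fun v => `|v| <= M / (16 * K%:R)) vs)%:R * (K%:R / 2)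
   <= \sum_(v <- vs) fejer K (v / M).
  rewrite -sum1_count natr_sum mulr_suml big_mkcond; apply: ler_sum => v _.
  case: ifP => [h|_]; last exact: fejer_ge0.
  rewrite mul1r; apply: fejer_ge => //.
  by rewrite normrM normfV (gtr0_norm M0) ler_pdivrMr // [_ * M]mulrC.
have main := @kernel_coarse R M N K vs K0 KN.
have cnt0 : 0 <= (count (fun v => `|v| <= M / (16 * K%:R)) vs)%:R * (K%:R / 2) :> R.
  by rewrite mulr_ge0 ?ler0n //; lra.
set cnt := (count _ vs)%:R * (K%:R / 2) in b5 cnt0 *.
have : N%:R / 1024 * cnt <= 64 * N%:R * S1 + 5 * (2 * N.+1%:R * S1)
   + 2 * K%:R * (4 * K%:R / N%:R * (2 * ((size vs)%:R + K%:R * S1))).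
  apply: le_trans (_ : (\sum_(i < N.+1 | (K <= i <= N - K)%N) kc R N i ^+ 2) * \sum_(v <- vs) fejer K (v / M) <= _).
    apply: ler_pM => //; rewrite divr_ge0 ?ler0n //.
  by apply: le_trans main _; lra.
have -> : 2 * K%:R * (4 * K%:R / N%:R * (2 * ((size vs)%:R + K%:R * S1)))
   = 16 * K%:R ^+ 2 * (size vs)%:R / N%:R + 16 * K%:R ^+ 3 * S1 / N%:R by ring.
have : 16 * K%:R ^+ 3 * S1 / N%:R <= 16 * K%:R ^+ 3 * S1.
  rewrite ler_pdivrMr // ler_peMr ?ler1n // !mulr_ge0 ?exprn_ge0 ?ler0n //.
have : 0 <= 16 * K%:R ^+ 2 * (size vs)%:R / N%:R :> R.
  by rewrite divr_ge0 ?mulr_ge0 ?exprn_ge0 ?ler0n.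
have : 0 <= N%:R * S1 by rewrite mulr_ge0 ?ler0n.
have -> : 1024 * 16 * K%:R ^+ 2 * (size vs)%:R / N%:R * 2
   = 2048 * (16 * K%:R ^+ 2 * (size vs)%:R / N%:R) :> R by ring.
by rewrite -natr1; clear b1 b2 b3 b4 b5 main AK; lra.
Qed.

(** * Mean squares *)

Lemma sum_uniq_le (R : realType) (g : nat -> R) (G : R) (s : seq nat) :
  (forall j, 0 <= g j) -> (forall J, \sum_(j < J) g j <= G) -> uniq s ->
  \sum_(j <- s) g j <= G.
Proof.
move=> g0 hG us; set J := (\max_(j <- s) j).+1.
apply: le_trans (hG J); rewrite -(big_mkord xpredT g).
have -> : \sum_(j <- s) g j = \sum_(j <- iota 0 J | j \in s) g j.
  rewrite -[RHS]big_filter; apply: perm_big; apply: uniq_perm => //.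
    by rewrite filter_uniq // iota_uniq.
  move=> j; rewrite mem_filter mem_iota add0n leq0n /= ltnS.
  case js : (j \in s) => //=; apply/esym.
  exact: leq_bigmax_seq.
rewrite /index_iota subn0 big_mkcond; apply: ler_sum => j _.
by case: ifP.
Qed.

Lemma sum_uniq_int_le (R : realType) (g : nat -> R) (G : R) (s : seq int) (u : int) :
  (forall j, 0 <= g j) -> (forall J, \sum_(j < J) g j <= G) -> uniq s ->
  \sum_(w <- s) g `|w - u|%N <= 2 * G.
Proof.
move=> g0 hG us; rewrite (bigID (fun w => u <= w)) /= mulr2n mulrDl !mul1r.
apply: lerD.
  rewrite -big_filter -(big_map (fun w => `|w - u|%N) xpredT g).
  apply: (sum_uniq_le g0 hG); rewrite map_inj_in_uniq ?filter_uniq //.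
  move=> x y; rewrite !mem_filter => /andP[h1 _] /andP[h2 _]; lia.
rewrite -big_filter -(big_map (fun w => `|w - u|%N) xpredT g).
apply: (sum_uniq_le g0 hG); rewrite map_inj_in_uniq ?filter_uniq //.
move=> x y; rewrite !mem_filter => /andP[h1 _] /andP[h2 _]; lia.
Qed.

Lemma sum_count_undup (R : realType) (T : eqType) (s : seq T) (F : T -> R) :
  \sum_(x <- s) F x = \sum_(u <- undup s) (count_mem u s)%:R * F u.
Proof.
rewrite -big_undup_iterop_count; apply: eq_bigr => u _.
by rewrite Monoid.iteropE iter_addr_0 mulr_natl.
Qed.

(** Schur's test: with multiplicities [c_u], the inequality [c_u c_w <= (c_u^2 + c_w^2) / 2] reduces
    near coincidences, weighted by a summable function of the distance, to exact coincidences. *)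
Lemma sum_hist_le (R : realType) (g : nat -> R) (G : R) (s : seq int) :
  (forall j, 0 <= g j) -> (forall J, \sum_(j < J) g j <= G) ->
  \sum_(x <- s) \sum_(y <- s) g `|x - y|%N
    <= 2 * G * \sum_(x <- s) \sum_(y <- s) (x == y)%:R.
Proof.
move=> g0 hG; pose c u : R := (count_mem u s)%:R.
have c0 u : 0 <= c u by rewrite ler0n.
have -> : \sum_(x <- s) \sum_(y <- s) (x == y)%:R = \sum_(u <- undup s) c u ^+ 2.
  rewrite sum_count_undup; apply: eq_bigr => u _; rewrite expr2; congr (_ * _).
  rewrite /c -sum1_count natr_sum [RHS]big_mkcond; apply: eq_bigr => y _.
  by rewrite eq_sym /=; case: (y == u).
have -> : \sum_(x <- s) \sum_(y <- s) g `|x - y|%N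
  = \sum_(u <- undup s) \sum_(w <- undup s) c u * c w * g `|u - w|%N.
  rewrite sum_count_undup; apply: eq_bigr => u _; rewrite sum_count_undup mulr_sumr.
  by apply: eq_bigr => w _; rewrite mulrA.
apply: le_trans (_ : \sum_(u <- undup s) \sum_(w <- undup s)
     (1 / 2 * c u ^+ 2 * g `|u - w|%N + 1 / 2 * c w ^+ 2 * g `|u - w|%N) <= _).
  apply: ler_sum => u _; apply: ler_sum => w _; rewrite -mulrDl ler_wpM2r //.
  by have := sqr_ge0 (c u - c w); nra.
have half : \sum_(u <- undup s) \sum_(w <- undup s) (1 / 2 * c u ^+ 2 * g `|u - w|%N)
   <= G * \sum_(u <- undup s) c u ^+ 2.
  rewrite mulr_sumr; apply: ler_sum => u _; rewrite -mulr_sumr.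
  have := sum_uniq_int_le u g0 hG (undup_uniq s) => h.
  have -> : \sum_(w <- undup s) g `|u - w|%N = \sum_(w <- undup s) g `|w - u|%N.
    by apply: eq_bigr => w _; congr g; lia.
  have := ler_wpM2l (sqr_ge0 (c u)) h; lra.
under eq_bigr do rewrite big_split /=.
rewrite big_split /=.
have -> : 2 * G * \sum_(u <- undup s) c u ^+ 2
  = G * \sum_(u <- undup s) c u ^+ 2 + G * \sum_(u <- undup s) c u ^+ 2 by ring.
apply: lerD => //.
rewrite exchange_big /=; apply: le_trans half.
apply: ler_sum => u _; apply: ler_sum => w _.
by have -> : `|w - u|%N = `|u - w|%N by lia.
Qed.

Lemma sum_inv_sqr_le (R : realType) (J : nat) : \sum_(j < J) (j.+1%:R : R) ^- 2 <= 2.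
Proof.
suff H n : \sum_(j < n.+1) (j.+1%:R : R) ^- 2 <= 2 - n.+1%:R^-1.
  case: J => [|J]; first by rewrite big_ord0.
  by apply: le_trans (H J) _; rewrite gerBl invr_ge0 ler0n.
elim: n => [|n IH]; first by rewrite big_ord1 expr1n; lra.
rewrite big_ord_recr /=; apply: le_trans (lerD IH (lexx _)) _.
have n1 : (0 : R) < n.+1%:R by rewrite ltr0n.
have E : (n.+2%:R : R) = n.+1%:R + 1 by rewrite -natr1.
rewrite E; move: (n.+1%:R) n1 => x x0 {E}.
have : ((x + 1) ^+ 2)^-1 <= (x * (x + 1))^-1.
  by rewrite lef_pV2 ?posrE ?exprn_gt0 ?mulr_gt0 //; nra.
have -> : (x * (x + 1))^-1 = x^-1 - (x + 1)^-1 by field; rewrite !gt_eqF //; lra.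
lra.
Qed.

Lemma fejer_le (R : realType) (L : nat) (t : R) : (0 < L)%N -> fejer L t <= L%:R /\
  (t != 0 -> `|t| <= 1 / 2 -> fejer L t <= 4 / (L%:R * t ^+ 2)).
Proof.
move=> L0; have LR : (0 : R) < L%:R by rewrite ltr0n.
have E : fejer L t = L%:R^-1 * esum (fun i => t * i%:R + 0) L ^+ 2.
  rewrite /fejer; congr (_ * _); rewrite esum_sqrE !expr2 !mulr_suml -big_split.
  apply: eq_bigr => a _ /=; rewrite !mulr_sumr -big_split; apply: eq_bigr => b _ /=.
  by rewrite -c2B; congr c2; ring.
have s0 := esum_ge0 (fun i => t * i%:R + 0) L.
rewrite E; split.
  have := esum_le (fun i => t * i%:R + 0) L; move: (esum _ _) s0 => z z0 h.
  by rewrite mulrC ler_pdivrMr //; nra.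
move=> t0 th; have tp : 0 < `|t| by rewrite normr_gt0.
have := esum_lin t 0 L; have := @sin_pi_dist R t 0; rewrite subr0 => /(_ th) h1 h2.
move: (esum _ _) s0 h2 => z z0 h2.
have h3 : z * (`|t| / 2) <= 1 by apply: le_trans h2; rewrite ler_wpM2l.
have h4 : (z * (`|t| / 2)) ^+ 2 <= 1 by rewrite expr_le1 // mulr_ge0 // divr_ge0.
have t2 : 0 < t ^+ 2 by rewrite exprn_even_gt0.
have -> : 4 / (L%:R * t ^+ 2) = L%:R^-1 * (4 / t ^+ 2) by rewrite invfM mulrCA.
rewrite ler_wpM2l ?invr_ge0 ?ler0n // ler_pdivlMr //.
by move: h4; rewrite !exprMn real_normK ?num_real //; lra.
Qed.

Lemma freq_sqrE (R : realType) (al : R) (vs : seq R) :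
  freq al vs ^+ 2 = \sum_(v <- vs) \sum_(w <- vs) c2 (al * (v - w)).
Proof.
rewrite eabs_sqrE big_map; apply: eq_bigr => v _; rewrite big_map; apply: eq_bigr => w _.
by rewrite mulrBr.
Qed.

(** A large sieve argument: among the differences of two indices below [L = 2 (N + 1)], every
    [k <= N] arises at least [N + 1] times, so the mean square is majorised by a Fejer kernel. That
    kernel decays like the inverse square of [(v - w) / M], and only pairs of nearby values
    matter. *)
Lemma l2_bound (R : realType) (M : R) (N : nat) (vs : seq R) : 0 < M ->
  (forall v, v \in vs -> `|v| <= M / 4) ->
  \sum_(k < N.+1) freq (k%:R / M) vs ^+ 2
   <= 8 * (4 * N.+1%:R + 4 * M ^+ 2 / N.+1%:R)
      * \sum_(v <- vs) \sum_(w <- vs) (Num.floor v == Num.floor w)%:R.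
Proof.
move=> M0 hv; set L := (N.+1 * 2)%N.
have L0 : (0 < L)%N by rewrite muln_gt0.
have LR : (0 : R) < L%:R by rewrite ltr0n.
have NR : (0 : R) < N.+1%:R by rewrite ltr0n.
have LE : (L%:R : R) = 2 * N.+1%:R by rewrite natrM mulrC.
have step1 : \sum_(k < N.+1) freq (k%:R / M) vs ^+ 2
   <= 2 * \sum_(v <- vs) \sum_(w <- vs) fejer L ((v - w) / M).
  have -> : \sum_(v <- vs) \sum_(w <- vs) fejer L ((v - w) / M)
    = L%:R^-1 * \sum_(a < L) \sum_(b < L) freq ((a%:R - b%:R) / M) vs ^+ 2.
    rewrite mulr_sumr.
    under eq_bigr do under eq_bigr do rewrite /fejer.
    under eq_bigr do rewrite -mulr_sumr.
    rewrite -mulr_sumr -mulr_sumr; congr (_ * _).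
    under [RHS]eq_bigr do under eq_bigr do rewrite freq_sqrE.
    transitivity (\sum_(v <- vs) \sum_(a < L) \sum_(b < L) \sum_(w <- vs) c2 ((a%:R - b%:R) * ((v - w) / M))).
      apply: eq_bigr => v _; rewrite exchange_big /=; apply: eq_bigr => a _.
      by rewrite exchange_big.
    rewrite exchange_big /=; apply: eq_bigr => a _.
    rewrite exchange_big /=; apply: eq_bigr => b _.
    apply: eq_bigr => v _; apply: eq_bigr => w _; congr c2; ring.
  have F0 a b : 0 <= freq ((a%:R - b%:R) / M) vs ^+ 2 by exact: sqr_ge0.
  have -> : L%:R^-1 = 1 / 2 / N.+1%:R :> R by rewrite LE invfM mul1r.
  have low : N.+1%:R * \sum_(k < N.+1) freq (k%:R / M) vs ^+ 2
      <= \sum_(a < L) \sum_(b < L) freq ((a%:R - b%:R) / M) vs ^+ 2.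
    rewrite exchange_big /=.
    rewrite -(big_mkord xpredT (fun b => \sum_(a < L) freq ((a%:R - b%:R) / M) vs ^+ 2)).
    have NL : (N.+1 <= L)%N by rewrite /L; lia.
    rewrite (@big_cat_nat _ _ _ N.+1) //= -[X in X <= _]addr0; apply: lerD; last first.
      by apply: sumr_ge0 => b _; apply: sumr_ge0.
    have -> : N.+1%:R * \sum_(k < N.+1) freq (k%:R / M) vs ^+ 2
      = \sum_(0 <= b < N.+1) \sum_(k < N.+1) freq (k%:R / M) vs ^+ 2.
      by rewrite sumr_const_nat subn0 mulr_natl.
    rewrite [X in X <= _]big_nat [X in _ <= X]big_nat; apply: ler_sum => b /andP[_ bN].
    rewrite -(big_mkord xpredT (fun a => freq ((a%:R - b%:R) / M) vs ^+ 2)).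
    have bN1 : (b + N.+1 <= L)%N by rewrite /L; lia.
    rewrite (@big_cat_nat _ _ _ b) //=; last by apply: leq_trans bN1; rewrite leq_addr.
    rewrite [X in _ + X](@big_cat_nat _ _ _ (b + N.+1)) ?leq_addr //=.
    rewrite -[X in X <= _]add0r; apply: lerD; first by apply: sumr_ge0.
    rewrite -[X in X <= _]addr0; apply: lerD; last by apply: sumr_ge0.
    rewrite [X in _ <= X](_ : _ = \sum_(0 + b <= a < b + N.+1) freq ((a%:R - b%:R) / M) vs ^+ 2) //.
    rewrite big_addn addKn big_mkord le_eqVlt; apply/orP; left; apply/eqP.
    by apply: eq_bigr => k _; rewrite natrD addrK.
  rewrite -(ler_pM2l NR); apply: (le_trans low).
  move: (\sum_(a < L) _) => z; move: (N.+1%:R) NR => x x0.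
  by rewrite le_eqVlt; apply/orP; left; apply/eqP; field; rewrite gt_eqF.
(* Integer parts at distance [j >= 2] force [|v - w| >= j - 1]. For [j <= 1] only the trivial bound
   [L] on the kernel is available. *)
pose g (j : nat) : R := if (j <= 1)%N then L%:R else 4 * M ^+ 2 / L%:R * j.-1%:R ^- 2.
have g0 j : 0 <= g j.
  rewrite /g; case: ifP => _; first by rewrite ler0n.
  by rewrite mulr_ge0 ?invr_ge0 ?sqr_ge0 // divr_ge0 ?ler0n // mulr_ge0 ?sqr_ge0.
have gG J : \sum_(j < J) g j <= 2 * L%:R + 8 * M ^+ 2 / L%:R.
  have e0 : 0 <= 4 * M ^+ 2 / L%:R by rewrite divr_ge0 ?ler0n // mulr_ge0 ?sqr_ge0.
  suff H n : \sum_(j < n.+2) g j <= 2 * L%:R + 8 * M ^+ 2 / L%:R.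
    case: J => [|[|J]].
    - by rewrite big_ord0; have := ltW LR; lra.
    - by rewrite big_ord1 /g /=; have := ltW LR; lra.
    - exact: H.
  rewrite big_ord_recl big_ord_recl /=.
  have -> : \sum_(i < n) g (bump 0 (bump 0 i)) = 4 * M ^+ 2 / L%:R * \sum_(i < n) (i.+1%:R : R) ^- 2.
    by rewrite mulr_sumr; apply: eq_bigr => i _; rewrite /g /bump /= !add1n.
  have := ler_wpM2l e0 (sum_inv_sqr_le R n).
  by rewrite /g /bump /=; lra.
have step2 : \sum_(v <- vs) \sum_(w <- vs) fejer L ((v - w) / M)
   <= \sum_(x <- [seq Num.floor v | v <- vs]) \sum_(y <- [seq Num.floor v | v <- vs]) g `|x - y|%N.
  rewrite big_map big_seq [X in _ <= X]big_seq; apply: ler_sum => v vin.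
  rewrite big_map big_seq [X in _ <= X]big_seq; apply: ler_sum => w win.
  have [h1 h2] := @fejer_le R L ((v - w) / M) L0.
  rewrite /g; case: ifP => // /negbT; rewrite -ltnNge => jj.
  set j := `|Num.floor v - Num.floor w|%N in jj *.
  have j1 : (0 < j.-1)%N by case: (j) jj => [|[|]].
  have dvw : (j.-1%:R : R) <= `|v - w|.
    have /andP[a1 a2] := floor_itv v; have /andP[b1 b2] := floor_itv w.
    rewrite intrD in a2; rewrite intrD in b2.
    have jE : (j%:R : R) = `|(Num.floor v)%:~R - (Num.floor w)%:~R|.
      by rewrite /j natr_absz -intrB intr_norm.
    have : (j%:R : R) = j.-1%:R + 1 by rewrite natr1 prednK // (leq_trans _ jj).
    rewrite jE => e; have := ler_normB (v - w) ((v - (Num.floor v)%:~R) - (w - (Num.floor w)%:~R)).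
    have -> : v - w - (v - (Num.floor v)%:~R - (w - (Num.floor w)%:~R)) = (Num.floor v)%:~R - (Num.floor w)%:~R by ring.
    have : `|v - (Num.floor v)%:~R - (w - (Num.floor w)%:~R)| <= 1 by rewrite ler_norml; apply/andP; split; lra.
    lra.
  have jR : (0 : R) < j.-1%:R by rewrite ltr0n.
  have vw0 : 0 < `|v - w| by exact: lt_le_trans jR dvw.
  have hv1 := hv v vin; have hv2 := hv w win.
  apply: le_trans (h2 _ _) _.
  - by rewrite mulf_eq0 negb_or invr_eq0 (gt_eqF M0) andbT -normr_gt0.
  - rewrite normrM normfV (gtr0_norm M0) ler_pdivrMr //.
    by apply: le_trans (ler_normB _ _) _; lra.
  have -> : 4 / (L%:R * ((v - w) / M) ^+ 2) = 4 * M ^+ 2 / L%:R * (`|v - w| ^+ 2)^-1.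
    have gen (x y z : R) : x != 0 -> y != 0 -> z != 0 ->
       4 / (x * (y / z) ^+ 2) = 4 * z ^+ 2 / x * (y ^+ 2)^-1.
      by move=> x0 y0 z0; field; rewrite ?x0 ?y0 ?z0.
    by rewrite real_normK ?num_real // gen ?(gt_eqF LR) ?(gt_eqF M0) // -normr_gt0.
  have e0 : 0 <= 4 * M ^+ 2 / L%:R by rewrite divr_ge0 ?ler0n // mulr_ge0 ?sqr_ge0.
  rewrite (ler_wpM2l e0) //.
  by rewrite lef_pV2 ?posrE ?exprn_gt0 // lerXn2r ?nnegrE // ltW.
have step3 := sum_hist_le [seq Num.floor v | v <- vs] g0 gG.
apply: (le_trans step1).
apply: le_trans (_ : 2 * (2 * (2 * L%:R + 8 * M ^+ 2 / L%:R) * \sum_(v <- vs) \sum_(w <- vs) (Num.floor v == Num.floor w)%:R) <= _).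
  rewrite ler_pM2l //; apply: (le_trans step2); apply: (le_trans step3).
  by rewrite big_map; under eq_bigr do rewrite big_map.
have Q0 : 0 <= \sum_(v <- vs) \sum_(w <- vs) (Num.floor v == Num.floor w)%:R :> R.
  by apply: sumr_ge0 => v _; apply: sumr_ge0 => w _; rewrite ler0n.
rewrite mulrA mulrA ler_wpM2r // LE; move: (N.+1%:R) NR => x x0.
have y0 : 0 <= M ^+ 2 / x by rewrite divr_ge0 ?sqr_ge0 // ltW.
have -> : 2 * 2 * (2 * (2 * x) + 8 * M ^+ 2 / (2 * x)) = 16 * x + 16 * (M ^+ 2 / x) by field; rewrite gt_eqF.
by rewrite -mulrA; lra.
Qed.

(** * Differences of cubics in diminished ranges *)

Definition dcub (R : realType) (b3 b2 b1 e y : R) : R :=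
  e * (b3 * (3 * y ^+ 2 + 3 * y * e + e ^+ 2) + b2 * (2 * y + e) + b1).

Lemma cubic_sub (R : realType) (b3 b2 b1 b0 e y : R) :
  cubic b3 b2 b1 b0 (y + e) - cubic b3 b2 b1 b0 y = dcub b3 b2 b1 e y.
Proof. by rewrite /cubic /dcub; ring. Qed.

(** From [X] on, the leading coefficient dominates the lower ones to the extent that the differences
    [dcub] and their increments have the size dictated by [b3] alone; the condition persists when
    [X] grows. *)
Definition tame (R : realType) (b3 b2 b1 X : R) : Prop :=
  [/\ 0 < b3, 0 < X, `|b2| <= b3 * X / 4 & `|b1| <= b3 * X ^+ 2 / 2].

Lemma tame_le (R : realType) (b3 b2 b1 X Z : R) : tame b3 b2 b1 X -> X <= Z -> tame b3 b2 b1 Z.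
Proof.
move=> [h3 X0 h2 h1] XZ; split => //; first exact: lt_le_trans XZ.
  by have := ler_wpM2l (ltW h3) XZ; lra.
have : X ^+ 2 <= Z ^+ 2 by rewrite lerXn2r ?nnegrE ?(ltW X0) // (le_trans (ltW X0)).
by move=> /(ler_wpM2l (ltW h3)); lra.
Qed.

Lemma tame_ex (R : realType) (b3 b2 b1 : R) : 0 < b3 -> exists X, tame b3 b2 b1 X.
Proof.
move=> h3; exists (1 + 4 * `|b2| / b3 + 2 * `|b1| / b3).
rewrite /tame.
have p2 : 0 <= 4 * `|b2| / b3 by rewrite divr_ge0 ?mulr_ge0 // ltW.
have p1 : 0 <= 2 * `|b1| / b3 by rewrite divr_ge0 ?mulr_ge0 // ltW.
have e2 : `|b2| = b3 * (4 * `|b2| / b3) / 4 by field; rewrite gt_eqF.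
have e1 : `|b1| = b3 * (2 * `|b1| / b3) / 2 by field; rewrite gt_eqF.
move: (4 * _ / b3) (2 * _ / b3) p2 p1 e2 e1 => u v u0 v0 -> ->.
split => //; first lra.
  by have := mulr_ge0 (ltW h3) v0; lra.
have : v <= (1 + u + v) ^+ 2 by nra.
by move=> /(ler_wpM2l (ltW h3)); lra.
Qed.

Lemma dcub_bounds (R : realType) (b3 b2 b1 e y : R) : tame b3 b2 b1 y -> 0 <= e ->
  b3 * e * y ^+ 2 <= dcub b3 b2 b1 e y <= 4 * b3 * e * (y + e) ^+ 2.
Proof.
move=> [h3 y0 h2 h1] e0; rewrite /dcub.
move: h2 h1; rewrite !ler_norml => /andP[h2 h2'] /andP[h1 h1'].
have k1 : - (b3 * y / 4) * (2 * y + e) <= b2 * (2 * y + e) by rewrite ler_wpM2r //; lra.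
have k2 : b2 * (2 * y + e) <= (b3 * y / 4) * (2 * y + e) by rewrite ler_wpM2r //; lra.
have ye : 0 <= b3 * (y * e) by rewrite !mulr_ge0 // ltW.
have yy : 0 <= b3 * y ^+ 2 by rewrite mulr_ge0 ?exprn_ge0 // ltW.
have ee : 0 <= b3 * e ^+ 2 by rewrite mulr_ge0 ?exprn_ge0 // ltW.
apply/andP; split.
  have -> : b3 * e * y ^+ 2 = e * (b3 * y ^+ 2) by ring.
  by apply: ler_wpM2l => //; lra.
have -> : 4 * b3 * e * (y + e) ^+ 2 = e * (4 * b3 * (y + e) ^+ 2) by ring.
by apply: ler_wpM2l => //; lra.
Qed.

Lemma dcub_diff_bounds (R : realType) (b3 b2 b1 e y u : R) : tame b3 b2 b1 y -> 0 <= e -> 0 <= u ->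
  3 * b3 * e * u * y <= dcub b3 b2 b1 e (y + u) - dcub b3 b2 b1 e y <= 7 * b3 * e * u * (y + u + e).
Proof.
move=> [h3 y0 h2 h1] e0 u0.
have -> : dcub b3 b2 b1 e (y + u) - dcub b3 b2 b1 e y = e * u * (b3 * (6 * y + 3 * u + 3 * e) + 2 * b2).
  by rewrite /dcub; ring.
move: h2; rewrite !ler_norml => /andP[h2 h2'].
have eu : 0 <= e * u by rewrite mulr_ge0.
have p1 : 0 <= b3 * y by rewrite mulr_ge0 // ltW.
have p2 : 0 <= b3 * u by rewrite mulr_ge0 // ltW.
have p3 : 0 <= b3 * e by rewrite mulr_ge0 // ltW.
apply/andP; split.
  have -> : 3 * b3 * e * u * y = e * u * (3 * b3 * y) by ring.
  by apply: ler_wpM2l => //; lra.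
have -> : 7 * b3 * e * u * (y + u + e) = e * u * (7 * b3 * (y + u + e)) by ring.
by apply: ler_wpM2l => //; lra.
Qed.

(* Writing [W = 6 b3 y + 3 b3 e + 3 b3 u + 2 b2], the second difference is [u e W], and
   [12 b3 dcub] is [e W ^ 2] up to terms depending on [e W] and [e] only. *)
Lemma dcub_inj (R : realType) (b3 b2 b1 Y u : R) (e y e' y' : R) :
  tame b3 b2 b1 Y -> 48 * b3 + 152 * b3 * Y + 16 < 14 * b3 ^+ 2 * Y ^+ 2 ->
  1 <= u <= Y -> 1 <= e <= Y -> Y <= y <= 2 * Y -> e <= e' <= Y -> Y <= y' <= 2 * Y ->
  `|dcub b3 b2 b1 e y - dcub b3 b2 b1 e' y'| < 2 ->
  `|dcub b3 b2 b1 e (y + u) - dcub b3 b2 b1 e' (y' + u)| < 2 ->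
  e' < e + 1.
Proof.
move=> [h3 Y0 h2 h1] hY /andP[u1 uY] /andP[e1 eY] /andP[y1 y2] /andP[ee' e'Y] /andP[y1' y2'] d1 d2.
rewrite ltNge; apply/negP => e'e.
pose W := 6 * b3 * y + 3 * b3 * e + 3 * b3 * u + 2 * b2.
pose W' := 6 * b3 * y' + 3 * b3 * e' + 3 * b3 * u + 2 * b2.
pose kap := 9 * b3 ^+ 2 * u ^+ 2 - 4 * b2 ^+ 2 + 12 * b3 * b1.
have E1 : u * (e * W - e' * W') = (dcub b3 b2 b1 e (y + u) - dcub b3 b2 b1 e' (y' + u))
    - (dcub b3 b2 b1 e y - dcub b3 b2 b1 e' y') by rewrite /W /W' /dcub; ring.
have E2 : e * W ^+ 2 - e' * W' ^+ 2 = 12 * b3 * (dcub b3 b2 b1 e y - dcub b3 b2 b1 e' y')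
    + 6 * b3 * (u * (e * W - e' * W')) + kap * (e' - e) + 3 * b3 ^+ 2 * (e' ^+ 3 - e ^+ 3).
  by rewrite /kap /W /W' /dcub; ring.
move: d1 d2; rewrite !ltr_norml => /andP[d1 d1'] /andP[d2 d2'].
have uw1 : u * (e * W - e' * W') < 4 by rewrite E1; lra.
have uw2 : -4 < u * (e * W - e' * W') by rewrite E1; lra.
have [w1 w2] : e * W - e' * W' < 4 /\ -4 < e * W - e' * W' by split; nra.
move: h2 h1; rewrite !ler_norml => /andP[h2 h2'] /andP[h1 h1'].
have b3Y : 0 < b3 * Y by rewrite mulr_gt0.
have W'l : 11 / 2 * (b3 * Y) + 3 * b3 * e' <= W'.
  by rewrite /W'; nra.
have Wu : W <= 19 * b3 * Y by rewrite /W; nra.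
have Wl : 0 <= W by rewrite /W; nra.
have e'0 : 0 <= 3 * b3 * e' by rewrite !mulr_ge0 ?(ltW h3) //; lra.
have W'0 : 0 <= W' by lra.
have W'sq : 30 * (b3 * Y) ^+ 2 + 9 * b3 ^+ 2 * e' ^+ 2 <= W' ^+ 2.
  have -> : 9 * b3 ^+ 2 * e' ^+ 2 = (3 * b3 * e') ^+ 2 by ring.
  move: (3 * b3 * e') (b3 * Y) e'0 b3Y W'l => p q p0 q0 h.
  have : (11 / 2 * q + p) ^+ 2 <= W' ^+ 2 by rewrite lerXn2r ?nnegrE //; lra.
  by have := mulr_ge0 p0 (ltW q0); nra.
have kapb : kap <= 16 * (b3 * Y) ^+ 2.
  have b2s : 0 <= b2 ^+ 2 := sqr_ge0 _.
  have k1 : b3 ^+ 2 * u ^+ 2 <= (b3 * Y) ^+ 2.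
    by rewrite -exprMn lerXn2r ?nnegrE ?mulr_ge0 ?(ltW h3) ?ler_pM2l //; clear -u1 Y0; lra.
  have k2 : b3 * b1 <= b3 * (b3 * Y ^+ 2 / 2) by rewrite ler_pM2l.
  by rewrite /kap; nra.
have cub : e' ^+ 3 - e ^+ 3 <= (e' - e) * (3 * e' ^+ 2).
  have -> : e' ^+ 3 - e ^+ 3 = (e' - e) * (e' ^+ 2 + e' * e + e ^+ 2) by ring.
  by apply: ler_wpM2l; [clear -ee'; lra|nra].
have key : W' ^+ 2 * (e' - e) - 4 * (2 * W + 4) <= e * W ^+ 2 - e' * W' ^+ 2.
  have e0 : 0 < e by clear -e1; lra.
  rewrite -(ler_pM2l e0).
  have -> : e * (e * W ^+ 2 - e' * W' ^+ 2)
    = (e * W - e' * W') * (e * W + e' * W') + W' ^+ 2 * (e' - e) * e' by ring.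
  have p0 : 0 <= e * W by rewrite mulr_ge0 // ltW.
  have p0' : 0 <= e' * W' by rewrite mulr_ge0 //; clear -e1 ee'; lra.
  have g1 : - 4 * (2 * (e * W) + 4) <= (e * W - e' * W') * (e * W + e' * W').
    by move: (e * W) (e' * W') p0 p0' w1 w2 => p p' *; nra.
  have g2 : e * (W' ^+ 2 * (e' - e)) <= W' ^+ 2 * (e' - e) * e'.
    by rewrite mulrC ler_wpM2l // mulr_ge0 ?sqr_ge0 //; clear -ee'; lra.
  have g3 : e * (4 * (2 * W + 4)) >= 4 * (2 * (e * W) + 4) by clear -e1; lra.
  rewrite mulrBr; clear -e1 g1 g2; lra.
(* If [e' >= e + 1], a quantity of size [(b3 Y)^2] is bounded by [48 b3 + 8 W + 16] with
   [W <= 19 b3 Y]. The hypothesis [hY], with [152 = 8 * 19], is what excludes this. *)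
have f1 : 14 * b3 ^+ 2 * Y ^+ 2 <= W' ^+ 2 - kap - 9 * b3 ^+ 2 * e' ^+ 2.
  by move: W'sq kapb; rewrite exprMn; clear; lra.
have f2 : (W' ^+ 2 - kap - 9 * b3 ^+ 2 * e' ^+ 2) * (e' - e) <= 48 * b3 + 8 * W + 16.
  have k3 : 3 * b3 ^+ 2 * (e' ^+ 3 - e ^+ 3) <= 3 * b3 ^+ 2 * ((e' - e) * (3 * e' ^+ 2)).
    by rewrite ler_wpM2l // mulr_ge0 ?sqr_ge0.
  have k4 : 12 * b3 * (dcub b3 b2 b1 e y - dcub b3 b2 b1 e' y') <= 12 * b3 * 2.
    by rewrite ler_pM2l ?mulr_gt0 // ltW.
  have k5 : 6 * b3 * (u * (e * W - e' * W')) <= 6 * b3 * 4 by rewrite ler_pM2l ?mulr_gt0 // ltW.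
  move: key; rewrite E2 => key.
  have -> : (W' ^+ 2 - kap - 9 * b3 ^+ 2 * e' ^+ 2) * (e' - e) = W' ^+ 2 * (e' - e)
     - kap * (e' - e) - 3 * b3 ^+ 2 * ((e' - e) * (3 * e' ^+ 2)) by ring.
  clear -k3 k4 k5 key; lra.
have f3 : 14 * b3 ^+ 2 * Y ^+ 2 <= (W' ^+ 2 - kap - 9 * b3 ^+ 2 * e' ^+ 2) * (e' - e).
  apply: (le_trans f1); rewrite ler_peMr //; last by clear -e'e; lra.
  by apply: (le_trans _ f1); have := mulr_ge0 (sqr_ge0 b3) (sqr_ge0 Y); clear; lra.
clear -hY Wu f2 f3; lra.
Qed.

(** * Counting near coincidences of differences *)

Lemma cauchy_fibers (R : realType) (T J : finType) (S : {set T}) (f : T -> J) :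
  (#|S|%:R : R) ^+ 2 <= #|f @: S|%:R
    * #|[set p : T * T | [&& p.1 \in S, p.2 \in S & f p.1 == f p.2]]|%:R.
Proof.
pose n j : nat := #|[set x in S | f x == j]|.
have E1 : #|S| = (\sum_(j in f @: S) n j)%N.
  rewrite -sum1_card (partition_big_imset f) /=; apply: eq_bigr => j _.
  by rewrite /n -sum1_card; apply: eq_bigl => x; rewrite inE.
have E2 : #|[set p : T * T | [&& p.1 \in S, p.2 \in S & f p.1 == f p.2]]|
    = (\sum_(j in f @: S) n j ^ 2)%N.
  rewrite -sum1_card (eq_bigl (fun p : T * T => (p.1 \in S) && ((p.2 \in S) && (f p.1 == f p.2)))); last by move=> p; rewrite inE.
  rewrite -(pair_big_dep (fun x => x \in S) (fun x y => (y \in S) && (f x == f y)) (fun _ _ => 1%N)) /=.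
  rewrite (partition_big_imset f) /=; apply: eq_bigr => j _.
  transitivity (\sum_(x in S | f x == j) n j)%N.
    apply: eq_bigr => x /andP[_ /eqP <-]; rewrite sum1_card /n; apply: eq_card => y.
    by rewrite !inE eq_sym.
  rewrite sum_nat_const -mulnn; congr (_ * _)%N; rewrite /n; apply: eq_card => y.
  by rewrite !inE.
rewrite E1 E2 !natr_sum cardE -!big_enum.
have := sqr_sum_le (enum (f @: S)) (fun j => (n j)%:R : R).
by under [X in _ <= _ * X -> _]eq_bigr do rewrite -natrX.
Qed.

Lemma leq_card_inj_on (T J : finType) (S : {set T}) (f : T -> J) :
  {in S &, injective f} -> (#|S| <= #|J|)%N.
Proof. by move=> fI; rewrite -(card_in_imset fI) max_card. Qed.

(** A tuple [(d, x, e, y)] encodes the points [P + x + 1] and [Y + y + 1] together with the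
    differences [d] and [e] to their partners. Only positive differences are kept: zero ones turn
    out to be diagonal, and negative ones follow by symmetry. *)
Definition sol (R : realType) (b3 b2 b1 c3 c2' c1 : R) (P Y : nat) : {set 'I_P * 'I_P * 'I_Y * 'I_Y} :=
  [set s : 'I_P * 'I_P * 'I_Y * 'I_Y |
    [&& (0 < s.1.1.1)%N, (s.1.1.2 + s.1.1.1 < P)%N, (0 < s.1.2)%N, (s.2 + s.1.2 < Y)%N &
      `|dcub b3 b2 b1 s.1.1.1%:R (P + s.1.1.2.+1)%:R - dcub c3 c2' c1 s.1.2%:R (Y + s.2.+1)%:R| < 1]].

(** Solutions are grouped by [d], [e] and the block of length [U] that contains [y], and
    Cauchy-Schwarz is applied to the fibres. Two solutions in one fibre differ by a shift [v] in [x]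
    and a shift [u < U] in [y]; if [u = 0] they coincide. A tuple [(d, x, v, u)] with [u > 0]
    determines [e] and [y] by [dcub_inj], so there are at most about [Dn P Vn U] such ordered pairs.
    The bounds [Dn] on [d] and [Vn] on [v] come from the sizes of first and second differences. *)
Lemma sol_bound (R : realType) (b3 b2 b1 c3 c2' c1 : R) (P Y U Dn Vn : nat) :
  tame b3 b2 b1 P%:R -> tame c3 c2' c1 Y%:R ->
  (0 < U)%N -> (U <= Y)%N -> (Y <= P)%N ->
  1 <= b3 * P%:R ^+ 2 -> 1 <= c3 * Y%:R ^+ 2 -> 2 <= b3 * P%:R -> 2 <= c3 * Y%:R ->
  48 * c3 + 152 * c3 * Y%:R + 16 < 14 * c3 ^+ 2 * Y%:R ^+ 2 ->
  17 * c3 * Y%:R ^+ 3 <= b3 * Dn%:R * P%:R ^+ 2 ->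
  16 * 17 * U%:R * P%:R <= 3 * Vn%:R * Y%:R :> R ->
  forall n : R, n = #|sol b3 b2 b1 c3 c2' c1 P Y|%:R ->
  n ^+ 2 <= (Dn.+1 * Y * (Y %/ U).+1)%:R * (n + 2 * (Dn.+1 * P * Vn.+1 * U)%:R).
Proof.
move=> tb tc U0 UY YP P2 Y2 P1 Y1 hY hD hV n ->.
set S := sol b3 b2 b1 c3 c2' c1 P Y.
have b30 : 0 < b3 by case: tb.
have c30 : 0 < c3 by case: tc.
have Y0 : (0 < Y)%N := leq_trans U0 UY.
have P0 : (0 < P)%N := leq_trans Y0 YP.
have PR : (0 : R) < P%:R by rewrite ltr0n.
have YR : (0 : R) < Y%:R by rewrite ltr0n.
pose xr (i : nat) : R := (P + i.+1)%:R.
pose yr (i : nat) : R := (Y + i.+1)%:R.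
pose A (d x : nat) : R := dcub b3 b2 b1 d%:R (xr x).
pose B (e y : nat) : R := dcub c3 c2' c1 e%:R (yr y).
have tx i : tame b3 b2 b1 (xr i) by apply: (tame_le tb); rewrite ler_nat leq_addr.
have ty i : tame c3 c2' c1 (yr i) by apply: (tame_le tc); rewrite ler_nat leq_addr.
have xl i : P%:R <= xr i by rewrite ler_nat leq_addr.
have yl i : Y%:R <= yr i by rewrite ler_nat leq_addr.
have xu i : (i < P)%N -> xr i <= 2 * P%:R.
  by move=> h; rewrite /xr -natrM ler_nat mul2n -addnn leq_add2l.
have yu i : (i < Y)%N -> yr i <= 2 * Y%:R.
  by move=> h; rewrite /yr -natrM ler_nat mul2n -addnn leq_add2l.
have xD i v : xr (i + v)%N = xr i + v%:R by rewrite /xr -natrD -addnA addSn.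
have yD i v : yr (i + v)%N = yr i + v%:R by rewrite /yr -natrD -addnA addSn.
have SP d x e y : (d, x, e, y) \in S ->
    [/\ (0 < d)%N, (x + d < P)%N, (0 < e)%N, (y + e < Y)%N & `|A d x - B e y| < 1].
  by rewrite inE /= => /and5P[].
have Al (d x : nat) : b3 * d%:R * P%:R ^+ 2 <= A d x.
  have /andP[h _] := dcub_bounds (tx x) (ler0n _ d); apply: le_trans h.
  by rewrite ler_wpM2l ?mulr_ge0 ?(ltW b30) // lerXn2r ?nnegrE ?ler0n // (le_trans _ (xl x)).
have Bl (e y : nat) : c3 * e%:R * Y%:R ^+ 2 <= B e y.
  have /andP[h _] := dcub_bounds (ty y) (ler0n _ e); apply: le_trans h.
  by rewrite ler_wpM2l ?mulr_ge0 ?(ltW c30) // lerXn2r ?nnegrE ?ler0n // (le_trans _ (yl y)).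
have Au (d x : nat) : (x + d < P)%N -> A d x <= 16 * b3 * d%:R * P%:R ^+ 2.
  move=> h; have /andP[_ k] := dcub_bounds (tx x) (ler0n _ d); apply: le_trans k _.
  have -> : 16 * b3 * d%:R * P%:R ^+ 2 = 4 * b3 * d%:R * (2 * P%:R) ^+ 2 by ring.
  rewrite ler_wpM2l ?mulr_ge0 ?(ltW b30) // lerXn2r ?nnegrE ?mulr_ge0 ?ler0n //.
    by rewrite addr_ge0 ?ler0n.
  by rewrite -xD xu.
have Bu (e y : nat) : (y + e < Y)%N -> B e y <= 16 * c3 * e%:R * Y%:R ^+ 2.
  move=> h; have /andP[_ k] := dcub_bounds (ty y) (ler0n _ e); apply: le_trans k _.
  have -> : 16 * c3 * e%:R * Y%:R ^+ 2 = 4 * c3 * e%:R * (2 * Y%:R) ^+ 2 by ring.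
  rewrite ler_wpM2l ?mulr_ge0 ?(ltW c30) // lerXn2r ?nnegrE ?mulr_ge0 ?ler0n //.
    by rewrite addr_ge0 ?ler0n.
  by rewrite -yD yu.
have Asep (d x v : nat) : (0 < d)%N -> (0 < v)%N -> 6 <= A d (x + v)%N - A d x.
  move=> d0 v0; rewrite /A xD.
  have /andP[h _] := dcub_diff_bounds (tx x) (ler0n _ d) (ler0n _ v); apply: le_trans h.
  have d1 : (1 : R) <= d%:R by rewrite ler1n.
  have v1 : (1 : R) <= v%:R by rewrite ler1n.
  have bx : 2 <= b3 * xr x by apply: le_trans P1 _; rewrite ler_pM2l.
  have -> : 3 * b3 * d%:R * v%:R * xr x = 3 * (d%:R * v%:R) * (b3 * xr x) by ring.
  by have : (1 : R) <= d%:R * v%:R; nra.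
have Bsep (e y u : nat) : (0 < e)%N -> (0 < u)%N -> 6 <= B e (y + u)%N - B e y.
  move=> e0 u0; rewrite /B yD.
  have /andP[h _] := dcub_diff_bounds (ty y) (ler0n _ e) (ler0n _ u); apply: le_trans h.
  have d1 : (1 : R) <= e%:R by rewrite ler1n.
  have v1 : (1 : R) <= u%:R by rewrite ler1n.
  have bx : 2 <= c3 * yr y by apply: le_trans Y1 _; rewrite ler_pM2l.
  have -> : 3 * c3 * e%:R * u%:R * yr y = 3 * (e%:R * u%:R) * (c3 * yr y) by ring.
  by have : (1 : R) <= e%:R * u%:R; nra.
have dD d x e y : (d, x, e, y) \in S -> (d <= Dn)%N.
  move=> /SP[d0 xd e0 ye]; rewrite ltr_norml => /andP[h1 h2].
  have k1 := Al d x; have k2 := Bu e y ye.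
  have eY : (e%:R : R) <= Y%:R by rewrite ler_nat (leq_trans (leq_addl y e)) // ltnW.
  have k3 : 1 <= c3 * e%:R * Y%:R ^+ 2.
    by apply: le_trans Y2 _; rewrite ler_pM2r ?exprn_gt0 // ler_peMr ?(ltW c30) // ler1n.
  have k4 : 17 * c3 * e%:R * Y%:R ^+ 2 <= 17 * c3 * Y%:R ^+ 3.
    have -> : 17 * c3 * Y%:R ^+ 3 = 17 * c3 * Y%:R * Y%:R ^+ 2 by ring.
    by rewrite ler_pM2r ?exprn_gt0 // ler_pM2l // mulr_gt0.
  have : b3 * d%:R * P%:R ^+ 2 <= b3 * Dn%:R * P%:R ^+ 2 by lra.
  by rewrite ler_pM2r ?exprn_gt0 // ler_pM2l // ler_nat.
have vV d x e y v u : (d, x, e, y) \in S -> (d, x, e, y) \in S -> True -> (0 < u <= U)%N ->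
    (x + v + d < P)%N -> (y + u + e < Y)%N -> `|A d (x + v)%N - B e (y + u)%N| < 1 -> (v <= Vn)%N.
  move=> /SP[d0 xd e0 ye]; rewrite ltr_norml => /andP[h1 h2] _ _ /andP[u0 uU] xvd yue.
  rewrite ltr_norml => /andP[h3 h4].
  have [->//|v0] := posnP v.
  have d1 : (1 : R) <= d%:R by rewrite ler1n.
  have e1 : (1 : R) <= e%:R by rewrite ler1n.
  have u1 : (1 : R) <= u%:R by rewrite ler1n.
  have v1 : (1 : R) <= v%:R by rewrite ler1n.
  have /andP[k1 _] := dcub_diff_bounds (tx x) (ler0n _ d) (ler0n _ v).
  have /andP[_ k2] := dcub_diff_bounds (ty y) (ler0n _ e) (ler0n _ u).
  rewrite -xD -/(A _ _) -/(A _ _) in k1; rewrite -yD -/(B _ _) -/(B _ _) in k2.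
  have eu1 : (1 : R) <= e%:R * u%:R by nra.
  have k3 : 3 * b3 * d%:R * v%:R * P%:R <= 16 * c3 * e%:R * u%:R * Y%:R.
    have l1 : 3 * b3 * d%:R * v%:R * P%:R <= 3 * b3 * d%:R * v%:R * xr x.
      by rewrite ler_wpM2l // !mulr_ge0 ?ler0n // ltW.
    have l2 : 7 * c3 * e%:R * u%:R * (yr (y + u)%N + e%:R) <= 7 * c3 * e%:R * u%:R * (2 * Y%:R).
      by rewrite ler_wpM2l ?mulr_ge0 ?ler0n ?(ltW c30) // -yD yu.
    have l3 : 2 <= 2 * c3 * e%:R * u%:R * Y%:R.
      have -> : 2 * c3 * e%:R * u%:R * Y%:R = 2 * ((e%:R * u%:R) * (c3 * Y%:R)) by ring.
      by nra.
    clear -h1 h4 k1 k2 l1 l2 l3; lra.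
  have k4 : c3 * e%:R * Y%:R ^+ 2 <= 17 * b3 * d%:R * P%:R ^+ 2.
    have := Bl e y; have := Au d x xd.
    have : 1 <= b3 * d%:R * P%:R ^+ 2.
      by apply: le_trans P2 _; rewrite ler_pM2r ?exprn_gt0 // ler_peMr ?(ltW b30).
    clear -h1; lra.
  have k5 : 3 * v%:R * Y%:R <= 16 * 17 * u%:R * P%:R :> R.
    have bdP : 0 < b3 * d%:R * P%:R by rewrite !mulr_gt0 // (lt_le_trans ltr01).
    rewrite -(ler_pM2l bdP).
    have m1 : 3 * b3 * d%:R * v%:R * P%:R * Y%:R <= 16 * c3 * e%:R * u%:R * Y%:R * Y%:R.
      by rewrite ler_pM2r.
    have m2 : 16 * u%:R * (c3 * e%:R * Y%:R ^+ 2) <= 16 * u%:R * (17 * b3 * d%:R * P%:R ^+ 2).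
      by rewrite ler_wpM2l // mulr_ge0 ?ler0n.
    clear -m1 m2; lra.
  have k6 : 16 * 17 * u%:R * P%:R <= 16 * 17 * U%:R * P%:R :> R.
    by rewrite -!natrM ler_nat leq_pmul2r // leq_pmul2l.
  have : 3 * v%:R * Y%:R <= 3 * Vn%:R * Y%:R :> R by clear -hV k5 k6; lra.
  by rewrite -!natrM ler_nat leq_pmul2r // leq_pmul2l.
pose f (s : 'I_P * 'I_P * 'I_Y * 'I_Y) : 'I_Dn.+1 * 'I_Y * 'I_(Y %/ U).+1 :=
  (inord s.1.1.1, s.1.2, inord (s.2 %/ U)).
have cau := @cauchy_fibers R _ _ S f.
set W := [set p | _] in cau.
have cf1 : (#|f @: S| <= Dn.+1 * Y * (Y %/ U).+1)%N.
  by apply: leq_trans (max_card _) _; rewrite !card_prod !card_ord.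
have fE (s : 'I_P * 'I_P * 'I_Y * 'I_Y) : s \in S -> (f s).1.1 = s.1.1.1 :> nat /\ (f s).2 = (s.2 %/ U)%N :> nat.
  move: s => [[[d x] e] y] hs /=; split; rewrite inordK // ltnS; first exact: dD hs.
  by apply: leq_div2r; exact: ltnW.
pose T := [set p in W | (p.1.2 < p.2.2)%N].
have WP p : p \in W -> [/\ p.1 \in S, p.2 \in S, p.1.1.1.1 = p.2.1.1.1 :> nat,
     p.1.1.2 = p.2.1.2 & (p.1.2 %/ U = p.2.2 %/ U)%N].
  rewrite inE => /and3P[s1 s2 /eqP E]; split => //.
  - by have [<- _] := fE _ s1; have [<- _] := fE _ s2; rewrite E.
  - by have := congr1 (fun z => z.1.2) E.
  - by have [_ <-] := fE _ s1; have [_ <-] := fE _ s2; rewrite E.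
have Wsym p : p \in W -> (p.2, p.1) \in W.
  by rewrite !inE /= => /and3P[-> -> /eqP ->]; rewrite eqxx.
have W1 : (#|W| <= #|S| + #|T| + #|T|)%N.
  have WU : W \subset [set (s, s) | s in S] :|: T :|: [set (p.2, p.1) | p in T].
    apply/fintype.subsetP => p pW; rewrite finset.in_setU finset.in_setU.
    have [s1 s2 E1 E2 E3] := WP p pW.
    case: p pW s1 s2 E1 E2 E3 => -[[[d x] e] y] [[[d' x'] e'] y'] /= pW s1 s2 E1 E2 E3.
    case: (ltngtP y y') => yy.
    - suff -> : ((d, x, e, y), (d', x', e', y')) \in T by rewrite orbT.
      by rewrite inE pW.
    - apply/orP; right; apply/imsetP; exists ((d', x', e', y'), (d, x, e, y)) => //.
      by rewrite inE yy andbT; exact: (Wsym _ pW).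
    - have yE : y = y' by exact: val_inj.
      have dE : d = d' by exact: val_inj.
      have xE : x = x'.
        apply: val_inj => /=; move: s1 s2; rewrite -yE -dE -E2 => /SP[d0 _ _ _ h1] /SP[_ _ _ _ h2].
        move: h1 h2; rewrite !ltr_norml => /andP[h1 h1'] /andP[h2 h2'].
        case: (ltngtP x x') => // xx.
          exfalso; have := Asep d x (x' - x)%N d0; rewrite subn_gt0 subnKC ?(ltnW xx) // => /(_ xx); clear -h1 h2'; lra.
        exfalso; have := Asep d x' (x - x')%N d0; rewrite subn_gt0 subnKC ?(ltnW xx) // => /(_ xx); clear -h1' h2; lra.
      by rewrite -dE -xE -E2 -yE; apply/orP; left; apply/orP; left; apply/imsetP; exists (d, x, e, y).
  apply: leq_trans (subset_leq_card WU) _; apply: leq_trans (leq_card_setU _ _) _.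
  apply: leq_add; last exact: leq_imset_card.
  apply: leq_trans (leq_card_setU _ _) _; rewrite leq_add2r; exact: leq_imset_card.
pose g (p : ('I_P * 'I_P * 'I_Y * 'I_Y) * ('I_P * 'I_P * 'I_Y * 'I_Y)) :
   'I_Dn.+1 * 'I_P * 'I_Vn.+1 * 'I_U.-1.+1 :=
   (inord p.1.1.1.1, p.1.1.1.2, inord (p.2.1.1.2 - p.1.1.1.2), inord (p.2.2 - p.1.2)).
have TP d x e y d' x' e' y' : ((d, x, e, y), (d', x', e', y')) \in T ->
   [/\ d' = d, e' = e, (x < x')%N, (0 < y' - y < U)%N &
    [/\ (x' - x <= Vn)%N, (d, x, e, y) \in S & (d, x', e, y') \in S]].
  rewrite inE => /andP[pW /= yy]; have [s1 s2 /= E1 E2 E3] := WP _ pW.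
  have dE : d = d' by exact: val_inj.
  rewrite -dE -E2 in s2.
  have [d0 xd e0 ye h1] := SP _ _ _ _ s1; have [_ xd' _ ye' h2] := SP _ _ _ _ s2.
  have uU : (0 < y' - y < U)%N.
    rewrite subn_gt0 yy /=; move: (divn_eq y U) (divn_eq y' U) (ltn_pmod y U0) (ltn_pmod y' U0) yy.
    by rewrite E3; move: (_ * U)%N; clear; lia.
  have xx : (x < x')%N.
    rewrite ltnNge; apply/negP => xx.
    have Ax : A d x' <= A d x.
      move: xx; rewrite leq_eqVlt => /orP[/eqP ->//|xx].
      have := Asep d x' (x - x')%N d0; rewrite subn_gt0 subnKC ?(ltnW xx) // => /(_ xx); clear; lra.
    have := Bsep e y (y' - y)%N e0; rewrite subnKC ?(ltnW yy) //; case/andP: uU => -> _ /(_ isT).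
    by move: h1 h2; rewrite !ltr_norml => /andP[h1 h1'] /andP[h2 h2']; clear -Ax h1' h2; lra.
  split => //; split => //.
  apply: (vV d x e y (x' - x)%N (y' - y)%N) => //.
  - by case/andP: uU => -> /ltnW.
  - by rewrite subnKC // ltnW.
  - by rewrite subnKC // ltnW.
  - by rewrite !subnKC // ltnW.
(* With [d], [x], [x'] fixed, the values of the second polynomial's differences agree up to 2 both
   at [y] and at [y + u]. Then [dcub_inj] gives [e2 = e], and the spacing 6 of [Bsep] gives
   [y2 = y]. *)
have key (d x x' : 'I_P) (e y y' e2 y2 y2' : 'I_Y) : (d, x, e, y) \in S -> (d, x', e, y') \in S ->
    (d, x, e2, y2) \in S -> (d, x', e2, y2') \in S ->
    (0 < y' - y < U)%N -> (y' - y = y2' - y2)%N -> (0 < y2' - y2)%N -> (e <= e2)%N -> e = e2 /\ y = y2.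
  move=> /SP[d0 _ e0 ye h1] /SP[_ _ _ ye' h2] /SP[_ _ e20 ye2 h3] /SP[_ _ _ ye2' h4] /andP[u0 uU'] uE u20 ee.
  set u := (y' - y)%N in u0 uU' uE.
  have yE : nat_of_ord y' = (y + u)%N by rewrite subnKC // ltnW // -subn_gt0.
  have y2E : nat_of_ord y2' = (y2 + u)%N by rewrite uE subnKC // ltnW // -subn_gt0.
  move: h1 h2 h3 h4; rewrite !ltr_norml => /andP[h1 h1'] /andP[h2 h2'] /andP[h3 h3'] /andP[h4 h4'].
  have elt : (e2%:R : R) < e%:R + 1.
    apply: (@dcub_inj R c3 c2' c1 Y%:R u%:R e%:R (yr y) e2%:R (yr y2) tc hY).
    - by rewrite ler1n u0 ler_nat (leq_trans (ltnW uU')).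
    - by rewrite ler1n e0 ler_nat ltnW.
    - by rewrite yl yu.
    - by rewrite ler_nat ee ler_nat ltnW.
    - by rewrite yl yu.
    - by rewrite -/(B e y) -/(B e2 y2) ltr_norml; apply/andP; split; clear -h1 h1' h3 h3'; lra.
    - by rewrite -!yD -yE -y2E -/(B e y') -/(B e2 y2') ltr_norml; apply/andP; split; clear -h2 h2' h4 h4'; lra.
  have eE' : e = e2.
    by apply: val_inj => /=; move: elt ee; rewrite natr1 ltr_nat; clear; lia.
  split => //; apply: val_inj => /=; subst e2.
  case: (ltngtP y y2) => // yy.
    exfalso; have := Bsep e y (y2 - y)%N e0; rewrite subn_gt0 subnKC ?(ltnW yy) // => /(_ yy); clear -h1 h1' h3 h3'; lra.
  exfalso; have := Bsep e y2 (y - y2)%N e0; rewrite subn_gt0 subnKC ?(ltnW yy) // => /(_ yy); clear -h1 h1' h3 h3'; lra.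
have gI : {in T &, injective g}.
  move=> [[[[d x] e] y] [[[d' x'] e'] y']] [[[[d2 x2] e2] y2] [[[d2' x2'] e2'] y2']] t1 t2.
  have [dE eE xx uU [vv s1 s1']] := TP _ _ _ _ _ _ _ _ t1.
  have [dE2 eE2 xx2 uU2 [vv2 s2 s2']] := TP _ _ _ _ _ _ _ _ t2.
  have dd := dD _ _ _ _ s1; have dd2 := dD _ _ _ _ s2.
  rewrite /g /= => gE.
  have G1 : d = d2.
    apply: val_inj; have := congr1 (fun z => val z.1.1.1) gE; by rewrite /= !inordK.
  have G2 : x = x2 by have := congr1 (fun z => z.1.1.2) gE.
  have G3 : (x' - x = x2' - x2)%N.
    by have := congr1 (fun z => val z.1.2) gE; rewrite /= !inordK.
  have G4 : (y' - y = y2' - y2)%N.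
    by have := congr1 (fun z => val z.2) gE; rewrite /= !inordK // prednK //; case/andP: uU; case/andP: uU2.
  have x'E : x' = x2' by apply: val_inj => /=; move: G3 xx xx2; rewrite G2; clear; lia.
  have [eE3 yE3] : e = e2 /\ y = y2.
    rewrite -G1 -G2 in s2; rewrite -G1 -x'E in s2'.
    have [le|lt] := leqP e e2.
      by apply: (key d x x' e y y' e2 y2 y2') => //; case/andP: uU2.
    have [-> ->] : e2 = e /\ y2 = y.
      by apply: (key d x x' e2 y2 y2' e y y') => //; [case/andP: uU|exact: ltnW].
    by [].
  have y'E : y' = y2' by apply: val_inj => /=; move: G4 uU uU2; rewrite yE3; clear; lia.
  by rewrite dE eE dE2 eE2 G1 G2 x'E eE3 yE3 y'E.
have T1 : (#|T| <= Dn.+1 * P * Vn.+1 * U)%N.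
  by apply: leq_trans (leq_card_inj_on gI) _; rewrite !card_prod !card_ord prednK.
apply: (le_trans cau); apply: ler_pM; rewrite ?ler0n ?ler_nat //.
apply: le_trans (_ : (#|S| + #|T| + #|T|)%:R <= _); first by rewrite ler_nat.
rewrite !natrD -addrA lerD2l.
have : (#|T|%:R : R) <= (Dn.+1 * P * Vn.+1 * U)%:R by rewrite ler_nat.
by lra.
Qed.

(** * Sums over arcs *)

(** Decay along one major arc; since [5/4 > 1], it is summable over equally spaced points. *)
Definition bw (R : realType) (y : R) : R := (Num.max 1 `|y|) `^ (- (5 / 4)).

Lemma bw_ge0 (R : realType) (y : R) : 0 <= bw y.
Proof. exact: powR_ge0. Qed.

Lemma powRN_le (R : realType) (x y r : R) : 0 < x -> x <= y -> 0 <= r -> y `^ (- r) <= x `^ (- r).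
Proof.
move=> x0 xy r0; have y0 : 0 < y by exact: lt_le_trans xy.
rewrite !powRN lef_pV2 ?posrE ?powR_gt0 //.
by apply: ge0_ler_powR; rewrite ?nnegrE ?(ltW x0) ?(ltW y0).
Qed.

Lemma sum_bw_le (R : realType) (c : R) : 0 < c ->
  exists2 G, 0 < G & forall n y, \sum_(k < n) bw (c * k%:R - y) <= G.
Proof.
move=> c0; pose c1 := Num.min 1 c.
have c10 : 0 < c1 by rewrite lt_min ltr01.
have c11 : c1 <= 1 by rewrite ge_min lexx.
have c1c : c1 <= c by rewrite ge_min lexx orbT.
pose D := (c1 / 3) `^ (- (5 / 4)).
have D0 : 0 < D by rewrite powR_gt0 // divr_gt0.
exists (2 * (D * 5)); first by rewrite !mulr_gt0.
move=> n y.
pose g (j : nat) : R := D * j.+1%:R `^ (- 1 - 4^-1).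
have g0 j : 0 <= g j by rewrite mulr_ge0 ?powR_ge0 // ltW.
have gG J : \sum_(j < J) g j <= D * 5.
  rewrite -mulr_sumr ler_pM2l //; apply: le_trans (@sum_zeta_le R 4 J isT).
  by rewrite big_add1 /= big_mkord.
have us : uniq [seq (k%:Z) | k <- iota 0 n] by rewrite map_inj_uniq ?iota_uniq // => a b [].
have := sum_uniq_int_le (Num.floor (y / c)) g0 gG us.
rewrite big_map -[n in iota 0 n]subn0 -/(index_iota 0 n) big_mkord; apply: le_trans.
apply: ler_sum => k _; rewrite /g /bw; set u := Num.floor (y / c).
set j := `|k%:Z - u|%N.
have -> : - 1 - 4^-1 = - (5 / 4) :> R by field.
rewrite -powRM ?divr_ge0 ?ler0n ?(ltW c10) //.
apply: powRN_le; [by rewrite mulr_gt0 ?divr_gt0 ?ltr0n | | lra].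
have /andP[u1 u2] := floor_itv (y / c); rewrite -/u intrD in u1 u2.
have jE : (j%:R : R) = `|k%:R - u%:~R| by rewrite /j natr_absz intr_norm intrB.
have h : c * (j%:R - 1) <= `|c * k%:R - y|.
  have -> : c * k%:R - y = c * (k%:R - y / c) by field; rewrite gt_eqF.
  rewrite normrM (gtr0_norm c0) ler_pM2l // jE.
  have := ler_normB (k%:R - y / c) (u%:~R - y / c).
  have -> : k%:R - y / c - (u%:~R - y / c) = k%:R - u%:~R by ring.
  have : `|u%:~R - y / c| <= 1 by rewrite ler_norml; apply/andP; split; lra.
  lra.
have [j1|j1] := leqP j 1.
  apply: le_trans (_ : 1 <= _); last by rewrite le_max lexx.
  have : (j%:R : R) <= 1 by rewrite (ler_nat R j 1).
  rewrite -(natr1 j) => jj; have := mulr_ge0 (ltW c10) (_ : 0 <= 1 - j%:R :> R); rewrite subr_ge0 => /(_ jj).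
  lra.
apply: le_trans (_ : `|c * k%:R - y| <= _); last by rewrite le_max lexx orbT.
apply: (le_trans _ h).
have jj : 2 <= (j%:R : R) by rewrite (ler_nat R 2 j).
rewrite -(natr1 j); apply: le_trans (_ : c * (3^-1 * (j%:R + 1)) <= _).
  by rewrite -mulrA; apply: ler_wpM2r => //; rewrite mulr_ge0 ?invr_ge0 ?addr_ge0 ?ler0n.
by rewrite ler_pM2l //; lra.
Qed.

Lemma bw_half (R : realType) (y z : R) : `|z| - 1 <= `|y| -> bw y <= 4 * bw z.
Proof.
move=> h; rewrite /bw.
have z1 : 1 <= Num.max 1 `|z| by rewrite le_max lexx.
have m0 : 0 < Num.max 1 `|z| / 2 by rewrite divr_gt0 //; lra.
apply: le_trans (@powRN_le R (Num.max 1 `|z| / 2) _ _ m0 _ _) _; [|lra|].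
  rewrite /Num.max; case: ifP => z1'; case: ifP => y1; have := normr_ge0 y; move: h y1; [lra| | lra | lra].
  move=> h /negbT; rewrite -leNgt; lra.
rewrite powR_div //; last lra.
rewrite opprK mulrC ler_wpM2r ?powR_ge0 //.
apply: le_trans (_ : 2 `^ 2%:R <= _); first by apply: ler_powR; lra.
by rewrite powR_mulrn // expr2; lra.
Qed.

(* Each index [k] is charged to one of the admissible fractions [a / q]. *)
Lemma arc_sum (R : realType) (n Q A0 : nat) (G : R) (phi : nat -> R) (x : nat -> int -> R)
    (F : nat -> R -> R) (w : nat -> R) :
  (forall q, 0 <= phi q) -> (forall k y, 0 <= F k y) ->
  (forall y, \sum_(k < n) F k y <= G) ->
  (forall k, (k < n)%N -> w k <= 0 \/
     exists q a, [/\ (0 < q <= Q)%N, (`|a| <= A0 * q)%N & w k <= phi q * F k (x q a)]) ->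
  \sum_(k < n) w k <= G * \sum_(1 <= q < Q.+1) (2 * A0 * q + 1)%:R * phi q.
Proof.
move=> phi0 F0 hG hw.
pose T k := \sum_(1 <= q < Q.+1) \sum_(j < 2 * A0 * q + 1) phi q * F k (x q (j%:Z - (A0 * q)%N%:Z)).
have T0 k : 0 <= T k by apply: sumr_ge0 => q _; apply: sumr_ge0 => j _; exact: mulr_ge0.
apply: le_trans (_ : \sum_(k < n) T k <= _).
  apply: ler_sum => k _; have [h|[q [a [qQ aA h]]]] := hw k (ltn_ord k); first exact: le_trans h (T0 k).
  apply: (le_trans h); rewrite /T.
  rewrite (bigD1_seq q) ?iota_uniq //=; last by rewrite mem_index_iota ltnS.
  have jlt : (absz (a + (A0 * q)%N%:Z)%R < 2 * A0 * q + 1)%N by move: aA; clear; lia.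
  rewrite (bigD1 (Ordinal jlt)) //=.
  have -> : (absz (a + (A0 * q)%N%:Z))%:Z - (A0 * q)%N%:Z = a by move: aA; clear; lia.
  rewrite -addrA lerDl addr_ge0 //.
    by apply: sumr_ge0 => j _; exact: mulr_ge0.
  by apply: sumr_ge0 => q' _; apply: sumr_ge0 => j _; exact: mulr_ge0.
rewrite /T exchange_big /= mulr_sumr; apply: ler_sum => q _.
rewrite exchange_big /=.
apply: le_trans (_ : \sum_(j < 2 * A0 * q + 1) phi q * G <= _).
  by apply: ler_sum => j _; rewrite -mulr_sumr ler_wpM2l.
by rewrite sumr_const card_ord -mulr_natl; lra.
Qed.

(** The centre [x k] moves with [k], so the first factor alone cannot be summed over all [k]. On a
    cell of [l] indices the centre is fixed, and as [c' l >= 1] the second factor is at most a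
    constant times a weight of the cell number. The first factor is summed inside each cell, the
    second over the cells. *)
Lemma cell_sum (R : realType) (c c' G G1 y : R) (l n : nat) (act : nat -> bool) (x : nat -> R) :
  (0 < l)%N -> 1 <= c' * l%:R ->
  (forall m z, \sum_(k < m) bw (c * k%:R - z) <= G) ->
  (forall m z, \sum_(k < m) bw (1 * k%:R - z : R) <= G1) ->
  (forall k k', act k -> act k' -> (k < n)%N -> (k' < n)%N -> (k %/ l = k' %/ l)%N -> x k = x k') ->
  \sum_(k < n) (act k)%:R * (bw (c * k%:R - x k) * bw (c' * k%:R - y)) <= 4 * G * G1.
Proof.
move=> l0 cl hG hG1 hx.
have lR : (0 : R) < l%:R by rewrite ltr0n.
have c'0 : 0 < c'.
  by rewrite -(pmulr_lgt0 _ lR); exact: lt_le_trans cl.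
have G0 : 0 <= G by apply: le_trans (hG 0%N 0); rewrite big_ord0.
pose z := y / (c' * l%:R).
have cl0 : 0 < c' * l%:R by exact: lt_le_trans cl.
have bwc k : bw (c' * k%:R - y) <= 4 * bw (1 * (k %/ l)%:R - z).
  apply: bw_half.
  have -> : c' * k%:R - y = c' * l%:R * (k%:R / l%:R - z).
    by rewrite /z; field; rewrite !gt_eqF.
  rewrite normrM (gtr0_norm cl0).
  apply: le_trans (_ : `|k%:R / l%:R - z| <= _); last by rewrite ler_peMl.
  have d1 : (k %/ l)%:R <= k%:R / l%:R :> R by rewrite ler_pdivlMr // -natrM ler_nat leq_divM.
  have d2 : k%:R / l%:R <= (k %/ l)%:R + 1 :> R.
    by rewrite ler_pdivrMr // natr1 -natrM ler_nat ltnW // ltn_ceil.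
  have := ler_normB (k%:R / l%:R - z) (k%:R / l%:R - (k %/ l)%:R).
  have -> : k%:R / l%:R - z - (k%:R / l%:R - (k %/ l)%:R) = 1 * (k %/ l)%:R - z by ring.
  have : `|k%:R / l%:R - (k %/ l)%:R| <= 1 :> R by rewrite ler_norml; apply/andP; split; lra.
  lra.
apply: le_trans (_ : \sum_(i < n) \sum_(k < n | (k %/ l == i)%N)
   (act k)%:R * (bw (c * k%:R - x k) * (4 * bw (1 * i%:R - z))) <= _).
  rewrite [X in X <= _](partition_big (fun k : 'I_n => Ordinal (leq_ltn_trans (leq_div k l) (ltn_ord k))) predT) //=.
  apply: ler_sum => i _.
  rewrite [X in X <= _](eq_bigl (fun k : 'I_n => (k %/ l == i)%N)); last by [].
  apply: ler_sum => k /eqP <-; rewrite ler_wpM2l ?ler0n // ler_wpM2l ?bw_ge0 //.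
apply: le_trans (_ : \sum_(i < n) 4 * bw (1 * i%:R - z) * G <= _); last first.
  rewrite -mulr_suml -mulr_sumr mulrAC ler_wpM2l ?mulr_ge0 //.
apply: ler_sum => i _.
have -> : \sum_(k < n | (k %/ l == i)%N) (act k)%:R * (bw (c * k%:R - x k) * (4 * bw (1 * i%:R - z)))
  = 4 * bw (1 * i%:R - z) * \sum_(k < n | (k %/ l == i)%N) (act k)%:R * bw (c * k%:R - x k).
  by rewrite mulr_sumr; apply: eq_bigr => k _; ring.
rewrite ler_wpM2l ?mulr_ge0 ?bw_ge0 //.
have [/existsP[k0 /andP[/eqP k0i ak0]]|none] := boolP [exists k0 : 'I_n, ((k0 %/ l)%N == i) && act k0].
  apply: le_trans (hG n (x k0)); rewrite big_mkcond; apply: ler_sum => k _.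
  case: ifP => [/eqP ki|_]; last exact: bw_ge0.
  case ak : (act k); last by rewrite mul0r bw_ge0.
  by rewrite mul1r (hx k k0) ?ltn_ord // ki k0i.
rewrite big1 // => k ki; case ak : (act k); last by rewrite mul0r.
by case/negP: none; apply/existsP; exists k; rewrite ki ak.
Qed.

Lemma weyl_params (R : realType) (k : nat) : (0 < k)%N ->
  exists2 C : R, 1 <= C & forall X : nat, (0 < X)%N ->
   [/\ 1 <= C * X%:R `^ (2 / k%:R),
     (forall n, (0 < n <= 6 * X ^ 2)%N -> (size (divisors n))%:R <= C * X%:R `^ (2 / k%:R)) &
     \sum_(1 <= r < (12 * X ^ 2).+1) (r%:R : R)^-1 <= C * X%:R `^ (2 / k%:R)].
Proof.
move=> k0; have [C1 [C10 hC1]] := divisor_bound k.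
have kR : (0 : R) < k%:R by rewrite ltr0n.
have ik0 : 0 <= k%:R^-1 :> R by rewrite invr_ge0 ltW.
pose Ca : R := (C1 * 6)%:R `^ (k%:R^-1); pose Cb : R := k%:R * 12 `^ (k%:R^-1).
have Ca0 : 0 <= Ca by exact: powR_ge0.
have Cb0 : 0 <= Cb by rewrite mulr_ge0 ?powR_ge0 // ltW.
exists (1 + Ca + Cb); first lra.
move=> X X0; have XR : (1 : R) <= X%:R by rewrite ler1n.
set p := X%:R `^ (2 / k%:R).
have p1 : 1 <= p.
  by have := @ler_powR R X%:R XR 0 (2 / k%:R); rewrite powRr0; apply; rewrite divr_ge0 // ltW.
have pE : (X%:R ^+ 2 : R) `^ (k%:R^-1) = p by rewrite -powR_mulrn ?ler0n // -powRrM.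
have Cap := mulr_ge0 Ca0 (le_trans ler01 p1).
have Cbp := mulr_ge0 Cb0 (le_trans ler01 p1).
split.
- by rewrite !mulrDl mul1r; lra.
- move=> n /andP[n0 nX].
  have h : (size (divisors n) ^ k <= C1 * 6 * X ^ 2)%N.
    by apply: leq_trans (hC1 n n0) _; rewrite -mulnA leq_mul2l nX orbT.
  apply: le_trans (_ : Ca * p <= _); last by rewrite !mulrDl mul1r; lra.
  rewrite -(ler_nat R) natrX natrM natrX in h.
  have d0 : 0 <= (size (divisors n))%:R :> R by rewrite ler0n.
  have -> : (size (divisors n))%:R = ((size (divisors n))%:R ^+ k) `^ (k%:R^-1) :> R.
    by rewrite -powR_mulrn // -powRrM divff ?powRr1 ?gt_eqF.
  rewrite -pE /Ca -powRM ?ler0n ?exprn_ge0 ?ler0n //.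
  by apply: ge0_ler_powR; rewrite ?nnegrE ?exprn_ge0 ?mulr_ge0 ?ler0n ?exprn_ge0.
- apply: le_trans (harmonic_le R _ k0) _.
  apply: le_trans (_ : Cb * p <= _); last by rewrite !mulrDl mul1r; lra.
  by rewrite natrM natrX powRM ?exprn_ge0 ?ler0n // pE mulrA.
Qed.

Definition Bmax (R : realType) (X t : R) : R := Num.max 1 (X ^+ 3 * `|t|).

(* Weyl's inequality on the major arcs has no [X ^ eps] loss: only [d(q)] enters. *)
Lemma weyl_maj (R : realType) (k : nat) : (0 < k)%N ->
  exists2 C : R, 0 < C & forall (X : nat) (t3 t2 t1 t0 : R), (0 < X)%N ->
  forall r, r = esum (fun i => cubic t3 t2 t1 t0 i%:R) X / X%:R ->
  r ^+ 4 <= C * X%:R `^ (6 / k%:R - 1) \/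
  exists q (a : int), [/\ (0 < q <= X)%N, `|q%:R * t3 - a%:~R| <= (12 * X ^ 2)%:R^-1 &
    r ^+ 4 <= C * q%:R `^ (- (49 / 50)) * Bmax X%:R (t3 - a%:~R / q%:R) `^ (- (3 / 4))].
Proof.
move=> k0; have [C hC1 hC] := weyl_params R k0.
(* [d(q) <= C q^(1/50)] is the origin of the exponent [49/50]. *)
have [D [D0 hD]] := divisor_bound 50.
pose E : R := D%:R `^ (50^-1).
have E0 : 0 <= E by exact: powR_ge0.
have C30 : 0 <= C ^+ 3 by rewrite exprn_ge0 //; lra.
exists (2000 * C ^+ 3 + 2000 * E + 1); first by lra.
move=> X t3 t2 t1 t0 X0 r rE.
have XR : (0 : R) < X%:R by rewrite ltr0n.
have [L1 hd hH] := hC X X0.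
set L := C * _ in L1 hd hH.
have XE : X%:R ^+ 4 * r ^+ 4 = esum (fun i => cubic t3 t2 t1 t0 i%:R) X ^+ 4.
  by rewrite rE -exprMn mulrC divfK ?gt_eqF.
have [h|[q [a [q0 qL _ hq h]]]] := weyl_majorant t3 t2 t1 t0 X0 L1 hd hH.
  left; rewrite -XE /L in h.
  have pE : (X%:R `^ (2 / k%:R)) ^+ 3 * X%:R ^+ 3 = X%:R ^+ 4 * X%:R `^ (6 / k%:R - 1) :> R.
    rewrite -powR_mulrn ?powR_ge0 // -powRrM -!powR_mulrn ?ler0n // -!powRD ?(gt_eqF XR) ?implybT //.
    by congr powR; field; rewrite pnatr_eq0 -lt0n.
  rewrite exprMn in h.
  have h2 : X%:R ^+ 4 * r ^+ 4 <= X%:R ^+ 4 * (2000 * C ^+ 3 * X%:R `^ (6 / k%:R - 1)).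
    apply: (le_trans h); rewrite le_eqVlt; apply/orP; left; apply/eqP.
    transitivity (2000 * C ^+ 3 * ((X%:R `^ (2 / k%:R)) ^+ 3 * X%:R ^+ 3)); first by ring.
    by rewrite pE; ring.
  rewrite ler_pM2l ?exprn_gt0 // in h2; apply: (le_trans h2).
  by rewrite ler_wpM2r ?powR_ge0 //; lra.
right; exists q, a; have qR : (0 : R) < q%:R by rewrite ltr0n.
split => //.
  by rewrite q0 /= -(ler_nat R); apply: le_trans qL; rewrite ler_peMr // ltW.
rewrite -/(Bmax _ _) in h.
have h3 : X%:R ^+ 4 * r ^+ 4 <= X%:R ^+ 4 * (2000 * ((size (divisors q))%:R / q%:R)
    * Bmax X%:R (t3 - a%:~R / q%:R) `^ (- (3 / 4))).
  by rewrite XE; apply: (le_trans h); rewrite le_eqVlt; apply/orP; left; apply/eqP; ring.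
rewrite ler_pM2l ?exprn_gt0 // in h3; apply: (le_trans h3).
have B0 : 0 <= Bmax X%:R (t3 - a%:~R / q%:R) `^ (- (3 / 4)) by exact: powR_ge0.
have hd2 : (size (divisors q))%:R / q%:R <= E * q%:R `^ (- (49 / 50)).
  have h1 := hD q q0; rewrite -(ler_nat R) natrX natrM in h1.
  have d0 : 0 <= (size (divisors q))%:R :> R by rewrite ler0n.
  have h2 : (size (divisors q))%:R <= E * q%:R `^ (50^-1).
    have -> : (size (divisors q))%:R = ((size (divisors q))%:R ^+ 50) `^ (50^-1) :> R.
      by rewrite -powR_mulrn // -powRrM divff ?powRr1 // pnatr_eq0.
    rewrite -powRM ?ler0n //; apply: ge0_ler_powR; rewrite ?nnegrE ?exprn_ge0 ?mulr_ge0 ?ler0n //.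
    by rewrite invr_ge0.
  have -> : q%:R `^ (- (49 / 50)) = q%:R `^ (50^-1) / q%:R :> R.
    have -> : - (49 / 50) = 50^-1 - 1 :> R by field.
    by rewrite powRB ?powRr1 ?ler0n // (gt_eqF qR) implybT.
  by rewrite mulrA ler_pM2r ?invr_gt0.
have q'0 : 0 <= q%:R `^ (- (49 / 50)) :> R by exact: powR_ge0.
have := ler_wpM2l B0 hd2; have := mulr_ge0 B0 q'0.
move: (Bmax _ _ `^ _) (q%:R `^ _) B0 q'0 => b z b0 z0 bz.
have : 0 <= C ^+ 3 * (b * z) by rewrite mulr_ge0.
lra.
Qed.

(** * Inverse form of Weyl's inequality *)

(** The modulus of the sum as a linear functional given by a vector of length at most 1. Linearity
    permits averaging arguments in which moduli could not be added. *)
Lemma eabs_dual (R : realType) (vs : seq R) : exists u v : R,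
  [/\ (forall x, u * c2 x + v * s2 x <= 1),
      (forall ws, \sum_(x <- ws) (u * c2 x + v * s2 x) <= eabs ws) &
      \sum_(x <- vs) (u * c2 x + v * s2 x) = eabs vs].
Proof.
set C := \sum_(x <- vs) c2 x; set S := \sum_(x <- vs) s2 x.
have AE : eabs vs ^+ 2 = C ^+ 2 + S ^+ 2 by exact: eabs_sqr.
have A0 := eabs_ge0 vs.
have cs (u v : R) : u ^+ 2 + v ^+ 2 <= 1 -> (forall x, u * c2 x + v * s2 x <= 1) /\
    (forall ws, \sum_(x <- ws) (u * c2 x + v * s2 x) <= eabs ws).
  move=> uv; have H ws : \sum_(x <- ws) (u * c2 x + v * s2 x) <= eabs ws.
    rewrite big_split /= -!mulr_sumr; apply: le_trans (ler_norm _) _.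
    rewrite -(@ler_pXn2r _ 2) // ?nnegrE ?eabs_ge0 // eabs_sqr real_normK ?num_real //.
    move: (\sum_(x <- ws) c2 x) (\sum_(x <- ws) s2 x) => a b.
    have h1 := sqr_ge0 (u * b - v * a).
    have h2 : (u ^+ 2 + v ^+ 2) * (a ^+ 2 + b ^+ 2) <= a ^+ 2 + b ^+ 2.
      by rewrite ler_piMl // addr_ge0 ?sqr_ge0.
    by nra.
  split => // x; have := H [:: x]; by rewrite big_seq1 eabs_seq1.
have [E|E] := eqVneq (eabs vs) 0.
  exists 0, 0; have [h1 h2] := cs 0 0 ltac:(by rewrite expr0n /= addr0 ler01).
  by split => //; rewrite E big1 // => x _; rewrite !mul0r addr0.
have Ap : 0 < eabs vs by rewrite lt_def E A0.
have [|h1 h2] := cs (C / eabs vs) (S / eabs vs).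
  by rewrite !expr_div_n -mulrDl -AE divff // expf_neq0.
exists (C / eabs vs), (S / eabs vs); split => //.
rewrite big_split /= -!mulr_sumr -/C -/S.
transitivity ((C ^+ 2 + S ^+ 2) / eabs vs); first by ring.
by rewrite -AE expr2 mulfK.
Qed.

(** Averaging over the starting point: up to edges of length [q l], the full sum is the mean of the
    sums over progressions of step [q] and length [l]. If each of these were small, so would be the
    full sum. *)
Lemma esum_block (R : realType) (phi : nat -> R) (X q l : nat) (eps : R) :
  (0 < l)%N -> (0 < X)%N -> 0 < eps -> 2 * (q * l)%:R <= eps * X%:R -> eps * X%:R <= esum phi X ->
  exists s, (s + q * l <= X)%N /\ eps / 2 * l%:R <= esum (fun i => phi (s + q * i)%N) l.
Proof.
move=> l0 X0 e0 hql hA.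
have XR : (0 : R) < X%:R by rewrite ltr0n.
have lR : (0 : R) < l%:R by rewrite ltr0n.
have [u [v [w1 wle wE]]] := eabs_dual [seq phi i | i <- iota 0 X].
pose w x := u * c2 (phi x) + v * s2 (phi x).
have Aw : \sum_(0 <= x < X) w x = esum phi X.
  by rewrite /esum -wE big_map /index_iota subn0.
have eX : eps * X%:R <= X%:R by apply: (le_trans hA); exact: esum_le.
have qlX : (q * l <= X)%N by rewrite -(ler_nat R); have := ler0n R (q * l); lra.
set X' := (X - q * l)%N.
have X'X : (X' <= X)%N by exact: leq_subr.
have col i : (i < l)%N -> esum phi X - (q * l)%:R <= \sum_(s < X') w (s + q * i)%N.
  move=> il; have qi : (q * i <= q * l)%N by rewrite leq_mul2l ltnW ?orbT.
  rewrite -Aw (@big_cat_nat _ _ _ (q * i)) //=; last by apply: leq_trans qlX.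
  rewrite [X in _ + X - _](@big_cat_nat _ _ _ (q * i + X')) ?leq_addr //=; last first.
    by move: qi qlX; rewrite /X'; clear; lia.
  have -> : \sum_(q * i <= x < q * i + X') w x = \sum_(s < X') w (s + q * i)%N.
    rewrite [LHS](_ : _ = \sum_(0 + q * i <= x < q * i + X') w x) //.
    by rewrite big_addn addKn big_mkord.
  have b1 (a b : nat) : \sum_(a <= x < b) w x <= (b - a)%:R.
    apply: le_trans (_ : \sum_(a <= x < b) 1 <= _); last by rewrite sumr_const_nat.
    by apply: ler_sum => x _; exact: w1.
  have h1 := b1 0%N (q * i)%N; have h2 := b1 (q * i + X')%N X.
  have : ((q * i - 0) + (X - (q * i + X')) <= q * l)%N by move: qi qlX; rewrite /X'; clear; lia.
  rewrite -(ler_nat R) natrD; lra.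
have tot : l%:R * (esum phi X - (q * l)%:R) <= \sum_(s < X') \sum_(i < l) w (s + q * i)%N.
  rewrite exchange_big /=.
  apply: le_trans (_ : \sum_(i < l) (esum phi X - (q * l)%:R) <= _).
    by rewrite sumr_const card_ord mulr_natl.
  by apply: ler_sum => i _; exact: col.
have [/existsP[s hs]|none] := boolP [exists s : 'I_X', eps / 2 * l%:R <= \sum_(i < l) w (s + q * i)%N].
  exists s; split; first by have := ltn_ord s; rewrite /X'; clear; lia.
  apply: (le_trans hs); apply: le_trans (wle _); rewrite big_map.
  by rewrite -[l in iota 0 l]subn0 -/(index_iota 0 l) big_mkord.
exfalso.
have X'0 : (0 < X')%N.
  rewrite subn_gt0 -(ltr_nat R); have : (0 : R) < X%:R by [].
  have := ler0n R (q * l); lra.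
have up : \sum_(s < X') \sum_(i < l) w (s + q * i)%N < \sum_(s < X') eps / 2 * l%:R.
  rewrite -subr_gt0 -sumrB; rewrite (bigD1 (Ordinal X'0)) //= ltr_wpDr //.
    apply: sumr_ge0 => s _; rewrite subr_ge0 ltW // ltNge; apply/negP => h.
    by case/negP: none; apply/existsP; exists s.
  rewrite subr_gt0 ltNge; apply/negP => h.
  by case/negP: none; apply/existsP; exists (Ordinal X'0).
rewrite sumr_const card_ord -[X in _ < X]mulr_natl in up.
have : X'%:R * (eps / 2 * l%:R) <= X%:R * (eps / 2 * l%:R).
  by rewrite ler_wpM2r ?ler_nat // mulr_ge0 ?ltW // divr_gt0.
have : l%:R * (eps * X%:R / 2) <= l%:R * (esum phi X - (q * l)%:R).
  by rewrite ler_pM2l //; lra.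
lra.
Qed.

Lemma esum_mod (R : realType) (phi psi : nat -> R) (z : nat -> int) (n : nat) (rho : R) :
  (forall i, (i < n)%N -> `|phi i - psi i - (z i)%:~R| <= rho) ->
  esum phi n <= esum psi n + 8 * pi * rho * n%:R.
Proof.
move=> h.
have E : esum psi n = eabs [seq psi i + (z i)%:~R | i <- iota 0 n].
  by rewrite /esum /eabs !big_map; congr (Num.sqrt (_ ^+ 2 + _ ^+ 2)); apply: eq_bigr => i _;
    rewrite ?c2Dint ?s2Dint.
rewrite E; apply: le_trans (eabs_perturb _ _ (fun i => psi i + (z i)%:~R)) _.
rewrite lerD2l big_seq.
apply: le_trans (_ : \sum_(i <- iota 0 n | i \in iota 0 n) 8 * pi * rho <= _).
  apply: ler_sum => i; rewrite mem_iota add0n => /andP[_ hi].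
  by rewrite ler_wpM2l ?mulr_ge0 ?pi_ge0 // opprD addrA h.
by rewrite -big_seq big_const_seq count_predT iter_addr_0 size_iota mulr_natr.
Qed.

Lemma wmin_sqrt_le (R : realType) (X t : R) : 0 <= X -> 0 < `|t| <= 1 / 2 ->
  wmin X t <= (2 * X) `^ (2^-1) * `|t| `^ (- 2^-1).
Proof.
move=> X0 /andP[t0 t1].
have h1 := wmin_le X t.
have h2 : wmin X t <= (`|t| / 2)^-1.
  apply: wmin_le_inv; first by rewrite divr_gt0.
  by have := @sin_pi_dist R t 0; rewrite subr0; apply.
have w0 := wmin_ge0 t X0.
rewrite -powR_div // ?mulr_ge0 //.
have h3 : wmin X t ^+ 2 <= 2 * X / `|t|.
  have -> : 2 * X / `|t| = X * (`|t| / 2)^-1 by field; rewrite gt_eqF.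
  by rewrite expr2; apply: ler_pM.
have -> : wmin X t = (wmin X t ^+ 2) `^ (2^-1).
  by rewrite -powR_mulrn // -powRrM divff ?powRr1 // pnatr_eq0.
by apply: ge0_ler_powR; rewrite ?nnegrE ?sqr_ge0 ?invr_ge0 // divr_ge0 ?mulr_ge0.
Qed.

(** In Weyl's inequality for quadratics the non-multiples of [q] contribute only [O(n^(3/2))], so
    the multiples of [q] must carry [eps^2 n^2 / 4]. Bounding those trivially bounds [q]; bounding
    them by the square root of the two trivial bounds controls [|t2 - a/q|]. *)
Lemma quad_inverse (R : realType) (eps : R) : 0 < eps ->
  exists2 Q0 : R, 0 < Q0 & forall (n : nat) (t2 t1 t0 : R), Q0 <= n%:R ->
    eps * n%:R <= esum (fun i => cubic 0 t2 t1 t0 i%:R) n ->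
    exists q (a : int), [/\ (0 < q)%N, q%:R <= Q0 & `|q%:R * t2 - a%:~R| <= Q0 / n%:R ^+ 2].
Proof.
move=> e0.
(* [8 / eps^2] bounds [q], [256 / eps^4] bounds [n^2 |q t2 - a|], and the last term makes the square
   root of [n] large enough to absorb the non-multiples of [q]. *)
exists (1 + 8 / eps ^+ 2 + 256 / eps ^+ 4 + (1600 / eps ^+ 2) ^+ 2).
  by rewrite !addr_gt0 ?divr_gt0 ?exprn_gt0 ?divr_gt0 ?exprn_gt0.
move=> n t2 t1 t0 hn hA.
have p8 : 0 < 8 / eps ^+ 2 by rewrite divr_gt0 ?exprn_gt0.
have p256 : 0 < 256 / eps ^+ 4 by rewrite divr_gt0 ?exprn_gt0.
have p16 : 0 < (1600 / eps ^+ 2) ^+ 2 by rewrite exprn_gt0 // divr_gt0 ?exprn_gt0.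
have nR1 : (1 : R) <= n%:R by lra.
have n0 : (0 < n)%N by rewrite -(ltr0n R); lra.
have nR : (0 : R) < n%:R by lra.
have e20 : 0 < eps ^+ 2 by rewrite exprn_gt0.
have [q [a [/andP[q0 qN] cop hq]]] := dirichlet_coprime t2 (N := 4 * n) ltac:(by rewrite muln_gt0).
have qR : (0 : R) < q%:R by rewrite ltr0n.
pose b := t2 - a%:~R / q%:R.
have hb : `|b| <= (4 * n%:R * q%:R)^-1.
  have -> : b = (q%:R * t2 - a%:~R) / q%:R by rewrite /b; field; rewrite gt_eqF.
  rewrite normrM normfV (gtr0_norm qR) ler_pdivrMr //; apply: (le_trans hq).
  by rewrite natrM le_eqVlt; apply/orP; left; apply/eqP; field; rewrite !gt_eqF.
pose a' := `|(a %% q)%Z|%N.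
have qz : q%:Z != 0 by apply/eqP; move: q0; clear; lia.
have a'E : a = (a %/ q)%Z * q%:Z + a'%:Z.
  by rewrite {1}(divz_eq a q) /a' gez0_abs // modz_ge0.
have cop' : coprime q a'.
  have := gcdz_modr q a => /(congr1 absz) /= E.
  by rewrite /coprime /a'; move: cop; rewrite /coprime -E.
pose w (j : nat) : R := wmin n%:R (j%:R * t2).
have w0 j : 0 <= w j by rewrite wmin_ge0 ?ler0n.
have wE j : w j = wmin n%:R (j%:R * (a'%:R / q%:R + b)).
  rewrite /w -(@wminDint _ _ (j%:R * (a'%:R / q%:R + b)) (j%:Z * (a %/ q)%Z)); congr wmin.
  by rewrite /b [in X in _ = _ + X]intrM {1}a'E intrD intrM -!pmulrn; field; rewrite gt_eqF.
have hjb j : (j <= 2 * n)%N -> `|j%:R * b| <= (2 * q%:R)^-1.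
  move=> jn; rewrite normrM normr_nat.
  apply: le_trans (ler_pM (ler0n _ _) (normr_ge0 _) (_ : _ <= (2 * n)%:R) hb) _; first by rewrite ler_nat.
  by rewrite natrM le_eqVlt; apply/orP; left; apply/eqP; field; rewrite !gt_eqF.
pose Mult := \sum_(1 <= j < (2 * n).+1 | (q %| j)%N) w j.
set sn := (n%:R : R) `^ (2^-1).
have sn2 : sn ^+ 2 = n%:R by rewrite -powR_mulrn ?powR_ge0 // -powRrM mulVf ?powRr1 ?ler0n // pnatr_eq0.
have sn0 : 0 <= sn by exact: powR_ge0.
have sn1 : 1 <= sn by rewrite -(@ler_pXn2r _ 2) ?nnegrE ?ler01 // sn2 expr1n.
have key : eps ^+ 2 * n%:R ^+ 2 <= 2 * (n%:R + Mult + 224 * n%:R * sn).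
  rewrite -exprMn; apply: le_trans (_ : esum (fun i => cubic 0 t2 t1 t0 i%:R) n ^+ 2 <= _).
    by rewrite lerXn2r ?nnegrE ?esum_ge0 // mulr_ge0 // ltW.
  apply: le_trans (weyl2 _ _ _ _) _; rewrite ler_pM2l //.
  apply: le_trans (_ : \sum_(0 <= j < (2 * n).+1) w j <= _).
    apply: le_trans (_ : \sum_(h < n) (w (2 * h)%N + w (2 * h + 1)%N) <= _).
      apply: ler_sum => h _; rewrite -[X in X <= _]addr0; apply: lerD => //.
      by rewrite /w natrM.
    rewrite big_nat_recr //= -[X in X <= _]addr0; apply: lerD => //.
    move: (w) w0; clear; move=> w w0; elim: n => [|n IH]; first by rewrite big_ord0 muln0 big_geq.
    rewrite big_ord_recr /= (_ : (2 * n.+1 = (2 * n).+2)%N) ?mulnS // !big_nat_recr //= -addrA.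
    by apply: lerD => //; rewrite addn1.
  rewrite big_ltn // -addrA; apply: lerD; first exact: wmin_le.
  rewrite (bigID (fun j => (q %| j)%N)) /= lerD2l.
  apply: le_trans (_ : \sum_(h < (2 * n).+1 | ~~ (q %| h)%N) w h <= _).
    rewrite -[X in _ <= X](big_mkord (fun h => ~~ (q %| h)%N) w) big_mkcond [X in _ <= X]big_mkcond.
    by rewrite [X in _ <= X]big_ltn // dvdn0 /= add0r.
  under eq_bigr do rewrite wE.
  pose L : R := 2 * (4 * n)%:R `^ (2^-1).
  apply: le_trans (@sum_wmin_nonmult R n%:R L q a' (2 * n).+1 b q0 cop' _ _) _.
  - by move=> h hh; apply: hjb.
  - apply: le_trans (@harmonic_le R 2 (4 * n) isT).
    rewrite [X in _ <= X](@big_cat_nat _ _ _ q.+1) //= ?ltnS //.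
    by rewrite lerDl; apply: sumr_ge0 => r _; rewrite invr_ge0 ler0n.
  have LE : L = 4 * sn.
    rewrite /L natrM powRM ?ler0n // -/sn powR12_sqrt //.
    have -> : (4 : R) = 2 ^+ 2 by rewrite expr2; clear; lra.
    by rewrite sqrtr_sqr ger0_norm //; clear; lra.
  rewrite LE; have : ((2 * n).+1 + q <= 7 * n)%N by move: qN n0; clear; lia.
  rewrite -(ler_nat R) natrM => h7.
  have -> : 224 * n%:R * sn = 8 * (7 * n%:R) * (4 * sn) by ring.
  by rewrite ler_wpM2r ?mulr_ge0 // ler_pM2l.
have snl : 1600 / eps ^+ 2 <= sn.
  have p0 : 0 <= 1600 / eps ^+ 2 by rewrite divr_ge0 // ltW.
  by rewrite -(@ler_pXn2r _ 2) ?nnegrE // sn2; clear -hn p8 p256; lra.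
have M4 : eps ^+ 2 * n%:R ^+ 2 / 4 <= Mult.
  have h1 : 1600 <= sn * eps ^+ 2 by rewrite -ler_pdivrMr.
  have h2 : n%:R * sn * 1600 <= n%:R * sn * (sn * eps ^+ 2) by rewrite ler_wpM2l ?mulr_ge0 // ltW.
  have h3 : n%:R * sn * (sn * eps ^+ 2) = eps ^+ 2 * n%:R ^+ 2.
    by rewrite -sn2; ring.
  have h4 : n%:R <= n%:R * sn by rewrite ler_peMr // ltW.
  have h5 : 0 <= eps ^+ 2 * n%:R ^+ 2 by rewrite mulr_ge0 ?sqr_ge0.
  by clear -hn p8 p256 key h2 h3 h4; lra.
exists q, a; split => //.
  have : Mult <= 2 * n%:R ^+ 2 / q%:R.
    rewrite /Mult sum_mult //.
    apply: le_trans (_ : \sum_(1 <= j < ((2 * n) %/ q).+1) n%:R <= _).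
      by apply: ler_sum => j _; exact: wmin_le.
    rewrite sumr_const_nat subSS subn0 -[X in X <= _]mulr_natl.
    have -> : 2 * n%:R ^+ 2 / q%:R = (2 * n)%:R / q%:R * n%:R :> R by rewrite natrM; ring.
    rewrite ler_pM2r // ler_pdivlMr // -natrM ler_nat; exact: leq_trunc_div.
  move=> h; have {h} h : eps ^+ 2 * n%:R ^+ 2 / 4 <= 2 * n%:R ^+ 2 / q%:R by clear -M4 h; lra.
  rewrite ler_pdivlMr // in h.
  have : q%:R <= 8 / eps ^+ 2.
    rewrite ler_pdivlMr // -(ler_pM2l (exprn_gt0 2 nR)); clear -h; lra.
  by clear -p8 p256 p16; lra.
have qbE : q%:R * t2 - a%:~R = q%:R * b by rewrite /b; field; rewrite gt_eqF.
rewrite qbE.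
have n20 : 0 < (n%:R : R) ^+ 2 by rewrite exprn_gt0.
have [b0|b0] := eqVneq b 0.
  by rewrite b0 mulr0 normr0 divr_ge0 ?sqr_ge0 //; clear -p8 p256; lra.
have bp : 0 < `|b| by rewrite normr_gt0.
set sb := `|b| `^ (2^-1).
have sb2 : sb ^+ 2 = `|b| by rewrite -powR_mulrn ?powR_ge0 // -powRrM mulVf ?powRr1 ?ler0n // pnatr_eq0.
have sbp : 0 < sb by exact: powR_gt0.
have h : Mult <= 4 * n%:R / sb / q%:R.
  apply: le_trans (_ : \sum_(1 <= j < (2 * n).+1 | (q %| j)%N) (2 * n%:R) `^ (2^-1) / sb * j%:R `^ (2%:R^-1 - 1) <= _).
    rewrite /Mult big_nat_cond [X in _ <= X]big_nat_cond.
    apply: ler_sum => j /andP[/andP[j1 j2] qj]; rewrite wE.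
    have jR : (0 : R) < j%:R by rewrite ltr0n.
    have -> : wmin n%:R (j%:R * (a'%:R / q%:R + b)) = wmin n%:R (j%:R * b).
      rewrite -(@wminDint _ _ (j%:R * b) ((j %/ q * a')%N%:Z)); congr wmin.
      rewrite -[X in _ = _ + X]pmulrn natrM.
      have -> : (j%:R : R) = (j %/ q)%:R * q%:R by rewrite -natrM divnK.
      by field; rewrite gt_eqF.
    apply: le_trans (wmin_sqrt_le _ _) _; rewrite ?ler0n //.
      apply/andP; split; first by rewrite normr_gt0 mulf_neq0 // gt_eqF.
      apply: le_trans (hjb _ _) _ => //.
      have q1 : (1 : R) <= q%:R by rewrite ler1n.
      by rewrite mul1r lef_pV2 ?posrE ?mulr_gt0 //; clear -q1; lra.
    rewrite -mulrA ler_wpM2l ?powR_ge0 //.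
    rewrite normrM normr_nat powRM ?ler0n // mulrC powRN -/sb.
    rewrite (_ : 2%:R^-1 - 1 = - 2^-1 :> R) //; clear; lra.
  rewrite -mulr_sumr.
  apply: le_trans (ler_wpM2l _ (@sum_mult_root R 2 q (2 * n) isT q0)) _.
    by rewrite divr_ge0 ?powR_ge0 // ltW.
  rewrite natrM.
  have -> : (2 * n%:R) `^ 2^-1 / sb * (2 * (2 * n%:R) `^ 2^-1 / q%:R)
    = 2 * ((2 * n%:R) `^ 2^-1) ^+ 2 / sb / q%:R :> R by ring.
  rewrite -powR_mulrn ?powR_ge0 // -powRrM mulVf ?powRr1 ?mulr_ge0 ?ler0n ?pnatr_eq0 //.
  by rewrite mulrA -natrM.
have {h} h : eps ^+ 2 * n%:R ^+ 2 / 4 <= 4 * n%:R / sb / q%:R by clear -M4 h; lra.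
have {}h : eps ^+ 2 * n%:R * (sb * q%:R) <= 16.
  move: h; rewrite ler_pdivlMr // ler_pdivlMr // => h.
  by rewrite -(ler_pM2l nR); clear -h; lra.
rewrite normrM normr_nat ler_pdivlMr // -sb2.
have h2 : (eps ^+ 2 * n%:R * (sb * q%:R)) ^+ 2 <= 16 ^+ 2.
  by rewrite lerXn2r ?nnegrE // !mulr_ge0 ?ler0n // ltW.
have q1 : (1 : R) <= q%:R by rewrite ler1n.
have h3 : q%:R * sb ^+ 2 * n%:R ^+ 2 <= 256 / eps ^+ 4.
  rewrite ler_pdivlMr ?exprn_gt0 //.
  apply: le_trans (_ : q%:R ^+ 2 * sb ^+ 2 * n%:R ^+ 2 * eps ^+ 4 <= _).
    rewrite !ler_wpM2r ?exprn_ge0 ?(ltW e0) // ?ler0n ?(ltW sbp) //.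
    by rewrite expr2 ler_peMr ?ler0n.
  have -> : q%:R ^+ 2 * sb ^+ 2 * n%:R ^+ 2 * eps ^+ 4 = (eps ^+ 2 * n%:R * (sb * q%:R)) ^+ 2 by ring.
  by apply: (le_trans h2); clear; lra.
by clear -p8 p256 p16 h3; lra.
Qed.

Lemma truncn_half (R : realType) (x : R) : 1 <= x ->
  exists l : nat, [/\ (0 < l)%N, x / 2 <= l%:R & l%:R <= x].
Proof.
move=> x1; exists (Num.Def.truncn x).
have x0 : 0 <= x by lra.
have /andP[h1 h2] := truncn_itv x0; rewrite -(natr1 (Num.Def.truncn x)) in h2.
have h3 : (0 < Num.Def.truncn x)%N by rewrite -(ltr_nat R) lt0r; apply/andP; split; [apply/eqP; lra | lra].
have h4 : (1 : R) <= (Num.Def.truncn x)%:R by rewrite ler1n.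
by split => //; lra.
Qed.

(** On a progression of step [q] starting at [s], the cubic coefficient multiplies [q] times an
    integer. Since [q t3] is within [E / X^3] of an integer, the cubic part is an integer up to
    [7 E l / X], and a quadratic phase with leading coefficient [q^2 t2] remains. The constant 1300
    makes this error harmless here and in [cubic_block2]. *)
Lemma cubic_block3 (R : realType) (X l q : nat) (eps E t3 t2 t1 t0 : R) (a3 : int) :
  0 < eps <= 1 -> 1 <= E -> (0 < l)%N -> (0 < X)%N -> q%:R <= E ->
  `|q%:R * t3 - a3%:~R| <= E / X%:R ^+ 3 -> 1300 * E * l%:R <= eps * X%:R ->
  eps * X%:R <= esum (fun i => cubic t3 t2 t1 t0 i%:R) X ->
  exists s c : R, eps / 4 * l%:R <= esum (fun i => cubic 0 (q%:R ^+ 2 * t2) s c i%:R) l.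
Proof.
move=> /andP[e0 e1] E1 l0 X0 qE h3 hl hA.
have XR : (0 : R) < X%:R by rewrite ltr0n.
have lR : (0 : R) < l%:R by rewrite ltr0n.
have ql : q%:R * l%:R <= E * l%:R by rewrite ler_wpM2r // ltW.
have El0 : 0 <= E * l%:R by rewrite mulr_ge0 //; lra.
have [|s [sX hs]] := esum_block l0 X0 e0 _ hA (q := q); first by rewrite natrM; lra.
have sXR : s%:R + q%:R * l%:R <= X%:R :> R by rewrite -natrM -natrD ler_nat.
exists (2 * s%:R * q%:R * t2 + q%:R * t1), (cubic t3 t2 t1 t0 s%:R).
have := @esum_mod R (fun i => cubic t3 t2 t1 t0 (s + q * i)%:R)
  (fun i => cubic 0 (q%:R ^+ 2 * t2) (2 * s%:R * q%:R * t2 + q%:R * t1) (cubic t3 t2 t1 t0 s%:R) i%:R)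
  (fun i => a3 * (i * (3 * s ^ 2 + 3 * s * (q * i) + (q * i) ^ 2))%N%:Z) l
  (7 * E * l%:R / X%:R).
set A := esum _ l; set B := esum _ l => H.
have {}H : A <= B + 8 * pi * (7 * E * l%:R / X%:R) * l%:R.
  apply: H => i il.
  have iR : (i%:R : R) <= l%:R by rewrite ler_nat ltnW.
  have qi : s%:R + q%:R * i%:R <= X%:R :> R.
    by apply: le_trans sXR; rewrite lerD2l ler_wpM2l.
  rewrite intrM -pmulrn natrM.
  have -> : cubic t3 t2 t1 t0 (s + q * i)%:R - cubic 0 (q%:R ^+ 2 * t2) (2 * s%:R * q%:R * t2 + q%:R * t1) (cubic t3 t2 t1 t0 s%:R) i%:R
     - a3%:~R * (i%:R * (3 * s ^ 2 + 3 * s * (q * i) + (q * i) ^ 2)%:R)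
     = (q%:R * t3 - a3%:~R) * (i%:R * (3 * s%:R ^+ 2 + 3 * s%:R * (q%:R * i%:R) + (q%:R * i%:R) ^+ 2)) :> R.
    by rewrite /cubic !natrD !natrM ?natrX ?natrM; ring.
  rewrite normrM.
  have k0 : 0 <= 3 * s%:R ^+ 2 + 3 * s%:R * (q%:R * i%:R) + (q%:R * i%:R) ^+ 2 :> R.
    by rewrite !addr_ge0 ?mulr_ge0 ?sqr_ge0 ?ler0n.
  have k1 : 3 * s%:R ^+ 2 + 3 * s%:R * (q%:R * i%:R) + (q%:R * i%:R) ^+ 2 <= 7 * X%:R ^+ 2 :> R.
    move: qi; have := ler0n R s; have : (0 : R) <= q%:R * i%:R by rewrite mulr_ge0.
    move: (q%:R * i%:R) (s%:R) (X%:R) => u v w u0 v0 uv.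
    have : v ^+ 2 + u ^+ 2 + 2 * (u * v) <= w ^+ 2 by nra.
    have : 0 <= u * v by rewrite mulr_ge0.
    by have := sqr_ge0 u; have := sqr_ge0 v; nra.
  rewrite (ger0_norm (mulr_ge0 (ler0n _ _) k0)).
  apply: le_trans (ler_pM (normr_ge0 _) (mulr_ge0 (ler0n _ _) k0) h3 (ler_pM (ler0n _ _) k0 iR k1)) _.
  by rewrite le_eqVlt; apply/orP; left; apply/eqP; field; rewrite gt_eqF.
have p2 := pihalf_lt2 R; have p0 := pi_ge0 R.
have h7 : 8 * pi * (7 * E * l%:R / X%:R) <= eps / 4.
  have -> : 8 * pi * (7 * E * l%:R / X%:R) = pi * (56 * E * l%:R / X%:R) by ring.
  have : 56 * E * l%:R / X%:R <= eps / 20 by rewrite ler_pdivrMr //; lra.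
  have : 0 <= 56 * E * l%:R / X%:R by rewrite divr_ge0 ?mulr_ge0 ?ler0n //; lra.
  by move: (56 * E * l%:R / X%:R) => z z0 z1; nra.
have hA2 : eps / 2 * l%:R <= A by [].
have := ler_wpM2r (ltW lR) h7; move: H hA2; clear; move: A B => A B; lra.
Qed.

Lemma cubic_block2 (R : realType) (X l q : nat) (eps E t3 t2 t1 t0 : R) (a3 a2 : int) :
  0 < eps <= 1 -> 1 <= E -> (0 < l)%N -> (0 < X)%N -> q%:R <= E ->
  `|q%:R * t3 - a3%:~R| <= E / X%:R ^+ 3 -> `|q%:R * t2 - a2%:~R| <= E / X%:R ^+ 2 ->
  1300 * E * l%:R <= eps * X%:R ->
  eps * X%:R <= esum (fun i => cubic t3 t2 t1 t0 i%:R) X ->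
  exists c : R, eps / 4 * l%:R <= esum (fun i => q%:R * t1 * i%:R + c) l.
Proof.
move=> /andP[e0 e1] E1 l0 X0 qE h3 h2 hl hA.
have XR : (0 : R) < X%:R by rewrite ltr0n.
have lR : (0 : R) < l%:R by rewrite ltr0n.
have ql : q%:R * l%:R <= E * l%:R by rewrite ler_wpM2r // ltW.
have El0 : 0 <= E * l%:R by rewrite mulr_ge0 //; lra.
have [|s [sX hs]] := esum_block l0 X0 e0 _ hA (q := q); first by rewrite natrM; lra.
have sXR : s%:R + q%:R * l%:R <= X%:R :> R by rewrite -natrM -natrD ler_nat.
exists (cubic t3 t2 t1 t0 s%:R).
have := @esum_mod R (fun i => cubic t3 t2 t1 t0 (s + q * i)%:R)
  (fun i => q%:R * t1 * i%:R + cubic t3 t2 t1 t0 s%:R)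
  (fun i => a3 * (i * (3 * s ^ 2 + 3 * s * (q * i) + (q * i) ^ 2))%N%:Z + a2 * (i * (2 * s + q * i))%N%:Z) l
  (10 * E * l%:R / X%:R).
set A := esum _ l; set B := esum _ l => H.
have {}H : A <= B + 8 * pi * (10 * E * l%:R / X%:R) * l%:R.
  apply: H => i il.
  have iR : (i%:R : R) <= l%:R by rewrite ler_nat ltnW.
  have qi : s%:R + q%:R * i%:R <= X%:R :> R.
    by apply: le_trans sXR; rewrite lerD2l ler_wpM2l.
  rewrite intrD !intrM -!pmulrn !natrM.
  have -> : cubic t3 t2 t1 t0 (s + q * i)%:R - (q%:R * t1 * i%:R + cubic t3 t2 t1 t0 s%:R)
     - (a3%:~R * (i%:R * (3 * s ^ 2 + 3 * s * (q * i) + (q * i) ^ 2)%:R) + a2%:~R * (i%:R * (2 * s + q * i)%:R))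
     = (q%:R * t3 - a3%:~R) * (i%:R * (3 * s%:R ^+ 2 + 3 * s%:R * (q%:R * i%:R) + (q%:R * i%:R) ^+ 2))
     + (q%:R * t2 - a2%:~R) * (i%:R * (2 * s%:R + q%:R * i%:R)) :> R.
    by rewrite /cubic !natrD !natrM ?natrX ?natrM; ring.
  apply: le_trans (ler_normD _ _) _; rewrite !normrM.
  have k0 : 0 <= 3 * s%:R ^+ 2 + 3 * s%:R * (q%:R * i%:R) + (q%:R * i%:R) ^+ 2 :> R.
    by rewrite !addr_ge0 ?mulr_ge0 ?sqr_ge0 ?ler0n.
  have m0 : 0 <= 2 * s%:R + q%:R * i%:R :> R by rewrite !addr_ge0 ?mulr_ge0 ?ler0n.
  have m1 : 2 * s%:R + q%:R * i%:R <= 3 * X%:R :> R.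
    have := ler0n R s; have : (0 : R) <= q%:R * i%:R by rewrite mulr_ge0.
    lra.
  have k1 : 3 * s%:R ^+ 2 + 3 * s%:R * (q%:R * i%:R) + (q%:R * i%:R) ^+ 2 <= 7 * X%:R ^+ 2 :> R.
    move: qi; have := ler0n R s; have : (0 : R) <= q%:R * i%:R by rewrite mulr_ge0.
    move: (q%:R * i%:R) (s%:R) (X%:R) => u v w u0 v0 uv.
    have : v ^+ 2 + u ^+ 2 + 2 * (u * v) <= w ^+ 2 by nra.
    have : 0 <= u * v by rewrite mulr_ge0.
    by have := sqr_ge0 u; have := sqr_ge0 v; nra.
  rewrite (ger0_norm k0) (ger0_norm m0) normr_nat.
  apply: le_trans (lerD (ler_pM (normr_ge0 _) (mulr_ge0 (ler0n _ _) k0) h3 (ler_pM (ler0n _ _) k0 iR k1))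
     (ler_pM (normr_ge0 _) (mulr_ge0 (ler0n _ _) m0) h2 (ler_pM (ler0n _ _) m0 iR m1))) _.
  by rewrite le_eqVlt; apply/orP; left; apply/eqP; field; rewrite gt_eqF.
have p2 := pihalf_lt2 R; have p0 := pi_ge0 R.
have h7 : 8 * pi * (10 * E * l%:R / X%:R) <= eps / 4.
  have -> : 8 * pi * (10 * E * l%:R / X%:R) = pi * (80 * E * l%:R / X%:R) by ring.
  have : 80 * E * l%:R / X%:R <= eps / 16 by rewrite ler_pdivrMr //; lra.
  have : 0 <= 80 * E * l%:R / X%:R by rewrite divr_ge0 ?mulr_ge0 ?ler0n //; lra.
  by move: (80 * E * l%:R / X%:R) => z z0 z1; nra.
have hA2 : eps / 2 * l%:R <= A by [].
have := ler_wpM2r (ltW lR) h7; move: H hA2; clear; move: A B => A B; lra.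
Qed.

(** Because [weyl_maj] has no [X^eps] loss on the major arcs, a sum of size [eps X] bounds both [q]
    and [X^3 |t3 - a/q|] in terms of [eps] alone. The choice [k = 12] turns the other alternative
    into [X^(-1/2)], too small for large [X]. *)
Lemma cubic_lead_inverse (R : realType) (eps : R) : 0 < eps ->
  exists2 E : R, 1 <= E & forall (X : nat) (t3 t2 t1 t0 : R), E <= X%:R ->
    eps * X%:R <= esum (fun i => cubic t3 t2 t1 t0 i%:R) X ->
    exists q (a : int), [/\ (0 < q)%N, q%:R <= E & `|q%:R * t3 - a%:~R| <= E / X%:R ^+ 3].
Proof.
move=> e0; have [C C0 hC] := @weyl_maj R 12 isT.
have e4 : 0 < eps ^+ 4 by rewrite exprn_gt0.
pose D := C / eps ^+ 4 + 1.
have D1 : 1 <= D by rewrite lerDr divr_ge0 // ltW.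
have hD : C < D * eps ^+ 4 by rewrite -ltr_pdivrMr // ltrDl.
exists (D ^+ 4); first by rewrite exprn_ege1.
move=> X t3 t2 t1 t0 hX hA.
have D2 : D ^+ 2 <= D ^+ 4 by rewrite ler_weXn2l.
have XR : (0 : R) < X%:R by apply: lt_le_trans hX; rewrite exprn_gt0 //; lra.
have X0 : (0 < X)%N by rewrite -(ltr0n R).
pose r := esum (fun i => cubic t3 t2 t1 t0 i%:R) X / X%:R; have re : eps <= r by rewrite ler_pdivlMr.
have re4 : eps ^+ 4 <= r ^+ 4 by rewrite lerXn2r ?nnegrE ?(ltW e0) // (le_trans (ltW e0)).
have [h|[q [a [/andP[q0 qX] hq h]]]] := hC X t3 t2 t1 t0 X0 r erefl.
  exfalso.
  have xE : (6 / 12 - 1 : R) = - 2^-1 by field.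
  have Xs : D <= X%:R `^ 2^-1.
    have D0 : 0 <= D by lra.
    rewrite -(@ler_pXn2r _ 2) ?nnegrE ?powR_ge0 // powR_root_pow //; lra.
  rewrite xE powRN ler_pdivlMr ?(lt_le_trans _ Xs) // in h; last by lra.
  have : r ^+ 4 * D <= r ^+ 4 * X%:R `^ 2^-1 by rewrite ler_wpM2l //; lra.
  have : eps ^+ 4 * D <= r ^+ 4 * D by rewrite ler_wpM2r //; lra.
  lra.
have qR : (1 : R) <= q%:R by rewrite ler1n.
have qR0 : (0 : R) < q%:R by lra.
set B := Bmax _ _ in h.
have B1 : 1 <= B by rewrite /B /Bmax le_max lexx.
have B0 : 0 < B by lra.
have half (x s : R) : 1 <= x -> 2^-1 <= s -> x <= (x `^ s) ^+ 2.
  move=> x1 hs; have -> : x = x `^ 1 by rewrite powRr1 //; lra.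
  rewrite [X in _ <= (X `^ _) ^+ 2]powRr1; last by lra.
  rewrite -powR_mulrn ?powR_ge0 // -powRrM; apply: ler_powR => //; lra.
have ge1 (x s : R) : 1 <= x -> 0 <= s -> 1 <= x `^ s.
  by move=> x1 hs; rewrite -(powRr0 x); apply: ler_powR.
set u := q%:R `^ (49 / 50) : R; set v := B `^ (3 / 4) : R.
have u1 : 1 <= u by apply: ge1 => //; lra.
have v1 : 1 <= v by apply: ge1 => //; lra.
have uv : u * v <= D.
  rewrite !powRN -/u -/v in h.
  have : eps ^+ 4 * (u * v) <= C.
    have : eps ^+ 4 <= C / u / v by lra.
    by rewrite ler_pdivlMr ?ler_pdivlMr ?(lt_le_trans ltr01) // mulrA mulrAC.
  move=> k; rewrite -(ler_pM2l e4); lra.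
have uD : u <= D by apply: le_trans uv; rewrite ler_peMr //; lra.
have vD : v <= D by apply: le_trans uv; rewrite ler_peMl //; lra.
have qD : q%:R <= D ^+ 2.
  apply: le_trans (half _ (49 / 50) qR _) _; first by lra.
  by rewrite -/u lerXn2r ?nnegrE //; lra.
have BD : B <= D ^+ 2.
  apply: le_trans (half _ (3 / 4) B1 _) _; first by lra.
  by rewrite -/v lerXn2r ?nnegrE //; lra.
exists q, a; split => //; first by lra.
have -> : q%:R * t3 - a%:~R = q%:R * (t3 - a%:~R / q%:R) by field; rewrite gt_eqF.
rewrite normrM normr_nat ler_pdivlMr ?exprn_gt0 //.
have : X%:R ^+ 3 * `|t3 - a%:~R / q%:R| <= B by rewrite /B /Bmax le_max lexx orbT.
move=> hB; have {}hB : X%:R ^+ 3 * `|t3 - a%:~R / q%:R| <= D ^+ 2 by lra.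
have -> : D ^+ 4 = D ^+ 2 * D ^+ 2 by ring.
rewrite -mulrA [`|_| * _]mulrC; apply: ler_pM => //.
by rewrite mulr_ge0 // exprn_ge0 // ltW.
Qed.

(** The coefficients are treated from the top down: once the higher ones are rational up to small
    errors, the phase on a progression of suitable step has lower degree, and the inverse theorem
    for that degree yields the next coefficient. *)
Lemma cubic_inverse (R : realType) (eps : R) : 0 < eps -> eps <= 1 ->
  exists2 Q0 : R, 1 <= Q0 & forall (X : nat) (t3 t2 t1 t0 : R), Q0 <= X%:R ->
    eps * X%:R <= esum (fun i => cubic t3 t2 t1 t0 i%:R) X ->
    exists q (a3 a2 a1 : int), [/\ (0 < q)%N, q%:R <= Q0,
      `|q%:R * t3 - a3%:~R| <= Q0 / X%:R ^+ 3, `|q%:R * t2 - a2%:~R| <= Q0 / X%:R ^+ 2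
      & `|q%:R * t1 - a1%:~R| <= Q0 / X%:R].
Proof.
move=> e0 e1; have e01 : 0 < eps <= 1 by rewrite e0.
have [E E1 hE] := cubic_lead_inverse e0.
have [|Q Q1 hQ] := @quad_inverse R (eps / 4); first by lra.
pose ka := eps / (1300 * E).
have E0 : 0 < E by lra.
have ka0 : 0 < ka by rewrite divr_gt0 // mulr_gt0.
pose F := E ^+ 2 * Q + 4 * Q / ka ^+ 2 + 1.
have kQ0 : 0 < 4 * Q / ka ^+ 2.
  by apply: divr_gt0; [rewrite mulr_gt0|rewrite exprn_gt0].
have F1 : 1 <= F by rewrite lerDr addr_ge0 ?mulr_ge0 ?sqr_ge0 ?invr_ge0 ?exprn_ge0 // ltW.
have F0 : 0 < F by lra.
pose kb := eps / (1300 * F).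
have kb0 : 0 < kb by rewrite divr_gt0 // mulr_gt0.
have p1 : 0 < 1 / ka by rewrite divr_gt0.
have p2 : 0 < 2 * Q / ka by rewrite divr_gt0 // mulr_gt0.
have p3 : 0 < 1 / kb by rewrite divr_gt0.
have p4 : 0 < 16 / (eps * kb) by rewrite divr_gt0 // mulr_gt0.
exists (E + 1 / ka + 2 * Q / ka + F + 1 / kb + 16 / (eps * kb)); first by clear -E1 p1 p2 p3 p4 F0; lra.
move=> X t3 t2 t1 t0 hX hA.
have XR : (0 : R) < X%:R by clear -E1 p1 p2 p3 p4 F0 hX; lra.
have X0 : (0 < X)%N by rewrite -(ltr0n R).
have [|q1 [b3 [q10 q1E h3]]] := hE X t3 t2 t1 t0 _ hA; first by clear -E1 p1 p2 p3 p4 F0 hX; lra.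
have kX : 1 <= ka * X%:R by rewrite mulrC -ler_pdivrMr //; clear -E1 p1 p2 p3 p4 F0 hX; lra.
have [l [l0 l1 l2]] := truncn_half kX.
have hl : 1300 * E * l%:R <= eps * X%:R.
  have -> : eps * X%:R = 1300 * E * (ka * X%:R) by rewrite /ka; field; rewrite gt_eqF.
  by rewrite ler_pM2l // mulr_gt0.
have [s [c hs]] := cubic_block3 e01 E1 l0 X0 q1E h3 hl hA.
have [|q2 [b2 [q20 q2Q h2]]] := hQ l _ _ _ _ hs.
  apply: le_trans l1; rewrite ler_pdivlMr // mulrC.
  by rewrite [ka * _]mulrC -ler_pdivrMr //; clear -E1 p1 p2 p3 p4 F0 hX; lra.
(* [q2] was found for the coefficient [q1^2 t2] of the quadratic phase, so this product serves both
   [t3] and [t2]. *)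
pose q := (q1 ^ 2 * q2)%N.
have q1R : (0 : R) < q1%:R by rewrite ltr0n.
have q2R : (0 : R) < q2%:R by rewrite ltr0n.
have qF : q%:R <= F.
  apply: le_trans (_ : E ^+ 2 * Q <= _); last first.
    by rewrite /F; clear -kQ0; lra.
  rewrite natrM natrX; apply: ler_pM; rewrite ?exprn_ge0 ?ler0n //.
  by rewrite lerXn2r ?nnegrE ?ler0n // ltW.
have h3' : `|q%:R * t3 - (b3 * (q1 * q2)%N%:Z)%:~R| <= F / X%:R ^+ 3.
  rewrite intrM -pmulrn.
  have -> : q%:R * t3 - b3%:~R * (q1 * q2)%:R = (q1 * q2)%:R * (q1%:R * t3 - b3%:~R) :> R.
    by rewrite /q !natrM ?natrX; ring.
  rewrite normrM normr_nat; apply: le_trans (_ : (E * Q) * (E / X%:R ^+ 3) <= _).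
    by apply: ler_pM => //; rewrite natrM; apply: ler_pM.
  rewrite mulrA ler_wpM2r ?invr_ge0 ?exprn_ge0 //.
  by rewrite /F; clear -kQ0; lra.
have h2' : `|q%:R * t2 - b2%:~R| <= F / X%:R ^+ 2.
  have -> : q%:R * t2 - b2%:~R = q2%:R * (q1%:R ^+ 2 * t2) - b2%:~R :> R.
    by rewrite /q natrM ?natrX; ring.
  apply: (le_trans h2).
  have lR : (0 : R) < l%:R by rewrite ltr0n.
  have kx0 : 0 < ka * X%:R by rewrite mulr_gt0.
  have : (ka * X%:R / 2) ^+ 2 <= l%:R ^+ 2 by rewrite lerXn2r ?nnegrE ?ler0n //; clear -kx0 l1; lra.
  move=> hl2; apply: le_trans (_ : Q / (ka * X%:R / 2) ^+ 2 <= _).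
    by rewrite ler_pM2l // lef_pV2 ?posrE ?exprn_gt0 // divr_gt0.
  have -> : Q / (ka * X%:R / 2) ^+ 2 = 4 * Q / ka ^+ 2 / X%:R ^+ 2.
    by field; rewrite !gt_eqF.
  rewrite ler_wpM2r ?invr_ge0 ?exprn_ge0 //.
  have : 0 < E ^+ 2 * Q by rewrite mulr_gt0 ?exprn_gt0.
  by rewrite /F; clear -kQ0; lra.
have kbX : 1 <= kb * X%:R by rewrite mulrC -ler_pdivrMr //; clear -E1 p1 p2 p3 p4 F0 hX; lra.
have [l' [l'0 l'1 l'2]] := truncn_half kbX.
have hl' : 1300 * F * l'%:R <= eps * X%:R.
  have -> : eps * X%:R = 1300 * F * (kb * X%:R) by rewrite /kb; field; rewrite gt_eqF.
  by rewrite ler_pM2l // mulr_gt0.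
have [c' hc'] := cubic_block2 e01 F1 l'0 X0 qF h3' h2' hl' hA.
have l'R : (0 : R) < l'%:R by rewrite ltr0n.
have X2 : 0 < (X%:R : R) ^+ 2 by rewrite exprn_gt0.
have X3 : 0 < (X%:R : R) ^+ 3 by rewrite exprn_gt0.
pose a1 := Num.floor (q%:R * t1 + 2^-1).
have /andP[f1 f2] := floor_itv (q%:R * t1 + 2^-1); rewrite -/a1 intrD in f1 f2.
exists q, (b3 * (q1 * q2)%N%:Z), b2, a1; split.
- by rewrite muln_gt0 expn_gt0 q10.
- by clear -E1 p1 p2 p3 p4 qF; lra.
- by apply: (le_trans h3'); rewrite ler_pM2r ?invr_gt0 //; clear -E1 p1 p2 p3 p4; lra.
- by apply: (le_trans h2'); rewrite ler_pM2r ?invr_gt0 //; clear -E1 p1 p2 p3 p4; lra.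
have hd : `|q%:R * t1 - a1%:~R| <= 1 / 2 by rewrite ler_norml; apply/andP; split; clear -f1 f2; lra.
have hsin := sin_pi_dist hd.
have := esum_lin (q%:R * t1) c' l' => hlin.
set S := esum _ _ in hlin hc'; set w := `|sin _| in hlin hsin; set d := `|_| in hsin *.
have d0 : 0 <= d by exact: normr_ge0.
have k1 : eps / 4 * l'%:R * (d / 2) <= 1.
  apply: le_trans hlin; apply: ler_pM => //; last by rewrite divr_ge0.
  by rewrite mulr_ge0 ?ler0n //; clear -e0; lra.
have k2 : eps / 4 * (kb * X%:R / 2) * (d / 2) <= 1.
  apply: le_trans k1; rewrite ler_wpM2r ?divr_ge0 // ler_wpM2l //; clear -e0 l'1; lra.
apply: le_trans (_ : 16 / (eps * kb) / X%:R <= _).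
  have fin (z e k x : R) : 0 < e -> 0 < k -> 0 < x -> e / 4 * (k * x / 2) * (z / 2) <= 1 ->
      z <= 16 / (e * k) / x.
    by move=> h1 h4 h5 h6; rewrite ler_pdivlMr // ler_pdivlMr ?mulr_gt0 //; clear -h6; lra.
  exact: fin.
by rewrite ler_pM2r ?invr_gt0 //; clear -E1 p1 p2 p3 F0; lra.
Qed.

(** * Incompatibility of an irrational ratio with two large sums *)

Lemma irrational_sep (R : realType) (b g : R) (H : nat) : g != 0 -> irrational (b / g) ->
  exists2 mu : R, 0 < mu & forall m n : int, (`|m| <= H)%N -> (`|n| <= H)%N -> m != 0 ->
    mu <= `|m%:~R * b - n%:~R * g|.
Proof.
move=> g0 irr.
pose T (m n : int) : R := `|m%:~R * b - n%:~R * g|^-1.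
have T0 m n : 0 <= T m n by rewrite invr_ge0.
(* A positive minimum over finitely many pairs is obtained as the inverse of [1 + S], where [S] sums
   all the inverses; a vanishing term contributes 0. *)
pose S := \sum_(i < (2 * H).+1) \sum_(j < (2 * H).+1) T (i%:Z - H%:Z) (j%:Z - H%:Z).
have S0 : 0 <= S by apply: sumr_ge0 => i _; apply: sumr_ge0.
exists (1 + S)^-1; first by rewrite invr_gt0; lra.
move=> m n mH nH m0.
have nz : m%:~R * b - n%:~R * g != 0.
  apply/negP => /eqP e; apply: irr; apply/rationalP.
  have E : b / g = n%:~R / m%:~R.
    have m0R : m%:~R != 0 :> R by rewrite intr_eq0.
    apply: (mulIf m0R); rewrite divfK //; apply: (mulIf g0).
    by rewrite mulrAC divfK // mulrC; apply/eqP; rewrite -subr_eq0 e.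
  have [mp|mn] := leP 0 m.
    by exists n, `|m|%N; rewrite E natr_absz ger0_norm.
  exists (- n), `|m|%N; rewrite E natr_absz ltr0_norm // !intrN invrN mulrNN //.
have iO : (absz (m + H%:Z)%R < (2 * H).+1)%N by move: mH; clear; lia.
have jO : (absz (n + H%:Z)%R < (2 * H).+1)%N by move: nH; clear; lia.
have iE : (absz (m + H%:Z)%R)%:Z - H%:Z = m by move: mH; clear; lia.
have jE : (absz (n + H%:Z)%R)%:Z - H%:Z = n by move: nH; clear; lia.
have TS : T m n <= S.
  rewrite /S (bigD1 (Ordinal iO)) //= (bigD1 (Ordinal jO)) //= iE jE.
  rewrite -addrA lerDl addr_ge0 ?sumr_ge0 // => i _; exact: sumr_ge0.
rewrite -[X in _ <= X]invrK lef_pV2 ?posrE ?invr_gt0 ?normr_gt0 //; last by lra.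
by move: TS; rewrite /T; lra.
Qed.

(** Every index other than 2 and 3 yields [b1], so statements about all [j] need no side
    condition. *)
Definition coef3 (R : realType) (b3 b2 b1 : R) (j : nat) : R :=
  if j == 3%N then b3 else if j == 2%N then b2 else b1.

Lemma coef3_inverse (R : realType) (eps b3 b2 b1 b0 : R) : 0 < eps -> eps <= 1 ->
  exists2 Q0 : R, 1 <= Q0 & forall (X : nat) (al : R), Q0 <= X%:R ->
    eps * X%:R <= esum (fun i => al * cubic b3 b2 b1 b0 i%:R) X ->
    exists2 q, (0 < q)%N & q%:R <= Q0 /\
      (exists a : int, `|q%:R * (al * b3) - a%:~R| <= Q0 / X%:R ^+ 3) /\
      (forall j, exists a : int, `|q%:R * (al * coef3 b3 b2 b1 j) - a%:~R| <= Q0 / X%:R).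
Proof.
move=> e0 e1; have [Q0 Q1 hQ] := cubic_inverse e0 e1.
exists Q0 => // X al QX hA.
have XR : (1 : R) <= X%:R by lra.
have [|q [a3 [a2 [a1 [q0 qQ h3 h2 h1]]]]] := hQ X (al * b3) (al * b2) (al * b1) (al * b0) QX.
  apply: (le_trans hA); rewrite le_eqVlt; apply/orP; left; apply/eqP.
  by apply: eq_esum => i; rewrite /cubic; ring.
exists q => //; split => //; split; first by exists a3.
have X0 : (0 : R) < X%:R by lra.
have w3 : Q0 / X%:R ^+ 3 <= Q0 / X%:R.
  rewrite ler_pM2l ?lef_pV2 ?posrE ?exprn_gt0 //; last by lra.
  by rewrite -[X in X <= _]expr1 ler_weXn2l.
have w2 : Q0 / X%:R ^+ 2 <= Q0 / X%:R.
  rewrite ler_pM2l ?lef_pV2 ?posrE ?exprn_gt0 //; last by lra.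
  by rewrite -[X in X <= _]expr1 ler_weXn2l.
move=> j; rewrite /coef3; case: ifP => _; first by exists a3; apply: le_trans w3.
by case: ifP => _; [exists a2; apply: le_trans w2|exists a1].
Qed.

Lemma int_small0 (R : realType) (a : int) (x d : R) : `|x - a%:~R| <= d -> `|x| + d < 1 -> a = 0.
Proof.
move=> h1 h2; apply/eqP; rewrite -[_ == _]negbK; apply/negP => a0.
have : 1 <= `|a%:~R| :> R.
  by rewrite -intr_norm (ler_int R 1); move: a0; clear; lia.
have := ler_normB x (x - a%:~R); rewrite opprB addrC subrK; lra.
Qed.

(** If both sums were large, [al b] and [al g] would be close to [a1/q] and [a2/q'] with bounded
    denominators. A nonzero [a2] contradicts the irrationality of [b/g]. If [a2 = 0], then [al] is
    so small that the numerator [a3] for the leading coefficient vanishes too, and its sharper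
    approximation forces [al] to be [O(P^-3)], against the lower bound on [al (CM P^3)]. *)
Lemma two_phase_sup (R : realType) (b3 b2 b1 b0 d3 d2 d1 d0 : R) (j1 j2 n1 n2 : nat)
    (eps A CM : R) : d3 != 0 ->
  0 < eps -> eps <= 1 -> 0 < A -> 0 < CM -> (0 < n1)%N -> (0 < n2)%N ->
  coef3 d3 d2 d1 j2 != 0 ->
  irrational (coef3 b3 b2 b1 j1 / coef3 d3 d2 d1 j2) ->
  exists2 K1 : R, 0 < K1 & forall (P : nat) (al : R), K1 <= P%:R -> 0 <= al -> al <= A ->
    K1 <= al * (CM * P%:R ^+ 3) ->
    esum (fun i => al * cubic b3 b2 b1 b0 i%:R) (n1 * P) < eps * (n1 * P)%:R \/
    esum (fun i => al * cubic d3 d2 d1 d0 i%:R) (n2 * P) < eps * (n2 * P)%:R.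
Proof.
move=> d30 e0 e1 A0 CM0 n10 n20; set b := coef3 b3 _ _ _; set g := coef3 d3 _ _ _ => g0 irr.
have [Q Q1 hQ] := coef3_inverse b3 b2 b1 b0 e0 e1.
have [Q' Q'1 hQ'] := coef3_inverse d3 d2 d1 d0 e0 e1.
pose q0 := Q + Q'.
have [q00 Qq Qq'] : [/\ 2 <= q0, Q <= q0 & Q' <= q0] by rewrite /q0; split; clear -Q1 Q'1; lra.
have gp : 0 < `|g| by rewrite normr_gt0.
have dp : 0 < `|d3| by rewrite normr_gt0.
pose Hr := q0 * (q0 * A * (`|b| + `|g|) + q0).
have bg0 : 0 <= q0 * A * (`|b| + `|g|) by rewrite !mulr_ge0 ?addr_ge0 //; clear -q00 A0 Q1 Q'1; lra.
have Hr0 : 0 < Hr by rewrite mulr_gt0 //; clear -q00 bg0; lra.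
pose H := (Num.Def.truncn Hr).+1.
have HrH : Hr <= H%:R by have /andP[_ /ltW] := truncn_itv (ltW Hr0).
have [mu mu0 hmu] := irrational_sep H g0 irr.
pose w := 2 * H%:R * q0 / mu.
have w0 : 0 < w by rewrite divr_gt0 // !mulr_gt0 ?ltr0n //; clear -q00; lra.
pose K1 := q0 + 1 + 2 * q0 * (1 + w * `|g|) + 2 * q0 + 2 * q0 * (1 + `|d3| * q0 / `|g|) + q0 * CM / `|d3| + 1.
have p1 : 0 <= q0 * (1 + w * `|g|).
  have wg : 0 <= w * `|g| by rewrite mulr_ge0 // ltW.
  by rewrite mulr_ge0 //; clear -q00 wg; lra.
have p2' : 0 <= `|d3| * q0 / `|g| by rewrite divr_ge0 ?mulr_ge0 ?normr_ge0 //; clear -q00; lra.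
have p2 : 0 <= q0 * (1 + `|d3| * q0 / `|g|) by rewrite mulr_ge0 //; clear -q00 p2'; lra.
have p3 : 0 <= q0 * CM / `|d3| by rewrite divr_ge0 ?mulr_ge0 ?normr_ge0 //; clear -q00 CM0; lra.
exists K1; first by rewrite /K1; clear -q00 p1 p2 p3; lra.
move=> P al hP al0 alA hk.
have [h1|h1] := ltP (esum (fun i => al * cubic b3 b2 b1 b0 i%:R) (n1 * P)) (eps * (n1 * P)%:R); first by left.
have [h2|h2] := ltP (esum (fun i => al * cubic d3 d2 d1 d0 i%:R) (n2 * P)) (eps * (n2 * P)%:R); first by right.
exfalso.
have PR : (0 : R) < P%:R by move: hP; rewrite /K1; clear -q00 p1 p2 p3; lra.
have X1 : (P%:R : R) <= (n1 * P)%:R by rewrite ler_nat leq_pmull.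
have X2 : (P%:R : R) <= (n2 * P)%:R by rewrite ler_nat leq_pmull.
have QX : Q <= (n1 * P)%:R by move: hP; rewrite /K1; clear -q00 p1 p2 p3 Qq X1; lra.
have QX' : Q' <= (n2 * P)%:R by move: hP; rewrite /K1; clear -q00 p1 p2 p3 Qq' X2; lra.
have [q qp [qQ [_ /(_ j1) [a1 ha1]]]] := hQ _ _ QX h1.
have [q' qp' [qQ' [[a3 ha3] /(_ j2) [a2 ha2]]]] := hQ' _ _ QX' h2.
rewrite -/b in ha1; rewrite -/g in ha2.
have iP (x y : R) : 0 <= x <= q0 -> P%:R <= y -> x / y <= q0 / P%:R.
  move=> /andP[x0 xq] Py; apply: ler_pM => //; first by rewrite invr_ge0; clear -PR Py; lra.
  by rewrite lef_pV2 ?posrE //; clear -PR Py; lra.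
have {}ha1 : `|q%:R * (al * b) - a1%:~R| <= q0 / P%:R.
  by apply: le_trans ha1 _; apply: iP => //; clear -Q1 Qq; lra.
have {}ha2 : `|q'%:R * (al * g) - a2%:~R| <= q0 / P%:R.
  by apply: le_trans ha2 _; apply: iP => //; clear -Q'1 Qq'; lra.
have P1 : (1 : R) <= P%:R by move: hP; rewrite /K1; clear -q00 p1 p2 p3; lra.
have ha3' : `|q'%:R * (al * d3) - a3%:~R| <= q0 / P%:R ^+ 3.
  apply: le_trans ha3 _; apply: ler_pM; [by clear -Q'1; lra|by rewrite invr_ge0 exprn_ge0|by []|].
  by rewrite lef_pV2 ?posrE ?exprn_gt0 ?(lt_le_trans PR) // lerXn2r ?nnegrE ?ler0n.
have qR : (1 : R) <= q%:R by rewrite ler1n.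
have qR' : (1 : R) <= q'%:R by rewrite ler1n.
have dP (x : R) : 2 * x <= P%:R -> x / P%:R <= 1 / 2 by move=> hx; rewrite ler_pdivrMr //; clear -hx; lra.
have small1 : q0 / P%:R <= 1 / 2 by apply: dP; move: hP; rewrite /K1; clear -q00 p1 p2 p3; lra.
(* With [a2] nonzero, [irrational_sep] keeps [a2 q b - a1 q' g] away from 0, while [al] times it is
   [O(1/P)]. Hence [al <= w / P], and then [al g] is too small for a nonzero numerator. *)
have a20 : a2 = 0.
  apply/eqP; rewrite -[_ == _]negbK; apply/negP => a2n.
  have bound (qq : nat) (z : R) (a : int) : 1 <= qq%:R :> R -> qq%:R <= q0 -> `|z| <= `|b| + `|g| ->
      `|qq%:R * (al * z) - a%:~R| <= q0 / P%:R -> `|a%:~R| <= q0 * A * (`|b| + `|g|) + q0.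
    move=> qq1 qq2 zz hh.
    have : `|qq%:R * (al * z)| <= q0 * A * (`|b| + `|g|).
      rewrite normrM normr_nat normrM (ger0_norm al0) mulrA.
      by apply: ler_pM; rewrite ?mulr_ge0 ?ler0n // ler_pM.
    have := ler_normB (qq%:R * (al * z)) (qq%:R * (al * z) - a%:~R).
    by rewrite opprB addrC subrK; clear -hh small1 q00; lra.
  have qq0 : q%:R <= q0 by clear -qQ Qq; lra.
  have qq0' : q'%:R <= q0 by clear -qQ' Qq'; lra.
  have B1 := bound q b a1 qR qq0 ltac:(by rewrite lerDl) ha1.
  have B2 := bound q' g a2 qR' qq0' ltac:(by rewrite lerDr) ha2.
  have toH (qq : nat) (a : int) : qq%:R <= q0 -> `|a%:~R| <= q0 * A * (`|b| + `|g|) + q0 -> (absz (a * qq%:Z)%R <= H)%N.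
    move=> h3 h4; rewrite -(ler_nat R); apply: le_trans HrH.
    rewrite natr_absz intr_norm intrM normrM -pmulrn normr_nat mulrC.
    by apply: ler_pM.
  have := hmu (a2 * q%:Z) (a1 * q'%:Z) (toH _ _ qq0 B2) (toH _ _ qq0' B1).
  rewrite mulf_eq0 (negbTE a2n) /= => /(_ _) hm.
  have {hm} : mu <= `|(a2 * q)%:~R * b - (a1 * q')%:~R * g|.
    by apply: hm; move: qp; clear; lia.
  rewrite !intrM -!pmulrn => hm.
  have alw : al <= w / P%:R.
    have E : al * (a2%:~R * q%:R * b - a1%:~R * q'%:R * g)
       = a2%:~R * (q%:R * (al * b) - a1%:~R) - a1%:~R * (q'%:R * (al * g) - a2%:~R) by ring.
    have k1 : al * mu <= `|al * (a2%:~R * q%:R * b - a1%:~R * q'%:R * g)|.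
      by rewrite normrM (ger0_norm al0) ler_wpM2l.
    have aH (a : int) : `|a%:~R| <= q0 * A * (`|b| + `|g|) + q0 -> `|a%:~R| <= H%:R :> R.
      move=> h; apply: le_trans HrH; apply: (le_trans h); rewrite /Hr ler_peMl //; clear -q00 bg0; lra.
    have k2 : `|a2%:~R * (q%:R * (al * b) - a1%:~R) - a1%:~R * (q'%:R * (al * g) - a2%:~R)|
        <= H%:R * (q0 / P%:R) + H%:R * (q0 / P%:R).
      apply: le_trans (ler_normB _ _) _; rewrite !normrM; apply: lerD; apply: ler_pM => //; exact: aH.
    rewrite E in k1.
    have -> : w / P%:R = (H%:R * (q0 / P%:R) + H%:R * (q0 / P%:R)) / mu.
      by rewrite /w; field; rewrite !gt_eqF.
    by rewrite ler_pdivlMr //; clear -k1 k2; lra.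
  have a2z : a2 = 0; last by rewrite a2z eqxx in a2n.
  apply: (int_small0 ha2).
  rewrite normrM normr_nat normrM (ger0_norm al0).
  have k3 : q'%:R * (al * `|g|) <= q0 * (w / P%:R * `|g|).
    by apply: ler_pM => //; rewrite ?mulr_ge0 // ler_wpM2r.
  have k4 : q0 * (w / P%:R * `|g|) + q0 / P%:R = q0 * (1 + w * `|g|) / P%:R by ring.
  have : q0 * (1 + w * `|g|) / P%:R <= 1 / 2 by apply: dP; move: hP; rewrite /K1; clear -q00 p1 p2 p3; lra.
  clear -k3 k4; lra.
rewrite a20 subr0 normrM normr_nat normrM (ger0_norm al0) in ha2.
have alg : al * `|g| <= q0 / P%:R.
  by apply: le_trans ha2; rewrite ler_peMl // mulr_ge0.
have {}alg : al <= q0 / `|g| / P%:R.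
  have -> : q0 / `|g| / P%:R = q0 / P%:R / `|g| by ring.
  by rewrite ler_pdivlMr.
have a30 : a3 = 0.
  apply: (int_small0 ha3').
  rewrite normrM normr_nat normrM (ger0_norm al0).
  have k3 : q'%:R * (al * `|d3|) <= q0 * (q0 / `|g| / P%:R * `|d3|).
    by apply: ler_pM => //; [rewrite mulr_ge0|clear -qQ' Qq'; lra|rewrite ler_wpM2r].
  have k4 : q0 / P%:R ^+ 3 <= q0 / P%:R.
    rewrite ler_pM2l; last by clear -q00; lra.
    by rewrite lef_pV2 ?posrE ?exprn_gt0 // -[X in X <= _]expr1 ler_weXn2l.
  have k5 : q0 * (q0 / `|g| / P%:R * `|d3|) + q0 / P%:R = q0 * (1 + `|d3| * q0 / `|g|) / P%:R by ring.
  have : q0 * (1 + `|d3| * q0 / `|g|) / P%:R <= 1 / 2 by apply: dP; move: hP; rewrite /K1; clear -q00 p1 p2 p3; lra.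
  clear -k3 k4 k5; lra.
rewrite a30 subr0 normrM normr_nat normrM (ger0_norm al0) in ha3'.
have P3 : 0 < (P%:R : R) ^+ 3 by rewrite exprn_gt0.
have : al * `|d3| <= q0 / P%:R ^+ 3.
  by apply: le_trans ha3'; rewrite ler_peMl // mulr_ge0.
rewrite ler_pdivlMr // => k.
have : al * (CM * P%:R ^+ 3) <= q0 * CM / `|d3|.
  have kk := ler_wpM2r (ltW CM0) k.
  rewrite ler_pdivlMr //; clear -kk; lra.
by move: hk; rewrite /K1; clear -q00 p1 p2 p3; lra.
Qed.

(** * Major arcs *)

(** The alternative of [weyl_maj] along the frequencies [k / M], for a normalised sum whose leading
    coefficient is [be]; [thr] bounds its minor arc case. *)
Definition weyl_dich (R : realType) (C thr M be : R) (X N : nat) (la : nat -> R) : Prop :=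
  forall k, (k < N.+1)%N -> la k ^+ 4 <= thr \/
    exists q (a : int), [/\ (0 < q <= X)%N, `|q%:R * (k%:R / M * be) - a%:~R| <= (12 * X ^ 2)%:R^-1 &
      la k ^+ 4 <= C * q%:R `^ (- (49 / 50)) * Bmax X%:R (k%:R / M * be - a%:~R / q%:R) `^ (- (3 / 4))].

Lemma bw_norm (R : realType) (y z : R) : `|y| = `|z| -> bw y = bw z.
Proof. by rewrite /bw => ->. Qed.

Lemma sum_bw_le_neq0 (R : realType) (c : R) : c != 0 ->
  exists2 G, 0 < G & forall n y, \sum_(k < n) bw (c * k%:R - y) <= G.
Proof.
move=> c0; have [c1|c1|c1] := ltrgtP c 0; last by rewrite c1 eqxx in c0.
  have [|G G0 hG] := @sum_bw_le R (- c); first by rewrite oppr_gt0.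
  exists G => // n y; apply: le_trans (hG n (- y)).
  rewrite le_eqVlt; apply/orP; left; apply/eqP; apply: eq_bigr => k _.
  by apply: bw_norm; rewrite -normrN; congr `|_|; ring.
exact: sum_bw_le.
Qed.

Lemma powR_mono (R : realType) (x y r : R) : 0 <= x -> x <= y -> 0 <= r -> x `^ r <= y `^ r.
Proof.
by move=> x0 xy r0; apply: ge0_ler_powR; rewrite ?nnegrE // (le_trans x0).
Qed.

Lemma powR_exp_anti (R : realType) (x r s : R) : 1 <= x -> s <= r -> x `^ (- r) <= x `^ (- s).
Proof. by move=> x1 sr; apply: ler_powR => //; lra. Qed.

Lemma fourth_powR (R : realType) (x r : R) : 0 <= x -> x `^ (4 * r) = (x ^+ 4) `^ r.
Proof. by move=> x0; rewrite -powR_mulrn // powRrM. Qed.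

Lemma powR_prod3 (R : realType) (C a b r : R) (s t : R) : 0 <= C -> 0 <= a -> 0 <= b ->
  (C * a `^ s * b `^ t) `^ r = C `^ r * a `^ (s * r) * b `^ (t * r).
Proof.
by move=> C0 a0 b0; rewrite !powRM ?mulr_ge0 ?powR_ge0 // -!powRrM.
Qed.

(** The weights are the shares of the seven long and the two short sums among the nine. *)
Lemma young_79 (R : realType) (x y : R) : 0 <= x -> 0 <= y -> x `^ (7 / 9) * y `^ (2 / 9) <= x + y.
Proof.
move=> x0 y0; pose z := Num.max x y.
have z0 : 0 <= z by rewrite le_max x0.
have h1 : x `^ (7 / 9) <= z `^ (7 / 9) by apply: powR_mono => //; [rewrite le_max lexx|lra].
have h2 : y `^ (2 / 9) <= z `^ (2 / 9) by apply: powR_mono => //; [rewrite le_max lexx orbT|lra].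
apply: le_trans (ler_pM (powR_ge0 _ _) (powR_ge0 _ _) h1 h2) _.
rewrite -powRD; last by apply/implyP => /eqP e; exfalso; lra.
have -> : 7 / 9 + 2 / 9 = 1 :> R by field.
rewrite powRr1 // /z; case: (leP x y) => xy.
  by rewrite lerDr.
by rewrite lerDl.
Qed.

Lemma Bmax_ge1 (R : realType) (X t : R) : 1 <= Bmax X t.
Proof. by rewrite /Bmax le_max lexx. Qed.

Lemma Bmax_bw (R : realType) (X t : R) : 0 <= X -> Bmax X t `^ (- (5 / 4)) = bw (X ^+ 3 * t).
Proof. by move=> X0; rewrite /Bmax /bw normrM ger0_norm // exprn_ge0. Qed.

(* The exponents [5/4], [5/3] and [21/10] are what the sums over [k] and over the fractions
   [a / q] with [q <= X] can afford. *)
Lemma lam7_le (R : realType) (C la q B : R) : 0 <= C -> 0 <= la -> 1 <= q -> 1 <= B ->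
  la ^+ 4 <= C * q `^ (- (49 / 50)) * B `^ (- (3 / 4)) ->
  la ^+ 7 <= C `^ (7 / 4) * q `^ (- (5 / 3)) * B `^ (- (5 / 4)).
Proof.
move=> C0 la0 q1 B1 h.
have -> : la ^+ 7 = (la ^+ 4) `^ (7 / 4).
  by rewrite -fourth_powR // -powR_mulrn //; congr powR; field.
have l0 : 0 <= la ^+ 4 by rewrite exprn_ge0.
apply: le_trans (powR_mono l0 h _) _; first by lra.
rewrite powR_prod3 //; [|lra|lra].
apply: ler_pM; rewrite ?mulr_ge0 ?powR_ge0 //.
  by rewrite ler_wpM2l ?powR_ge0 // mulNr; apply: powR_exp_anti => //; lra.
by rewrite mulNr; apply: powR_exp_anti => //; lra.
Qed.

(** The left side is [(la^4)^(5/3) (b^4)^(10/21)]. In [B] this gives exactly [3/4 * 5/3 = 5/4]. In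
    the denominators it gives [q^(-49/30)] and [q'^(-7/15)], which are the powers [7/9] and [2/9] of
    [q^(-21/10)] and [q'^(-21/10)]; [young_79] then separates them. The exponent [21/10] exceeds 2,
    so the sum over the numerators and [q] converges. *)
Lemma nu_le (R : realType) (C C' la b q B q' B' : R) : 0 <= C -> 0 <= C' -> 0 <= la -> 0 <= b ->
  1 <= q -> 1 <= B -> 1 <= q' -> 1 <= B' ->
  la ^+ 4 <= C * q `^ (- (49 / 50)) * B `^ (- (3 / 4)) ->
  b ^+ 4 <= C' * q' `^ (- (49 / 50)) * B' `^ (- (3 / 4)) ->
  (la ^+ 7 * b ^+ 2) `^ (20 / 21) <= C `^ (5 / 3) * C' `^ (10 / 21) * (B `^ (- (5 / 4))
    * (q `^ (- (21 / 10)) + q' `^ (- (21 / 10)) * B' `^ (- (5 / 4)))).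
Proof.
move=> C0 C'0 la0 b0 q1 B1 q'1 B'1 h h'.
have q0 : 0 <= q by lra.
have B0 : 0 <= B by lra.
have q'0 : 0 <= q' by lra.
have B'0 : 0 <= B' by lra.
have E1 : (la ^+ 7) `^ (20 / 21) = (la ^+ 4) `^ (5 / 3).
  by rewrite -fourth_powR // -powR_mulrn // -powRrM; congr powR; field.
have E2 : (b ^+ 2) `^ (20 / 21) = (b ^+ 4) `^ (10 / 21).
  by rewrite -fourth_powR // -powR_mulrn // -powRrM; congr powR; field.
rewrite powRM ?exprn_ge0 // E1 E2.
have l0 : 0 <= la ^+ 4 by rewrite exprn_ge0.
have l0' : 0 <= b ^+ 4 by rewrite exprn_ge0.
have k1 : (la ^+ 4) `^ (5 / 3) <= C `^ (5 / 3) * (q `^ (- (21 / 10))) `^ (7 / 9) * B `^ (- (5 / 4)).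
  apply: le_trans (powR_mono l0 h _) _; first by lra.
  rewrite powR_prod3 // -powRrM le_eqVlt; apply/orP; left; apply/eqP.
  by congr (_ * powR _ _ * powR _ _); field.
have k2 : (b ^+ 4) `^ (10 / 21) <= C' `^ (10 / 21) * (q' `^ (- (21 / 10)) * B' `^ (- (5 / 4))) `^ (2 / 9).
  apply: le_trans (powR_mono l0' h' _) _; first by lra.
  rewrite powR_prod3 // [X in _ <= _ * X]powRM ?powR_ge0 // -!powRrM [X in _ <= X]mulrA.
  apply: ler_pM; [by rewrite mulr_ge0 ?powR_ge0|exact: powR_ge0| |].
    by rewrite le_eqVlt; apply/orP; left; apply/eqP; congr (_ * powR _ _); field.
  have -> : - (3 / 4) * (10 / 21) = - (5 / 14) :> R by field.
  have -> : - (5 / 4) * (2 / 9) = - (5 / 18) :> R by field.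
  by apply: powR_exp_anti => //; lra.
apply: le_trans (ler_pM (powR_ge0 _ _) (powR_ge0 _ _) k1 k2) _.
have y := young_79 (powR_ge0 q (- (21 / 10))) (mulr_ge0 (powR_ge0 q' (- (21 / 10))) (powR_ge0 B' (- (5 / 4)))).
have c0 : 0 <= C `^ (5 / 3) * C' `^ (10 / 21) * B `^ (- (5 / 4)) by rewrite !mulr_ge0 ?powR_ge0.
have := ler_wpM2l c0 y.
move: (C `^ _) (C' `^ _) (B `^ _) => u v w; move: (_ `^ (7 / 9)) (_ `^ (2 / 9)) (q `^ _ + _) => f g s.
by rewrite (_ : u * f * w * (v * g) = u * v * w * (f * g)) ?[u * v * (w * s)]mulrA //; ring.
Qed.

Lemma arc_numerator (R : realType) (q X : nat) (a : int) (t A : R) (A0 : nat) : (0 < q)%N -> (0 < X)%N ->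
  `|t| <= A -> A + 1 <= A0%:R ->
  `|q%:R * t - a%:~R| <= (12 * X ^ 2)%:R^-1 -> (`|a| <= A0 * q)%N.
Proof.
move=> q0 X0 tA hA h; rewrite -(ler_nat R) natrM natr_absz intr_norm.
have q1 : (1 : R) <= q%:R by rewrite ler1n.
have i1 : ((12 * X ^ 2)%:R : R)^-1 <= 1.
  by rewrite invf_le1 ?ltr0n ?ler1n muln_gt0 expn_gt0 X0.
have k1 : `|q%:R * t| <= A * q%:R by rewrite normrM normr_nat mulrC ler_wpM2r.
have := ler_normB (q%:R * t) (q%:R * t - a%:~R); rewrite opprB addrC subrK => k2.
have : A * q%:R + 1 * q%:R <= A0%:R * q%:R by rewrite -mulrDl ler_wpM2r.
lra.
Qed.

(** [a q' - a' q] is an integer of absolute value at most [1/12 + 1/12 + 1/2], hence zero. So the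
    approximating fraction is constant on short blocks of frequencies. *)
Lemma frac_sep (R : realType) (X q q' : nat) (a a' : int) (s t : R) :
  (0 < q <= X)%N -> (0 < q' <= X)%N ->
  `|q%:R * s - a%:~R| <= (12 * X ^ 2)%:R^-1 -> `|q'%:R * t - a'%:~R| <= (12 * X ^ 2)%:R^-1 ->
  2 * X%:R ^+ 2 * `|s - t| <= 1 -> a%:~R / q%:R = a'%:~R / q'%:R :> R.
Proof.
move=> /andP[q0 qX] /andP[q'0 q'X] h h' st.
have qR : (0 : R) < q%:R by rewrite ltr0n.
have qR' : (0 : R) < q'%:R by rewrite ltr0n.
have XR : (0 : R) < X%:R by rewrite ltr0n (leq_trans q0).
have qXR : (q%:R : R) <= X%:R by rewrite ler_nat.
have qXR' : (q'%:R : R) <= X%:R by rewrite ler_nat.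
suff e : (a * q'%:Z - a' * q%:Z)%R = 0.
  apply/eqP; rewrite eqr_div ?(gt_eqF qR) ?(gt_eqF qR') // -subr_eq0.
  have E := congr1 (fun z : int => z%:~R : R) e; rewrite intrB !intrM -!pmulrn in E.
  by apply/eqP; exact: E.
apply/eqP; rewrite -[_ == _]negbK; apply/negP => nz.
have : 1 <= `|(a * q'%:Z - a' * q%:Z)%:~R| :> R.
  by rewrite -intr_norm (ler_int R 1); move: nz; clear; lia.
rewrite intrB !intrM -!pmulrn.
have -> : a%:~R * q'%:R - a'%:~R * q%:R = q%:R * (q'%:R * t - a'%:~R) - q'%:R * (q%:R * s - a%:~R) + q%:R * q'%:R * (s - t) :> R by ring.
have n1 := ler_normD (q%:R * (q'%:R * t - a'%:~R) - q'%:R * (q%:R * s - a%:~R)) (q%:R * q'%:R * (s - t)).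
have n2 := ler_normB (q%:R * (q'%:R * t - a'%:~R)) (q'%:R * (q%:R * s - a%:~R)).
have e1 : `|q%:R * (q'%:R * t - a'%:~R)| <= 12^-1.
  rewrite normrM normr_nat; apply: le_trans (ler_pM (ler0n _ _) (normr_ge0 _) qXR h') _.
  rewrite natrM natrX invfM mulrCA ler_piMr ?invr_ge0 //.
  by rewrite ler_pdivrMr ?exprn_gt0 // mul1r -[X in X <= _]expr1 ler_weXn2l // ler1n (leq_trans q0).
have e2 : `|q'%:R * (q%:R * s - a%:~R)| <= 12^-1.
  rewrite normrM normr_nat; apply: le_trans (ler_pM (ler0n _ _) (normr_ge0 _) qXR' h) _.
  rewrite natrM natrX invfM mulrCA ler_piMr ?invr_ge0 //.
  by rewrite ler_pdivrMr ?exprn_gt0 // mul1r -[X in X <= _]expr1 ler_weXn2l // ler1n (leq_trans q0).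
have e3 : `|q%:R * q'%:R * (s - t)| <= 2^-1.
  rewrite normrM normrM !normr_nat; apply: le_trans (_ : X%:R ^+ 2 * `|s - t| <= _); last by lra.
  by rewrite ler_wpM2r // expr2; apply: ler_pM.
move=> h1; lra.
Qed.

Lemma sum_q_weight (R : realType) (A0 Q : nat) (r s : R) (Z : R) : 1 + s = r ->
  \sum_(1 <= q < Q.+1) (q%:R : R) `^ r <= Z ->
  \sum_(1 <= q < Q.+1) (2 * A0 * q + 1)%:R * (q%:R : R) `^ s <= (2 * A0 + 1)%:R * Z.
Proof.
move=> rs hZ; apply: le_trans (ler_wpM2l (ler0n _ _) hZ); rewrite mulr_sumr big_nat [X in _ <= X]big_nat.
apply: ler_sum => q /andP[q1 _].
have qR : (0 : R) < q%:R by rewrite ltr0n.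
rewrite -rs powRD ?(gt_eqF qR) ?implybT // powRr1 ?ler0n // mulrA ler_wpM2r ?powR_ge0 //.
by rewrite -natrM ler_nat mulnDl mul1n leq_add2l.
Qed.

(** Only the seven long factors are expanded over arcs. Seven do not suffice for convergence: the
    terms [q * q^(-5/3)] add up to about [P^(1/3)]. The small short sum compensates this with
    [thr'^(1/2)]. *)
Lemma major_small (R : realType) (C be CM A : R) (n : nat) : 0 <= C -> be != 0 -> 0 < CM -> (0 < n)%N ->
  0 <= A ->
  exists2 C' : R, 0 <= C' & forall (P N : nat) (M : R) (la b : nat -> R) (thr thr' : R),
    (0 < P)%N -> M = CM * P%:R ^+ 3 -> (forall k, (k < N.+1)%N -> k%:R / M <= A) ->
    (forall k, 0 <= la k) -> (forall k, 0 <= b k) -> 0 <= thr' ->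
    weyl_dich C thr M be (n * P) N la ->
    \sum_(k < N.+1) ((thr < la k ^+ 4) && (b k ^+ 4 <= thr'))%:R * (la k ^+ 7 * b k ^+ 2)
      <= C' * (n * P)%:R `^ (3%:R^-1) * thr' `^ (2^-1).
Proof.
move=> C0 be0 CM0 n0 A0'.
pose c := n%:R ^+ 3 * be / CM.
have nR : (0 : R) < n%:R by rewrite ltr0n.
have c0 : c != 0 by rewrite !mulf_neq0 ?invr_eq0 ?expf_neq0 ?(gt_eqF nR) ?(gt_eqF CM0).
have [G G0 hG] := sum_bw_le_neq0 c0.
have A10 : 0 <= A * `|be| + 1 by rewrite addr_ge0 ?mulr_ge0.
pose A0 := (Num.Def.truncn (A * `|be| + 1)).+1.
have hA0 : A * `|be| + 1 <= A0%:R by have /andP[_ /ltW] := truncn_itv A10.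
exists (G * ((2 * A0 + 1)%:R * 3) * C `^ (7 / 4)).
  by rewrite !mulr_ge0 ?powR_ge0 ?ler0n // ltW.
move=> P N M la b thr thr' P0 ME hk la0 b0 t0 dich.
have PR : (0 : R) < P%:R by rewrite ltr0n.
have M0 : 0 < M by rewrite ME mulr_gt0 ?exprn_gt0.
have X0 : (0 < n * P)%N by rewrite muln_gt0 n0.
pose D := C `^ (7 / 4) * thr' `^ (2^-1).
have D0 : 0 <= D by rewrite mulr_ge0 ?powR_ge0.
have := @arc_sum R N.+1 (n * P) A0 G (fun q => D * q%:R `^ (- (5 / 3)))
  (fun q a => (n * P)%:R ^+ 3 * (a%:~R / q%:R)) (fun k y => bw (c * k%:R - y))
  (fun k => ((thr < la k ^+ 4) && (b k ^+ 4 <= thr'))%:R * (la k ^+ 7 * b k ^+ 2)).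
move=> H; apply: le_trans (H _ _ _ _) _.
- by move=> q; rewrite mulr_ge0 ?powR_ge0.
- by move=> k y; exact: bw_ge0.
- by move=> y; exact: hG.
- move=> k kN; case: (boolP (_ && _)) => [/andP[h1 h2]|_]; last by left; rewrite mul0r.
  right; have [h|[q [a [/andP[q0 qX] hq h]]]] := dich k kN; first by exfalso; lra.
  exists q, a; split; first by rewrite q0.
    apply: (@arc_numerator R q (n * P) a (k%:R / M * be) (A * `|be|) A0) => //.
    have k0 : 0 <= k%:R / M by rewrite divr_ge0 ?ler0n // ltW.
    by rewrite normrM (ger0_norm k0) ler_wpM2r // hk.
  rewrite mul1r.
  have q1 : (1 : R) <= q%:R by rewrite ler1n.
  have l7 := lam7_le C0 (la0 k) q1 (Bmax_ge1 _ _) h.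
  rewrite Bmax_bw ?ler0n // in l7.
  have -> : c * k%:R - (n * P)%:R ^+ 3 * (a%:~R / q%:R)
    = (n * P)%:R ^+ 3 * (k%:R / M * be - a%:~R / q%:R).
    rewrite /c ME natrM; move: (P%:R) (n%:R) PR nR q1 => p nn p0 nn0 q1.
    by field; rewrite !gt_eqF //; clear -q1; lra.
  have b2 : b k ^+ 2 <= thr' `^ (2^-1).
    have -> : b k ^+ 2 = (b k ^+ 4) `^ (2^-1).
      by rewrite -fourth_powR // -powR_mulrn //; congr powR; field.
    by apply: powR_mono => //; rewrite ?exprn_ge0 // invr_ge0.
  apply: le_trans (ler_pM _ _ l7 b2) _; rewrite ?exprn_ge0 //.
  by rewrite /D le_eqVlt; apply/orP; left; apply/eqP; ring.
have -> : \sum_(1 <= q < (n * P).+1) (2 * A0 * q + 1)%:R * (D * q%:R `^ (- (5 / 3)))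
  = D * \sum_(1 <= q < (n * P).+1) (2 * A0 * q + 1)%:R * q%:R `^ (- (5 / 3)) :> R.
  by rewrite mulr_sumr; apply: eq_bigr => q _; ring.
have hS := @sum_q_weight R A0 (n * P) (3%:R^-1 - 1) (- (5 / 3)) _ ltac:(by field) (@sum_root_le R 3 (n * P) isT).
apply: le_trans (ler_wpM2l (ltW G0) (ler_wpM2l D0 hS)) _.
by rewrite /D le_eqVlt; apply/orP; left; apply/eqP; ring.
Qed.

(** After [nu_le] the part with [q] alone is summed over the arcs of the long sum, the part with
    [q'] over those of the short sum. The latter still contains the decay around a moving fraction
    of the long sum. The last two hypotheses fix the block length [l] for [cell_sum]: long enough
    for the short sum's weight to be summable over blocks, short enough for [frac_sep] to freeze the
    fraction. *)
Lemma major_main (R : realType) (C be ga CM A : R) (n : nat) : 0 <= C -> be != 0 -> 0 < ga ->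
  0 < CM -> (0 < n)%N -> 0 <= A ->
  exists2 C' : R, 0 <= C' & forall (P Y l N : nat) (M : R) (la b : nat -> R) (thr thr' : R),
    (0 < P)%N -> (0 < Y)%N -> (0 < l)%N ->
    M = CM * P%:R ^+ 3 -> (forall k, (k < N.+1)%N -> k%:R / M <= A) ->
    (forall k, 0 <= la k) -> (forall k, 0 <= b k) ->
    weyl_dich C thr M be (n * P) N la -> weyl_dich C thr' M ga Y N b ->
    M <= ga * Y%:R ^+ 3 * l%:R -> 2 * (n * P)%:R ^+ 2 * (`|be| * l%:R) <= M ->
    \sum_(k < N.+1) ((thr < la k ^+ 4) && (thr' < b k ^+ 4))%:R * (la k ^+ 7 * b k ^+ 2) `^ (20 / 21)
      <= C'.
Proof.
move=> C0 be0 ga0 CM0 n0 A0'.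
pose c := n%:R ^+ 3 * be / CM.
have nR : (0 : R) < n%:R by rewrite ltr0n.
have c0 : c != 0 by rewrite !mulf_neq0 ?invr_eq0 ?expf_neq0 ?(gt_eqF nR) ?(gt_eqF CM0).
have [G G0 hG] := sum_bw_le_neq0 c0.
have [G1 G10 hG1] := @sum_bw_le_neq0 R 1 (oner_neq0 _).
have A10 : 0 <= A * (`|be| + ga) + 1 by rewrite addr_ge0 ?mulr_ge0 ?addr_ge0 // ltW.
pose A0 := (Num.Def.truncn (A * (`|be| + ga) + 1)).+1.
have hA0 : A * (`|be| + ga) + 1 <= A0%:R by have /andP[_ /ltW] := truncn_itv A10.
pose E := C `^ (5 / 3) * C `^ (10 / 21).
have E0 : 0 <= E by rewrite mulr_ge0 ?powR_ge0.
pose Z : R := (2 * A0 + 1)%:R * 11.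
have Z0 : 0 <= Z by rewrite mulr_ge0 ?ler0n.
exists (E * (G * Z + 4 * G * G1 * Z)).
  by rewrite mulr_ge0 // addr_ge0 ?mulr_ge0 // ltW.
move=> P Y l N M la b thr thr' P0 Y0 l0 ME hk la0 b0 dl db hl hX.
have PR : (0 : R) < P%:R by rewrite ltr0n.
have M0 : 0 < M by rewrite ME mulr_gt0 ?exprn_gt0.
have X0 : (0 < n * P)%N by rewrite muln_gt0 n0.
have XR : (0 : R) < (n * P)%:R by rewrite ltr0n.
pose act k := (thr < la k ^+ 4) && (thr' < b k ^+ 4).
(* One fraction is selected for each active frequency; [(0, 0)] is a dummy for the others. *)
have /choice [f hf] : forall k, exists p : nat * int, (k < N.+1)%N -> act k ->
   [/\ (0 < p.1 <= n * P)%N, `|p.1%:R * (k%:R / M * be) - p.2%:~R| <= (12 * (n * P) ^ 2)%:R^-1 &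
      la k ^+ 4 <= C * p.1%:R `^ (- (49 / 50)) * Bmax (n * P)%:R (k%:R / M * be - p.2%:~R / p.1%:R) `^ (- (3 / 4))].
  move=> k; have [kN|kN] := ltnP k N.+1; last by exists (0%N, 0).
  have [/andP[h1 _]|_] := boolP (act k); last by exists (0%N, 0).
  have [h|[q [a h]]] := dl k kN; first by exfalso; lra.
  by exists (q, a).
pose x k := (n * P)%:R ^+ 3 * ((f k).2%:~R / (f k).1%:R) : R.
have kA k (z : R) : (k < N.+1)%N -> `|k%:R / M * z| <= A * `|z|.
  move=> kN; have k0 : 0 <= k%:R / M by rewrite divr_ge0 ?ler0n // ltW.
  by rewrite normrM (ger0_norm k0) ler_wpM2r // hk.
have Abe : A * `|be| + 1 <= A0%:R by apply: le_trans hA0; rewrite lerD2r ler_wpM2l // lerDl ltW.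
have Aga : A * `|ga| + 1 <= A0%:R by apply: le_trans hA0; rewrite lerD2r ler_wpM2l // (gtr0_norm ga0) lerDr.
have xE k : (k < N.+1)%N -> act k ->
    Bmax (n * P)%:R (k%:R / M * be - (f k).2%:~R / (f k).1%:R) `^ (- (5 / 4)) = bw (c * k%:R - x k).
  move=> kN ak; have [/andP[q0 _] _ _] := hf k kN ak.
  rewrite Bmax_bw ?ler0n //; congr bw; rewrite /x /c ME natrM.
  have q1 : (0 : R) < (f k).1%:R by rewrite ltr0n.
  move: (P%:R) (n%:R) ((f k).1%:R) PR nR q1 => p nn qq p0 nn0 qq0.
  by field; rewrite !gt_eqF.
pose c' := Y%:R ^+ 3 * ga / M.
pose w1 k := (act k)%:R * ((f k).1%:R `^ (- (21 / 10)) * bw (c * k%:R - x k)) : R.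
have /choice [f' hf'] : forall k, exists p : nat * int, (k < N.+1)%N -> act k ->
   [/\ (0 < p.1 <= Y)%N, `|p.1%:R * (k%:R / M * ga) - p.2%:~R| <= (12 * Y ^ 2)%:R^-1 &
      b k ^+ 4 <= C * p.1%:R `^ (- (49 / 50)) * Bmax Y%:R (k%:R / M * ga - p.2%:~R / p.1%:R) `^ (- (3 / 4))].
  move=> k; have [kN|kN] := ltnP k N.+1; last by exists (0%N, 0).
  have [/andP[_ h1]|_] := boolP (act k); last by exists (0%N, 0).
  have [h|[q [a h]]] := db k kN; first by exfalso; clear -h1 h; lra.
  by exists (q, a).
pose y k := Y%:R ^+ 3 * ((f' k).2%:~R / (f' k).1%:R) : R.
have yE k : (k < N.+1)%N -> act k ->
    Bmax Y%:R (k%:R / M * ga - (f' k).2%:~R / (f' k).1%:R) `^ (- (5 / 4)) = bw (c' * k%:R - y k).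
  move=> kN ak; have [/andP[q0 _] _ _] := hf' k kN ak.
  rewrite Bmax_bw ?ler0n //; congr bw; rewrite /y /c'.
  have q1 : (0 : R) < (f' k).1%:R by rewrite ltr0n.
  move: ((f' k).1%:R) q1 => qq qq0.
  by field; rewrite !gt_eqF.
pose w2 k := (f' k).1%:R `^ (- (21 / 10)) * ((act k)%:R * (bw (c * k%:R - x k) * bw (c' * k%:R - y k))) : R.
apply: le_trans (_ : E * (\sum_(k < N.+1) w1 k + \sum_(k < N.+1) w2 k) <= _).
  rewrite -big_split /= mulr_sumr; apply: ler_sum => k _; rewrite -/(act k) /w1 /w2.
  case: (boolP (act k)) => ak; last by rewrite !mul0r mulr0 addr0 mulr0.
  have kN := ltn_ord k.
  have [/andP[q0 _] _ h1] := hf k kN ak; have [/andP[q'0 _] _ h2] := hf' k kN ak.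
  have q1 : (1 : R) <= (f k).1%:R by rewrite ler1n.
  have q'1 : (1 : R) <= (f' k).1%:R by rewrite ler1n.
  rewrite !mul1r; apply: le_trans (nu_le C0 C0 (la0 k) (b0 k) q1 (Bmax_ge1 _ _) q'1 (Bmax_ge1 _ _) h1 h2) _.
  rewrite -/E xE // yE // le_eqVlt; apply/orP; left; apply/eqP; ring.
have S21 (Q : nat) : \sum_(1 <= q < Q.+1) (2 * A0 * q + 1)%:R * (q%:R : R) `^ (- (21 / 10)) <= Z.
  exact: (@sum_q_weight R A0 Q (- 1 - 10%:R^-1) (- (21 / 10)) _ ltac:(by field) (@sum_zeta_le R 10 Q isT)).
rewrite ler_wpM2l //; apply: lerD.
  apply: le_trans (@arc_sum R N.+1 (n * P) A0 G (fun q => q%:R `^ (- (21 / 10)))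
    (fun q a => (n * P)%:R ^+ 3 * (a%:~R / q%:R)) (fun k y => bw (c * k%:R - y)) w1 _ _ _ _) _.
  - by move=> q; exact: powR_ge0.
  - by move=> k z; exact: bw_ge0.
  - by move=> z; exact: hG.
  - move=> k kN; rewrite /w1; case: (boolP (act k)) => ak; last by left; rewrite mul0r.
    right; exists (f k).1, (f k).2; have [/andP[q0 qX] hq _] := hf k kN ak.
    split; [by rewrite q0| |by rewrite mul1r].
    by apply: (@arc_numerator R _ (n * P) _ (k%:R / M * be) (A * `|be|) A0) => //; exact: kA.
  by rewrite ler_pM2l.
apply: le_trans (@arc_sum R N.+1 Y A0 (4 * G * G1) (fun q => q%:R `^ (- (21 / 10)))
    (fun q a => Y%:R ^+ 3 * (a%:~R / q%:R))
    (fun k z => (act k)%:R * (bw (c * k%:R - x k) * bw (c' * k%:R - z))) w2 _ _ _ _) _.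
- by move=> q; exact: powR_ge0.
- by move=> k z; rewrite mulr_ge0 ?ler0n // mulr_ge0 ?bw_ge0.
- move=> z; apply: (@cell_sum R c c' G G1 z l N.+1 act x) => //.
    by rewrite /c' mulrAC ler_pdivlMr // mul1r [Y%:R ^+ 3 * _]mulrC.
  move=> k k' ak ak' kN kN' kk; rewrite /x; congr (_ * _).
  have [qX hq _] := hf k kN ak; have [qX' hq' _] := hf k' kN' ak'.
  apply: (frac_sep qX qX' hq hq').
  have -> : k%:R / M * be - k'%:R / M * be = (k%:R - k'%:R) / M * be by ring.
  rewrite normrM normrM normfV (gtr0_norm M0).
  have kl : `|k%:R - k'%:R| <= l%:R :> R.
    have h1 : (k <= k' + l)%N.
      by move: (divn_eq k l) (divn_eq k' l) (ltn_pmod k l0) (ltn_pmod k' l0); rewrite kk; move: (_ * l)%N; clear; lia.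
    have h2 : (k' <= k + l)%N.
      by move: (divn_eq k l) (divn_eq k' l) (ltn_pmod k l0) (ltn_pmod k' l0); rewrite kk; move: (_ * l)%N; clear; lia.
    move: h1 h2; rewrite -!(ler_nat R) !natrD ler_norml => h1 h2; apply/andP; split; clear -h2 h1; lra.
  have -> : 2 * (n * P)%:R ^+ 2 * (`|k%:R - k'%:R| / M * `|be|)
     = 2 * (n * P)%:R ^+ 2 * (`|be| * `|k%:R - k'%:R|) / M by ring.
  rewrite ler_pdivrMr // mul1r; apply: le_trans hX.
  by rewrite ler_wpM2l ?mulr_ge0 ?sqr_ge0 // ler_wpM2l.
- move=> k kN; rewrite /w2; case: (boolP (act k)) => ak; last by left; rewrite mul0r mulr0.
  right; exists (f' k).1, (f' k).2; have [/andP[q0 qX] hq _] := hf' k kN ak.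
  split; [by rewrite q0| |by rewrite mul1r].
  by apply: (@arc_numerator R _ Y _ (k%:R / M * ga) (A * `|ga|) A0) => //; exact: kA.
by rewrite ler_wpM2l // !mulr_ge0 // ltW.
Qed.

(** * Mean values over diminished ranges *)

Lemma sum_map_iota (R : realType) (T : Type) (F : nat -> T) (g : T -> R) (n : nat) :
  \sum_(x <- [seq F i | i <- iota 0 n]) g x = \sum_(i < n) g (F i).
Proof. by rewrite big_map -[n in iota 0 n]subn0 -/(index_iota 0 n) big_mkord. Qed.

Definition vals (R : realType) (b3 b2 b1 b0 : R) (s n : nat) : seq R :=
  [seq cubic b3 b2 b1 b0 (s + i)%:R | i <- iota 0 n].

Lemma size_vals (R : realType) (b3 b2 b1 b0 : R) (s n : nat) : size (vals b3 b2 b1 b0 s n) = n.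
Proof. by rewrite size_map size_iota. Qed.

Lemma floor_eq_dist (R : realType) (v w : R) : Num.floor v = Num.floor w -> `|v - w| < 1.
Proof.
move=> e; have /andP[a1 a2] := floor_itv v; have /andP[b1 b2] := floor_itv w.
rewrite e intrD in a1 a2; rewrite intrD in b2.
by rewrite ltr_norml; apply/andP; split; lra.
Qed.

(** Both polynomials increase by at least 1 at each step of their ranges. So equal integer parts
    force either the same pair or indices that move in opposite directions; each of the two
    directions is counted by [sol]. *)
Lemma pair_count (R : realType) (b3 b2 b1 b0 c3 c2' c1 c0 : R) (P Y : nat) :
  tame b3 b2 b1 P%:R -> tame c3 c2' c1 Y%:R ->
  1 <= b3 * P%:R ^+ 2 -> 1 <= c3 * Y%:R ^+ 2 ->
  forall vs : seq R, vs = [seq v + w | v <- vals b3 b2 b1 b0 P.+1 P, w <- vals c3 c2' c1 c0 Y.+1 Y] ->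
  (\sum_(v <- vs) \sum_(w <- vs) (Num.floor v == Num.floor w)%:R : R)
    <= (P * Y + (#|sol b3 b2 b1 c3 c2' c1 P Y| + #|sol b3 b2 b1 c3 c2' c1 P Y|))%:R.
Proof.
move=> tb tc P2 Y2 vs vsE.
have b30 : 0 < b3 by case: tb.
have c30 : 0 < c3 by case: tc.
pose F (i : nat) := cubic b3 b2 b1 b0 (P.+1 + i)%:R.
pose G (i : nat) := cubic c3 c2' c1 c0 (Y.+1 + i)%:R.
have sumE (g : R -> R) : \sum_(v <- vs) g v = \sum_(p : 'I_P * 'I_Y) g (F p.1 + G p.2).
  rewrite vsE big_allpairs_dep sum_map_iota -(pair_bigA _ (fun (i : 'I_P) (j : 'I_Y) => g (F i + G j))) /=; apply: eq_bigr => i _.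
  by rewrite sum_map_iota.
rewrite sumE; under eq_bigr do rewrite sumE.
rewrite pair_bigA /=.
pose W := [set p : ('I_P * 'I_Y) * ('I_P * 'I_Y) |
  Num.floor (F p.1.1 + G p.1.2) == Num.floor (F p.2.1 + G p.2.2)].
rewrite -natr_sum.
have -> : (\sum_(p : ('I_P * 'I_Y) * ('I_P * 'I_Y)) (Num.floor (F p.1.1 + G p.1.2) == Num.floor (F p.2.1 + G p.2.2)) = #|W|)%N.
  rewrite -sum1_card [in RHS]big_mkcond /=; apply: eq_bigr => p _.
  by rewrite inE; case: eqP.
rewrite ler_nat.
have Fd (i d : nat) : F (i + d)%N - F i = dcub b3 b2 b1 d%:R (P + i.+1)%:R.
  by rewrite -(cubic_sub b3 b2 b1 b0) /F -!natrD; congr (cubic _ _ _ _ _%:R - cubic _ _ _ _ _%:R); lia.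
have Gd (i d : nat) : G (i + d)%N - G i = dcub c3 c2' c1 d%:R (Y + i.+1)%:R.
  by rewrite -(cubic_sub c3 c2' c1 c0) /G -!natrD; congr (cubic _ _ _ _ _%:R - cubic _ _ _ _ _%:R); lia.
clearbody F G.
have Fl (i d : nat) : (0 < d)%N -> 1 <= F (i + d)%N - F i.
  move=> d0; rewrite Fd.
  have PX : (P%:R : R) <= (P + i.+1)%:R by rewrite ler_nat leq_addr.
  have /andP[h _] := dcub_bounds (tame_le tb PX) (ler0n _ d); apply: le_trans h.
  apply: (le_trans P2); apply: ler_pM; rewrite ?sqr_ge0 ?(ltW b30) //.
    by rewrite ler_peMr ?(ltW b30) // ler1n.
  by rewrite lerXn2r ?nnegrE ?ler0n // ler_nat leq_addr.
have Gl (i d : nat) : (0 < d)%N -> 1 <= G (i + d)%N - G i.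
  move=> d0; rewrite Gd.
  have PX : (Y%:R : R) <= (Y + i.+1)%:R by rewrite ler_nat leq_addr.
  have /andP[h _] := dcub_bounds (tame_le tc PX) (ler0n _ d); apply: le_trans h.
  apply: (le_trans Y2); apply: ler_pM; rewrite ?sqr_ge0 ?(ltW c30) //.
    by rewrite ler_peMr ?(ltW c30) // ler1n.
  by rewrite lerXn2r ?nnegrE ?ler0n // ler_nat leq_addr.
have Gm (i j : nat) : (i <= j)%N -> G i <= G j.
  rewrite leq_eqVlt => /orP[/eqP ->//|ij].
  have := @Gl i (j - i)%N; rewrite subn_gt0 => /(_ ij); rewrite subnKC ?(ltnW ij) //; lra.
pose Di := [set (p, p) | p : 'I_P * 'I_Y].
pose S1 := [set p in W | (p.2.1 < p.1.1)%N].
pose S2 := [set p in W | (p.1.1 < p.2.1)%N].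
have WP i j i' j' : ((i, j), (i', j')) \in W -> `|F i + G j - (F i' + G j')| < 1.
  by rewrite inE => /eqP /floor_eq_dist.
have sub : W \subset Di :|: (S1 :|: S2).
  apply/fintype.subsetP => -[[i j] [i' j']] pW; rewrite !finset.in_setU.
  have h := WP _ _ _ _ pW; have [ii|ii|ii] := ltngtP i i'.
  - by apply/orP; right; apply/orP; right; rewrite finset.in_set pW.
  - by apply/orP; right; apply/orP; left; rewrite finset.in_set pW.
  have {}ii : i = i' by exact: val_inj.
  apply/orP; left.
  apply/imsetP; exists (i, j); rewrite // ii; congr (_, (_, _)); apply: val_inj => /=.
  move: h; rewrite ii opprD addrACA subrr add0r ltr_norml => /andP[h1 h2].
  have [jj|jj|//] := ltngtP j j'; exfalso.
    have := @Gl j (j' - j)%N; rewrite subn_gt0 => /(_ jj); rewrite subnKC ?(ltnW jj) //; lra.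
  have := @Gl j' (j - j')%N; rewrite subn_gt0 => /(_ jj); rewrite subnKC ?(ltnW jj) //; lra.
have s1 : (#|S1| <= #|sol b3 b2 b1 c3 c2' c1 P Y|)%N.
  pose g (p : ('I_P * 'I_Y) * ('I_P * 'I_Y)) : 'I_P * 'I_P * 'I_Y * 'I_Y :=
    (insubd p.1.1 (p.1.1 - p.2.1)%N, p.2.1, insubd p.1.2 (p.2.2 - p.1.2)%N, p.1.2).
  have gv1 (i i' : 'I_P) : nat_of_ord (insubd i (i - i')%N) = (i - i')%N.
    by rewrite val_insubd (leq_ltn_trans (leq_subr _ _)).
  have gv2 (i i' : 'I_Y) : nat_of_ord (insubd i (i' - i)%N) = (i' - i)%N.
    by rewrite val_insubd (leq_ltn_trans (leq_subr _ _)).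
  have jj i j i' j' : ((i, j), (i', j')) \in S1 -> (j < j')%N.
    rewrite finset.in_set /= => /andP[/WP h ii]; rewrite ltnNge; apply/negP => /Gm hG.
    have := @Fl i' (i - i')%N; rewrite subn_gt0 => /(_ ii); rewrite subnKC ?(ltnW ii) //.
    by move: h; rewrite ltr_norml => /andP[h1 h2]; lra.
  have gI : {in S1 &, injective g}.
    move=> [[i j] [i' j']] [[k l] [k' l']] h1 h2; have j1 := jj _ _ _ _ h1; have j2 := jj _ _ _ _ h2.
    move: h1 h2; rewrite !finset.in_set /= => /andP[_ h1] /andP[_ h2] E.
    have E1 := congr1 (fun z => nat_of_ord z.1.1.1) E.
    have E2 : i' = k' := congr1 (fun z => z.1.1.2) E.
    have E3 := congr1 (fun z => nat_of_ord z.1.2) E.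
    have E4 : j = l := congr1 (fun z => z.2) E.
    rewrite /= !gv1 in E1; rewrite /= !gv2 in E3.
    have E5 : i = k by apply: val_inj => /=; move: E1 h1 h2; rewrite E2; clear; lia.
    have E6 : j' = l' by apply: val_inj => /=; move: E3 j1 j2; rewrite E4; clear; lia.
    by rewrite E2 E4 E5 E6.
  rewrite -(card_in_imset gI); apply: subset_leq_card; apply/fintype.subsetP => z /imsetP[[[i j] [i' j']] h ->].
  have j1 := jj _ _ _ _ h; move: h; rewrite finset.in_set /= => /andP[/WP h ii].
  rewrite inE /= gv1 gv2 !subn_gt0 ii j1 subnKC ?(ltnW ii) // subnKC ?(ltnW j1) // !ltn_ord /=.
  rewrite -Fd -Gd subnKC ?(ltnW ii) // subnKC ?(ltnW j1) //.
  by move: h; congr (`|_| < 1); ring.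
have s2 : (#|S2| <= #|S1|)%N.
  pose sw (p : ('I_P * 'I_Y) * ('I_P * 'I_Y)) := (p.2, p.1).
  have swI : injective sw by move=> [a b] [a' b'] [-> ->].
  rewrite -(card_imset _ swI); apply: subset_leq_card; apply/fintype.subsetP => z /imsetP[[a b] h ->].
  by move: h; rewrite !inE /= eq_sym.
apply: leq_trans (subset_leq_card sub) _; apply: leq_trans (leq_card_setU _ _) _.
apply: leq_add.
  by apply: leq_trans (leq_imset_card _ _) _; rewrite card_prod !card_ord.
by apply: leq_trans (leq_card_setU _ _) _; apply: leq_add => //; apply: leq_trans s1.
Qed.

Lemma quad_ineq (R : realType) (n A B T : R) : 0 <= n -> 0 <= A -> 0 <= B -> 0 <= T ->
  n ^+ 2 <= A * (n + B) -> 2 * (A * B) <= T ^+ 2 -> n <= 2 * A + T.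
Proof.
move=> n0 A0 B0 T0 h1 h2; rewrite leNgt; apply/negP => h3.
have k1 : 2 * A * n <= n * n by rewrite ler_wpM2r //; lra.
have k2 : T * T < n * n by apply: ltr_pM; lra.
move: h1 h2; rewrite !expr2; lra.
Qed.

(** With [U = m^4], the bound [Dn] has order [Y^3 / P^2 = m^13] and [Vn] has order [U P / Y = m^13].
    Then [sol_bound] reads [n^2 << m^71 (n + m^70)], which gives [n << m^71 = P Y]. *)
Lemma sol_card (R : realType) (b3 b2 b1 c3 c2' c1 : R) : 0 < b3 -> 0 < c3 ->
  exists2 C : R, 0 < C & exists m0 : nat, forall m, (m0 <= m)%N ->
   [/\ tame b3 b2 b1 (m ^ 40)%:R, tame c3 c2' c1 (m ^ 31)%:R, 1 <= b3 * (m ^ 40)%:R ^+ 2,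
       1 <= c3 * (m ^ 31)%:R ^+ 2 &
       (#|sol b3 b2 b1 c3 c2' c1 (m ^ 40) (m ^ 31)|%:R : R) <= C * m%:R ^+ 71].
Proof.
move=> b30 c30.
have [Xb tb] := tame_ex b2 b1 b30; have [Xc tc] := tame_ex c2' c1 c30.
pose Cd := (Num.Def.truncn (17 * c3 / b3)).+1.
have hCd : 17 * c3 <= b3 * Cd%:R.
  have h0 : 0 <= 17 * c3 / b3 by rewrite divr_ge0 ?mulr_ge0 // ltW.
  by rewrite [b3 * _]mulrC -ler_pdivrMr // ltW //; have /andP[] := truncn_itv h0.
exists (32 * Cd.+1%:R); first by rewrite mulr_gt0 ?ltr0n.
pose z := `|Xb| + `|Xc| + 2 / b3 + 20 / c3 + 48.
have z0 : 0 <= z by rewrite !addr_ge0 ?divr_ge0 // ltW.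
exists (Num.Def.truncn z).+1 => m hm.
have zm : z <= m%:R.
  have /andP[_ /ltW h] := truncn_itv z0; apply: (le_trans h); by rewrite ler_nat.
have pb : 0 < 2 / b3 by rewrite divr_gt0.
have pc : 0 < 20 / c3 by rewrite divr_gt0.
have nX := normr_ge0 Xb; have nX' := normr_ge0 Xc.
have m0 : (0 < m)%N by rewrite -(ltr0n R); move: zm; rewrite /z; lra.
have lb := ler_norm Xb; have lc := ler_norm Xc.
have mP : (m%:R : R) <= (m ^ 40)%:R by rewrite ler_nat -{1}(expn1 m) leq_pexp2l.
have mY : (m%:R : R) <= (m ^ 31)%:R by rewrite ler_nat -{1}(expn1 m) leq_pexp2l.
set P := (m ^ 40)%N in mP *; set Y := (m ^ 31)%N in mY *.
have tP : tame b3 b2 b1 P%:R by apply: (tame_le tb); move: zm; rewrite /z; lra.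
have tY : tame c3 c2' c1 Y%:R by apply: (tame_le tc); move: zm; rewrite /z; lra.
have P1 : 2 <= b3 * P%:R by rewrite mulrC -ler_pdivrMr //; move: zm; rewrite /z; lra.
have Y1 : 20 <= c3 * Y%:R by rewrite mulrC -ler_pdivrMr //; move: zm; rewrite /z; lra.
have P48 : 48 <= P%:R :> R by move: zm; rewrite /z; lra.
have Y48 : 48 <= Y%:R :> R by move: zm; rewrite /z; lra.
have P2 : 1 <= b3 * P%:R ^+ 2 by rewrite expr2 mulrA; move: P1 P48; clear; move: (b3 * P%:R) (P%:R) => x y; nra.
have Y2 : 1 <= c3 * Y%:R ^+ 2 by rewrite expr2 mulrA; move: Y1 Y48; clear; move: (c3 * Y%:R) (Y%:R) => x y; nra.
split => //.
have PE : P = (m ^ 40)%N by []. have YE : Y = (m ^ 31)%N by [].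
have YU : (Y %/ m ^ 4 = m ^ 27)%N by rewrite YE (_ : 31%N = (27 + 4)%N) // expnD mulnK // expn_gt0 m0.
(* [91] is the least integer with [3 * 91 >= 16 * 17]. *)
have := @sol_bound R b3 b2 b1 c3 c2' c1 P Y (m ^ 4) (Cd * m ^ 13) (91 * m ^ 13) tP tY.
rewrite YU => /(_ _ _ _ P2 Y2 P1) H.
set n : R := #|_|%:R; have n0 : 0 <= n by rewrite ler0n.
have {}H : n ^+ 2 <= ((Cd * m ^ 13).+1 * Y * (m ^ 27).+1)%:R * (n + 2 * ((Cd * m ^ 13).+1 * P * (91 * m ^ 13).+1 * m ^ 4)%:R).
  apply: H => //.
  - by rewrite expn_gt0 m0.
  - by rewrite leq_pexp2l.
  - by rewrite leq_pexp2l.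
  - by lra.
  - have h48 : 48 * c3 <= c3 * Y%:R by rewrite mulrC ler_pM2l.
    have -> : 14 * c3 ^+ 2 * Y%:R ^+ 2 = 14 * (c3 * Y%:R) * (c3 * Y%:R) by ring.
    by have : 20 * (c3 * Y%:R) <= (c3 * Y%:R) * (c3 * Y%:R); [rewrite ler_wpM2r //; clear -Y1; lra | clear -Y1 h48; lra].
  - have -> : b3 * (Cd * m ^ 13)%:R * P%:R ^+ 2 = b3 * Cd%:R * Y%:R ^+ 3.
      rewrite natrM -mulrA -mulrA -mulrA; congr (_ * (_ * _)); rewrite -!natrX -natrM PE YE.
      by rewrite -!expnM -expnD.
    by rewrite ler_pM2r // exprn_gt0 // ltr0n expn_gt0 m0.
  - rewrite PE YE -!natrM ler_nat.
    have -> : (3 * (91 * m ^ 13) * m ^ 31 = 273 * m ^ 44)%N.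
      by rewrite mulnA -mulnA -expnD.
    by rewrite -mulnA -expnD leq_mul2r orbC; apply/orP; left.
have m71 : (0 : R) <= m%:R ^+ 71 by rewrite exprn_ge0.
have Aup : ((Cd * m ^ 13).+1 * Y * (m ^ 27).+1)%:R <= 2 * Cd.+1%:R * m%:R ^+ 71 :> R.
  rewrite -natrX -!natrM ler_nat YE.
  have -> : (2 * Cd.+1 * m ^ 71 = Cd.+1 * m ^ 13 * m ^ 31 * (2 * m ^ 27))%N.
    by rewrite (_ : 71%N = (13 + 31 + 27)%N) // !expnD; ring.
  have h13 : (0 < m ^ 13)%N by rewrite expn_gt0 m0.
  have h27 : (0 < m ^ 27)%N by rewrite expn_gt0 m0.
  apply: leq_mul; first apply: leq_mul => //.
    by rewrite mulSn -add1n leq_add2r.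
  by rewrite mul2n -addnn -add1n leq_add2r.
have Bup : 2 * ((Cd * m ^ 13).+1 * P * (91 * m ^ 13).+1 * m ^ 4)%:R <= 184 * Cd.+1%:R * m%:R ^+ 70 :> R.
  rewrite -natrX -!natrM ler_nat PE.
  have -> : (184 * Cd.+1 * m ^ 70 = 2 * (Cd.+1 * m ^ 13 * m ^ 40 * (92 * m ^ 13) * m ^ 4))%N.
    by rewrite (_ : 70%N = (13 + 40 + 13 + 4)%N) // !expnD; ring.
  have h13 : (0 < m ^ 13)%N by rewrite expn_gt0 m0.
  apply: leq_mul => //; apply: leq_mul => //; apply: leq_mul; first apply: leq_mul => //.
    by rewrite mulSn -add1n leq_add2r.
  by rewrite ltn_pmul2r.
set A : R := (_ * Y * _)%:R in H Aup; set B : R := 2 * _ in H Bup.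
have A0 : 0 <= A by rewrite ler0n.
have B0 : 0 <= B by rewrite mulr_ge0 ?ler0n.
have T0 : 0 <= 28 * Cd.+1%:R * m%:R ^+ 71 :> R by rewrite mulr_ge0 ?mulr_ge0 ?ler0n.
have := quad_ineq n0 A0 B0 T0 H _.
have -> : 32 * Cd.+1%:R * m%:R ^+ 71 = 2 * (2 * Cd.+1%:R * m%:R ^+ 71) + 28 * Cd.+1%:R * m%:R ^+ 71 :> R by ring.
move=> K; apply: le_trans (K _) _; last by clear -Aup; lra.
have AB : A * B <= 2 * Cd.+1%:R * m%:R ^+ 71 * (184 * Cd.+1%:R * m%:R ^+ 70) by apply: ler_pM.
have m7071 : 184 * Cd.+1%:R * m%:R ^+ 70 <= 184 * Cd.+1%:R * m%:R ^+ 71 :> R.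
  by rewrite ler_pM2l ?mulr_gt0 ?ltr0n // ler_weXn2l // ler1n.
have : 2 * Cd.+1%:R * m%:R ^+ 71 * (184 * Cd.+1%:R * m%:R ^+ 70) <= 2 * Cd.+1%:R * m%:R ^+ 71 * (184 * Cd.+1%:R * m%:R ^+ 71) :> R.
  by rewrite ler_wpM2l // mulr_ge0 // mulr_ge0.
have : 0 <= (Cd.+1%:R * m%:R ^+ 71) ^+ 2 :> R by exact: sqr_ge0.
move: AB; move: (m%:R ^+ 71) (m%:R ^+ 70) (A * B) (Cd.+1%:R) => x y w u; clear; rewrite !expr2; lra.
Qed.

Lemma freq_allpairs (R : realType) (al : R) (vs ws : seq R) :
  freq al [seq v + w | v <- vs, w <- ws] = freq al vs * freq al ws.
Proof.
rewrite /freq -eabs_allpairs; congr eabs.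
by rewrite map_allpairs allpairs_mapl allpairs_mapr; apply: eq_allpairs => v w; rewrite mulrDr.
Qed.

Lemma pair_l2 (R : realType) (b3 b2 b1 b0 c3 c2' c1 c0 eta : R) : 0 < b3 -> 0 < c3 -> 0 < eta ->
  exists2 C : R, 0 < C & exists m0 : nat, forall m, (m0 <= m)%N ->
   forall (M : R) (N : nat), 0 < M -> M <= eta * N.+1%:R -> eta * N.+1%:R <= 3 * M ->
   (forall v w, v \in vals b3 b2 b1 b0 (m ^ 40).+1 (m ^ 40) ->
      w \in vals c3 c2' c1 c0 (m ^ 31).+1 (m ^ 31) -> `|v + w| <= M / 4) ->
   \sum_(k < N.+1) (freq (k%:R / M) (vals b3 b2 b1 b0 (m ^ 40).+1 (m ^ 40))
       * freq (k%:R / M) (vals c3 c2' c1 c0 (m ^ 31).+1 (m ^ 31))) ^+ 2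
     <= C * M * m%:R ^+ 71.
Proof.
move=> b30 c30 eta0.
have [C C0 [m0 hm0]] := sol_card b2 b1 c2' c1 b30 c30.
pose D := 8 * (12 / eta + 4 * eta).
have D0 : 0 < D by rewrite mulr_gt0 // addr_gt0 ?divr_gt0 ?mulr_gt0.
exists (D * (1 + 2 * C)); first by rewrite mulr_gt0 //; lra.
exists m0 => m mm M N M0 hN1 hN2 hv.
have [tb tc P2 Y2 hs] := hm0 m mm.
set fs := vals b3 _ _ _ _ _; set gs := vals c3 _ _ _ _ _.
under eq_bigr do rewrite -freq_allpairs.
have NR : (0 : R) < N.+1%:R by rewrite ltr0n.
apply: le_trans (@l2_bound R M N _ M0 _) _.
  by move=> v /allpairsP[[a b] /= [h1 h2 ->]]; apply: hv.
have hq := pair_count tb tc P2 Y2 (erefl [seq v + w | v <- fs, w <- gs]).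
set Q := \sum_(v <- _) _ in hq *.
have Q0 : 0 <= Q by apply: sumr_ge0 => v _; apply: sumr_ge0 => w _; rewrite ler0n.
have hQ : Q <= (1 + 2 * C) * m%:R ^+ 71.
  apply: (le_trans hq); rewrite !natrD natrM -natrM -expnD natrX; clear -hs; lra.
have hD : 8 * (4 * N.+1%:R + 4 * M ^+ 2 / N.+1%:R) <= D * M.
  have h1 : N.+1%:R <= 3 * M / eta by rewrite ler_pdivlMr // mulrC.
  have h2 : M ^+ 2 / N.+1%:R <= eta * M.
    rewrite ler_pdivrMr // expr2 mulrAC ler_pM2r //.
  have -> : D * M = 8 * (4 * (3 * M / eta) + 4 * (eta * M)) by rewrite /D; field; rewrite gt_eqF.
  have -> : 4 * M ^+ 2 / N.+1%:R = 4 * (M ^+ 2 / N.+1%:R) by rewrite mulrA.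
  move: h1 h2; clear; move: (N.+1%:R) (3 * M / eta) (eta * M) (M ^+ 2 / _) => x u w y; lra.
apply: le_trans (_ : D * M * ((1 + 2 * C) * m%:R ^+ 71) <= _).
  apply: ler_pM => //; rewrite mulr_ge0 ?addr_ge0 ?mulr_ge0 ?invr_ge0 ?sqr_ge0 ?ler0n //; exact: ltW.
by rewrite le_eqVlt; apply/orP; left; apply/eqP; ring.
Qed.

(** * Values of cubics and sumsets *)

Lemma nat_above (R : realType) (x : R) : exists m0 : nat, forall m, (m0 <= m)%N -> x <= m%:R.
Proof.
exists (Num.Def.truncn `|x|).+1 => m hm.
have /andP[_ /ltW h] := truncn_itv (normr_ge0 x).
by apply: le_trans (ler_norm _) _; apply: (le_trans h); rewrite ler_nat.
Qed.

Lemma powR_decay (R : realType) (c r d : R) : 0 <= c -> 0 < r -> 0 < d ->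
  exists m0 : nat, forall m, (m0 <= m)%N -> c * m%:R `^ (- r) <= d.
Proof.
move=> c0 r0 d0; have [m0 h] := nat_above (((c / d) + 1) `^ (r^-1) + 1).
exists m0 => m /h hm; have y0 : 0 <= c / d by rewrite divr_ge0 // ltW.
have z0 : 0 <= (c / d + 1) `^ (r^-1) by exact: powR_ge0.
have mR : 0 < m%:R :> R by lra.
have k1 : c / d + 1 <= m%:R `^ r.
  have -> : c / d + 1 = ((c / d + 1) `^ (r^-1)) `^ r.
    by rewrite -powRrM mulVf ?gt_eqF // powRr1 //; lra.
  by apply: powR_mono => //; [lra|exact: ltW].
have mr : 0 < m%:R `^ r :> R by exact: powR_gt0.
rewrite powRN ler_pdivrMr // mulrC -ler_pdivrMr //; lra.
Qed.

Lemma freq_vals (R : realType) (al b3 b2 b1 b0 : R) (s X : nat) :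
  exists t2 t1 t0, freq al (vals b3 b2 b1 b0 s X) = esum (fun i => cubic (al * b3) t2 t1 t0 i%:R) X.
Proof.
exists (al * (3 * b3 * s%:R + b2)), (al * (3 * b3 * s%:R ^+ 2 + 2 * b2 * s%:R + b1)), (al * cubic b3 b2 b1 b0 s%:R).
rewrite /freq /vals -map_comp; congr eabs; apply: eq_map => i /=.
by rewrite natrD /cubic; ring.
Qed.

Lemma freq_vals0 (R : realType) (al b3 b2 b1 b0 : R) (X : nat) :
  freq al (vals b3 b2 b1 b0 0 X) = esum (fun i => al * cubic b3 b2 b1 b0 i%:R) X.
Proof. by rewrite /freq /vals -map_comp. Qed.

(** The choice [k = 800] gives [6/800 - 1 = -397/400]. Five such sums of length [m^40] save
    [m^(5/4 * 40 * 397/400) = m^(397/8)], which exceeds the [m^49] that has to be beaten. *)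
Lemma freq_dich (R : realType) : exists2 C : R, 0 < C &
  forall (b3 b2 b1 b0 M thr : R) (s X N : nat), (0 < X)%N -> C * X%:R `^ (- (397 / 400)) <= thr ->
    weyl_dich C thr M b3 X N (fun k => freq (k%:R / M) (vals b3 b2 b1 b0 s X) / X%:R).
Proof.
have [C C0 hC] := @weyl_maj R 800 isT; exists C => // b3 b2 b1 b0 M thr s X N X0 ht k _.
have [t2 [t1 [t0 E]]] := freq_vals (k%:R / M) b3 b2 b1 b0 s X; rewrite E.
have [h|[q [a [q0 hq h]]]] := hC X (k%:R / M * b3) t2 t1 t0 X0 _ erefl.
  by left; apply: (le_trans h); apply: le_trans ht; rewrite (_ : 6 / 800 - 1 = - (397 / 400)) //; field.
by right; exists q, a; split.
Qed.

Lemma lam_range (R : realType) (al : R) (vs : seq R) (X : nat) : size vs = X ->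
  0 <= freq al vs / X%:R <= 1.
Proof.
move=> <-; rewrite divr_ge0 ?freq_ge0 ?ler0n //=.
have [->|n0] := posnP (size vs); first by rewrite invr0 mulr0.
by rewrite ler_pdivrMr ?ltr0n // mul1r freq_le.
Qed.

Definition cnorm (R : realType) (b3 b2 b1 b0 : R) : R := `|b3| + `|b2| + `|b1| + `|b0|.

Lemma cubic_norm_le (R : realType) (b3 b2 b1 b0 x X : R) : 0 <= x -> x <= X -> 1 <= X ->
  `|cubic b3 b2 b1 b0 x| <= cnorm b3 b2 b1 b0 * X ^+ 3.
Proof.
move=> x0 xX X1; rewrite /cubic /cnorm.
have X3 : 1 <= X ^+ 3 by rewrite exprn_ege1.
have x3 : x ^+ 3 <= X ^+ 3 by rewrite lerXn2r ?nnegrE //; lra.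
have x2 : x ^+ 2 <= X ^+ 3.
  apply: le_trans (_ : X ^+ 2 <= _); first by rewrite lerXn2r ?nnegrE //; lra.
  by rewrite ler_weXn2l.
have x1 : x <= X ^+ 3 by apply: (le_trans xX); rewrite -[X in X <= _]expr1 ler_weXn2l.
have m3 : `|b3 * x ^+ 3| <= `|b3| * X ^+ 3.
  by rewrite normrM (ger0_norm (exprn_ge0 _ x0)) ler_wpM2l.
have m2 : `|b2 * x ^+ 2| <= `|b2| * X ^+ 3.
  by rewrite normrM (ger0_norm (exprn_ge0 _ x0)) ler_wpM2l.
have m1 : `|b1 * x| <= `|b1| * X ^+ 3 by rewrite normrM (ger0_norm x0) ler_wpM2l.
have m0 : `|b0| <= `|b0| * X ^+ 3 by rewrite ler_peMr.
have t1 := ler_normD (b3 * x ^+ 3 + b2 * x ^+ 2 + b1 * x) b0.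
have t2 := ler_normD (b3 * x ^+ 3 + b2 * x ^+ 2) (b1 * x).
have t3 := ler_normD (b3 * x ^+ 3) (b2 * x ^+ 2).
rewrite !mulrDl; lra.
Qed.

Lemma cubic_ge (R : realType) (b3 b2 b1 b0 : R) : 0 < b3 ->
  exists2 B, 0 <= B & forall x, 0 <= x -> b3 / 2 * x ^+ 3 - B <= cubic b3 b2 b1 b0 x.
Proof.
move=> b30; pose e : R := `|b2| + `|b1| + `|b0|.
have e0 : 0 <= e by rewrite !addr_ge0.
pose X0 : R := 2 * e / b3 + 1.
have X01 : 1 <= X0 by rewrite lerDr divr_ge0 ?mulr_ge0 // ltW.
have c0 : 0 <= cnorm b3 b2 b1 b0 by rewrite !addr_ge0.
have X03 : 0 <= X0 ^+ 3 by rewrite exprn_ge0 //; lra.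
have B0 : 0 <= (cnorm b3 b2 b1 b0 + b3) * X0 ^+ 3 by rewrite mulr_ge0 ?addr_ge0 // ltW.
exists ((cnorm b3 b2 b1 b0 + b3) * X0 ^+ 3) => // x x0.
have [xX|xX] := leP x X0.
  have := cubic_norm_le b3 b2 b1 b0 x0 xX X01; rewrite ler_norml => /andP[h _].
  have : b3 * x ^+ 3 <= b3 * X0 ^+ 3 by rewrite ler_pM2l // lerXn2r ?nnegrE //; lra.
  have : 0 <= b3 * X0 ^+ 3 by rewrite mulr_ge0 // ltW.
  rewrite mulrDl; lra.
have x1 : 1 <= x by lra.
have x2 : 1 <= x ^+ 2 by rewrite exprn_ege1.
have xx2 : x <= x ^+ 2 by rewrite -[X in X <= _]expr1 ler_weXn2l.
have ex : e <= b3 / 2 * x.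
  have -> : e = b3 / 2 * (2 * e / b3) by field; rewrite gt_eqF.
  by rewrite ler_wpM2l //; [lra|move: xX; rewrite /X0; lra].
have k : e * x ^+ 2 <= b3 / 2 * x ^+ 3.
  by rewrite (_ : b3 / 2 * x ^+ 3 = b3 / 2 * x * x ^+ 2); [rewrite ler_wpM2r //; lra|ring].
have l2 : - (`|b2| * x ^+ 2) <= b2 * x ^+ 2.
  have : `|b2 * x ^+ 2| <= `|b2| * x ^+ 2 by rewrite normrM (ger0_norm (exprn_ge0 _ x0)).
  by rewrite ler_norml => /andP[].
have l1 : - (`|b1| * x ^+ 2) <= b1 * x.
  have : `|b1 * x| <= `|b1| * x ^+ 2 by rewrite normrM (ger0_norm x0) ler_wpM2l.
  by rewrite ler_norml => /andP[].
have l0 : - (`|b0| * x ^+ 2) <= b0.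
  have : `|b0| <= `|b0| * x ^+ 2 by rewrite ler_peMr.
  by rewrite ler_norml => /andP[].
rewrite /e !mulrDl in k.
by move: B0; rewrite /cubic; move: ((_ + b3) * X0 ^+ 3) => z z0; lra.
Qed.

(** A discrete intermediate value argument: [g] climbs past [w] with steps at most [S], so the [r]
    points just before the first crossing lie within [S r] below [w]. Starting at least [S r] below
    [w] guarantees that there are [r] such points. *)
Lemma count_fill (R : realType) (g : nat -> R) (S T w : R) (X r : nat) :
  0 < S -> (forall x, (x < X)%N -> `|g x.+1 - g x| <= S) ->
  g 0%N + S * r%:R <= w -> w <= g X -> S * r%:R <= T ->
  (r <= count (fun v => `|v - w| <= T)%R [seq g i | i <- iota 0 X])%N.
Proof.
move=> S0 hS h0 hX hT.
have ex : exists x, w <= g x by exists X.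
pose x0 := ex_minn ex.
have [wx0 min] : w <= g x0 /\ forall y, w <= g y -> (x0 <= y)%N by rewrite /x0; case: ex_minnP.
have x0X : (x0 <= X)%N by exact: min.
have lip (i : nat) : forall d, (i + d <= X)%N -> `|g (i + d)%N - g i| <= S * d%:R.
  elim=> [|d IH] h; first by rewrite addn0 subrr normr0 mulr0.
  rewrite addnS in h *; have := IH (ltnW h); have := hS _ h.
  rewrite -(natr1 d) mulrDr mulr1 => k1 k2.
  have := ler_normD (g (i + d).+1 - g (i + d)%N) (g (i + d)%N - g i).
  by rewrite addrA subrK; lra.
have rx0 : (r <= x0)%N.
  have := lip 0%N x0; rewrite add0n => /(_ x0X); rewrite ler_norml => /andP[_ h].
  by rewrite -(ler_nat R) -(ler_pM2l S0); lra.
rewrite -[X in iota 0 X](subnKC x0X) iotaD add0n map_cat count_cat.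
apply: leq_trans (leq_addr _ _).
rewrite -[x0 in iota 0 x0](subnK rx0) iotaD add0n map_cat count_cat.
apply: leq_trans (leq_addl _ _).
suff : all (fun v => `|v - w| <= T) [seq g i | i <- iota (x0 - r) r].
  by rewrite all_count size_map size_iota => /eqP ->.
apply/allP => v /mapP[i]; rewrite mem_iota subnK // => /andP[i1 i2] -> /=.
have iw : g i < w by rewrite ltNge; apply/negP => /min; rewrite leqNgt i2.
have := lip i (x0 - i)%N; rewrite subnKC ?(ltnW i2) // => /(_ x0X); rewrite ler_norml => /andP[_ h].
have : S * (x0 - i)%:R <= S * r%:R by rewrite ler_pM2l // ler_nat; move: i1 rx0; clear; lia.
by move=> k; rewrite ler_norml; apply/andP; split; lra.
Qed.

Definition sumset (R : realType) (c : R) (ls : seq (seq R)) : seq R :=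
  foldr (fun l acc => [seq v + w | v <- l, w <- acc]) [:: c] ls.

Lemma freq_sumset (R : realType) (al c : R) (ls : seq (seq R)) :
  freq al (sumset c ls) = \prod_(l <- ls) freq al l.
Proof.
elim: ls => [|l ls IH] /=; first by rewrite big_nil /freq /= eabs_seq1.
by rewrite freq_allpairs IH big_cons.
Qed.

Lemma size_sumset (R : realType) (c : R) (ls : seq (seq R)) :
  size (sumset c ls) = (\prod_(l <- ls) size l)%N.
Proof.
elim: ls => [|l ls IH] /=; first by rewrite big_nil.
by rewrite size_allpairs IH big_cons.
Qed.

Lemma mem_sumset (R : realType) (c : R) (L : nat -> seq R) (js : seq nat) (v : R) : uniq js ->
  v \in sumset c [seq L j | j <- js] ->
  exists2 y : nat -> R, (forall j, j \in js -> y j \in L j) & v = \sum_(j <- js) y j + c.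
Proof.
elim: js v => [|j js IH] v /=.
  by move=> _; rewrite mem_seq1 => /eqP ->; exists (fun=> 0) => //; rewrite big_nil add0r.
case/andP=> jn u /allpairsP[[a b] /= [aL bV ->]].
have [y hy ->] := IH b u bV.
exists (fun i => if i == j then a else y i).
  move=> i; rewrite inE; case: eqP => [->//|_] /=; exact: hy.
rewrite big_cons eqxx -addrA; congr (_ + (_ + _)).
by apply: eq_big_seq => i ij; case: eqP => // e; rewrite -e ij in jn.
Qed.

Lemma count_allpairs_ge (R : realType) (p : pred R) (vs ws : seq R) (r : nat) :
  (forall w, w \in ws -> (r <= count (fun v => p (v + w)%R) vs)%N) ->
  (r * size ws <= count p [seq (v + w)%R | v <- vs, w <- ws])%N.
Proof.
have E : count p [seq v + w | v <- vs, w <- ws] = (\sum_(w <- ws) count (fun v => p (v + w)%R) vs)%N.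
  rewrite -sum1_count big_mkcond big_allpairs_dep exchange_big /=; apply: eq_bigr => w _.
  by rewrite -sum1_count [RHS]big_mkcond.
move=> h; rewrite E big_seq.
apply: leq_trans (_ : \sum_(w <- ws | w \in ws) r <= _)%N; last exact: leq_sum.
by rewrite -big_seq big_const_seq count_predT iter_addn_0.
Qed.

(** * The sums over all frequencies *)

Lemma powR_expn (R : realType) (m k : nat) (r : R) : (m ^ k)%:R `^ r = m%:R `^ (k%:R * r) :> R.
Proof. by rewrite natrX -powR_mulrn ?ler0n // -powRrM. Qed.

Lemma major_pair (R : realType) (C be ga CM eta : R) (n : nat) : 0 <= C -> be != 0 -> 0 < ga ->
  0 < CM -> (0 < n)%N -> 0 < eta ->
  exists2 C1 : R, 0 <= C1 & forall d, 0 < d -> exists m0 : nat, forall m, (m0 <= m)%N ->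
    forall (N : nat) (M thr thr' : R) (la b : nat -> R),
    M = CM * (m ^ 40)%:R ^+ 3 -> eta * N.+1%:R <= 3 * M ->
    (forall k, 0 <= la k) -> (forall k, 0 <= b k) ->
    thr' = C * (m ^ 31)%:R `^ (- (397 / 400)) ->
    weyl_dich C thr M be (n * m ^ 40) N la -> weyl_dich C thr' M ga (m ^ 31) N b ->
    \sum_(k < N.+1) ((thr < la k ^+ 4) && (b k ^+ 4 <= thr'))%:R * (la k ^+ 7 * b k ^+ 2) <= d /\
    \sum_(k < N.+1) ((thr < la k ^+ 4) && (thr' < b k ^+ 4))%:R * (la k ^+ 7 * b k ^+ 2) `^ (20 / 21)
      <= C1.
Proof.
move=> C0 be0 ga0 CM0 n0 eta0.
have A0 : 0 <= 3 / eta by rewrite divr_ge0 // ltW.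
have [Ca Ca0 ha] := major_small C0 be0 CM0 n0 A0.
have [Cb Cb0 hb] := major_main C0 be0 ga0 CM0 n0 A0.
exists Cb => // d d0.
have cc0 : 0 <= Ca * n%:R `^ 3%:R^-1 * C `^ 2^-1 by rewrite !mulr_ge0 ?powR_ge0.
(* The factor [P^(1/3) = m^(40/3)] of [major_small] meets the saving [m^(31 * 397/800)]; the total
   exponent is below -1. *)
have [m1 hm1] := powR_decay cc0 (ltr01 : 0 < 1 :> R) d0.
have Lc0 : 0 <= CM / ga by rewrite divr_ge0 // ltW.
pose Lc := (Num.Def.truncn (CM / ga)).+1.
have hLc : CM <= ga * Lc%:R.
  by rewrite [ga * _]mulrC -ler_pdivrMr // ltW //; have /andP[] := truncn_itv Lc0.
have [m2 hm2] := nat_above (2 * n%:R ^+ 2 * (`|be| * Lc%:R) / CM).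
exists (maxn (maxn m1 m2) 1) => m; rewrite !geq_max => /andP[/andP[mm1 mm2] m0].
move=> N M thr thr' la b ME hN la0 b0 tE dl db.
have mR : (1 : R) <= m%:R by rewrite ler1n.
have mR0 : (0 : R) < m%:R by lra.
have P0 : (0 < m ^ 40)%N by rewrite expn_gt0 m0.
have Y0 : (0 < m ^ 31)%N by rewrite expn_gt0 m0.
have M0 : 0 < M by rewrite ME mulr_gt0 ?exprn_gt0 ?ltr0n.
have hk k : (k < N.+1)%N -> k%:R / M <= 3 / eta.
  move=> kN; rewrite ler_pdivrMr // mulrAC ler_pdivlMr // mulrC; apply: le_trans hN.
  by rewrite ler_pM2l // ler_nat ltnW.
have t0 : 0 <= thr' by rewrite tE mulr_ge0 ?powR_ge0.
split.
  apply: le_trans (ha _ N M la b thr thr' P0 ME hk la0 b0 t0 dl) _.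
  apply: le_trans (hm1 m mm1); rewrite tE [X in _ * X]powRM ?powR_ge0 // natrM powRM ?ler0n //.
  rewrite -powRrM !powR_expn.
  have -> : Ca * (n%:R `^ 3^-1 * m%:R `^ (40 * 3^-1)) * (C `^ 2^-1 * m%:R `^ (31 * (- (397 / 400) * 2^-1)))
    = Ca * n%:R `^ 3%:R^-1 * C `^ 2^-1 * (m%:R `^ (40 * 3^-1) * m%:R `^ (31 * (- (397 / 400) * 2^-1))) :> R by ring.
  rewrite ler_wpM2l // -powRD ?(gt_eqF mR0) ?implybT //.
  by apply: ler_powR => //; lra.
(* The block length is of order [P^3 / Y^3 = m^27]. For the separation of fractions
   [m^27 P^2 = m^107] has to stay below [P^3 = m^120]. *)
apply: (hb _ _ (Lc * m ^ 27)%N N M la b thr thr' P0 Y0 _ ME hk la0 b0 dl db).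
- by rewrite muln_gt0 expn_gt0 m0.
- rewrite ME; have -> : ga * (m ^ 31)%:R ^+ 3 * (Lc * m ^ 27)%:R = ga * Lc%:R * (m ^ 40)%:R ^+ 3.
    rewrite -!natrX natrM -!expnM (_ : (40 * 3 = 31 * 3 + 27)%N) // expnD natrM; ring.
  by rewrite ler_wpM2r ?exprn_ge0 ?ler0n.
rewrite ME.
have -> : 2 * (n * m ^ 40)%:R ^+ 2 * (`|be| * (Lc * m ^ 27)%:R)
    = (2 * n%:R ^+ 2 * (`|be| * Lc%:R) / CM) * (CM * (m ^ 107)%:R).
  rewrite (natrM _ n) (natrM _ Lc) exprMn (_ : 107%N = (40 * 2 + 27)%N) // expnD expnM natrM natrX.
  by field; rewrite gt_eqF.
have -> : CM * (m ^ 40)%:R ^+ 3 = (m ^ 13)%:R * (CM * (m ^ 107)%:R).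
  rewrite -!natrX -!expnM (_ : (40 * 3 = 13 + 107)%N) // expnD natrM; ring.
rewrite ler_wpM2r ?mulr_ge0 ?ler0n ?(ltW CM0) //.
apply: le_trans (hm2 m mm2) _; rewrite ler_nat -{1}(expn1 m) leq_pexp2l //.
Qed.

(* Variable [0] runs over [[0, n P)], variables 1 to 4 over [[0, P)], variables 5 and 6 over
   [(P, 2P]], variables 7 and 8 over [(Y, 2Y]], where [P = m ^ 40] and [Y = m ^ 31];
   [b i j] is the coefficient of [x ^ j] in the [i]-th cubic. *)
Definition range_len (n m i : nat) : nat :=
  if (i < 7)%N then ((if i == 0%N then n else 1) * m ^ 40)%N else (m ^ 31)%N.

Definition range_start (m i : nat) : nat :=
  if (i < 5)%N then 0%N else if (i < 7)%N then (m ^ 40).+1 else (m ^ 31).+1.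

Definition range_vals (R : realType) (b : nat -> nat -> R) (n m i : nat) : seq R :=
  vals (b i 3%N) (b i 2%N) (b i 1%N) (b i 0%N) (range_start m i) (range_len n m i).

Definition range_freq (R : realType) (b : nat -> nat -> R) (n m : nat) (M : R) (i k : nat) : R :=
  freq (k%:R / M) (range_vals b n m i) / (range_len n m i)%:R.

Lemma lam_ge0 (R : realType) (b : nat -> nat -> R) (n m : nat) (M : R) (i k : nat) : 0 <= range_freq b n m M i k.
Proof. by have /andP[] := @lam_range R (k%:R / M) _ _ (size_vals (b i 3%N) (b i 2%N) (b i 1%N) (b i 0%N) (range_start m i) (range_len n m i)). Qed.

Lemma lam_le1 (R : realType) (b : nat -> nat -> R) (n m : nat) (M : R) (i k : nat) : range_freq b n m M i k <= 1.
Proof. by have /andP[] := @lam_range R (k%:R / M) _ _ (size_vals (b i 3%N) (b i 2%N) (b i 1%N) (b i 0%N) (range_start m i) (range_len n m i)). Qed.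

Definition pair_bdd (R : realType) (b : nat -> nat -> R) (n m i j : nat) (M : R) : Prop :=
  forall v w, v \in range_vals b n m i -> w \in range_vals b n m j -> `|v + w| <= M / 4.

(** The remaining four sums are paired as (5, 7) and (6, 8), and [x y <= x^2 + y^2] makes the mean
    values of [pair_l2] applicable. Normalised, those are of order [M m^71 / (P Y)^2], that is
    [m^49], against [m^(-397/8)] from five Weyl sums; [m^(-5/8)] is left. *)
Lemma minor_sum (R : realType) (b : nat -> nat -> R) (n : nat) (C CM eta d : R) :
  (forall i, (5 <= i < 9)%N -> 0 < b i 3%N) -> 0 <= C -> 0 < CM -> 0 < eta -> 0 < d ->
  exists m0 : nat, forall m, (m0 <= m)%N -> forall (N : nat) (M thr : R),
    M = CM * (m ^ 40)%:R ^+ 3 -> M <= eta * N.+1%:R -> eta * N.+1%:R <= 3 * M ->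
    pair_bdd b n m 5 7 M -> pair_bdd b n m 6 8 M ->
    thr = C * (m ^ 40)%:R `^ (- (397 / 400)) ->
    \sum_(k < N.+1) [forall i : 'I_5, range_freq b n m M i k ^+ 4 <= thr]%:R * \prod_(i < 9) range_freq b n m M i k <= d.
Proof.
move=> bp C0 CM0 eta0 d0.
have [C1 C10 [m1 h1]] := pair_l2 (b 5%N 2%N) (b 5%N 1%N) (b 5%N 0%N) (b 7%N 2%N) (b 7%N 1%N) (b 7%N 0%N) (bp 5%N isT) (bp 7%N isT) eta0.
have [C2 C20 [m2 h2]] := pair_l2 (b 6%N 2%N) (b 6%N 1%N) (b 6%N 0%N) (b 8%N 2%N) (b 8%N 1%N) (b 8%N 0%N) (bp 6%N isT) (bp 8%N isT) eta0.
have cc0 : 0 <= C `^ (5 / 4) * ((C1 + C2) * CM) by rewrite !mulr_ge0 ?powR_ge0 ?addr_ge0 // ltW.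
have r58 : 0 < 5 / 8 :> R by lra.
have [m3 h3] := powR_decay cc0 r58 d0.
exists (maxn (maxn m1 m2) (maxn m3 1)) => m; rewrite !geq_max => /andP[/andP[mm1 mm2] /andP[mm3 m0]].
move=> N M thr ME hN1 hN2 pb1 pb2 tE.
have mR0 : (0 : R) < m%:R by rewrite ltr0n.
have M0 : 0 < M by rewrite ME mulr_gt0 ?exprn_gt0 ?ltr0n ?expn_gt0 ?m0.
have t0 : 0 <= thr by rewrite tE mulr_ge0 ?powR_ge0.
pose T := thr `^ (4^-1).
have T0 : 0 <= T by exact: powR_ge0.
have lamT i k : range_freq b n m M i k ^+ 4 <= thr -> range_freq b n m M i k <= T.
  move=> h; have -> : range_freq b n m M i k = (range_freq b n m M i k ^+ 4) `^ (4^-1).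
    by rewrite -fourth_powR ?lam_ge0 // divff ?pnatr_eq0 // powRr1 // lam_ge0.
  by apply: powR_mono => //; rewrite ?exprn_ge0 ?lam_ge0 // invr_ge0.
have {h1} S1 := h1 m mm1 M N M0 hN1 hN2.
have {h2} S2 := h2 m mm2 M N M0 hN1 hN2.
pose PY : R := (m ^ 40)%:R * (m ^ 31)%:R.
have PY0 : 0 < PY by rewrite mulr_gt0 ?ltr0n ?expn_gt0 ?m0.
have e57 k : (range_freq b n m M 5 k * range_freq b n m M 7 k) ^+ 2 = (freq (k%:R / M) (range_vals b n m 5) * freq (k%:R / M) (range_vals b n m 7)) ^+ 2 / PY ^+ 2.
  by rewrite /range_freq /PY /range_len /= mul1n mulf_div expr_div_n.
have e68 k : (range_freq b n m M 6 k * range_freq b n m M 8 k) ^+ 2 = (freq (k%:R / M) (range_vals b n m 6) * freq (k%:R / M) (range_vals b n m 8)) ^+ 2 / PY ^+ 2.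
  by rewrite /range_freq /PY /range_len /= mul1n mulf_div expr_div_n.
have L5 i : (i == 5%N) || (i == 6%N) -> range_vals b n m i = vals (b i 3%N) (b i 2%N) (b i 1%N) (b i 0%N) (m ^ 40).+1 (m ^ 40).
  by case/orP => /eqP ->; rewrite /range_vals /range_start /range_len /= mul1n.
have L7 i : (i == 7%N) || (i == 8%N) -> range_vals b n m i = vals (b i 3%N) (b i 2%N) (b i 1%N) (b i 0%N) (m ^ 31).+1 (m ^ 31).
  by case/orP => /eqP ->; rewrite /range_vals /range_start /range_len /=.
rewrite -!L5 // -!L7 // in S1 S2.
apply: le_trans (_ : \sum_(k < N.+1) T ^+ 5 * ((range_freq b n m M 5 k * range_freq b n m M 7 k) ^+ 2 + (range_freq b n m M 6 k * range_freq b n m M 8 k) ^+ 2) <= _).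
  apply: ler_sum => k _.
  have s0 : 0 <= T ^+ 5 * ((range_freq b n m M 5 k * range_freq b n m M 7 k) ^+ 2 + (range_freq b n m M 6 k * range_freq b n m M 8 k) ^+ 2).
    by rewrite mulr_ge0 ?exprn_ge0 // addr_ge0 ?sqr_ge0.
  have [/forallP mi|_] := boolP [forall i : 'I_5, range_freq b n m M i k ^+ 4 <= thr]; last by rewrite mul0r.
  rewrite mul1r 4!big_ord_recr /=.
  have p5 : \prod_(i < 5) range_freq b n m M i k <= T ^+ 5.
    rewrite -[5%N in X in _ <= X](card_ord 5) -prodr_const; apply: ler_prod => i _.
    by rewrite lam_ge0 lamT.
  have p50 : 0 <= \prod_(i < 5) range_freq b n m M i k by apply: prodr_ge0 => i _; exact: lam_ge0.
  move: p5 p50; move: (\prod_(i < 5) _) => p p5 p50.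
  have l5 := lam_ge0 b n m M 5 k; have l6 := lam_ge0 b n m M 6 k.
  have l7 := lam_ge0 b n m M 7 k; have l8 := lam_ge0 b n m M 8 k.
  have -> : p * range_freq b n m M 5 k * range_freq b n m M 6 k * range_freq b n m M 7 k * range_freq b n m M 8 k
    = p * ((range_freq b n m M 5 k * range_freq b n m M 7 k) * (range_freq b n m M 6 k * range_freq b n m M 8 k)) by ring.
  have x0 := mulr_ge0 l5 l7; have y0 := mulr_ge0 l6 l8.
  apply: ler_pM => //; first exact: mulr_ge0.
  move: (_ * range_freq b n m M 7 k) (_ * range_freq b n m M 8 k) x0 y0 => x y x0 y0.
  by have := sqr_ge0 (x - y); have := mulr_ge0 x0 y0; rewrite !expr2; nra.
rewrite -mulr_sumr big_split /=.
under eq_bigr do rewrite e57.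
under [X in _ + X]eq_bigr do rewrite e68.
rewrite -!mulr_suml.
have {}S1 := S1 pb1; have {}S2 := S2 pb2.
move: S1 S2; move: (\sum_(i < N.+1) _) (\sum_(i < N.+1) _) => s1 s2 S1 S2.
have PY2 : 0 < PY ^+ 2 by rewrite exprn_gt0.
apply: le_trans (_ : T ^+ 5 * (C1 * M * m%:R ^+ 71 / PY ^+ 2 + C2 * M * m%:R ^+ 71 / PY ^+ 2) <= _).
  by rewrite ler_wpM2l ?exprn_ge0 //; apply: lerD; rewrite ler_pM2r ?invr_gt0.
have E49 : M * m%:R ^+ 71 / PY ^+ 2 = CM * m%:R ^+ 49.
  rewrite ME /PY -!natrX -natrM -expnD -natrX -!expnM.
  rewrite (_ : (40 * 3 = 120)%N) // (_ : ((40 + 31) * 2 = 142)%N) // -mulrA -mulrA; congr (_ * _).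
  by rewrite mulrA -natrM -expnD (_ : (120 + 71 = 49 + 142)%N) // expnD natrM mulfK // gt_eqF // ltr0n expn_gt0 m0.
have E5 : T ^+ 5 = C `^ (5 / 4) * m%:R `^ (- (397 / 8)).
  rewrite /T -powR_mulrn ?powR_ge0 // -powRrM tE powRM ?powR_ge0 // powR_expn -!powRrM.
  by congr (powR _ _ * powR _ _); field.
have -> : T ^+ 5 * (C1 * M * m%:R ^+ 71 / PY ^+ 2 + C2 * M * m%:R ^+ 71 / PY ^+ 2)
   = T ^+ 5 * ((C1 + C2) * (M * m%:R ^+ 71 / PY ^+ 2)) by ring.
rewrite E49 E5; apply: le_trans (h3 m mm3).
have -> : C `^ (5 / 4) * m%:R `^ (- (397 / 8)) * ((C1 + C2) * (CM * m%:R ^+ 49))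
   = C `^ (5 / 4) * ((C1 + C2) * CM) * (m%:R `^ (- (397 / 8)) * m%:R ^+ 49) by ring.
rewrite -powR_mulrn ?ler0n // -powRD ?(gt_eqF mR0) ?implybT //.
rewrite le_eqVlt; apply/orP; left; apply/eqP; congr (_ * powR _ _).
by field.
Qed.

Lemma ex_argmax (R : realType) (f : nat -> R) (n : nat) :
  exists2 i, (i < n.+1)%N & forall j, (j < n.+1)%N -> f j <= f i.
Proof.
elim: n => [|n [i iN hi]]; first by exists 0%N => // j; rewrite ltnS leqn0 => /eqP ->.
have [h|h] := leP (f n.+1) (f i).
  exists i; first exact: ltnW.
  by move=> j; rewrite ltnS leq_eqVlt => /orP[/eqP ->//|]; exact: hi.
exists n.+1 => // j; rewrite ltnS leq_eqVlt => /orP[/eqP ->//|/hi]; lra.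
Qed.

Lemma prod_le_factor (R : realType) (f : nat -> R) (n x : nat) :
  (forall i, 0 <= f i <= 1) -> (x < n)%N -> \prod_(i < n) f i <= f x.
Proof.
move=> h xn; rewrite (bigD1 (Ordinal xn)) //= ler_piMr; [by []|by case/andP: (h x)|].
apply: le_trans (_ : \prod_(i < n | i != Ordinal xn) 1 <= _); last by rewrite big1.
by apply: ler_prod => i _; exact: h.
Qed.

Lemma prod_le_expn (R : realType) (f : nat -> R) (n : nat) (y : R) :
  (forall i, 0 <= f i) -> (forall i, (i < n)%N -> f i <= y) -> \prod_(i < n) f i <= y ^+ n.
Proof.
move=> h0 h; rewrite -[n in X in _ <= X](card_ord n) -prodr_const.
by apply: ler_prod => i _; rewrite h0 h.
Qed.

Lemma sum_lt_le (R : realType) (n k : nat) : \sum_(i < n) ((i < k)%N)%:R <= k%:R :> R.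
Proof.
elim: n k => [|n IH] [|k]; rewrite ?big_ord0 ?ler0n //.
  by rewrite big1.
by rewrite big_ord_recl -natr1 addrC; apply: lerD => //; exact: IH.
Qed.

(** This combines the smallness without rate of each term with the boundedness of the sum of
    [20/21]-th powers. *)
Lemma powR_split (R : realType) (x y eps : R) : 0 <= x -> x <= y -> x <= eps ->
  x <= eps `^ (21^-1) * y `^ (20 / 21).
Proof.
move=> x0 xy xe.
have -> : x = x `^ (21^-1) * x `^ (20 / 21).
  rewrite -powRD; last by apply/implyP => /eqP e; exfalso; lra.
  by have -> : 21^-1 + 20 / 21 = 1 :> R; [field|rewrite powRr1].
by apply: ler_pM; rewrite ?powR_ge0 //; apply: powR_mono => //; rewrite ?invr_ge0 //; lra.
Qed.

Definition ssum (R : realType) (b : nat -> nat -> R) (n m : nat) (M thr thr' : R) (i j k : nat) : R :=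
  ((thr < range_freq b n m M i k ^+ 4) && (range_freq b n m M j k ^+ 4 <= thr'))%:R
     * (range_freq b n m M i k ^+ 7 * range_freq b n m M j k ^+ 2).

Definition msum (R : realType) (b : nat -> nat -> R) (n m : nat) (M thr thr' : R) (i j k : nat) : R :=
  ((thr < range_freq b n m M i k ^+ 4) && (thr' < range_freq b n m M j k ^+ 4))%:R
     * (range_freq b n m M i k ^+ 7 * range_freq b n m M j k ^+ 2) `^ (20 / 21).

Lemma major_all (R : realType) (b : nat -> nat -> R) (n : nat) (C CM eta : R) :
  (forall i, (i < 7)%N -> b i 3%N != 0) -> (forall i, (7 <= i < 9)%N -> 0 < b i 3%N) ->
  0 < C -> 0 < CM -> 0 < eta -> (0 < n)%N ->
  (forall (b3 b2 b1 b0 M thr : R) (s X N : nat), (0 < X)%N -> C * X%:R `^ (- (397 / 400)) <= thr ->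
    weyl_dich C thr M b3 X N (fun k => freq (k%:R / M) (vals b3 b2 b1 b0 s X) / X%:R)) ->
  exists2 C1 : R, 0 <= C1 & forall d, 0 < d -> exists m0 : nat, forall m, (m0 <= m)%N ->
    forall (N : nat) (M thr thr' : R),
    M = CM * (m ^ 40)%:R ^+ 3 -> eta * N.+1%:R <= 3 * M ->
    thr = C * (m ^ 40)%:R `^ (- (397 / 400)) -> thr' = C * (m ^ 31)%:R `^ (- (397 / 400)) ->
    \sum_(k < N.+1) \sum_(p : 'I_7 * 'I_2) ssum b n m M thr thr' p.1 (p.2 + 7) k <= d /\
    \sum_(k < N.+1) \sum_(p : 'I_7 * 'I_2) msum b n m M thr thr' p.1 (p.2 + 7) k <= C1.
Proof.
move=> bn bp C0 CM0 eta0 n0 hC.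
pose nn i := if i == 0%N then n else 1%N.
have nn0 i : (0 < nn i)%N by rewrite /nn; case: ifP.
have bp' (j : 'I_2) : 0 < b (j + 7)%N 3%N by apply: bp; have := ltn_ord j; clear; lia.
have /choice [C1 hC1] : forall p : 'I_7 * 'I_2, exists C1 : R, 0 <= C1 /\
   forall d, 0 < d -> exists m0 : nat, forall m, (m0 <= m)%N ->
    forall (N : nat) (M thr thr' : R),
    M = CM * (m ^ 40)%:R ^+ 3 -> eta * N.+1%:R <= 3 * M ->
    thr = C * (m ^ 40)%:R `^ (- (397 / 400)) -> thr' = C * (m ^ 31)%:R `^ (- (397 / 400)) ->
    \sum_(k < N.+1) ssum b n m M thr thr' p.1 (p.2 + 7) k <= d /\
    \sum_(k < N.+1) msum b n m M thr thr' p.1 (p.2 + 7) k <= C1.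
  move=> [i j] /=.
  have [C1 C10 h] := major_pair (ltW C0) (bn i (ltn_ord i)) (bp' j) CM0 (nn0 i) eta0.
  exists C1; split => // d d0; have [m0 hm0] := h d d0.
  exists (maxn m0 1) => m; rewrite geq_max => /andP[mm m1] N M thr thr' ME hN tE tE'.
  have P0 : (0 < m ^ 40)%N by rewrite expn_gt0 m1.
  have Y0 : (0 < m ^ 31)%N by rewrite expn_gt0 m1.
  apply: (hm0 m mm N M thr thr' (range_freq b n m M i) (range_freq b n m M (j + 7)%N) ME hN) => //.
  - by move=> k; exact: lam_ge0.
  - by move=> k; exact: lam_ge0.
  - rewrite /range_freq /range_vals /range_len ltn_ord; apply: hC; first by rewrite muln_gt0 nn0.
    rewrite tE ler_pM2l //; apply: powRN_le; rewrite ?ltr0n // ?ler_nat ?leq_pmull //; lra.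
  - rewrite /range_freq /range_vals /range_len (_ : (j + 7 < 7)%N = false); last by rewrite ltnNge leq_addl.
    by apply: hC => //; rewrite tE'.
exists (\sum_p C1 p); first by apply: sumr_ge0 => p _; case: (hC1 p).
move=> d d0.
have d14 : 0 < d / 14 by rewrite divr_gt0.
have /choice [m0 hm0] : forall p : 'I_7 * 'I_2, exists m0 : nat, forall m, (m0 <= m)%N ->
    forall (N : nat) (M thr thr' : R),
    M = CM * (m ^ 40)%:R ^+ 3 -> eta * N.+1%:R <= 3 * M ->
    thr = C * (m ^ 40)%:R `^ (- (397 / 400)) -> thr' = C * (m ^ 31)%:R `^ (- (397 / 400)) ->
    \sum_(k < N.+1) ssum b n m M thr thr' p.1 (p.2 + 7) k <= d / 14 /\
    \sum_(k < N.+1) msum b n m M thr thr' p.1 (p.2 + 7) k <= C1 p.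
  by move=> p; have [_ h] := hC1 p; exact: h.
exists (\max_p m0 p) => m hm N M thr thr' ME hN tE tE'.
have key p := hm0 p m (leq_trans (leq_bigmax p) hm) N M thr thr' ME hN tE tE'.
rewrite ![\sum_(k < N.+1) _]exchange_big /=; split.
  apply: le_trans (_ : \sum_(p : 'I_7 * 'I_2) d / 14 <= _).
    by apply: ler_sum => p _; case: (key p).
  by rewrite sumr_const card_prod !card_ord -mulr_natr; lra.
by apply: ler_sum => p _; case: (key p).
Qed.

(** Each term is dominated by one of four contributions of total at most [d / 4]: frequencies below
    [K1], five small long sums, a large long sum with small short sums, and large sums of both
    kinds. In the last case [two_phase_sup] supplies the bound [eps]. It applies since [i2 <= 1], so
    that variables [0] and [i2] both have ranges that start at 0. *)
Lemma circle_sum (R : realType) (b : nat -> nat -> R) (n i2 j1 j2 : nat) (CM eta d : R) :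
  b 0%N 3%N < 0 -> (forall i, (1 <= i < 9)%N -> 0 < b i 3%N) -> (i2 <= 1)%N ->
  0 < CM -> 0 < eta -> 0 < d -> (0 < n)%N ->
  coef3 (b i2 3%N) (b i2 2%N) (b i2 1%N) j2 != 0 ->
  irrational (coef3 (b 0%N 3%N) (b 0%N 2%N) (b 0%N 1%N) j1 / coef3 (b i2 3%N) (b i2 2%N) (b i2 1%N) j2) ->
  exists K0 : R, forall K : nat, (0 < K)%N -> K0 <= K%:R -> exists m0 : nat, forall m, (m0 <= m)%N ->
    forall (N : nat) (M : R), M = CM * (m ^ 40)%:R ^+ 3 -> M <= eta * N.+1%:R -> eta * N.+1%:R <= 3 * M ->
    pair_bdd b n m 5 7 M -> pair_bdd b n m 6 8 M ->
    \sum_(1 <= k < N.+1) Num.min 1 (k%:R / K%:R) * \prod_(i < 9) range_freq b n m M i k <= d.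
Proof.
move=> b0n bp i21 CM0 eta0 d0 n0 g0 irr.
have [C C0 hC] := freq_dich R.
have bn i : (i < 7)%N -> b i 3%N != 0.
  by case: i => [|i] hi; [rewrite lt_eqF|rewrite gt_eqF // bp //; move: hi; clear; lia].
have bp7 i : (7 <= i < 9)%N -> 0 < b i 3%N by move=> h; apply: bp; move: h; clear; lia.
have bp5 i : (5 <= i < 9)%N -> 0 < b i 3%N by move=> h; apply: bp; move: h; clear; lia.
have [S S0 hS] := major_all bn bp7 C0 CM0 eta0 n0 hC.
(* [S] bounds the sum of the [20/21]-th powers, and [eps^(1/21) <= e0] turns it into at most
   [d / 4]. *)
pose e0 := d / (4 * (S + 1)).
have e00 : 0 < e0 by rewrite divr_gt0 // mulr_gt0 //; lra.
pose eps := Num.min 1 (e0 ^+ 21).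
have eps0 : 0 < eps by rewrite lt_min ltr01 exprn_gt0.
have eps1 : eps <= 1 by rewrite ge_min lexx.
have epsr : eps `^ (21^-1) <= e0.
  have -> : e0 = (e0 ^+ 21) `^ (21^-1).
    by rewrite -powR_mulrn ?(ltW e00) // -powRrM divff ?pnatr_eq0 // powRr1 // ltW.
  apply: powR_mono; rewrite ?(ltW eps0) ?invr_ge0 //.
  by rewrite ge_min lexx orbT.
have A0 : 0 < 3 / eta by rewrite divr_gt0.
pose n2 := if i2 == 0%N then n else 1%N.
have n20 : (0 < n2)%N by rewrite /n2; case: ifP.
have d30 : b i2 3%N != 0 by apply: bn; move: i21; clear; lia.
have [K1 K10 hK1] := two_phase_sup (b 0%N 0%N) (b i2 0%N) d30 eps0 eps1 A0 CM0 n0 n20 g0 irr.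
pose ka := (Num.Def.truncn K1).+1.
have hka : K1 <= ka%:R by have /andP[_ /ltW] := truncn_itv (ltW K10).
(* At most [ka] frequencies lie below [K1], each of weight at most [K1 / K]; a [K] of this size
   bounds their total by [d / 4]. *)
exists (4 * (ka%:R * K1) / d) => K Kp hK.
have KR : (0 : R) < K%:R by rewrite ltr0n.
have d4 : 0 < d / 4 by lra.
have [m1 hm1] := hS (d / 4) d4.
have [m2 hm2] := minor_sum n bp5 (ltW C0) CM0 eta0 d4.
have [m3 hm3] := nat_above K1.
exists (maxn (maxn m1 m2) (maxn m3 1)) => m; rewrite !geq_max => /andP[/andP[mm1 mm2] /andP[mm3 mp]].
move=> N M ME hN1 hN2 pb1 pb2.
pose thr := C * (m ^ 40)%:R `^ (- (397 / 400)).
pose thr' := C * (m ^ 31)%:R `^ (- (397 / 400)).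
have [B1 B2] := hm1 m mm1 N M thr thr' ME hN2 erefl erefl.
have B3 := hm2 m mm2 N M thr ME hN1 hN2 pb1 pb2 erefl.
have PR : (0 : R) < (m ^ 40)%:R by rewrite ltr0n expn_gt0 mp.
have M0 : 0 < M by rewrite ME mulr_gt0 ?exprn_gt0.
have K1P : K1 <= (m ^ 40)%:R.
  by apply: le_trans (hm3 m mm3) _; rewrite ler_nat -{1}(expn1 m) leq_pexp2l.
pose nu k := \prod_(i < 9) range_freq b n m M i k.
have nu0 k : 0 <= nu k by apply: prodr_ge0 => i _; exact: lam_ge0.
have l01 k i : 0 <= range_freq b n m M i k <= 1 by rewrite lam_ge0 lam_le1.
have nu_fac k x : (x < 9)%N -> nu k <= range_freq b n m M x k.
  by move=> x9; exact: (@prod_le_factor R (fun i => range_freq b n m M i k) 9 x (l01 k) x9).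
have nu1 k : nu k <= 1 by apply: le_trans (nu_fac k 0%N isT) _; exact: lam_le1.
pose mi k : R := [forall i : 'I_5, range_freq b n m M i k ^+ 4 <= thr]%:R * nu k.
pose al k : R := K1 / K%:R * ((k < ka)%N)%:R.
pose sm k := \sum_(p : 'I_7 * 'I_2) ssum b n m M thr thr' p.1 (p.2 + 7) k.
pose ma k := \sum_(p : 'I_7 * 'I_2) msum b n m M thr thr' p.1 (p.2 + 7) k.
have mi0 k : 0 <= mi k by rewrite mulr_ge0 ?ler0n.
have al0 k : 0 <= al k by rewrite mulr_ge0 ?ler0n // divr_ge0 // ltW.
have ss0 i j k : 0 <= ssum b n m M thr thr' i j k.
  by rewrite mulr_ge0 ?ler0n // mulr_ge0 ?exprn_ge0 ?lam_ge0.
have ms0 i j k : 0 <= msum b n m M thr thr' i j k by rewrite mulr_ge0 ?ler0n ?powR_ge0.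
have sm0 k : 0 <= sm k by exact: sumr_ge0.
have ma0 k : 0 <= ma k by exact: sumr_ge0.
pose er := eps `^ (21^-1).
have er0 : 0 <= er by exact: powR_ge0.
have ptw k : (0 < k < N.+1)%N -> Num.min 1 (k%:R / K%:R) * nu k <= al k + mi k + sm k + er * ma k.
  case/andP=> k0 kN; have em0 := mulr_ge0 er0 (ma0 k).
  have mi0k := mi0 k; have al0k := al0 k; have sm0k := sm0 k.
  have mn0 : 0 <= Num.min 1 (k%:R / K%:R) :> R by rewrite le_min ler01 divr_ge0 ?ler0n.
  have [kK|kK] := ltP k%:R K1.
    have : Num.min 1 (k%:R / K%:R) * nu k <= al k; last by clear -em0 mi0k sm0k; lra.
    apply: le_trans (_ : k%:R / K%:R * 1 <= _).
      by apply: ler_pM => //; rewrite ge_min lexx orbT.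
    have kka : (k < ka)%N by rewrite -(ltr_nat R); clear -hka kK; lra.
    by rewrite /al kka !mulr1 ler_pM2r ?invr_gt0 // ltW.
  apply: le_trans (_ : nu k <= _).
    by rewrite ler_piMl // ge_min lexx.
  have [mn|] := boolP [forall i : 'I_5, range_freq b n m M i k ^+ 4 <= thr].
    have : mi k = nu k by rewrite /mi mn mul1r.
    by clear -al0k sm0k em0; lra.
  rewrite negb_forall => /existsP[i0]; rewrite -ltNge => hi0.
  (* The largest of the seven long sums and the larger of the two short ones: the product of all
     nine is at most the seventh power of the first times the square of the second. *)
  have [i iN hi] := ex_argmax (fun i => range_freq b n m M i k) 6.
  have [j jN hj] := ex_argmax (fun j => range_freq b n m M (j + 7)%N k) 1.
  have la0 := lam_ge0 b n m M i k; have lb0 := lam_ge0 b n m M (j + 7) k.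
  set y := range_freq b n m M i k ^+ 7 * range_freq b n m M (j + 7) k ^+ 2.
  have nuy : nu k <= y.
    rewrite /nu 2!big_ord_recr /= -mulrA /y; apply: ler_pM.
    - by apply: prodr_ge0 => x _; exact: lam_ge0.
    - by rewrite mulr_ge0 ?lam_ge0.
    - exact: (@prod_le_expn R (fun x => range_freq b n m M x k) 7 _ (fun x => lam_ge0 _ _ _ _ _ _) hi).
    rewrite expr2; apply: ler_pM; rewrite ?lam_ge0 //; [exact: (hj 0%N)|exact: (hj 1%N)].
  have thi : thr < range_freq b n m M i k ^+ 4.
    apply: (lt_le_trans hi0); rewrite lerXn2r ?nnegrE ?lam_ge0 // hi //.
    by apply: ltn_trans (ltn_ord i0) _.
  have [bs|bl] := leP (range_freq b n m M (j + 7) k ^+ 4) thr'.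
    have : y <= sm k; last by clear -nuy mi0k al0k em0; lra.
    rewrite /sm (bigD1 (Ordinal iN, Ordinal jN)) //= -[X in X <= _]addr0; apply: lerD.
      by rewrite /ssum thi bs mul1r.
    exact: sumr_ge0.
  have nue : nu k <= eps.
    have hk : k%:R / M * (CM * (m ^ 40)%:R ^+ 3) = k%:R by rewrite -ME divfK // gt_eqF.
    have kM0 : 0 <= k%:R / M by rewrite divr_ge0 ?ler0n // ltW.
    have kA : k%:R / M <= 3 / eta.
      rewrite ler_pdivrMr // mulrAC ler_pdivlMr // mulrC; apply: le_trans hN2.
      by rewrite ler_pM2l // ler_nat ltnW.
    have [h|h] := hK1 (m ^ 40)%N (k%:R / M) K1P kM0 kA ltac:(by rewrite hk).
      apply: le_trans (nu_fac k 0%N isT) _.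
      rewrite /range_freq /range_vals /range_len /range_start /= freq_vals0 ler_pdivrMr ?ltW //.
      by rewrite ltr0n muln_gt0 n0 expn_gt0 mp.
    have i29 : (i2 < 9)%N by apply: leq_ltn_trans i21 _.
    apply: le_trans (nu_fac k i2 i29) _.
    rewrite /range_freq /range_vals /range_len /range_start (leq_ltn_trans i21 _) // (leq_ltn_trans i21 _) // -/n2 freq_vals0.
    rewrite ler_pdivrMr ?ltW //.
    by rewrite ltr0n muln_gt0 n20 expn_gt0 mp.
  have := powR_split (nu0 k) nuy nue.
  have : er * y `^ (20 / 21) <= er * ma k; last by rewrite /er; clear -al0k mi0k sm0k; lra.
  rewrite ler_wpM2l // /ma (bigD1 (Ordinal iN, Ordinal jN)) //= -[X in X <= _]addr0; apply: lerD.
    by rewrite /msum thi bl mul1r.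
  exact: sumr_ge0.
apply: le_trans (_ : \sum_(k < N.+1) (al k + mi k + sm k + er * ma k) <= _).
  rewrite -(big_mkord xpredT (fun k => al k + mi k + sm k + er * ma k)) [X in _ <= X]big_ltn //.
  rewrite -[X in X <= _]add0r; apply: lerD.
    by rewrite !addr_ge0 // mulr_ge0.
  by rewrite [X in X <= _]big_nat [X in _ <= X]big_nat; apply: ler_sum => k; exact: ptw.
rewrite !big_split /= -!mulr_sumr.
have S1 : K1 / K%:R * \sum_(i < N.+1) ((i < ka)%N)%:R <= d / 4.
  apply: le_trans (ler_wpM2l _ (sum_lt_le R N.+1 ka)) _; first by rewrite divr_ge0 ?ltW.
  rewrite mulrAC ler_pdivrMr //.
  have : 4 * (ka%:R * K1) <= K%:R * d by rewrite -ler_pdivrMr.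
  clear; lra.
have S2 : er * \sum_(i < N.+1) ma i <= d / 4.
  have ms : 0 <= \sum_(i < N.+1) ma i by apply: sumr_ge0 => k _; exact: ma0.
  apply: le_trans (ler_pM er0 ms epsr B2) _.
  rewrite /e0 mulrAC ler_pdivrMr ?mulr_gt0 //; last by clear -S0; lra.
  have := mulr_ge0 (ltW d0) S0; clear -d0; lra.
move: B1 B3; rewrite -/(nu _) => B1 B3.
clear -S1 S2 B1 B3; lra.
Qed.

(** * Nine cubics *)

Definition bcub (R : realType) (b : nat -> nat -> R) (i : nat) (x : R) : R :=
  cubic (b i 3%N) (b i 2%N) (b i 1%N) (b i 0%N) x.

Definition bnorm (R : realType) (b : nat -> nat -> R) (i : nat) : R :=
  cnorm (b i 3%N) (b i 2%N) (b i 1%N) (b i 0%N).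

Lemma bnorm_ge0 (R : realType) (b : nat -> nat -> R) (i : nat) : 0 <= bnorm b i.
Proof. by rewrite !addr_ge0. Qed.

Lemma cubic_step (R : realType) (b3 b2 b1 b0 : R) (x X : R) : 0 <= x -> x + 1 <= X -> 1 <= X ->
  `|cubic b3 b2 b1 b0 (x + 1) - cubic b3 b2 b1 b0 x| <= (7 * `|b3| + 3 * `|b2| + `|b1|) * X ^+ 2.
Proof.
move=> x0 xX X1; rewrite cubic_sub /dcub mul1r.
have X2 : 1 <= X ^+ 2 by rewrite exprn_ege1.
have k0 : 0 <= 3 * x ^+ 2 + 3 * x * 1 + 1 ^+ 2 by have := sqr_ge0 x; rewrite expr1n; lra.
have k1 : 3 * x ^+ 2 + 3 * x * 1 + 1 ^+ 2 <= 7 * X ^+ 2.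
  by have : (x + 1) ^+ 2 <= X ^+ 2; [rewrite lerXn2r ?nnegrE //; lra|rewrite !expr2; have := mulr_ge0 x0 x0; lra].
have l0 : 0 <= 2 * x + 1 by lra.
have l1 : 2 * x + 1 <= 3 * X ^+ 2.
  have : X <= X ^+ 2 by rewrite -[X in X <= _]expr1 ler_weXn2l.
  lra.
have t1 := ler_normD (b3 * (3 * x ^+ 2 + 3 * x * 1 + 1 ^+ 2) + b2 * (2 * x + 1)) b1.
have t2 := ler_normD (b3 * (3 * x ^+ 2 + 3 * x * 1 + 1 ^+ 2)) (b2 * (2 * x + 1)).
have m3 : `|b3 * (3 * x ^+ 2 + 3 * x * 1 + 1 ^+ 2)| <= `|b3| * (7 * X ^+ 2) by rewrite normrM (ger0_norm k0) ler_wpM2l.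
have m2 : `|b2 * (2 * x + 1)| <= `|b2| * (3 * X ^+ 2) by rewrite normrM (ger0_norm l0) ler_wpM2l.
have m1 : `|b1| <= `|b1| * X ^+ 2 by rewrite ler_peMr.
apply: le_trans t1 _; apply: le_trans (lerD (le_trans t2 (lerD m3 m2)) m1) _.
by rewrite le_eqVlt; apply/orP; left; apply/eqP; ring.
Qed.

Lemma mem_Lv (R : realType) (b : nat -> nat -> R) (n m i : nat) (v : R) : v \in range_vals b n m i ->
  exists2 t, (t < range_len n m i)%N & v = bcub b i (range_start m i + t)%:R.
Proof. by case/mapP => t; rewrite mem_iota add0n => h ->; exists t. Qed.

Lemma start_len_le (n m i : nat) : (0 < m)%N -> (0 < i)%N -> (range_start m i + range_len n m i <= (2 * m ^ 40).+1)%N.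
Proof.
move=> m0 i0; rewrite /range_start /range_len (gtn_eqF i0) mul1n.
have h : (m ^ 31 <= m ^ 40)%N by rewrite leq_pexp2l.
by case: ifP => h5; case: ifP => h7; move: h h5 h7; move: (m ^ 31)%N (m ^ 40)%N => y p; clear; lia.
Qed.

Lemma two_le_sum (R : realType) (f : nat -> R) (r : seq nat) (i j : nat) : uniq r ->
  i \in r -> j \in r -> i != j -> (forall k, 0 <= f k) -> f i + f j <= \sum_(k <- r) f k.
Proof.
move=> ur ir jr ij f0; rewrite (big_rem i) //= (big_rem j) /=; last first.
  by rewrite mem_rem_uniq // inE eq_sym ij.
by rewrite addrA lerDl sumr_ge0.
Qed.

Lemma Lv_bound (R : realType) (b : nat -> nat -> R) (n m i : nat) (v : R) : (0 < m)%N -> (0 < i)%N ->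
  v \in range_vals b n m i -> `|v| <= 8 * bnorm b i * (m ^ 40)%:R ^+ 3.
Proof.
move=> mp i0 /mem_Lv [t tl ->].
have P1 : (1 : R) <= (m ^ 40)%:R by rewrite ler1n expn_gt0 mp.
have -> : 8 * bnorm b i * (m ^ 40)%:R ^+ 3 = bnorm b i * (2 * (m ^ 40)%:R) ^+ 3 :> R by ring.
apply: cubic_norm_le; rewrite ?ler0n //; last by lra.
by rewrite -natrM ler_nat; have := start_len_le n mp i0; move: tl; move: (m ^ 40)%N; clear; lia.
Qed.

Lemma Lv0_bound (R : realType) (b : nat -> nat -> R) (n m : nat) (v : R) :
  v \in range_vals b n m 0 -> `|v| <= bnorm b 0 * n%:R ^+ 3 * (m ^ 40)%:R ^+ 3.
Proof.
move=> /mem_Lv [t]; rewrite /range_len /range_start /= add0n => tl ->.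
rewrite -mulrA -exprMn -natrM; apply: cubic_norm_le; rewrite ?ler0n // ?ler_nat ?(ltnW tl) //.
by rewrite ler1n (leq_ltn_trans _ tl).
Qed.

Definition rest_norm (R : realType) (b : nat -> nat -> R) (c0 : R) : R :=
  \sum_(i <- iota 1 8) 8 * bnorm b i + `|c0| + 1.

(** Variable 5 exceeds [P] and its cubic alone is of order [P^3], while the other cubics and the
    constant are bounded below. The contribution of variables 1 to 8 is thus positive of exact order
    [P^3], at a height that variable 0 can cancel. *)
Lemma rest_bounds (R : realType) (b : nat -> nat -> R) (c0 : R) (n m : nat) (B : nat -> R) (w : R) :
  (0 < m)%N -> (forall i, (1 <= i < 9)%N -> 0 < b i 3%N) ->
  (forall i, (1 <= i < 9)%N -> forall x, 0 <= x -> b i 3%N / 2 * x ^+ 3 - B i <= bcub b i x) ->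
  \sum_(i <- iota 1 8) B i + `|c0| <= b 5%N 3%N / 4 * (m ^ 40)%:R ^+ 3 ->
  w \in sumset c0 [seq range_vals b n m i | i <- iota 1 8] ->
  b 5%N 3%N / 4 * (m ^ 40)%:R ^+ 3 <= w /\ `|w| <= rest_norm b c0 * (m ^ 40)%:R ^+ 3.
Proof.
move=> mp bp hB hm.
have P1 : (1 : R) <= (m ^ 40)%:R by rewrite ler1n expn_gt0 mp.
have P31 : 1 <= ((m ^ 40)%:R : R) ^+ 3 by rewrite exprn_ege1.
case/(mem_sumset (iota_uniq 1 8)) => y hy ->; split.
  have ly j : j \in iota 1 8 -> (if j == 5%N then b 5%N 3%N / 2 * (m ^ 40)%:R ^+ 3 else 0) - B j <= y j.
    move=> jj; have jr : (1 <= j < 9)%N by move: jj; rewrite mem_iota.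
    have /mem_Lv [t tl ->] := hy j jj; apply: le_trans (hB j jr _ (ler0n _ _)); rewrite lerD2r.
    have bj : 0 <= b j 3%N / 2 by rewrite divr_ge0 // ltW // bp.
    case: eqP => [j5|_]; last by rewrite mulr_ge0 // exprn_ge0.
    move: bj tl; rewrite j5 => bj tl; rewrite ler_wpM2l //.
    by rewrite lerXn2r ?nnegrE ?ler0n // ler_nat /range_start /= addSn leqW // leq_addr.
  have : \sum_(j <- iota 1 8) ((if j == 5%N then b 5%N 3%N / 2 * (m ^ 40)%:R ^+ 3 else 0) - B j) <= \sum_(j <- iota 1 8) y j.
    by rewrite big_seq [X in _ <= X]big_seq; apply: ler_sum.
  rewrite sumrB.
  have -> : \sum_(j <- iota 1 8) (if j == 5%N then b 5%N 3%N / 2 * (m ^ 40)%:R ^+ 3 else 0) = 2 * (b 5%N 3%N / 4 * (m ^ 40)%:R ^+ 3).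
    by rewrite /= !big_cons big_nil /=; lra.
  have : - `|c0| <= c0 by rewrite lerNl -normrN; exact: ler_norm.
  lra.
have sb : `|\sum_(j <- iota 1 8) y j| <= \sum_(j <- iota 1 8) 8 * bnorm b j * (m ^ 40)%:R ^+ 3.
  apply: le_trans (ler_norm_sum _ _ _) _; rewrite big_seq [X in _ <= X]big_seq.
  apply: ler_sum => j jj; apply: (@Lv_bound R b n m) => //; last exact: hy.
  by move: jj; rewrite mem_iota => /andP[].
apply: le_trans (ler_normD _ _) _; rewrite /rest_norm 2!mulrDl mul1r.
rewrite -mulr_suml in sb.
have : `|c0| <= `|c0| * (m ^ 40)%:R ^+ 3 by rewrite ler_peMr.
lra.
Qed.

(** Minus the cubic of variable 0 starts below [L / 2] and climbs above [Cw P^3 >= w], with steps at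
    most [sg P^2]. As [T <= L / 2], there is room for [r] values within [T] of [w]. *)
Lemma central_count (R : realType) (b : nat -> nat -> R) (n m r : nat) (Ba Cw T w sg L : R) :
  b 0%N 3%N < 0 -> (0 < m)%N -> (0 < n)%N -> 0 <= Ba ->
  (forall x, 0 <= x -> - b 0%N 3%N / 2 * x ^+ 3 - Ba <= - bcub b 0 x) ->
  Cw + Ba <= - b 0%N 3%N / 2 * n%:R -> `|w| <= Cw * (m ^ 40)%:R ^+ 3 ->
  sg = (7 * `|b 0%N 3%N| + 3 * `|b 0%N 2%N| + `|b 0%N 1%N|) * n%:R ^+ 2 ->
  sg * (m ^ 40)%:R ^+ 2 * r%:R <= T -> 2 * `|b 0%N 0%N| <= L -> T <= L / 2 -> L <= w ->
  (r <= count (fun v => `|v + w| <= T)%R (range_vals b n m 0))%N.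
Proof.
move=> b0n mp n0 Ba0 hBa hn wu sgE Sr bL TL Lw.
have P1 : (1 : R) <= (m ^ 40)%:R by rewrite ler1n expn_gt0 mp.
have P31 : 1 <= ((m ^ 40)%:R : R) ^+ 3 by rewrite exprn_ege1.
have nR : (1 : R) <= n%:R by rewrite ler1n.
have nR0 : (0 : R) < n%:R by lra.
have sg0 : 0 < sg.
  rewrite sgE mulr_gt0 // ?exprn_gt0 //.
  have : 0 < `|b 0%N 3%N| by rewrite normr_gt0 lt_eqF.
  have := normr_ge0 (b 0%N 2%N); have := normr_ge0 (b 0%N 1%N); lra.
pose g (x : nat) := - bcub b 0 x%:R.
have -> : count (fun v => (`|v + w| <= T)%R) (range_vals b n m 0) = count (fun v => `|v - w| <= T)%R [seq g i | i <- iota 0 (n * m ^ 40)].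
  rewrite /range_vals /vals /range_start /range_len /= !count_map; apply: eq_count => i /=.
  by rewrite add0n /g /bcub -normrN opprD.
apply: (@count_fill R g (sg * (m ^ 40)%:R ^+ 2) T w (n * m ^ 40) r) => //.
- by rewrite mulr_gt0 // exprn_gt0 //; lra.
- move=> x xX; rewrite /g opprK addrC distrC -normrN opprB /bcub -(natr1 x).
  have -> : sg * (m ^ 40)%:R ^+ 2 = (7 * `|b 0%N 3%N| + 3 * `|b 0%N 2%N| + `|b 0%N 1%N|) * (n * m ^ 40)%:R ^+ 2.
    by rewrite sgE natrM; ring.
  rewrite distrC; apply: cubic_step; rewrite ?ler0n // ?natr1 ?ler_nat //.
  by rewrite ler1n (leq_ltn_trans _ xX).
- have : g 0%N <= `|b 0%N 0%N|.
    rewrite /g /bcub /cubic !expr0n /= !mulr0 !add0r -normrN; exact: ler_norm.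
  lra.
have h1 : Cw * (m ^ 40)%:R ^+ 3 <= g (n * m ^ 40)%N.
  apply: le_trans (hBa (n * m ^ 40)%:R (ler0n _ _)); rewrite natrM exprMn.
  have n3 : n%:R <= n%:R ^+ 3 :> R by rewrite -[X in X <= _]expr1 ler_weXn2l.
  have k1 : (Cw + Ba) * (m ^ 40)%:R ^+ 3 <= - b 0%N 3%N / 2 * n%:R ^+ 3 * (m ^ 40)%:R ^+ 3.
    rewrite ler_pM2r; last by lra.
    by apply: (le_trans hn); rewrite ler_pM2l //; lra.
  have : Ba <= Ba * (m ^ 40)%:R ^+ 3 by rewrite ler_peMr.
  rewrite mulrDl in k1; lra.
by have := ler_norm w; lra.
Qed.

(** Arithmetic of the constants: the left side is at least [sz ka N], and each of the two terms on
    the right is at most a quarter of that. The [300] bounds [148 (N + 1) + 16 K^3] divided by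
    [N]. *)
Lemma kernel_contra (R : realType) (CM sg n P z r K N F d ka cn sz : R) :
  0 < CM -> 0 < sg -> 0 < n -> 0 < P -> 0 < z -> 0 < K ->
  ka = CM / (64 * sg * n) -> d = ka / (4 * 1024 * 300) ->
  CM * P / (16 * K * sg) / 2 <= r -> r * z <= cn -> sz = n * P * z -> 0 <= F -> F <= sz * d ->
  8 * K + 16 * K ^+ 3 + 512 * 256 * K ^+ 2 / ka + 1 <= N ->
  cn * (K / 2) * N <= 1024 * (148 * (N + 1) + 16 * K ^+ 3) * F + 1024 * 16 * K ^+ 2 * sz / N * 2 -> False.
Proof.
move=> CM0 sg0 n0 P0 z0 K0 kaE dE hr hcn szE F0 Fd hN hk.
have ka0 : 0 < ka by rewrite kaE divr_gt0 // mulr_gt0 // mulr_gt0.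
have K30 : 0 < K ^+ 3 by rewrite exprn_gt0.
have K20 : 0 < K ^+ 2 by rewrite exprn_gt0.
have Kk : 0 < 512 * 256 * K ^+ 2 / ka by rewrite divr_gt0 // mulr_gt0 // mulr_gt0.
have N1 : 1 <= N by clear -K0 hN K30 Kk; lra.
have N0 : 0 < N by clear -K0 hN K30 Kk; lra.
have szp : 0 < sz by rewrite szE mulr_gt0 // mulr_gt0.
have K2 : 0 < K / 2 by rewrite divr_gt0.
have lhs : sz * ka * N <= cn * (K / 2) * N.
  rewrite ler_pM2r //; apply: le_trans (_ : r * z * (K / 2) <= _); last by rewrite ler_pM2r.
  have -> : sz * ka = CM * P / (16 * K * sg) / 2 * z * (K / 2).
    by rewrite szE kaE; field; rewrite (gt_eqF K0) (gt_eqF sg0) (gt_eqF n0).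
  by rewrite ler_pM2r // ler_pM2r.
have rhs1 : 1024 * (148 * (N + 1) + 16 * K ^+ 3) * F <= sz * (ka / 4) * N.
  have h1 : 1024 * (148 * (N + 1) + 16 * K ^+ 3) <= 1024 * 300 * N by clear -K0 hN K30 Kk; lra.
  have h0 : 0 <= 1024 * (148 * (N + 1) + 16 * K ^+ 3) by clear -K0 hN K30 Kk; lra.
  apply: le_trans (ler_pM h0 F0 h1 Fd) _; rewrite le_eqVlt; apply/orP; left; apply/eqP.
  by rewrite dE; field.
have rhs2 : 1024 * 16 * K ^+ 2 * sz / N * 2 <= sz * (ka / 4) * N.
  have h1 : 512 * 256 * K ^+ 2 <= ka * N by rewrite [ka * _]mulrC -ler_pdivrMr //; clear -K0 hN K30; lra.
  have h2 : 1024 * 32 * K ^+ 2 <= ka / 4 * N * N.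
    have : ka * N * 1 <= ka * N * N by rewrite ler_wpM2l // mulr_ge0 // ltW.
    clear -h1; lra.
  have -> : 1024 * 16 * K ^+ 2 * sz / N * 2 = sz * (1024 * 32 * K ^+ 2) / N by ring.
  rewrite ler_pdivrMr //; have := ler_wpM2l (ltW szp) h2; clear; lra.
have : 0 < sz * ka * N by rewrite mulr_gt0 // mulr_gt0.
clear -hk lhs rhs1 rhs2; lra.
Qed.

Lemma choose_N (R : realType) (M eta : R) : 0 < eta -> eta <= M ->
  exists N : nat, [/\ M <= eta * N%:R, M <= eta * N.+1%:R & eta * N.+1%:R <= 3 * M].
Proof.
move=> eta0 eM; have Me0 : 0 <= M / eta by rewrite divr_ge0 //; lra.
exists (Num.Def.truncn (M / eta)).+1; move: (truncn_itv Me0).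
move: (Num.Def.truncn _) => N; rewrite ler_pdivlMr // ltr_pdivrMr // -!(natr1 N.+1) -!(natr1 N) => /andP[h1 h2].
by split; lra.
Qed.

Lemma nine_cubics (R : realType) (b : nat -> nat -> R) (c0 eta : R) (i2 j1 j2 : nat) :
  b 0%N 3%N < 0 -> (forall i, (1 <= i < 9)%N -> 0 < b i 3%N) -> (i2 <= 1)%N -> 0 < eta ->
  coef3 (b i2 3%N) (b i2 2%N) (b i2 1%N) j2 != 0 ->
  irrational (coef3 (b 0%N 3%N) (b 0%N 2%N) (b 0%N 1%N) j1 / coef3 (b i2 3%N) (b i2 2%N) (b i2 1%N) j2) ->
  exists x : nat -> nat, `|\sum_(i < 9) bcub b i (x i)%:R + c0| < eta.
Proof.
move=> b0n bp i21 eta0 g0 irr.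
have /choice [B hB] : forall i, exists B : R,
   (1 <= i < 9)%N -> forall x, 0 <= x -> b i 3%N / 2 * x ^+ 3 - B <= bcub b i x.
  move=> i; have [h|h] := boolP (1 <= i < 9)%N; last by exists 0.
  by have [B B0 hB] := cubic_ge (b i 2%N) (b i 1%N) (b i 0%N) (bp i h); exists B.
have [Bt BtE] : { x : R | x = \sum_(i <- iota 1 8) B i } by exists (\sum_(i <- iota 1 8) B i).
have [Cw CwE] : { x : R | x = rest_norm b c0 } by exists (rest_norm b c0).
have Cw1 : 1 <= Cw.
  by rewrite CwE lerDr addr_ge0 //; apply: sumr_ge0 => i _; rewrite mulr_ge0 // bnorm_ge0.
have a0 : 0 < - b 0%N 3%N by lra.
have [Ba Ba0 hBa] : exists2 Ba : R, 0 <= Ba & forall x, 0 <= x -> - b 0%N 3%N / 2 * x ^+ 3 - Ba <= - bcub b 0 x.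
  have [Ba Ba0 h] := cubic_ge (- b 0%N 2%N) (- b 0%N 1%N) (- b 0%N 0%N) a0; exists Ba => // x x0.
  by apply: le_trans (h x x0) _; rewrite le_eqVlt; apply/orP; left; apply/eqP; rewrite /bcub /cubic; ring.
(* The sum of the other variables may reach [Cw P^3]; the range of variable 0 is lengthened by [n]
   until minus its cubic reaches that height. *)
have [n n0 hn] : exists2 n : nat, (0 < n)%N & Cw + Ba <= - b 0%N 3%N / 2 * n%:R.
  have [n1 /(_ _ (leqnSn _)) h] := nat_above (2 * (Cw + Ba) / - b 0%N 3%N).
  by exists n1.+1 => //; rewrite ler_pdivrMr // in h; lra.
have nR : (1 : R) <= n%:R by rewrite ler1n.
have nR0 : (0 : R) < n%:R by lra.
have [sg sgE] : { x : R | x = (7 * `|b 0%N 3%N| + 3 * `|b 0%N 2%N| + `|b 0%N 1%N|) * n%:R ^+ 2 }.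
  by exists ((7 * `|b 0%N 3%N| + 3 * `|b 0%N 2%N| + `|b 0%N 1%N|) * n%:R ^+ 2).
have sg0 : 0 < sg.
  rewrite sgE mulr_gt0 // ?exprn_gt0 //.
  have : 0 < `|b 0%N 3%N| by rewrite normr_gt0 lt_eqF.
  have := normr_ge0 (b 0%N 2%N); have := normr_ge0 (b 0%N 1%N); lra.
have bn3 : 0 <= bnorm b 0 * n%:R ^+ 3 by rewrite mulr_ge0 ?exprn_ge0 ?bnorm_ge0.
(* The factor 4 yields [|v| <= M / 4]: the cosine is then monotone in [|v| / M] where [kernel_bound]
   needs it, and differences of two values stay within [M / 2]. *)
have [CM CME] : { x : R | x = 4 * (bnorm b 0 * n%:R ^+ 3 + Cw) } by exists (4 * (bnorm b 0 * n%:R ^+ 3 + Cw)).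
have CM0 : 0 < CM by rewrite CME; lra.
have [ka kaE] : { x : R | x = CM / (64 * sg * n%:R) } by exists (CM / (64 * sg * n%:R)).
have ka0 : 0 < ka by rewrite kaE divr_gt0 // mulr_gt0 // mulr_gt0.
have [d dE] : { x : R | x = ka / (4 * 1024 * 300) } by exists (ka / (4 * 1024 * 300)).
have d0 : 0 < d by rewrite dE divr_gt0 // mulr_gt0 // mulr_gt0.
have [K0 hK0] := circle_sum b0n bp i21 CM0 eta0 d0 n0 g0 irr.
have [cl clE] : { x : R | x = b 5%N 3%N / 4 } by exists (b 5%N 3%N / 4).
have cl0 : 0 < cl by rewrite clE divr_gt0 // bp.
have q1 : 0 < CM / (8 * cl) by rewrite divr_gt0 // mulr_gt0.
(* [K >= CM / (8 cl)] makes the window [M / (16 K)] at most half of [cl P^3], the lower bound for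
   the sum of the other variables. *)
have [K [Kp KK0 KCM]] : exists K : nat, [/\ (0 < K)%N, K0 <= K%:R & CM / (8 * cl) <= K%:R].
  have [K /(_ K (leqnn _)) hK1] := nat_above (`|K0| + CM / (8 * cl) + 1).
  have nK0 := normr_ge0 K0; have lK0 := ler_norm K0.
  by exists K; split; [rewrite -(ltr0n R)| |]; clear -hK1 nK0 lK0 q1; lra.
have KR : (0 : R) < K%:R by rewrite ltr0n.
have [m1 hm1] := hK0 K Kp KK0.
have [Nm NmE] : { x : R | x = 8 * K%:R + 16 * K%:R ^+ 3 + 512 * 256 * K%:R ^+ 2 / ka + 1 }.
  by exists (8 * K%:R + 16 * K%:R ^+ 3 + 512 * 256 * K%:R ^+ 2 / ka + 1).
have [Nm1 Nm8] : 1 <= Nm /\ 8 * K%:R <= Nm.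
  have K20 : 0 <= 512 * 256 * K%:R ^+ 2 / ka by rewrite divr_ge0 ?(ltW ka0) // mulr_ge0 ?sqr_ge0 // mulr_ge0.
  have K30 : 0 <= (K%:R : R) ^+ 3 by rewrite exprn_ge0.
  by rewrite NmE; split; clear -K20 K30 KR; lra.
have [m [mm1 mp c1 c2 [c3 c4]]] : exists m : nat, [/\ (m1 <= m)%N, (0 < m)%N,
     (Bt + `|c0|) / cl <= m%:R, 2 * `|b 0%N 0%N| / cl <= m%:R &
     16 * K%:R * sg / CM <= m%:R /\ eta * Nm / CM <= m%:R].
  have [a1 h1] := nat_above ((Bt + `|c0|) / cl).
  have [a2 h2] := nat_above (2 * `|b 0%N 0%N| / cl).
  have [a3 h3] := nat_above (16 * K%:R * sg / CM).
  have [a4 h4] := nat_above (eta * Nm / CM).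
  exists (m1 + a1 + a2 + a3 + a4).+1.
  by split; [| |apply: h1|apply: h2|split; [apply: h3|apply: h4]]; clear; lia.
have {}hm1 := hm1 m mm1.
pose P := (m ^ 40)%N.
have mP : (m%:R : R) <= P%:R by rewrite ler_nat -{1}(expn1 m) leq_pexp2l.
have P1 : (1 : R) <= P%:R by rewrite ler1n expn_gt0 mp.
have PR : (0 : R) < P%:R by clear -P1; lra.
have PP3 : (P%:R : R) <= P%:R ^+ 3 by rewrite -[X in X <= _]expr1 ler_weXn2l.
have P3 : 0 < (P%:R : R) ^+ 3 by rewrite exprn_gt0.
have big (u v : R) : 0 < v -> u / v <= m%:R -> u <= v * P%:R ^+ 3.
  by move=> v0 hu; rewrite [v * _]mulrC -ler_pdivrMr //; apply: (le_trans hu); apply: (le_trans mP).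
have {}c1 : Bt + `|c0| <= cl * P%:R ^+ 3 by exact: big.
have {}c2 : 2 * `|b 0%N 0%N| <= cl * P%:R ^+ 3 by exact: big.
have {}c4 : eta * Nm <= CM * P%:R ^+ 3 by exact: big.
have [M ME] : { x : R | x = CM * P%:R ^+ 3 } by exists (CM * P%:R ^+ 3).
have M0 : 0 < M by rewrite ME mulr_gt0.
have etaNm : eta <= eta * Nm by rewrite ler_peMr // ltW.
have eM : eta <= M by rewrite ME; apply: (le_trans etaNm).
have [N [N1 N4 N3]] := choose_N eta0 eM.
have NmN : Nm <= N%:R by rewrite -(ler_pM2l eta0); apply: (le_trans c4); rewrite -ME.
pose rest := sumset c0 [seq range_vals b n m i | i <- iota 1 8].
pose V := [seq v + w | v <- range_vals b n m 0, w <- rest].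
have VE : V = sumset c0 [seq range_vals b n m i | i <- iota 0 9] by [].
have restb w : w \in rest -> cl * P%:R ^+ 3 <= w /\ `|w| <= Cw * P%:R ^+ 3.
  by rewrite clE CwE; apply: (rest_bounds mp bp hB); rewrite -BtE -clE.
have Vb v : v \in V -> `|v| <= M / 4.
  case/allpairsP => -[x w] /= [xL /restb [_ wb] ->].
  apply: le_trans (ler_normD _ _) _; have := Lv0_bound xL; rewrite -/P => xb.
  by rewrite ME CME; move: wb xb; clear; lra.
have pb i j : (1 <= i < 9)%N -> (1 <= j < 9)%N -> i != j -> pair_bdd b n m i j M.
  move=> ir jr ij v w vi wj.
  have i0 : (0 < i)%N by case/andP: ir.
  have j0 : (0 < j)%N by case/andP: jr.
  apply: le_trans (ler_normD _ _) _.
  apply: le_trans (lerD (Lv_bound mp i0 vi) (Lv_bound mp j0 wj)) _; rewrite -/P -mulrDl ME CME.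
  have -> : 4 * (bnorm b 0 * n%:R ^+ 3 + Cw) * P%:R ^+ 3 / 4 = (bnorm b 0 * n%:R ^+ 3 + Cw) * P%:R ^+ 3 by field.
  rewrite ler_pM2r // CwE /rest_norm.
  have := @two_le_sum R (fun k => 8 * bnorm b k) (iota 1 8) i j (iota_uniq _ _).
  rewrite !mem_iota => /(_ ir jr ij (fun k => mulr_ge0 (ler0n _ 8) (bnorm_ge0 b k))).
  have := normr_ge0 c0; move: bn3; clear; lra.
have [/hasP [v vV hv]|/hasPn none] := boolP (has (fun v => `|v| < eta) V).
  rewrite VE in vV; have [y hy vE] := mem_sumset (iota_uniq 0 9) vV.
  have /choice [x hx] : forall j, exists x : nat, j \in iota 0 9 -> y j = bcub b j x%:R.
    move=> j; have [jj|_] := boolP (j \in iota 0 9); last by exists 0%N.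
    by have /mem_Lv [t _ ->] := hy j jj; exists (range_start m j + t)%N.
  exists x; move: hv; rewrite vE; congr (`|_ + c0| < eta).
  rewrite big_seq (eq_bigr (fun j => bcub b j (x j)%:R)); last by move=> j /hx.
  by rewrite -big_seq -[iota 0 9]/(index_iota 0 9) big_mkord.
exfalso.
have hV v : v \in V -> eta <= `|v| <= M / 4.
  by move=> vV; rewrite Vb // andbT leNgt; exact: none.
have N8 : (8 * K <= N)%N by rewrite -(ler_nat R) natrM; apply: (le_trans Nm8).
have kb := kernel_bound Kp N8 eta0 N1 M0 hV.
have lenp i : (0 < range_len n m i)%N.
  rewrite /range_len; case: ifP => _; last by rewrite expn_gt0 mp.
  by rewrite muln_gt0 expn_gt0 mp andbT; case: ifP.
have fE k : freq (k%:R / M) V = (size V)%:R * \prod_(i < 9) range_freq b n m M i k.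
  rewrite VE freq_sumset size_sumset !big_map natr_prod.
  rewrite -[iota 0 9]/(index_iota 0 9) !big_mkord -big_split /=; apply: eq_bigr => i _.
  by rewrite size_vals /range_freq [RHS]mulrC divfK // pnatr_eq0 -lt0n.
have circ := hm1 N M ME N4 N3 (pb 5%N 7%N isT isT isT) (pb 6%N 8%N isT isT isT).
set F := \sum_(1 <= k < N.+1) _ in kb.
have FE : F = (size V)%:R * \sum_(1 <= k < N.+1) Num.min 1 (k%:R / K%:R) * \prod_(i < 9) range_freq b n m M i k.
  by rewrite /F mulr_sumr; apply: eq_bigr => k _; rewrite fE mulrCA.
have F0 : 0 <= F.
  by apply: sumr_ge0 => k _; rewrite mulr_ge0 ?freq_ge0 // le_min ler01 divr_ge0 ?ler0n.
have Fd : F <= (size V)%:R * d by rewrite FE ler_wpM2l ?ler0n.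
have rx1 : 1 <= CM * P%:R / (16 * K%:R * sg).
  have p16 : 0 < 16 * K%:R * sg by rewrite mulr_gt0 // mulr_gt0.
  by rewrite ler_pdivlMr // mul1r [CM * _]mulrC -ler_pdivrMr //; apply: (le_trans c3).
have [r [r0 r1 r2]] := truncn_half rx1.
have [T TE] : { x : R | x = M / (16 * K%:R) } by exists (M / (16 * K%:R)).
have Sr : sg * P%:R ^+ 2 * r%:R <= T.
  have -> : T = sg * P%:R ^+ 2 * (CM * P%:R / (16 * K%:R * sg)).
    by rewrite TE ME; field; rewrite (gt_eqF KR) (gt_eqF sg0).
  by rewrite ler_pM2l // mulr_gt0 // exprn_gt0.
have Tcl : T <= cl * P%:R ^+ 3 / 2.
  rewrite TE ler_pdivrMr ?mulr_gt0 // ME.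
  have hc : CM <= 8 * cl * K%:R by rewrite [8 * cl * _]mulrC -ler_pdivrMr // mulr_gt0.
  have := ler_wpM2r (ltW P3) hc; clear; lra.
have cnt : (r * size rest <= count (fun v => `|v| <= T)%R V)%N.
  apply: count_allpairs_ge => w /restb [wl wu].
  exact: (central_count b0n mp n0 Ba0 hBa hn wu sgE Sr c2 Tcl wl).
have resz : (0 < size rest)%N.
  by rewrite size_sumset big_map big_seq; apply: prodn_cond_gt0 => i _; rewrite size_vals.
rewrite -TE in kb.
apply: (@kernel_contra R CM sg n%:R P%:R (size rest)%:R r%:R K%:R N%:R F d ka
  (count (fun v => `|v| <= T) V)%:R (size V)%:R) => //.
- by rewrite ltr0n.
- by rewrite -natrM ler_nat.
- by rewrite size_allpairs size_vals /range_len /= !natrM.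
- by rewrite -NmE.
- by rewrite natr1.
Qed.

(** * Reduction to nine cubics with prescribed signs *)

Lemma irrational_sign (R : realType) (x : R) (n : nat) : irrational x -> irrational ((-1) ^+ n * x).
Proof.
move=> irr /rationalP[a [c E]]; apply: irr; apply/rationalP.
exists ((-1) ^+ n * a), c; rewrite intrM -mulrA -E.
have -> : ((-1) ^+ n)%:~R = (-1) ^+ n :> R by rewrite rmorphXn /= rmorphN1.
by rewrite mulrA -exprD addnn -mul2n exprM sqrrN expr1n expr1n mul1r.
Qed.

(** Replacing the variable by its negative multiplies a leading cubic coefficient by [(-1)^3]; the
    boolean in the exponent flips the sign exactly when it is the wrong one. *)
Lemma signr_fix (R : realType) (x : R) (c : bool) : x != 0 ->
  (0 < (-1) ^+ (((0 < x) != c) * 3) * x) = c.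
Proof.
move=> x0; case: (ltP 0 x) => hx; case: c => /=.
- by rewrite mul0n expr0 mul1r hx.
- by rewrite mul1n exprS sqrrN expr1n mulr1 mulN1r oppr_gt0 ltNge (ltW hx).
- by rewrite mul1n exprS sqrrN expr1n mulr1 mulN1r oppr_gt0 lt_neqAle x0 hx.
- by rewrite mul0n expr0 mul1r ltNge hx.
Qed.

Lemma horner_cubic (R : realType) (p : {poly R}) (t n : nat) : size p = 4%N ->
  p.[((-1) ^+ t * n%:Z)%:~R] = cubic ((-1) ^+ (t * 3) * p`_3) ((-1) ^+ (t * 2) * p`_2)
    ((-1) ^+ (t * 1) * p`_1) ((-1) ^+ (t * 0) * p`_0) n%:R.
Proof.
move=> sp; rewrite horner_coef sp !big_ord_recl big_ord0 /= /bump /= addr0.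
have -> : ((-1) ^+ t * n%:Z)%:~R = (-1) ^+ t * n%:R :> R.
  by rewrite intrM -pmulrn rmorphXn /= rmorphN1.
rewrite /cubic muln0 muln1 !exprM !expr0 !mul1r mulr1 expr1; ring.
Qed.

Theorem theorem1p7 (R : realType) (s : nat) (hs : (9 <= s)%N)
    (tau eta : R) (heta : 0 < eta)
    (h : 'I_s -> {poly R})
    (hdeg : forall i : 'I_s, size (h i) = 4%N)
    (hirr : irrationality_condition h) :
  exists x : 'I_s -> int, `|separable_sum h x - tau| < eta.
Proof.
have [i1 [i2 [j1 [j2 [j1r j2r c2n irr]]]]] := hirr.
have lead i : (h i)`_3 != 0.
  have := lead_coef_eq0 (h i); rewrite lead_coefE hdeg /= => ->.
  by rewrite -size_poly_eq0 hdeg.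
(* A reordering that puts [i1] first and [i2], if different, second. The variables of the
   irrationality condition thus get positions [0] and [p2 <= 1], where the ranges start at 0. *)
pose l := i1 :: (if i1 == i2 then [::] else [:: i2]) ++ [seq i <- enum 'I_s | (i != i1) && (i != i2)].
have ml i : i \in l.
  rewrite inE mem_cat mem_filter mem_enum andbT.
  case: (eqVneq i i1) => // n1; case: (eqVneq i i2) => [i2E|n2] /=; rewrite ?orbT // orbF.
  by case: eqVneq => [e12|_]; [move: n1; rewrite i2E e12 eqxx|rewrite i2E inE].
have ul : uniq l.
  rewrite /l cons_uniq cat_uniq filter_uniq ?enum_uniq // andbT mem_cat mem_filter eqxx /= orbF.
  case: eqVneq => [e|n12] /=; first by rewrite has_pred0.
  by rewrite inE n12 /=; apply/hasPn => i; rewrite mem_filter inE => /andP[/andP[_ ->]].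
have pl : perm_eq l (enum 'I_s) by apply: uniq_perm; rewrite ?enum_uniq // => i; rewrite ml mem_enum.
have sl : size l = s by rewrite (perm_size pl) size_enum_ord.
pose e k := nth i1 l k.
pose p2 : nat := (i1 != i2).
have e0 : e 0%N = i1 by [].
have e2 : e p2 = i2 by rewrite /e /p2 /l; case: eqVneq => [->|].
pose t k : nat := ((0 < (h (e k))`_3) != (k != 0%N)).
pose b k j : R := (-1) ^+ (t k * j) * (h (e k))`_j.
have b0n : b 0%N 3%N < 0.
  have : (0 < b 0%N 3%N) = false by rewrite /b /t signr_fix.
  by move=> /negbT; rewrite -leNgt le_eqVlt mulf_eq0 signr_eq0 (negbTE (lead _)).
have bp k : (1 <= k < 9)%N -> 0 < b k 3%N.
  by case/andP=> k0 _; rewrite /b /t signr_fix // -lt0n.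
have cE k j : (1 <= j <= 3)%N -> coef3 (b k 3%N) (b k 2%N) (b k 1%N) j = b k j.
  by case: j => [|[|[|[|j]]]].
have g0 : coef3 (b p2 3%N) (b p2 2%N) (b p2 1%N) j2 != 0.
  by rewrite cE // /b e2 mulf_neq0 // signr_eq0.
have irr' : irrational (coef3 (b 0%N 3%N) (b 0%N 2%N) (b 0%N 1%N) j1 / coef3 (b p2 3%N) (b p2 2%N) (b p2 1%N) j2).
  rewrite !cE // /b e0 e2 invfM invr_sign mulrACA -exprD; exact: irrational_sign.
(* The variables from position 9 on are frozen at 0; their values and the target merge into one
   constant. *)
pose c0 := \sum_(9 <= k < s) (h (e k)).[0] - tau.
have p21 : (p2 <= 1)%N by rewrite /p2; case: (_ != _).
have [x hx] := nine_cubics c0 b0n bp p21 heta g0 irr'.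
pose X i : int := if (index i l < 9)%N then (-1) ^+ t (index i l) * (x (index i l))%:Z else 0.
have XE k : (k < s)%N -> X (e k) = if (k < 9)%N then (-1) ^+ t k * (x k)%:Z else 0.
  by move=> ks; rewrite /X /e index_uniq ?sl.
exists X; suff -> : separable_sum h X - tau = \sum_(i < 9) bcub b i (x i)%:R + c0 by [].
rewrite /separable_sum /c0 addrA; congr (_ - _).
rewrite -[LHS]big_enum -(perm_big _ pl) (big_nth i1) sl (@big_cat_nat _ _ _ 9) //.
congr (_ + _).
  rewrite big_mkord; apply: eq_bigr => k _; rewrite -/(e k).
  have ks : (k < s)%N by apply: leq_trans (ltn_ord k) hs.
  by rewrite XE // ltn_ord horner_cubic ?hdeg.
by apply: eq_big_nat => k /andP[k9 ks]; rewrite -/(e k) XE // ltnNge k9.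
Qed.
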